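(* Let assumption (a) of the context hold, and let $\mu$, $(T_t)_{t>0}$ and $(P_t)_{t>0}$ be as in the context. Then: (i) $(P_t)_{t>0}$ is irreducible in the probabilistic sense, i.e. for any $x\in\mathbb{R}^d$, $t>0$ and $E\in\mathcal{B}(\mathbb{R}^d)$ with $\mu(E)>0$ we have $P_t1_E(x)>0$. (ii) $(T_t)_{t>0}$ is strictly irreducible, i.e. for any weakly invariant set $E$ relative to $(T_t)_{t>0}$ we have $\mu(E)=0$ or $\mu(\mathbb{R}^d\setminus E)=0$.
   Context: Let $d\ge2$, $p\in(d,\infty)$. For a matrix $B=(b_{ij})$ of functions, $\nabla B$ is the vector field with $i$-th component $\sum_j\partial_jb_{ij}$. Assumption (a): $A=(a_{ij})$ with $a_{ji}=a_{ij}\in H^{1,2}_{loc}(\mathbb{R}^d)\cap C(\mathbb{R}^d)$, such that for every relatively compact $V$ there is $\nu_V>0$ with $\nu_V^{-1}\|\xi\|^2\le\langle A(x)\xi,\xi\rangle\le\nu_V\|\xi\|^2$ for all $\xi\in\mathbb{R}^d$, $x\in V$; $C=(c_{ij})$ with $-c_{ji}=c_{ij}\in H^{1,2}_{loc}(\mathbb{R}^d)\cap C(\mathbb{R}^d)$; $\mathbf{H}\in L^p_{loc}(\mathbb{R}^d,\mathbb{R}^d)$. Put $\mathbf{G}=(g_1,\dots,g_d)=\tfrac12\nabla(A+C^T)+\mathbf{H}$ and $Lf=\tfrac12\sum_{i,j}a_{ij}\partial_{ij}f+\sum_ig_i\partial_if$, $f\in C^2(\mathbb{R}^d)$. Measure: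 $\mu=\rho\,dx$, where $\rho\in H^{1,p}_{loc}(\mathbb{R}^d)\cap C(\mathbb{R}^d)$, $\rho>0$ everywhere, and $\int Lf\,d\mu=0$ for all $f\in C_0^\infty(\mathbb{R}^d)$ (such $\rho$ exists under (a); one is fixed). Semigroup: put $\beta^{\rho,A}_i=\tfrac12\sum_j(\partial_ja_{ij}+a_{ij}\tfrac{\partial_j\rho}\rho)$, $\mathbf{B}=\mathbf{G}-\beta^{\rho,A}$. For relatively compact open $V$ let $(L^{0,V},D(L^{0,V}))$ be the self-adjoint generator on $L^2(V,\mu)$ of the closure of $\tfrac12\int_V\langle A\nabla u,\nabla v\rangle d\mu$, $u,v\in C_0^\infty(V)$. The operator $L^{0,V}u+\langle\mathbf{B},\nabla u\rangle$ on bounded $u\in D(L^{0,V})$ is closable in $L^1(V,\mu)$ and its closure generates a sub-Markovian $C_0$-semigroup of contractions, with resolvent $\overline{G}^V_\alpha$; put $\overline{G}^V_\alpha f:=\overline{G}^V_\alpha(f1_V)$ (zero outside $V$) for $f\in L^1(\mathbb{R}^d,\mu)$. For relatively compact open $V_n\uparrow\mathbb{R}^d$ the limits $\overline{G}_\alpha f=\lim_n\overline{G}^{V_n}_\alpha f$ exist in $L^1(\mathbb{R}^d,\mu)$, do not depend on $(V_n)$, and form the resolvent of a sub-Markovian $C_0$-semigroup of contractions $(\overline{T}_t)_{t>0}$ on $L^1(\mathbb{R}^d,\mu)$, whose generator extends $(L,C_0^\infty(\mathbb{R}^d))$. $(T_t)_{t>0}$ denotes the sub-Markovian semigroup on every $L^s(\mathbb{R}^d,\mu)$,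 $s\in[1,\infty]$, obtained by restricting $(\overline{T}_t)$ to $L^1\cap L^\infty$ and extending. For $f\in\bigcup_{s\in[1,\infty]}L^s(\mathbb{R}^d,\mu)$ and $t>0$, $T_tf$ has a continuous $\mu$-version, denoted $P_tf$. Definition: $E\in\mathcal{B}(\mathbb{R}^d)$ is weakly invariant relative to $(T_t)_{t>0}$ if $T_t(f1_E)(x)=0$ for $\mu$-a.e. $x\in\mathbb{R}^d\setminus E$, for any $t>0$ and $f\in L^2(\mathbb{R}^d,\mu)$. *)

(* Defs.v *)
From HB Require Import structures.
From mathcomp Require Import all_boot all_order all_algebra.
From mathcomp Require Import all_classical all_reals all_analysis.
From mathcomp Require Import measurable_realfun.
Set Implicit Arguments.
Unset Strict Implicit.
Unset Printing Implicit Defensive.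
Import Order.TTheory GRing.Theory Num.Theory numFieldNormedType.Exports.
Local Open Scope classical_set_scope.
Local Open Scope ring_scope.

Section borel.
Variables (R : realType) (n : nat).
(* Borel sigma-algebra on row vectors (the topology is the product one). *)
HB.instance Definition _ := @isMeasurable.Build (sigma_display (@open 'rV[R]_n))
  'rV[R]_n <<s (@open 'rV[R]_n) >> (@sigma_algebra0 _ setT _)
  (@sigma_algebraC _ _) (@sigma_algebra_bigcup _ setT _).

Lemma open_measurable_rV (U : set 'rV[R]_n) : open U -> measurable U.
Proof. exact: sub_sigma_algebra. Qed.

Lemma open_rV_bigcup_ball (U : set 'rV[R]_n) : open U ->
  U = \bigcup_(qk in [set qk : 'rV[rat]_n * nat |
         ball (map_mx ratr qk.1 : 'rV[R]_n) (qk.2.+1%:R^-1) `<=` U])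
       ball (map_mx ratr qk.1 : 'rV[R]_n) (qk.2.+1%:R^-1).
Proof.
move=> oU; apply/seteqP; split=> [x Ux|x [qk /= + +]]; last exact.
have /nbhs_ballP[e /= e0 xeU] : nbhs x U by exact: open_nbhs_nbhs.
have e20 : 0 < e / 2 by rewrite divr_gt0.
have [k ke] : exists k : nat, k.+1%:R^-1 < e / 2.
  have /= [k _ /(_ k (leqnn k))/=] := near_infty_natSinv_lt (PosNum e20).
  by exists k.
have k0 : 0 < k.+1%:R^-1 :> R by rewrite invr_gt0.
have [q qx] : exists q : 'rV[rat]_n,
    ball (map_mx ratr q : 'rV[R]_n) k.+1%:R^-1 x.
  have H j : exists q : rat, ball (x ord0 j) k.+1%:R^-1 (ratr q : R).
    have [|y [xy [q _ qy]]] :=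
      @dense_rat R (ball (x ord0 j) k.+1%:R^-1) _ (ball_open _ _).
      by exists (x ord0 j); exact: ballxx.
    by exists q; rewrite qy.
  have /choice[q qP] := H.
  exists (\row_j q j); apply: ball_sym; split => // i j.
  by rewrite ord1 !mxE; exact: qP.
exists (q, k) => //= y qy; apply: xeU.
rewrite (splitr e); have := ball_triangle (ball_sym qx) qy.
by apply: le_ball; rewrite lerD ?ltW.
Qed.

Lemma measurable_fun_rV d (T : measurableType d) (f : T -> 'rV[R]_n) :
  (forall x e, measurable (f @^-1` ball x e)) -> measurable_fun setT f.
Proof.
move=> mf; apply: (measurability (@open 'rV[R]_n)) => //.
move=> _ [U oU <-]; rewrite setTI (open_rV_bigcup_ball oU) preimage_bigcup.
rewrite bigcup_mkcond; apply: countable_bigcupT_measurable => [|qk].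
  exact: countableP.
by case: ifP.
Qed.

End borel.

Section lebesgue.
Variable R : realType.

Lemma measurable_coord n (i : 'I_n) :
  measurable_fun setT (fun x : 'rV[R]_n => x ord0 i).
Proof.
apply: (measurability (@RGenOpens.G R)); first exact: RGenOpens.measurableE.
move=> _ [_ [a [b ->]] <-]; rewrite setTI; apply: open_measurable_rV.
apply: open_comp => [x _|]; first exact: coord_continuous.
exact: interval_open.
Qed.

Definition rV_cons n (x : R * 'rV[R]_n) : 'rV[R]_n.+1 :=
  row_mx (const_mx x.1 : 'rV_1) x.2.
Definition rV_uncons n (v : 'rV[R]_n.+1) : R * 'rV[R]_n :=
  (v ord0 ord0, @rsubmx R 1 1 n v).

Lemma rV_consK n : cancel (@rV_cons n) (@rV_uncons n).
Proof.
move=> [x v]; congr pair; last exact: row_mxKr.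
by rewrite /rV_cons mxE; case: splitP => // j _; rewrite mxE.
Qed.

Lemma measurable_rV_cons n : measurable_fun setT (@rV_cons n).
Proof.
apply: measurable_fun_rV => x e.
have [e0|e0] := leP e 0.
  rewrite (_ : _ @^-1` _ = set0); first exact: measurable0.
  by apply/seteqP; split=> // y [/=]; rewrite ltNge e0.
rewrite (_ : _ @^-1` _ = ball (x ord0 ord0) e `*` ball (rsubmx (x : 'rV_(1 + n))) e).
  apply: measurableX; last by apply: open_measurable_rV; exact: ball_open.
  by apply: open_measurable; exact: ball_open.
apply/seteqP; split=> [[y v]|[y v]].
  move=> [/= _ h]; split => /=.
    have := h ord0 ord0; rewrite /rV_cons mxE.
    by case: splitP => // j _; rewrite mxE.
  split=> // i j; have := h i (rshift 1 j).
  by rewrite /rV_cons (@row_mxEr _ 1 1 n) mxE.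
move=> [/= h1 [_ h2]]; split => // i j; rewrite ord1.
rewrite /rV_cons; case: (@split_ordP 1 n j) => k ->.
  rewrite (@row_mxEl _ 1 1 n) mxE.
  by have -> : lshift n k = ord0 by apply/val_inj; rewrite /= ord1.
by rewrite (@row_mxEr _ 1 1 n); have := h2 i k; rewrite mxE ord1.
Qed.

Lemma measurable_rV_uncons n : measurable_fun setT (@rV_uncons n).
Proof.
apply/measurable_fun_pairP; split; first exact: measurable_coord.
apply: measurable_fun_rV => x e; apply: open_measurable_rV.
apply: open_comp => [y _|]; first exact: continuous_rsubmx.
have [e0|e0] := leP e 0; last exact: ball_open.
rewrite (_ : ball _ _ = set0); first exact: open0.
by apply/seteqP; split=> // z [/=]; rewrite ltNge e0.
Qed.

Section step.
Variables (n : nat) (m : {sigma_finite_measure set 'rV[R]_n -> \bar R}).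

Definition leb_cons : set 'rV[R]_n.+1 -> \bar R :=
  pushforward (lebesgue_measure \x m)%E (@rV_cons n).

Let leb_cons0 : leb_cons set0 = 0%E.
Proof. by rewrite /leb_cons /pushforward preimage_set0 measure0. Qed.

Let leb_cons_ge0 A : (0 <= leb_cons A)%E.
Proof. exact: (@measure_ge0 _ _ _ (lebesgue_measure \x m)%E). Qed.

Let leb_cons_sigma_additive : semi_sigma_additive leb_cons.
Proof.
move=> F mF tF mUF; rewrite /leb_cons /pushforward preimage_bigcup.
have mc B : measurable B -> measurable (@rV_cons n @^-1` B).
  by rewrite -[_ @^-1` _]setTI; exact: measurable_rV_cons.
apply: measure_semi_sigma_additive => [i||]; first exact: mc.
  apply/trivIsetP => i j _ _ ij; rewrite -preimage_setI.
  by move/trivIsetP : tF => /(_ _ _ _ _ ij) ->//; rewrite preimage_set0.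
by rewrite -preimage_bigcup; exact: mc.
Qed.

HB.instance Definition _ := isMeasure.Build _ _ _ leb_cons
  leb_cons0 leb_cons_ge0 leb_cons_sigma_additive.

Let leb_cons_sigma_finite : sigma_finite setT leb_cons.
Proof.
have /sigma_finiteP[F [TF ndF Foo]] := sigma_finiteT (@lebesgue_measure R).
have /sigma_finiteP[G [TG ndG Goo]] := sigma_finiteT m.
exists (fun k => @rV_uncons n @^-1` (F k `*` G k)).
  rewrite -preimage_bigcup (_ : \bigcup_k _ = setT) ?preimage_setT//.
  apply/seteqP; split=> // -[x v] _.
  have [k _ Fx] : (\bigcup_k F k) x by rewrite -TF.
  have [l _ Gv] : (\bigcup_l G l) v by rewrite -TG.
  exists (maxn k l) => //; split => /=.
    by move: x Fx; exact/subsetPset/ndF/leq_maxl.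
  by move: v Gv; exact/subsetPset/ndG/leq_maxr.
move=> k; have [mF Fk] := Foo k; have [mG Gk] := Goo k; split.
  rewrite -[_ @^-1` _]setTI; apply: measurable_rV_uncons => //.
  exact: measurableX.
rewrite /leb_cons /pushforward -comp_preimage (_ : _ \o _ = id); last first.
  by apply/funext => x; exact: rV_consK.
by rewrite preimage_id product_measure1E// lte_mul_pinfty// ge0_fin_numE.
Qed.

HB.instance Definition _ := Measure_isSigmaFinite.Build _ _ _ leb_cons
  leb_cons_sigma_finite.
End step.

(* Iterated product measure; [lebesgue_rV_box] below gives its value on boxes. *)
Fixpoint lebesgue_rV n : {sigma_finite_measure set 'rV[R]_n -> \bar R} :=
  match n with
  | 0 => \d_(0 : 'rV[R]_0)
  | n'.+1 => leb_cons (lebesgue_rV n')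
  end.

Definition box n (a b : 'rV[R]_n) : set 'rV[R]_n :=
  [set x | forall i, a ord0 i < x ord0 i <= b ord0 i].

Lemma measurable_box n (a b : 'rV[R]_n) : measurable (box a b).
Proof.
rewrite (_ : box a b = \bigcap_(i in [set: 'I_n])
  ((fun x : 'rV[R]_n => x ord0 i) @^-1` `]a ord0 i, b ord0 i])); last first.
  by apply/seteqP; split=> x h i; have := h i; rewrite /= in_itv//; exact.
apply: fin_bigcap_measurable => // i _.
by rewrite -[_ @^-1` _]setTI; apply: measurable_coord.
Qed.

Lemma lebesgue_rV_box n (a b : 'rV[R]_n) : (forall i, a ord0 i <= b ord0 i) ->
  lebesgue_rV n (box a b) = (\prod_i (b ord0 i - a ord0 i))%:E.
Proof.
elim: n a b => [|n IHn] a b ab.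
  by rewrite big_ord0 /= diracE mem_set// => -[].
rewrite /= /leb_cons /pushforward.
rewrite (_ : _ @^-1` _ = `]a ord0 ord0, b ord0 ord0] `*`
    box (rsubmx (a : 'rV_(1 + n))) (rsubmx (b : 'rV_(1 + n)))); last first.
  have E0 (y : R) (v : 'rV[R]_n) : rV_cons (y, v) ord0 ord0 = y.
    by rewrite /rV_cons mxE; case: splitP => // j _; rewrite mxE.
  have E1 (y : R) (v : 'rV[R]_n) j : rV_cons (y, v) ord0 (rshift 1 j) = v ord0 j.
    by rewrite /rV_cons (@row_mxEr _ 1 1 n).
  apply/seteqP; split=> [[y v] /= h|[y v] [/= h1 h2] i].
    split; first by have := h ord0; rewrite E0 in_itv.
    by move=> j; have := h (rshift 1 j); rewrite E1 !mxE.
  case: (@split_ordP 1 n i) => k ->; last by have := h2 k; rewrite E1 !mxE.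
  have -> : lshift n k = ord0 by apply/val_inj; rewrite /= ord1.
  by rewrite E0; move: h1; rewrite in_itv.
rewrite product_measure1E//=; last exact: measurable_box.
rewrite lebesgue_measure_itv/= lte_fin IHn => [|i]; last first.
  by rewrite !mxE; exact: ab.
rewrite big_ord_recl EFinM; congr (_ * _)%E.
  by rewrite EFinB; case: ltP (ab ord0) => // ba ab0;
    rewrite (@le_anti _ _ (a ord0 ord0) (b ord0 ord0)) ?ab0// -EFinB subrr.
congr EFin; apply: eq_bigr => i _; rewrite !mxE.
by have -> : rshift 1 i = lift ord0 i by exact: val_inj.
Qed.
End lebesgue.

Section sobolev.
Context {R : realType} {d : nat}.
Local Notation Rd := 'rV[R]_d.
Local Notation leb := (lebesgue_rV R d).

Definition pderiv (i : 'I_d) (f : Rd -> R) : Rd -> R :=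
  fun x => 'D_(delta_mx ord0 i) f x.

Definition grad (f : Rd -> R) (x : Rd) : Rd := \row_i pderiv i f x.

Definition dot (u v : Rd) : R := \sum_i u ord0 i * v ord0 i.

(* The image of the vector u (stored as a row) under the matrix M. *)
Definition mxapply (M : 'M[R]_d) (u : Rd) : Rd := u *m M^T.

Fixpoint Ck (k : nat) (f : Rd -> R) : Prop :=
  continuous f /\
  match k with
  | 0 => True
  | k'.+1 => forall i, (forall x, derivable f x (delta_mx ord0 i)) /\
                       Ck k' (pderiv i f)
  end.

Definition support (f : Rd -> R) : set Rd := closure [set x | f x != 0].

Definition test_fun (V : set Rd) (f : Rd -> R) : Prop :=
  [/\ forall k, Ck k f, compact (support f) & support f `<=` V].

Definition relatively_compact (V : set Rd) : Prop := compact (closure V).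

Definition Lloc (q : R) (f : Rd -> R) : Prop :=
  measurable_fun setT f /\
  forall K, compact K -> (f \* \1_K) \in Lfun leb q%:E.

Definition weak_pderiv (i : 'I_d) (f g : Rd -> R) : Prop :=
  forall phi, test_fun setT phi ->
    (\int[leb]_x (f x * pderiv i phi x)%:E
     = - \int[leb]_x (g x * phi x)%:E)%E.

Definition H1loc (q : R) (f : Rd -> R) : Prop :=
  Lloc q f /\ forall i, exists2 g, Lloc q g & weak_pderiv i f g.

(* A representative of the weak partial derivative; it is determined up to
   Lebesgue-null sets whenever it exists, and is arbitrary otherwise. *)
Definition wpderiv (i : 'I_d) (f : Rd -> R) : Rd -> R :=
  get [set g | Lloc 1 g /\ weak_pderiv i f g].

Definition wgrad (f : Rd -> R) (x : Rd) : Rd := \row_i wpderiv i f x.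

Definition mxdiv (B : Rd -> 'M[R]_d) (x : Rd) : Rd :=
  \row_i \sum_j wpderiv j (fun y => B y i j) x.

End sobolev.

Section coefficients.
Context {R : realType} {d : nat}.
Local Notation Rd := 'rV[R]_d.
Variables (A C : Rd -> 'M[R]_d) (H : Rd -> Rd).

Record assumption_a (p : R) : Prop := AssumptionA {
  A_sym : forall x i j, A x j i = A x i j;
  A_sobolev : forall i j, H1loc 2 (fun x => A x i j);
  A_continuous : forall i j, continuous (fun x => A x i j);
  A_elliptic : forall V : set Rd, relatively_compact V ->
    exists2 nu : R, 0 < nu &
      forall xi x, V x ->
        nu^-1 * dot xi xi <= dot (mxapply (A x) xi) xi <= nu * dot xi xi;
  C_antisym : forall x i j, - C x j i = C x i j;
  C_sobolev : forall i j, H1loc 2 (fun x => C x i j);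
  C_continuous : forall i j, continuous (fun x => C x i j);
  H_Lploc : forall i, Lloc p (fun x => H x ord0 i)
}.

Definition drift (x : Rd) : Rd :=
  2^-1 *: mxdiv (fun y => A y + (C y)^T) x + H x.

Definition Lop (f : Rd -> R) (x : Rd) : R :=
  2^-1 * (\sum_i \sum_j A x i j * pderiv i (pderiv j f) x)
  + dot (drift x) (grad f x).

Variable rho : Rd -> R.

Definition beta (x : Rd) : Rd :=
  \row_i (2^-1 * \sum_j (wpderiv j (fun y => A y i j) x
                           + A x i j * (wpderiv j rho x / rho x))).

Definition Bfield (x : Rd) : Rd := drift x - beta x.

Variable mu : {measure set Rd -> \bar R}.

Record invariant_density (p : R) : Prop := InvariantDensity {
  rho_sobolev : H1loc p rho;
  rho_continuous : continuous rho;
  rho_gt0 : forall x, 0 < rho x;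
  mu_density : forall D, measurable D ->
    mu D = (\int[lebesgue_rV R d]_(x in D) (rho x)%:E)%E;
  mu_invariant : forall f, test_fun setT f ->
    (\int[mu]_x (Lop f x)%:E = 0)%E
}.

(* L^s(V, mu), its elements being extended by zero outside V. *)
Definition Lp_on (s : \bar R) (V : set Rd) (f : Rd -> R) : Prop :=
  f \in Lfun mu s /\ forall x, ~ V x -> f x = 0.

Definition Lpnorm (s : \bar R) (f : Rd -> R) : \bar R :=
  ('N[mu]_s[EFin \o f])%E.

Definition Lp_cvg (s : \bar R) (fn : nat -> Rd -> R) (f : Rd -> R) : Prop :=
  Lpnorm s (fn n \- f) @[n --> \oo] --> 0%E.

Definition energy (V : set Rd) (u v : Rd -> R) : \bar R :=
  (\int[mu]_(x in V)
     (2^-1 * dot (mxapply (A x) (grad u x)) (grad v x))%:E)%E.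

(* un is an energy-Cauchy sequence of test functions with L^2-limit u; these
   sequences define the closure of the form [energy V] on test functions. *)
Definition form_approx (V : set Rd) (un : nat -> Rd -> R) (u : Rd -> R) :=
  [/\ forall n, test_fun V (un n), Lp_on 2%:E V u, Lp_cvg 2%:E un u &
      forall eps : R, 0 < eps -> exists N, forall m n, (N <= m)%N -> (N <= n)%N ->
        (energy V (un m \- un n)%R (un m \- un n)%R < eps%:E)%E].

Definition form_dom (V : set Rd) (u : Rd -> R) : Prop :=
  exists un, form_approx V un u.

Definition form_val (V : set Rd) (u v : Rd -> R) (r : \bar R) : Prop :=
  exists un vn, [/\ form_approx V un u, form_approx V vn v &
    energy V (un n) (vn n) @[n --> \oo] --> r].

(* w = L^{0,V} u, where L^{0,V} is the generator of the closed form. *)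
Definition form_generator (V : set Rd) (u w : Rd -> R) : Prop :=
  [/\ form_dom V u, Lp_on 2%:E V w & forall v, form_dom V v ->
    form_val V u v (- \int[mu]_(x in V) (w x * v x)%:E)%E].

(* w = L^{0,V} u + <B, grad u> with u bounded; since form_dom V is H^{1,2}_0(V)
   extended by zero, the weak gradient on the whole space restricts to that
   on V. *)
Definition local_op (V : set Rd) (u w : Rd -> R) : Prop :=
  exists w0, [/\ form_generator V u w0, u \in Lfun mu +oo%E, Lp_on 1%:E V w &
    {ae mu, forall x, V x -> w x = w0 x + dot (Bfield x) (wgrad u x)}].

Definition local_op_closure (V : set Rd) (u w : Rd -> R) : Prop :=
  [/\ Lp_on 1%:E V u, Lp_on 1%:E V w &
    exists un wn, [/\ forall n, local_op V (un n) (wn n),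
                      Lp_cvg 1%:E un u & Lp_cvg 1%:E wn w]].

Record submarkov_C0_contraction (V : set Rd) (S : R -> (Rd -> R) -> Rd -> R)
    : Prop := SubmarkovC0Contraction {
  sg_L1 : forall t f, 0 < t -> Lp_on 1%:E V f -> Lp_on 1%:E V (S t f);
  sg_linear : forall t a f g, 0 < t -> Lp_on 1%:E V f -> Lp_on 1%:E V g ->
    {ae mu, forall x, S t (fun y => a * f y + g y) x = a * S t f x + S t g x};
  sg_add : forall s t f, 0 < s -> 0 < t -> Lp_on 1%:E V f ->
    {ae mu, forall x, S (s + t) f x = S s (S t f) x};
  sg_contraction : forall t f, 0 < t -> Lp_on 1%:E V f ->
    (Lpnorm 1%:E (S t f) <= Lpnorm 1%:E f)%E;
  sg_C0 : forall f, Lp_on 1%:E V f ->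
    Lpnorm 1%:E (S t f \- f) @[t --> 0^'+] --> 0%E;
  sg_submarkov : forall t f, 0 < t -> Lp_on 1%:E V f ->
    {ae mu, forall x, 0 <= f x <= 1} -> {ae mu, forall x, 0 <= S t f x <= 1}
}.

Definition generator (V : set Rd) (S : R -> (Rd -> R) -> Rd -> R)
    (u w : Rd -> R) : Prop :=
  [/\ Lp_on 1%:E V u, Lp_on 1%:E V w &
    Lpnorm 1%:E (fun x => t^-1 * (S t u x - u x) - w x)
      @[t --> 0^'+] --> 0%E].

(* G alpha f = (alpha - generator)^-1 f *)
Definition resolvent (V : set Rd) (S G : R -> (Rd -> R) -> Rd -> R) : Prop :=
  forall alpha f, 0 < alpha -> Lp_on 1%:E V f ->
    generator V S (G alpha f) (fun x => alpha * G alpha f x - f x).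

Definition local_resolvent (V : set Rd) (G : R -> (Rd -> R) -> Rd -> R) : Prop :=
  exists S, [/\ submarkov_C0_contraction V S,
    forall u w, generator V S u w <-> local_op_closure V u w &
    resolvent V S G].

Definition exhaustion (Vn : nat -> set Rd) : Prop :=
  [/\ forall n, open (Vn n) /\ relatively_compact (Vn n),
      forall n, Vn n `<=` Vn n.+1 & \bigcup_n Vn n = setT].

Definition L1_semigroup (Tbar : R -> (Rd -> R) -> Rd -> R) : Prop :=
  submarkov_C0_contraction setT Tbar /\
  (exists (GV : set Rd -> R -> (Rd -> R) -> Rd -> R)
          (G : R -> (Rd -> R) -> Rd -> R),
    [/\ forall V, open V -> relatively_compact V -> local_resolvent V (GV V),
        resolvent setT Tbar G &
        forall Vn alpha f, exhaustion Vn -> 0 < alpha -> Lp_on 1%:E setT f ->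
          Lp_cvg 1%:E (fun n => GV (Vn n) alpha (f \* \1_(Vn n))) (G alpha f)]) /\
  (forall f, test_fun setT f -> generator setT Tbar f (Lop f)).

Definition L1_Loo (f : Rd -> R) : Prop :=
  f \in Lfun mu 1%:E /\ f \in Lfun mu +oo%E.

(* On L^s with s finite the extension is by L^s-continuity from L^1 /\ L^oo,
   which is dense. As L^1 /\ L^oo is not dense in L^oo, on L^oo it is the a.e.
   limit along cut-offs (monotone for nonnegative functions). *)
Record Lp_extension (Tbar T : R -> (Rd -> R) -> Rd -> R) : Prop := LpExtension {
  ext_L1_Loo : forall t f, 0 < t -> L1_Loo f ->
    {ae mu, forall x, T t f x = Tbar t f x};
  ext_Ls : forall t s f, 0 < t -> 1 <= s -> f \in Lfun mu s%:E ->
    T t f \in Lfun mu s%:E /\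
    forall fn, (forall n, L1_Loo (fn n)) -> Lp_cvg s%:E fn f ->
      Lp_cvg s%:E (fun n => T t (fn n)) (T t f);
  ext_Loo : forall t f, 0 < t -> f \in Lfun mu +oo%E ->
    T t f \in Lfun mu +oo%E /\
    forall Vn, exhaustion Vn ->
      {ae mu, forall x, T t (f \* \1_(Vn n)) x @[n --> \oo] --> T t f x}
}.

Definition Lp_semigroup (T : R -> (Rd -> R) -> Rd -> R) : Prop :=
  exists2 Tbar, L1_semigroup Tbar & Lp_extension Tbar T.

Definition continuous_version (T P : R -> (Rd -> R) -> Rd -> R) : Prop :=
  forall t f, 0 < t -> (exists2 s : \bar R, (1 <= s)%E & f \in Lfun mu s) ->
    continuous (P t f) /\ {ae mu, forall x, P t f x = T t f x}.

Definition weakly_invariant (T : R -> (Rd -> R) -> Rd -> R) (E : set Rd) : Prop :=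
  measurable E /\
  forall t f, 0 < t -> f \in Lfun mu 2%:E ->
    {ae mu, forall x, ~ E x -> T t (f \* \1_E) x = 0}.

End coefficients.

(* Main.v *)
(** Claim (ii) follows from (i). If [P t \1_E] vanishes at [x0], replace [\1_E] by an integrable indicator [f <= \1_E].
A logarithmic Caccioppoli estimate for [- ln (eps + T_s f)], summed over time steps by convexity, and Baire's theorem show
that, for a dense set of small [s], the zero set of [T_s f] is translation invariant, so [T_s f > 0] almost everywhere.
As [P_(t-s) (T_s f)] vanishes at [x0], so does [P_(t-s) g] for every integrable [g], and by iteration [P_s g] for all [s > 0].
But some [v = T_s (G_1 f)] is positive almost everywhere, and the generator maps it below [v]: De Giorgi's iteration on the
sublevel sets of [v] bounds it from below by a positive constant near [x0], a contradiction. *)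
From HB Require Import structures.
From mathcomp Require Import all_boot all_order all_algebra.
From mathcomp Require Import all_classical all_reals all_analysis.
From mathcomp Require Import measurable_realfun ring lra.
Require Import Defs.
Set Implicit Arguments.
Unset Strict Implicit.
Unset Printing Implicit Defensive.
Import Order.TTheory GRing.Theory Num.Theory numFieldNormedType.Exports.
Local Open Scope classical_set_scope.
Local Open Scope ring_scope.

(** The drift is only locally square integrable, and functions in the domain of the generator come
    without a gradient. Identities are therefore derived on balls, for test functions approximating
    local resolvents, and estimates pass to the limit only after gradients have been traded for
    differences under translations; averaged translations also take the place of Sobolev
    inequalities. From [rho B] the divergence of the antisymmetric matrix [rho C / 2] is split off.
    The remaining field is divergence free and in L^d_loc, and after integration by parts it
    multiplies values of the solution, never its gradient. The logarithm serves because the second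
    derivative of [- ln] is the square of the first: the squared oscillation of [ln (eps + u)] under
    a shift is at most of order [|ln eps|], whereas a jump between the zero set and its complement
    contributes the order [(ln eps)^2]. Approximants of a function with values in [0, 1] may leave
    this interval. The convex penalty [trap], used as a profile, shows that their energy outside
    tends to 0, so that other profiles need convexity only near [0, 1]. *)

Notation testT := (test_fun setT).
Notation meas := (measurable_fun setT).

Lemma eq_ler {R : realType} (x y : R) : x = y -> x <= y.
Proof. by move=> ->. Qed.

(** * Convergence of real sequences *)

Section real_sequences.
Context {R : realType}.
Implicit Types (a b : nat -> R).

Lemma cvg0_le a b : (forall n, `|a n| <= b n) ->
 b n @[n --> \oo] --> 0 -> a n @[n --> \oo] --> 0.
Proof.
move=> ab b0; apply/cvgr0Pnorm_lt => e e0.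
move/cvgr0Pnorm_lt : b0 => /(_ e e0); apply: filterS => n.
by apply: le_lt_trans; apply: (le_trans (ab n)); exact: ler_norm.
Qed.

Lemma cvg0P a : (forall e, 0 < e -> exists N, forall n, (N <= n)%N -> `|a n| < e) ->
 a n @[n --> \oo] --> 0.
Proof.
move=> h; apply/cvgr0Pnorm_lt => e /h[N hN]; near=> n; apply: hN.
by near: n; exists N.
Unshelve. all: by end_near. Qed.

Lemma cvg_eN a l e : a n @[n --> \oo] --> l -> 0 < e ->
 exists N, forall n, (N <= n)%N -> `|a n - l| < e.
Proof.
move=> /cvgrPdist_lt /(_ e) h e0; have /= [N _ hN] := h e0.
by exists N => n Nn; rewrite distrC; exact: hN.
Qed.

Lemma cvg0_eN a e : a n @[n --> \oo] --> 0 -> 0 < e ->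
 exists N, forall n, (N <= n)%N -> `|a n| < e.
Proof.
by move=> /cvg_eN h /h[N hN]; exists N => n /hN; rewrite subr0.
Qed.

Lemma cvg0_sub a l : (a n - l) @[n --> \oo] --> 0 -> a n @[n --> \oo] --> l.
Proof.
move=> h; apply/cvgrPdist_lt => e e0; have [N hN] := cvg0_eN h e0.
by exists N => // n Nn; rewrite distrC; exact: hN.
Qed.

End real_sequences.

(** * Real-valued integrals with respect to a measure *)

Section integral_toolbox.
Context {d} {T : measurableType d} {R : realType}.
Variable m : {measure set T -> \bar R}.
Implicit Types (f g h : T -> R).

Definition ibl f := m.-integrable setT (EFin \o f).
(** The finite part of the integral, hence 0 where the integral is infinite. Algebraic rules
    therefore carry [ibl] hypotheses, while nonnegativity holds without them. *)
Definition Int f := Rintegral m setT f.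

Lemma ibl_meas f : ibl f -> meas f.
Proof. by move=> /integrableP[/measurable_EFinP]. Qed.

Lemma ibl_le f g : meas f -> (forall x, `|f x| <= g x) ->
 ibl g -> ibl f.
Proof.
move=> mf fg ig; apply: le_integrable ig => //; first exact/measurable_EFinP.
move=> x _ /=; rewrite lee_fin; apply: le_trans (fg x) _; exact: ler_norm.
Qed.

Lemma eq_ibl f g : f =1 g -> ibl f -> ibl g.
Proof. by move=> /funext ->. Qed.

Lemma ibl0 : ibl (fun=> 0).
Proof. exact: integrable0. Qed.

Lemma iblD f g : ibl f -> ibl g -> ibl (fun x => f x + g x).
Proof. by move=> hf hg; apply: (integrableD measurableT hf hg). Qed.

Lemma iblZ (k : R) f : ibl f -> ibl (fun x => k * f x).
Proof. by move=> hf; apply: (integrableZl measurableT k hf). Qed.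

Lemma iblZr (k : R) f : ibl f -> ibl (fun x => f x * k).
Proof. by move=> /(iblZ k); apply: eq_ibl => x; rewrite mulrC. Qed.

Lemma iblN f : ibl f -> ibl (fun x => - f x).
Proof. by move=> /(iblZ (-1)); apply: eq_ibl => x; rewrite mulN1r. Qed.

Lemma iblB f g : ibl f -> ibl g -> ibl (fun x => f x - g x).
Proof. by move=> hf hg; apply: iblD => //; exact: iblN. Qed.

Lemma ibl_abs f : ibl f -> ibl (fun x => `|f x|).
Proof. exact: integrable_norm. Qed.

Lemma ibl_sum (I : Type) (s : seq I) (P : pred I) (F : I -> T -> R) :
 (forall i, P i -> ibl (F i)) -> ibl (fun x => \sum_(i <- s | P i) F i x).
Proof.
move=> h; elim: s => [|i s IH]; first by under eq_fun do rewrite big_nil; exact: ibl0.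
case Pi : (P i); under eq_fun do rewrite big_cons Pi; last exact: IH.
by apply: iblD => //; exact: h.
Qed.

Lemma iblMb f g (C : R) : ibl f -> meas g ->
 (forall x, `|g x| <= C) -> ibl (fun x => f x * g x).
Proof.
move=> hf mg gC; apply: (@ibl_le _ (fun x => C * `|f x|)).
- by apply: measurable_funM => //; exact: ibl_meas.
- by move=> x; rewrite normrM mulrC ler_wpM2r.
- by apply: iblZ; exact: ibl_abs.
Qed.

Lemma iblbM f g (C : R) : ibl f -> meas g ->
 (forall x, `|g x| <= C) -> ibl (fun x => g x * f x).
Proof.
by move=> hf mg /(iblMb hf mg); apply: eq_ibl => x; rewrite mulrC.
Qed.

Lemma iblM2 f g : meas f -> meas g ->
 ibl (fun x => f x ^+ 2) -> ibl (fun x => g x ^+ 2) -> ibl (fun x => f x * g x).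
Proof.
move=> mf mg f2 g2; apply: (@ibl_le _ (fun x => f x ^+ 2 + g x ^+ 2)).
- exact: measurable_funM.
- move=> x; rewrite normrM -[f x ^+ 2]real_normK ?num_real//.
 rewrite -[g x ^+ 2]real_normK ?num_real//.
 have := sqr_ge0 (`|f x| - `|g x|); have := normr_ge0 (f x); have := normr_ge0 (g x).
 nra.
- exact: iblD.
Qed.

Lemma iblD2 f g : meas f -> meas g ->
 ibl (fun x => f x ^+ 2) -> ibl (fun x => g x ^+ 2) -> ibl (fun x => (f x + g x) ^+ 2).
Proof.
move=> mf mg f2 g2.
apply: (@eq_ibl (fun x => f x ^+ 2 + 2 * (f x * g x) + g x ^+ 2)); first by move=> x; ring.
by apply: iblD => //; apply: iblD => //; apply: iblZ; exact: iblM2.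
Qed.

Lemma eq_Int f g : f =1 g -> Int f = Int g.
Proof. by move=> /funext ->. Qed.

Lemma Int0 : Int (fun=> 0) = 0.
Proof. by rewrite /Int /Rintegral integral0. Qed.

Lemma IntD f g : ibl f -> ibl g -> Int (fun x => f x + g x) = Int f + Int g.
Proof. by move=> hf hg; rewrite /Int RintegralD. Qed.

Lemma IntB f g : ibl f -> ibl g -> Int (fun x => f x - g x) = Int f - Int g.
Proof. by move=> hf hg; rewrite /Int RintegralB. Qed.

Lemma IntZ (k : R) f : ibl f -> Int (fun x => k * f x) = k * Int f.
Proof. by move=> hf; rewrite /Int RintegralZl. Qed.

Lemma IntN f : ibl f -> Int (fun x => - f x) = - Int f.
Proof. by move=> hf; rewrite -mulN1r -IntZ//; apply: eq_Int => x; rewrite mulN1r. Qed.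

Lemma Int_sum (I : Type) (s : seq I) (P : pred I) (F : I -> T -> R) :
 (forall i, P i -> ibl (F i)) ->
 Int (fun x => \sum_(i <- s | P i) F i x) = \sum_(i <- s | P i) Int (F i).
Proof.
move=> h; elim: s => [|i s IH].
 by rewrite [RHS]big_nil -[RHS]Int0; apply: eq_Int => x; rewrite big_nil.
rewrite big_cons; case Pi : (P i); under [LHS]eq_Int do rewrite big_cons Pi; last exact: IH.
by rewrite IntD ?IH//; [exact: h|exact: ibl_sum].
Qed.

Lemma Int_ge0 f : (forall x, 0 <= f x) -> 0 <= Int f.
Proof. by move=> h; apply: Rintegral_ge0 => x _. Qed.

Lemma Int_le f g : ibl f -> ibl g -> (forall x, f x <= g x) -> Int f <= Int g.
Proof. by move=> hf hg h; apply: le_Rintegral. Qed.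

Lemma Int_abs f : ibl f -> `|Int f| <= Int (fun x => `|f x|).
Proof. by move=> hf; apply: le_normr_Rintegral. Qed.

Lemma ibl_integral f : ibl f -> (\int[m]_x (f x)%:E)%E = (Int f)%:E.
Proof.
move=> h; rewrite /Int /Rintegral fineK//.
exact: (integrable_fin_num measurableT h).
Qed.

Lemma ae_eq_ibl f g : meas g -> {ae m, forall x, f x = g x} ->
 ibl f -> ibl g.
Proof.
move=> mg fg hf; have mf := ibl_meas hf.
move/integrableP : hf => [_ hf]; apply/integrableP; split; first exact/measurable_EFinP.
rewrite -(@ge0_ae_eq_integral _ _ _ _ _ (fun x => `|(EFin \o f) x|%E))//.
- by apply: measurableT_comp => //; exact/measurable_EFinP.
- by apply: measurableT_comp => //; exact/measurable_EFinP.
- by apply: filterS fg => x /= -> _.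
Qed.

Lemma ae_eq_Int f g : meas f -> meas g ->
 {ae m, forall x, f x = g x} -> Int f = Int g.
Proof.
move=> mf mg fg; rewrite /Int /Rintegral; congr fine.
by apply: ae_eq_integral => //; [exact/measurable_EFinP|exact/measurable_EFinP|
 apply: filterS fg => x /= -> _].
Qed.

Lemma ae_le_Int f g : ibl f -> ibl g -> {ae m, forall x, f x <= g x} ->
 Int f <= Int g.
Proof.
move=> hf hg fg; have mf := ibl_meas hf; have mg := ibl_meas hg.
have mmx : meas (fun x => Order.max (f x) (g x)).
 exact: measurable_maxr.
have E : Int g = Int (fun x => Order.max (f x) (g x)).
 by apply: ae_eq_Int => //; apply: filterS fg => x xfg; rewrite max_r.
have i : ibl (fun x => Order.max (f x) (g x)).
 by apply: ae_eq_ibl hg => //; apply: filterS fg => x xfg; rewrite max_r.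
by rewrite E; apply: Int_le => // x; rewrite le_max lexx.
Qed.

Lemma Int_eq0 f : ibl f -> (forall x, 0 <= f x) -> Int f = 0 ->
 {ae m, forall x, f x = 0}.
Proof.
move=> hf f0 If; have E := ibl_integral hf; rewrite If in E.
have mf := ibl_meas hf.
have : (\int[m]_x `|(f x)%:E| = 0)%E.
 by rewrite -[RHS]E; apply: eq_integral => x _ /=; rewrite ger0_norm.
move=> /(ae_eq_integral_abs m measurableT (f := EFin \o f)).
move=> h; have {}h := h ltac:(exact/measurable_EFinP).
by apply: filterS h => x /= /(_ I)[].
Qed.

Lemma Int_dom (f_ : nat -> T -> R) f g :
 (forall n, meas (f_ n)) -> meas f ->
 {ae m, forall x, f_ n x @[n --> \oo] --> f x} -> ibl g ->
 (forall n x, `|f_ n x| <= g x) ->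
 Int (f_ n) @[n --> \oo] --> Int f.
Proof.
move=> mf_ mf ff hg fg.
have [|||||iF _ h] := @dominated_convergence _ _ _ m setT measurableT
 (fun n x => (f_ n x)%:E) (EFin \o f) (EFin \o g).
- by move=> n; exact/measurable_EFinP.
- exact/measurable_EFinP.
- by apply: filterS ff => x h _; apply/fine_cvgP; split; [exact: nearW|].
- exact: hg.
- by apply: aeW => x n _ /=; rewrite lee_fin.
rewrite /Int /Rintegral.
have F : (\int[m]_x (f x)%:E)%E = (fine (\int[m]_x (f x)%:E))%:E.
 by rewrite fineK//; exact: (integrable_fin_num measurableT iF).
by move: h; rewrite /= F => /fine_cvgP[].
Qed.

Lemma Int_cvg (f_ : nat -> T -> R) f : (forall n, ibl (f_ n)) -> ibl f ->
 Int (fun x => `|f_ n x - f x|) @[n --> \oo] --> 0 ->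
 Int (f_ n) @[n --> \oo] --> Int f.
Proof.
move=> hf_ hf h; apply: cvg0_sub; apply: cvg0_le h => n.
by rewrite -IntB//; apply: Int_abs; exact: iblB.
Qed.

(* A weight may be truncated at a large level, so convergence in mean of a
  uniformly bounded sequence survives multiplication by an integrable weight. *)
Lemma Int_wcvg0 (w : T -> R) (z : nat -> T -> R) (C : R) : ibl w ->
 (forall n, ibl (z n)) -> (forall n x, `|z n x| <= C) ->
 Int (fun x => `|z n x|) @[n --> \oo] --> 0 ->
 Int (fun x => `|w x * z n x|) @[n --> \oo] --> 0.
Proof.
move=> hw hz zC z0; have mw := ibl_meas hw.
pose t (k : nat) x := Num.max (`|w x| - k%:R) 0.
have mt k : meas (t k).
 by apply: measurable_maxr => //; apply: measurable_funB => //; apply: measurableT_comp.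
have t0 k x : 0 <= t k x by rewrite /t le_max lexx orbT.
have tw k x : `|t k x| <= `|w x|.
 by rewrite ger0_norm// /t ge_max normr_ge0 andbT lerBlDr lerDl.
have it k : ibl (t k) by apply: ibl_le (mt k) (tw k) _; exact: ibl_abs.
have It : Int (t k) @[k --> \oo] --> 0.
 rewrite -Int0; apply: (Int_dom (g := fun x => `|w x|)) => //.
 - apply: aeW => x; apply: cvg0P => e e0.
  exists (Num.bound `|w x|) => n Nn; rewrite ger0_norm// /t max_r//.
  rewrite subr_le0; apply: ltW; apply: lt_le_trans (_ : (Num.bound `|w x|)%:R <= _).
   exact: archi_boundP.
  by rewrite ler_nat.
 - exact: ibl_abs.
apply: cvg0P => e e0.
have C1 : 0 < `|C| + 1 by rewrite ltr_wpDl.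
have [K hK] := cvg0_eN It (divr_gt0 e0 (mulr_gt0 (ltr0n R 2) C1)).
have K1 : 0 < K%:R + 1 :> R by rewrite ltr_wpDl.
have [N hN] := cvg0_eN z0 (divr_gt0 e0 (mulr_gt0 (ltr0n R 2) K1)).
exists N => n /hN; rewrite ger0_norm; last exact: Int_ge0.
move=> Hn; have := hK _ (leqnn K); rewrite ger0_norm; last exact: Int_ge0.
move=> HK; rewrite ger0_norm; last exact: Int_ge0.
have i1 : ibl (fun x => K%:R * `|z n x|) by apply: iblZ; exact: ibl_abs.
have i2 : ibl (fun x => (`|C| + 1) * t K x) by apply: iblZ.
apply: (@le_lt_trans _ _ (Int (fun x => K%:R * `|z n x| + (`|C| + 1) * t K x))).
 apply: Int_le; [|exact: iblD|].
  by apply: ibl_abs; apply: (iblMb hw _ (zC n)); exact: ibl_meas.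
 move=> x; rewrite normrM.
 have h1 : `|w x| <= K%:R + t K x by rewrite addrC -lerBlDr /t le_max lexx.
 have h2 : `|z n x| <= `|C| + 1.
  by apply: le_trans (zC n x) _; apply: le_trans (ler_norm _) _; rewrite lerDl.
 have := normr_ge0 (w x); have := normr_ge0 (z n x); have := t0 K x; nra.
rewrite IntD// !IntZ//; last exact: ibl_abs.
move: Hn HK; rewrite !ltr_pdivlMr ?mulr_gt0// => Hn HK.
have := Int_ge0 (fun x => normr_ge0 (z n x)); nra.
Qed.

Lemma CauchySchwarz f g : meas f -> meas g ->
 ibl (fun x => f x ^+ 2) -> ibl (fun x => g x ^+ 2) ->
 Int (fun x => f x * g x) ^+ 2 <= Int (fun x => f x ^+ 2) * Int (fun x => g x ^+ 2).
Proof.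
move=> mf mg f2 g2; have fg := iblM2 mf mg f2 g2.
set A := Int (fun x => f x ^+ 2); set B := Int _; set C := Int (fun x => g x ^+ 2).
have A0 : 0 <= A by apply: Int_ge0 => x; exact: sqr_ge0.
have h t : 0 <= A - t * (2 * B) + t ^+ 2 * C.
 have i1 : ibl (fun x => (2 * t) * (f x * g x)) by exact: iblZ.
 have i2 : ibl (fun x => t ^+ 2 * g x ^+ 2) by exact: iblZ.
 rewrite (_ : _ + _ = Int (fun x => (f x - t * g x) ^+ 2)).
  by apply: Int_ge0 => x; exact: sqr_ge0.
 rewrite (@eq_Int (fun x => (f x - t * g x) ^+ 2)
  (fun x => f x ^+ 2 - (2 * t) * (f x * g x) + t ^+ 2 * g x ^+ 2)); last by move=> x; ring.
 by rewrite IntD ?IntB ?IntZ//; [rewrite -/A -/B -/C; ring|exact: iblB].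
have C0 : 0 <= C by apply: Int_ge0 => x; exact: sqr_ge0.
have [C00|Cn0] := eqVneq C 0.
 have [->|Bn0] := eqVneq B 0; first by rewrite C00 mulr0 expr0n.
 (* With [C = 0] the quadratic is affine in [t]; at this [t] it equals -1. *)
 have := h ((A + 1) / (2 * B)); rewrite C00 mulr0 addr0 divfK ?mulf_neq0// => ?.
 by exfalso; lra.
have Cp : 0 < C by rewrite lt_neqAle eq_sym Cn0.
have := h (B / C); rewrite expr_div_n => /(mulr_ge0 C0).
rewrite mulrDr mulrBr [C * (B / C * _)](_ : _ = 2 * B ^+ 2); last by field.
rewrite [C * (_ / _ * C)](_ : _ = B ^+ 2); last by field.
by move=> ?; nra.
Qed.

(** The sum of the series has integral at most [M], hence is finite almost everywhere, and [G] is
    its finite part. Where the sum is infinite [G] is 0, so the domination is asserted almost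
    everywhere only. *)
Lemma ibl_series (f_ : nat -> T -> R) (M : R) : (forall n, ibl (f_ n)) ->
 (forall n x, 0 <= f_ n x) -> (forall n, \sum_(k < n) Int (f_ k) <= M) ->
 exists G, [/\ ibl G, forall x, 0 <= G x &
  {ae m, forall x, forall n, \sum_(k < n) f_ k x <= G x}].
Proof.
move=> hf f0 fM.
pose S x := (\sum_(0 <= k <oo) (f_ k x)%:E)%E.
have mf k : meas (fun x => (f_ k x)%:E).
 by apply/measurable_EFinP; exact: ibl_meas.
have mS : meas S.
 by apply: ge0_emeasurable_sum => //= k x _ _; rewrite lee_fin.
have S0 x : (0 <= S x)%E by apply: nneseries_ge0 => k _ _; rewrite lee_fin.
have IS : (\int[m]_x S x <= M%:E)%E.
 rewrite integral_nneseries//; last by move=> k x _; rewrite lee_fin.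
 apply: lime_le; first by apply: is_cvg_nneseries => k _ _;
  apply: integral_ge0 => x _; rewrite lee_fin.
 apply: nearW => n; rewrite big_mkord (eq_bigr (fun k : 'I_n => (Int (f_ k))%:E)).
  by rewrite sumEFin lee_fin; exact: fM.
 by move=> k _; rewrite ibl_integral.
have iS : m.-integrable setT S.
 apply/integrableP; split => //; apply: le_lt_trans (ltry M).
 by under eq_integral do rewrite gee0_abs//.
have fS := integrable_ae measurableT iS.
have mfS : meas (fine \o S) by apply: measurableT_comp.
exists (fine \o S); split.
- apply/integrableP; split; first exact/measurable_EFinP.
 apply: le_lt_trans (ltry M); apply: le_trans IS.
 apply: ge0_le_integral => //; first exact/measurableT_comp/measurable_EFinP.
 move=> x _ /=; rewrite ger0_norm ?fine_ge0//.
 by case: (S x) (S0 x) => //= r; rewrite ?leey.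
- by move=> x; apply: fine_ge0.
- apply: filterS fS => x /(_ I) xS n /=.
 rewrite -lee_fin fineK// -sumEFin -(big_mkord xpredT (fun k => (f_ k x)%:E)).
 by apply: nneseries_lim_ge => k _ _; rewrite lee_fin.
Qed.

(** For sequences whose integrals are bounded but which have no common majorant; the integrability
    of the limit is part of the result. *)
Lemma Int_fatou (g_ : nat -> T -> R) g (M : R) :
 (forall n, ibl (g_ n)) -> (forall n x, 0 <= g_ n x) ->
 meas g -> {ae m, forall x, g_ n x @[n --> \oo] --> g x} ->
 (forall n, Int (g_ n) <= M) -> (forall x, 0 <= g x) -> ibl g /\ Int g <= M.
Proof.
move=> hg g_0 mg gg gM g0.
have mg_ n : meas (fun x => (g_ n x)%:E).
 by apply/measurable_EFinP; exact: ibl_meas.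
have g_0' n x : setT x -> (0 <= (g_ n x)%:E)%E by rewrite lee_fin.
have F := @fatou _ _ _ m setT measurableT _ mg_ g_0'.
have FM : (\int[m]_x (g x)%:E <= M%:E)%E.
 apply: le_trans (_ : (\int[m]_x limn_einf ((fun n x => (g_ n x)%:E) ^~ x) <= _)%E).
  apply: ae_ge0_le_integral => //.
  - by move=> x _; rewrite lee_fin.
  - exact/measurable_EFinP.
  - move=> x _; rewrite limn_einf_lim; apply: lime_ge; first exact: is_cvg_einfs.
   apply: nearW => n; apply: le_ereal_inf_tmp => _ [k /= nk <-].
   by rewrite lee_fin.
  - rewrite (_ : (fun x => _) = (fun x => - limn_esup (fun n => - (g_ n x)%:E))%E).
    apply: measurableT_comp => //; apply: measurable_fun_limn_esup => n.
    exact: measurableT_comp.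
   apply/funext => x; rewrite -limn_einfN; congr limn_einf.
   by apply/funext => n; rewrite /comp oppeK.
  - apply: filterS gg => x gx _.
   have h : (fun n => (g_ n x)%:E) @ \oo --> (g x)%:E.
    by apply/fine_cvgP; split => //; exact: nearW.
   rewrite is_cvg_limn_einfE; first by rewrite (cvg_lim _ h).
   by apply/cvg_ex; exists (g x)%:E.
 apply: le_trans F _; rewrite limn_einf_lim; apply: lime_le; first exact: is_cvg_einfs.
 apply: nearW => n; apply: ge_ereal_inf; exists (\int[m]_x (g_ n x)%:E)%E.
  by exists n => /=.
 by rewrite ibl_integral// lee_fin.
have ig : ibl g.
 apply/integrableP; split; first exact/measurable_EFinP.
 apply: le_lt_trans (ltry M); apply: le_trans FM; apply: ge0_le_integral => //.
 - by apply: measurableT_comp => //; exact/measurable_EFinP.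
 - exact/measurable_EFinP.
 - by move=> x _ /=; rewrite ger0_norm.
by split => //; rewrite -lee_fin -ibl_integral.
Qed.

(* Riesz-Fischer: along a subsequence with squared increments below 8^-k,
  [|a| <= 2^k a^2 + 2^-k] makes the increments summable almost everywhere. *)
Lemma L2_complete (f_ : nat -> T -> R) :
 (forall n, meas (f_ n)) -> (forall n, ibl (fun x => f_ n x ^+ 2)) ->
 (forall e, 0 < e -> exists N, forall p q, (N <= p)%N -> (N <= q)%N ->
   Int (fun x => (f_ p x - f_ q x) ^+ 2) < e) ->
 exists f, [/\ meas f, ibl (fun x => f x ^+ 2) &
  Int (fun x => (f_ n x - f x) ^+ 2) @[n --> \oo] --> 0].
Proof.
move=> mf f2 Cf.
have i2 p q : ibl (fun x => (f_ p x - f_ q x) ^+ 2).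
 apply: iblD2 => //; first exact: measurable_funN.
 by apply: eq_ibl (f2 q) => x; rewrite sqrrN.
have e8 k : 0 < (8%:R ^- k : R) by rewrite invr_gt0 exprn_gt0.
have /choice[N hN] : forall k, exists N, forall p q, (N <= p)%N -> (N <= q)%N ->
  Int (fun x => (f_ p x - f_ q x) ^+ 2) < 8%:R ^- k by move=> k; exact: Cf.
pose nk k := (\sum_(j < k.+1) (N j).+1)%N.
have nkN k : (N k <= nk k)%N by rewrite /nk big_ord_recr/= addnS ltnW// ltnS leq_addl.
have nkS k : (nk k <= nk k.+1)%N by rewrite {2}/nk big_ord_recr/= leq_addr.
pose s k := f_ (nk k).
pose h k x := 2 ^+ k * (s k.+1 x - s k x) ^+ 2.
have [||n|G [iG G0 hG]] := @ibl_series h 2.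
- by move=> k; apply: iblZ; exact: i2.
- by move=> k x; rewrite mulr_ge0 ?sqr_ge0// exprn_ge0.
- apply: (@le_trans _ _ (\sum_(k < n) 2^-1 ^+ k)).
  apply: ler_sum => k _; rewrite /h IntZ; last exact: i2.
  have E : (2^-1 ^+ k : R) = 2 ^+ k * 4%:R ^- k.
   by rewrite -!exprVn -exprMn; congr (_ ^+ _); field.
  rewrite E ler_wpM2l ?exprn_ge0//; apply: le_trans (ltW (hN k _ _ _ _)) _.
  + by apply: leq_trans (nkN k) _.
  + exact: nkN.
  + by rewrite lef_pV2 ?posrE ?exprn_gt0//; apply: lerXn2r; rewrite ?nnegrE// ler_nat.
 elim: n => [|n IH]; first by rewrite big_ord0.
 suff H : forall n, \sum_(k < n) 2^-1 ^+ k = 2 - 2 * (2^-1 ^+ n) :> R.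
  by rewrite H gerBl mulr_ge0// exprn_ge0// invr_ge0.
 elim=> [|n' IH']; first by rewrite big_ord0 expr0; lra.
 by rewrite big_ord_recr/= IH' exprS; field.
have cs : {ae m, forall x, cvgn (fun k => s k x)}.
 apply: filterS hG => x hx.
 pose v n := \sum_(k < n) `|s k.+1 x - s k x|.
 have vb n : v n <= G x + 2.
  apply: le_trans (_ : \sum_(k < n) (h k x + 2^-1 ^+ k) <= _).
   apply: ler_sum => k _; rewrite /h.
   have p2 : (0 : R) < 2 ^+ k by rewrite exprn_gt0.
   rewrite exprVn; set a := s _ x - s _ x; set p := (2 : R) ^+ k.
   have : 0 <= p * (`|a| - p^-1) ^+ 2 by rewrite mulr_ge0 ?sqr_ge0 ?ltW.
   rewrite (_ : _ * _ = p * `|a| ^+ 2 - 2 * `|a| + p^-1); last first.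
    by field; rewrite gt_eqF.
   rewrite real_normK ?num_real//; have := normr_ge0 a; lra.
  rewrite big_split/= lerD//; first exact: hx.
  suff H : forall n, \sum_(k < n) 2^-1 ^+ k = 2 - 2 * (2^-1 ^+ n) :> R.
   by rewrite H gerBl mulr_ge0// exprn_ge0// invr_ge0.
  elim=> [|n' IH']; first by rewrite big_ord0 expr0; lra.
  by rewrite big_ord_recr/= IH' exprS; field.
 have sv n : s n x <= s 0%N x + v n.
  elim: n => [|n IH]; first by rewrite /v big_ord0 addr0.
  rewrite /v big_ord_recr/= -/(v n) addrA.
  have := ler_norm (s n.+1 x - s n x); lra.
 have cv : cvgn v.
  apply: nondecreasing_is_cvgn; last by exists (G x + 2) => _ [n _ <-].
  by apply/nondecreasing_seqP => n; rewrite /v big_ord_recr/= lerDl.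
 (* The increments of [v] are the absolute increments of [s], so [s + v] is nondecreasing as well,
    and [s] converges as a difference of two bounded monotone sequences. *)
 have cu : cvgn (fun n => s n x + v n).
  apply: nondecreasing_is_cvgn.
   apply/nondecreasing_seqP => n; rewrite /v big_ord_recr/=.
   have := ler_norm (- (s n.+1 x - s n x)); rewrite normrN; lra.
  exists (s 0%N x + (G x + 2) + (G x + 2)) => _ [n _ <-].
  by have := sv n; have := vb n; lra.
 rewrite (_ : (fun k => s k x) = (fun n => (s n x + v n) - v n)).
  exact: is_cvgB.
 by apply/funext => n; rewrite addrK.
(* The upper limit is measurable and defined everywhere; at almost every point it is the limit of
   [s]. *)
pose f x := fine (limn_esup (fun k => (s k x)%:E)).
have mff : meas f.
 apply: measurableT_comp => //; apply: measurable_fun_limn_esup => k.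
 exact/measurable_EFinP/mf.
have sf : {ae m, forall x, s k x @[k --> \oo] --> f x}.
 apply: filterS cs => x /cvg_ex[/= l sl].
 have hl : (fun k => (s k x)%:E) @ \oo --> l%:E.
  by apply/fine_cvgP; split => //; exact: nearW.
 rewrite /f is_cvg_limn_esupE; last by apply/cvg_ex; exists l%:E.
 by rewrite (cvg_lim _ hl).
have key n e : (forall p, (n <= p)%N -> Int (fun x => (f_ n x - f_ p x) ^+ 2) <= e) ->
  ibl (fun x => (f_ n x - f x) ^+ 2) /\ Int (fun x => (f_ n x - f x) ^+ 2) <= e.
 move=> he; have nkn k : (k <= nk k)%N.
  elim: k => // k IH; rewrite /nk big_ord_recr/= -/(nk k) addnS ltnS.
  exact: leq_trans IH (leq_addr _ _).
 apply: (@Int_fatou (fun k x => (f_ n x - s (n + k)%N x) ^+ 2)).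
 - by move=> k; exact: i2.
 - by move=> k x; exact: sqr_ge0.
 - by apply: measurable_funX; exact: measurable_funB.
 - apply: filterS sf => x sfx; rewrite expr2.
  under eq_fun do rewrite expr2.
  have hs : f_ n x - s (n + k)%N x @[k --> \oo] --> f_ n x - f x.
   apply: cvgB; first exact: cvg_cst.
   have E : (fun k => s (n + k)%N x) = (fun k => s (k + n)%N x).
    by apply/funext => k; rewrite addnC.
   by rewrite E (cvg_shiftn n (fun k => s k x)).
  exact: cvgM.
 - by move=> k; apply: he; apply: leq_trans (nkn _); exact: leq_addr.
 - by move=> x; exact: sqr_ge0.
exists f; split => //.
- have [N0 hN0] := Cf 1 ltr01.
 have [iN _] : ibl (fun x => (f_ N0 x - f x) ^+ 2) /\ Int (fun x => (f_ N0 x - f x) ^+ 2) <= 1.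
  by apply: key => p Np; apply/ltW/hN0.
 apply: (@eq_ibl (fun x => (f_ N0 x - (f_ N0 x - f x)) ^+ 2)).
  by move=> x; rewrite subKr.
 apply: iblD2 => //; first by apply: measurable_funN; exact: measurable_funB.
 by apply: eq_ibl iN => x; rewrite sqrrN.
- apply: cvg0P => e e0; have [N0 hN0] := Cf (e / 2) (divr_gt0 e0 (ltr0n _ 2)).
 exists N0 => n Nn; rewrite ger0_norm; last by apply: Int_ge0 => x; exact: sqr_ge0.
 apply: le_lt_trans (_ : e / 2 < e); last by rewrite gtr_pMr// invf_lt1// ltr1n.
 by apply: (key n _ _).2 => p np; apply/ltW/hN0 => //; exact: leq_trans np.
Qed.

End integral_toolbox.

(** * Smooth functions of one real variable *)

Section smooth_one_dim.
Context {R : realType}.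
Implicit Types (f g h : R -> R).

(** Class C^k with the derivatives supplied as witnesses; closure under sums, products, composition
    and inverses then follows from the pointwise rules of differentiation. *)
Fixpoint S1 (k : nat) (h : R -> R) : Prop :=
 match k with
 | 0 => continuous h
 | k'.+1 => exists h' : R -> R, (forall x : R, is_derive x 1 h (h' x)) /\ S1 k' h'
 end.

Definition smooth h := forall k, S1 k h.

Lemma is_derive_continuous h h' : (forall x : R, is_derive x 1 h (h' x)) -> continuous h.
Proof.
move=> hh x; have [dh _] := hh x.
by move/derivable1_diffP : dh => /differentiable_continuous.
Qed.

Lemma S1_continuous k h : S1 k h -> continuous h.
Proof. by case: k => // k [h' [hh' _]]; exact: is_derive_continuous hh'. Qed.

Lemma S1W k h : S1 k.+1 h -> S1 k h.
Proof.
elim: k h => [|k IH] h; first exact: S1_continuous.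
by move=> [h' [hh' Sh']]; exists h'; split => //; exact: IH.
Qed.

Lemma S1_cst k (c : R) : S1 k (fun=> c).
Proof.
elim: k c => [|k IH] c; first exact: cst_continuous.
by exists (fun=> 0); split => // x; exact: is_derive_cst.
Qed.

Lemma S1_id k : S1 k id.
Proof.
case: k => [|k]; first by move=> x; exact: cvg_id.
by exists (fun=> 1); split; [move=> x; exact: is_derive_id|exact: S1_cst].
Qed.

Lemma S1D k f g : S1 k f -> S1 k g -> S1 k (fun x => f x + g x).
Proof.
elim: k f g => [|k IH] f g; first by move=> cf cg x; apply: cvgD; [exact: cf|exact: cg].
move=> [f' [ff' Sf]] [g' [gg' Sg]]; exists (fun x => f' x + g' x).
by split; [move=> x; exact: is_deriveD|exact: IH].
Qed.

Lemma S1M k f g : S1 k f -> S1 k g -> S1 k (fun x => f x * g x).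
Proof.
elim: k f g => [|k IH] f g; first by move=> cf cg x; apply: cvgM; [exact: cf|exact: cg].
move=> Sf Sg; have := S1W Sf; have := S1W Sg.
case: Sf => [f' [ff' Sf']]; case: Sg => [g' [gg' Sg']] Sg Sf.
exists (fun x => f x * g' x + g x * f' x); split; first by move=> x; exact: is_deriveM.
by apply: S1D; exact: IH.
Qed.

Lemma S1Z k (c : R) f : S1 k f -> S1 k (fun x => c * f x).
Proof. by move=> Sf; apply: S1M => //; exact: S1_cst. Qed.

Lemma S1N k f : S1 k f -> S1 k (fun x => - f x).
Proof.
move=> /(S1Z (-1)); rewrite (_ : (fun x => -1 * f x) = fun x => - f x)//.
by apply/funext => x; rewrite mulN1r.
Qed.

Lemma S1B k f g : S1 k f -> S1 k g -> S1 k (fun x => f x - g x).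
Proof. by move=> Sf Sg; apply: S1D => //; exact: S1N. Qed.

Lemma S1_comp k f g : S1 k f -> S1 k g -> S1 k (fun x => f (g x)).
Proof.
elim: k f g => [|k IH] f g.
 by move=> cf cg x; apply: continuous_comp; [exact: cg|exact: cf].
move=> [f' [ff' Sf']] Sg; have := S1W Sg; case: Sg => [g' [gg' Sg']] Sg.
exists (fun x => f' (g x) * g' x); split; last by apply: S1M => //; exact: IH.
by move=> x; exact: (@is_derive1_comp _ f g).
Qed.

Lemma S1V k f : (forall x, f x != 0) -> S1 k f -> S1 k (fun x => (f x)^-1).
Proof.
move=> f0; elim: k => [|k IH]; first by move=> cf x; apply: cvgV => //; exact: cf.
move=> Sf; have Sf_ := S1W Sf; case: Sf => [f' [ff' Sf']].
exists (fun x => - ((f x)^-1 * (f x)^-1) * f' x); split.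
 by move=> x; rewrite -invfM -expr2; apply: is_deriveV.
by apply: S1M => //; apply: S1N; apply: S1M; exact: IH.
Qed.

Lemma S1_ln k f : (forall x, 0 < f x) -> S1 k f -> S1 k (fun x => ln (f x)).
Proof.
move=> f0; case: k => [cf x|k Sf].
 by apply: continuous_comp; [exact: cf|exact: continuous_ln].
have Sf_ := S1W Sf; case: Sf => [f' [ff' Sf']].
exists (fun x => (f x)^-1 * f' x); split.
 by move=> x; apply: (@is_derive1_comp _ (@ln R) f); exact: is_derive1_ln.
by apply: S1M => //; apply: S1V => // x; rewrite gt_eqF.
Qed.

(* [flat p s = p(1/s) e^(-1/s)] for [s > 0], extended by zero; the derivative
  is [flat] of the polynomial [X^2 (p - p')]. *)
Definition flat (p : {poly R}) (s : R) : R :=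
 if 0 < s then p.[s^-1] * expR (- s^-1) else 0.

(** With [y = 1/s] and [q = p X] one has [p(y) = q(y) s], so a bound on [q(y) e^(-y)] suffices, and
    each monomial obeys [y^i <= i! e^y]. The decay at 0 is what continuity of the difference
    quotients there requires. *)
Lemma flat_bound (p : {poly R}) : exists2 C, 0 <= C & forall s, `|flat p s| <= C * `|s|.
Proof.
pose q := p * 'X.
exists (\sum_(i < size q) `|q`_i| * i`!%:R) => [|s].
 by apply: sumr_ge0 => i _; rewrite mulr_ge0.
rewrite /flat; case: ifPn => [s0|_]; last by rewrite normr0 mulr_ge0// sumr_ge0// => i _; rewrite mulr_ge0.
have y0 : 0 < s^-1 by rewrite invr_gt0.
rewrite normrM (ger0_norm (expR_ge0 _)) expRN ler_pdivrMr ?expR_gt0//.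
have -> : p.[s^-1] = q.[s^-1] * s by rewrite /q hornerMX mulfVK// gt_eqF.
rewrite normrM mulrAC ler_wpM2r//.
rewrite horner_coef mulr_suml; apply: le_trans (ler_norm_sum _ _ _) _.
apply: ler_sum => i _; rewrite normrM -mulrA ler_wpM2l// ger0_norm; last by rewrite exprn_ge0// ltW.
case: (nat_of_ord i) => [|n].
 by rewrite expr0 fact0 mul1r -expR0 ler_expR (ltW y0).
rewrite mulrC -ler_pdivrMr ?ltr0n ?fact_gt0//.
by apply: le_trans (expR_ge1Dxn n (ltW y0)); rewrite lerDr.
Qed.

Lemma flat_derive p (x : R) : is_derive x 1 (flat p) (flat ('X^2 * (p - p^`())) x).
Proof.
have [x0|x0|->] := ltgtP x 0.
- rewrite {2}/flat ltNge (ltW x0)/=.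
 apply: (@near_eq_is_derive _ _ _ (cst 0)).
 near=> z; rewrite /flat ltNge (_ : z <= 0)//; apply: ltW.
 by near: z; exact: lt_nbhsl.
- rewrite {2}/flat x0.
 have E : \near x, p.[x^-1] * expR (- x^-1) = flat p x.
  by near=> z; rewrite /flat ifT//; near: z; exact: lt_nbhsr.
 have xn0 : x != 0 by rewrite gt_eqF.
 have iV : is_derive x 1 (fun z : R => z^-1) (- x ^- 2).
  have := @is_deriveV _ id x 1 1 xn0 (is_derive_id _ _).
  by move=> h; apply: is_derive_eq h _; rewrite /= [LHS]mulr1.
 have ip : is_derive x 1 (fun z => p.[z^-1]) ((p^`()).[x^-1] * (- x ^- 2)).
  exact: (@is_derive1_comp _ (horner p) (fun z : R => z^-1)).
 have ie : is_derive x 1 (fun z => expR (- z^-1)) (expR (- x^-1) * (x ^- 2)).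
  apply: (@is_derive1_comp _ (@expR R) (fun z : R => - z^-1)).
  by rewrite -[x ^- 2]opprK; exact: is_deriveN.
 apply: (near_eq_is_derive E); apply: is_derive_eq (is_deriveM ip ie) _ => /=.
 by rewrite !hornerE /= -![_ *: _]/(_ * _); field.
(* At 0 the difference quotient of [flat p] is [flat (p * 'X)], which tends to 0 by [flat_bound]. *)
- rewrite {2}/flat ltxx; apply/is_derive1_caratheodory; exists (flat (p * 'X)); split.
 + move=> z; rewrite subr0 [flat p 0]/flat ltxx subr0 /flat; case: ifPn => z0.
   by rewrite hornerMX; field; rewrite gt_eqF.
  by rewrite mul0r.
 + have [C C0 hC] := flat_bound (p * 'X).
  apply/cvgrPdist_lt => e e0; exists (e / (C + 1)) => [|z] /=.
   by rewrite divr_gt0// ltr_wpDl.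
  rewrite sub0r normrN ltr_pdivlMr ?ltr_wpDl// => ze.
  rewrite [flat _ 0]/flat ltxx sub0r normrN.
  apply: le_lt_trans (hC z) _; apply: le_lt_trans ze.
  by rewrite mulrC ler_wpM2l// lerDl.
 + by rewrite /flat ltxx.
Unshelve. all: by end_near. Qed.

Lemma S1_flat p k : S1 k (flat p).
Proof.
elim: k p => [|k IH] p; first exact: is_derive_continuous (flat_derive p).
by exists (flat ('X^2 * (p - p^`()))); split => //; exact: flat_derive.
Qed.

End smooth_one_dim.

(** * Cutoffs, the smooth ramp and the penalty for leaving [0, 1] *)

Section profiles.
Context {R : realType}.
Implicit Types (s : R).

Lemma smooth_continuous (f : R -> R) : smooth f -> continuous f.
Proof. by move=> /(_ 0%N). Qed.

Lemma smooth_derive (f : R -> R) : smooth f ->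
 exists f', (forall x : R, is_derive x 1 f (f' x)) /\ smooth f'.
Proof.
move=> sf; exists (fun x => 'D_1 f x); split=> [x|k].
 by have [f' [ff' _]] := sf 1%N; have [df _] := ff' x; exact: DeriveDef.
have [f' [ff' Sf']] := sf k.+1.
rewrite (_ : (fun x => 'D_1 f x) = f')//; apply/funext => x.
by have [_ ] := ff' x.
Qed.

Definition bexp (s : R) := flat 1 s.

Lemma smooth_bexp : smooth bexp. Proof. by move=> k; exact: S1_flat. Qed.

Lemma bexpE s : 0 < s -> bexp s = expR (- s^-1).
Proof. by move=> s0; rewrite /bexp /flat s0 hornerC mul1r. Qed.

Lemma flat_le0 p s : s <= 0 -> flat p s = 0.
Proof. by move=> s0; rewrite /flat ltNge s0. Qed.

Lemma bexp_gt0 s : 0 < s -> 0 < bexp s.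
Proof. by move=> s0; rewrite bexpE// expR_gt0. Qed.

Lemma bexp_ge0 s : 0 <= bexp s.
Proof. by have [/bexp_gt0/ltW//|s0] := ltP 0 s; rewrite /bexp flat_le0. Qed.

Lemma bexp_le1 s : bexp s <= 1.
Proof.
have [s0|s0] := ltP 0 s; last by rewrite /bexp flat_le0.
by rewrite bexpE// expR_le1 oppr_le0 invr_ge0 ltW.
Qed.

Definition step (s : R) := bexp s / (bexp s + bexp (1 - s)).

Lemma step_den s : 0 < bexp s + bexp (1 - s).
Proof.
have [s0|s0] := ltP 0 s; first by rewrite ltr_pwDl ?bexp_gt0 ?bexp_ge0.
by rewrite ltr_wpDl ?bexp_ge0// bexp_gt0//; lra.
Qed.

Lemma smooth_step : smooth step.
Proof.
move=> k; apply: S1M; first exact: smooth_bexp.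
apply: S1V => [x|]; first by rewrite gt_eqF// step_den.
apply: S1D; first exact: smooth_bexp.
by apply: S1_comp; [exact: smooth_bexp|apply: S1B; [exact: S1_cst|exact: S1_id]].
Qed.

Lemma step_ge0 s : 0 <= step s.
Proof. by rewrite divr_ge0 ?bexp_ge0// ltW// step_den. Qed.

Lemma step_le1 s : step s <= 1.
Proof. by rewrite ler_pdivrMr ?step_den// mul1r lerDl bexp_ge0. Qed.

Lemma step_le0 s : s <= 0 -> step s = 0.
Proof. by move=> s0; rewrite /step /bexp flat_le0// mul0r. Qed.

Lemma step_ge1 s : 1 <= s -> step s = 1.
Proof.
move=> s1; rewrite /step [bexp (1 - s)](flat_le0 _)//; last by lra.
by rewrite addr0 divff// gt_eqF// bexp_gt0//; lra.
Qed.

(** The argument of [step] is 1 at [|s| = 1] and 0 at [|s| = 2]. *)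
Definition bump (s : R) := step ((4 - s ^+ 2) / 3).

Lemma S1_sqr k : S1 k (fun s : R => s ^+ 2).
Proof.
rewrite (_ : (fun s => _) = fun s => id s * id s); first by apply: S1M; exact: S1_id.
by apply/funext => s; rewrite expr2.
Qed.

Lemma smooth_bump : smooth bump.
Proof.
move=> k; apply: S1_comp; first exact: smooth_step.
apply: S1M; last exact: S1_cst.
by apply: S1B; [exact: S1_cst|exact: S1_sqr].
Qed.

Lemma bump_ge0 s : 0 <= bump s. Proof. exact: step_ge0. Qed.
Lemma bump_le1 s : bump s <= 1. Proof. exact: step_le1. Qed.
Lemma bumpN s : bump (- s) = bump s. Proof. by rewrite /bump sqrrN. Qed.

Lemma bump_eq1 s : `|s| <= 1 -> bump s = 1.
Proof.
move=> s1; apply: step_ge1; have : s ^+ 2 <= 1.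
 by rewrite -real_normK ?num_real// expr_le1.
by lra.
Qed.

Lemma bump_eq0 s : 2 <= `|s| -> bump s = 0.
Proof.
move=> s1; apply: step_le0; have : 4 <= s ^+ 2.
 by rewrite -real_normK ?num_real//; nra.
by lra.
Qed.

(* A smooth convex replacement for the positive part. *)
Definition ramp s := s * bexp s.
Definition ramp1 s := flat (1 + 'X : {poly R}) s.
Definition ramp2 s := flat ('X^3 : {poly R}) s.

Lemma smooth_ramp : smooth ramp.
Proof. by move=> k; apply: S1M; [exact: S1_id|exact: smooth_bexp]. Qed.

Lemma smooth_ramp1 : smooth ramp1. Proof. by move=> k; exact: S1_flat. Qed.
Lemma smooth_ramp2 : smooth ramp2. Proof. by move=> k; exact: S1_flat. Qed.

Lemma is_derive_ramp s : is_derive s 1 ramp (ramp1 s).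
Proof.
have h := is_deriveM (is_derive_id s 1) (@flat_derive R 1 s).
apply: is_derive_eq h _; rewrite -![_ *: _]/(_ * _) mulr1 /ramp1 /flat.
case: ifPn => s0; last by rewrite mulr0 add0r.
by rewrite !hornerE /= derivC hornerC; field; rewrite gt_eqF.
Qed.

Lemma is_derive_ramp1 s : is_derive s 1 ramp1 (ramp2 s).
Proof.
apply: is_derive_eq (@flat_derive R (1 + 'X) s) _; rewrite /ramp2; congr flat.
rewrite derivD derivC derivX; ring.
Qed.

Lemma ramp_ge0 s : 0 <= ramp s.
Proof.
have [s0|s0] := ltP 0 s; first by rewrite mulr_ge0 ?ltW// bexp_gt0.
by rewrite /ramp /bexp flat_le0// mulr0.
Qed.

Lemma ramp_le0 s : s <= 0 -> ramp s = 0.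
Proof. by move=> s0; rewrite /ramp /bexp flat_le0// mulr0. Qed.

Lemma ramp_le s : 0 <= s -> ramp s <= s.
Proof. by move=> s0; rewrite /ramp ler_piMr// bexp_le1. Qed.

Lemma ramp1_ge0 s : 0 <= ramp1 s.
Proof.
rewrite /ramp1 /flat; case: ifPn => // s0.
by rewrite !hornerE mulr_ge0 ?expR_ge0// addr_ge0// invr_ge0 ltW.
Qed.

Lemma ramp1_le1 s : ramp1 s <= 1.
Proof.
rewrite /ramp1 /flat; case: ifPn => // s0.
by rewrite !hornerE expRN ler_pdivrMr ?expR_gt0// mul1r expR_ge1Dx.
Qed.

Lemma ramp2_ge0 s : 0 <= ramp2 s.
Proof.
rewrite /ramp2 /flat; case: ifPn => // s0.
by rewrite !hornerE mulr_ge0 ?expR_ge0// exprn_ge0// invr_ge0 ltW.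
Qed.

Lemma ramp2_gt0 s : 0 < s -> 0 < ramp2 s.
Proof.
move=> s0; rewrite /ramp2 /flat s0.
by rewrite !hornerE mulr_gt0 ?expR_gt0// exprn_gt0// invr_gt0.
Qed.

Lemma ramp2_le s : ramp2 s <= 6.
Proof.
rewrite /ramp2 /flat; case: ifPn => // s0.
rewrite !hornerE expRN ler_pdivrMr ?expR_gt0//.
have y0 : 0 <= s^-1 by rewrite invr_ge0 ltW.
have := expR_ge1Dxn 2 y0; rewrite (_ : 3`!%:R = 6 :> R)// => h.
have {}h : s^-1 ^+ 3 / 6 <= expR s^-1 by apply: le_trans h; rewrite lerDr.
by rewrite -ler_pdivrMl// mulrC.
Qed.

(** A convex penalty that vanishes exactly on [0, 1]. Functions approximating some [u] with values
    in [0, 1] may leave this interval; used as a profile, [trap] shows that their energy weighted by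
    [trap2] tends to 0. *)
Definition trap s := ramp (s - 1) + ramp (- s).
Definition trap1 s := ramp1 (s - 1) - ramp1 (- s).
Definition trap2 s := ramp2 (s - 1) + ramp2 (- s).

Lemma is_derive_subr s c : is_derive s 1 (fun x : R => x - c) 1.
Proof.
have h := is_deriveB (is_derive_id s 1) (is_derive_cst c s 1).
by apply: is_derive_eq h _; rewrite subr0.
Qed.

Lemma is_derive_trap s : is_derive s 1 trap (trap1 s).
Proof.
have h1 := @is_derive1_comp _ ramp (fun x => x - 1) s _ _ (is_derive_ramp (s - 1)) (is_derive_subr s 1).
have h2 := @is_derive1_comp _ ramp -%R s _ _ (is_derive_ramp (- s)) (is_deriveNid s 1).
by apply: is_derive_eq (is_deriveD h1 h2) _; rewrite /trap1 mulr1 mulrN1.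
Qed.

Lemma is_derive_trap1 s : is_derive s 1 trap1 (trap2 s).
Proof.
have h1 := @is_derive1_comp _ ramp1 (fun x => x - 1) s _ _ (is_derive_ramp1 (s - 1)) (is_derive_subr s 1).
have h2 := @is_derive1_comp _ ramp1 -%R s _ _ (is_derive_ramp1 (- s)) (is_deriveNid s 1).
by apply: is_derive_eq (is_deriveB h1 h2) _; rewrite /trap2 mulr1 mulrN1 opprK.
Qed.

Lemma smooth_trap : smooth trap.
Proof.
move=> k; apply: S1D; apply: S1_comp; try exact: smooth_ramp.
 by apply: S1B; [exact: S1_id|exact: S1_cst].
by apply: S1N; exact: S1_id.
Qed.

Lemma smooth_trap2 : smooth trap2.
Proof.
move=> k; apply: S1D; apply: S1_comp; try exact: smooth_ramp2.
 by apply: S1B; [exact: S1_id|exact: S1_cst].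
by apply: S1N; exact: S1_id.
Qed.

Lemma trap_in s : 0 <= s <= 1 -> [/\ trap s = 0, trap1 s = 0 & trap2 s = 0].
Proof.
move=> /andP[s0 s1].
have h1 : s - 1 <= 0 by lra. have h2 : - s <= 0 by lra.
by rewrite /trap /trap1 /trap2 /ramp1 /ramp2 !ramp_le0// !flat_le0// addr0 subr0.
Qed.

Lemma trap1_le s : `|trap1 s| <= 1.
Proof.
have := ramp1_ge0 (s - 1); have := ramp1_ge0 (- s).
have := ramp1_le1 (s - 1); have := ramp1_le1 (- s).
by rewrite /trap1 ler_norml => *; apply/andP; split; lra.
Qed.

Lemma trap2_ge0 s : 0 <= trap2 s.
Proof. by rewrite addr_ge0// ramp2_ge0. Qed.

Lemma trap2_le s : trap2 s <= 12.
Proof. by have := ramp2_le (s - 1); have := ramp2_le (- s); rewrite /trap2; lra. Qed.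

Lemma trap2_gt0 s : ~~ (0 <= s <= 1) -> 0 < trap2 s.
Proof.
rewrite negb_and -!ltNge => /orP[h|h].
 by rewrite ltr_wpDl ?ramp2_ge0// ramp2_gt0//; lra.
by rewrite ltr_pwDl ?ramp2_ge0// ramp2_gt0//; lra.
Qed.

Lemma continuous_itv_bounded (f : R -> R) a b : continuous f ->
 exists2 M, 0 <= M & forall x, a <= x <= b -> `|f x| <= M.
Proof.
move=> cf; have [ab|ba] := leP a b; last first.
 by exists 0 => // x /andP[ax xb]; exfalso; lra.
have [c _ hc] : exists2 c, c \in `[a, b]%R & forall t, t \in `[a, b]%R -> `|f t| <= `|f c|.
 apply: (@EVT_max _ (fun t => `|f t|)) => //.
 by apply: continuous_subspaceT => x; apply: (continuous_comp (cf x)); exact: norm_continuous.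
by exists `|f c| => // x hx; apply: hc; rewrite in_itv.
Qed.

(** Outside [[-2, 3]] there is nothing to compensate. On the two compact intervals between
    [[- dlt, 1 + dlt]] and these ends [trap2] has a positive minimum and [a] is bounded, so a large
    multiple of [trap2] wins. *)
Lemma trap2_slack (a : R -> R) (dlt : R) : continuous a -> 0 < dlt ->
 (forall s, - dlt <= s <= 1 + dlt -> 0 <= a s) ->
 (forall s, ~~ (-2 <= s <= 3) -> 0 <= a s) ->
 exists2 C, 0 <= C & forall s, 0 <= a s + C * trap2 s.
Proof.
move=> ca d0 ain aout.
have ct : continuous trap2 by exact: smooth_continuous smooth_trap2.
have pos p q : (forall s, p <= s <= q -> 0 < trap2 s) ->
  exists2 c, 0 < c & forall s, p <= s <= q -> c <= trap2 s.
 move=> h; have [pq|qp] := leP p q; last first.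
  by exists 1 => // s /andP[ps sq]; exfalso; lra.
 have [c ci hc] : exists2 c, c \in `[p, q]%R & forall t, t \in `[p, q]%R -> trap2 c <= trap2 t.
  by apply: EVT_min => //; exact: continuous_subspaceT.
 by exists (trap2 c) => [|s hs]; [apply: h; rewrite in_itv in ci|apply: hc; rewrite in_itv].
have [M M0 hM] := continuous_itv_bounded (-2) 3 ca.
have [|c1 c10 h1] := pos (-2) (- dlt).
 by move=> s /andP[_ sd]; apply: trap2_gt0; rewrite negb_and -!ltNge; apply/orP; left; lra.
have [|c2 c20 h2] := pos (1 + dlt) 3.
 by move=> s /andP[sd _]; apply: trap2_gt0; rewrite negb_and -!ltNge; apply/orP; right; lra.
have H c s : 0 < c -> c <= trap2 s -> -2 <= s <= 3 -> 0 <= a s + M / c * trap2 s.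
 move=> c0 ct2 s23; have := hM _ s23; rewrite ler_norml => /andP[Ma _].
 rewrite -lerBlDl sub0r; apply: (@le_trans _ _ M); first by lra.
 by rewrite mulrAC ler_pdivlMr// ler_wpM2l.
exists (M / c1 + M / c2) => [|s]; first by rewrite addr_ge0// divr_ge0// ltW.
rewrite mulrDl; have t0 := trap2_ge0 s.
have Mc1 : 0 <= M / c1 * trap2 s by rewrite mulr_ge0// divr_ge0// ltW.
have Mc2 : 0 <= M / c2 * trap2 s by rewrite mulr_ge0// divr_ge0// ltW.
have [s23|] := boolP (-2 <= s <= 3); last by move/aout; lra.
have [sd|sd] := leP s (- dlt).
 by have := H c1 s c10 (h1 _ _) s23; rewrite sd; move: s23 => /andP[-> _] /(_ isT); lra.
have [sd'|sd'] := leP (1 + dlt) s.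
 by have := H c2 s c20 (h2 _ _) s23; rewrite sd'; move: s23 => /andP[_ ->] /(_ isT); lra.
by have := ain s; rewrite (ltW sd) (ltW sd') => /(_ isT); lra.
Qed.

End profiles.

(** * Smooth functions and test functions of several variables *)

Section smooth_rV.
Context {R : realType} {d : nat}.
Local Notation Rd := 'rV[R]_d.
Local Notation e_ i := (delta_mx ord0 i : Rd).
Implicit Types (f g : Rd -> R) (k : nat).

Definition Coo f := forall k, Ck k f.

Lemma fun_continuousD f g : continuous f -> continuous g -> continuous (fun x => f x + g x).
Proof. by move=> cf cg x; exact: (continuousD (cf x) (cg x)). Qed.

Lemma fun_continuousM f g : continuous f -> continuous g -> continuous (fun x => f x * g x).
Proof. by move=> cf cg x; exact: (continuousM (cf x) (cg x)). Qed.

Lemma Ck_continuous k f : Ck k f -> continuous f.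
Proof. by case: k => [[]|k []]. Qed.

Lemma Coo_continuous f : Coo f -> continuous f.
Proof. by move=> /(_ 0%N)[]. Qed.

Lemma CkW k f : Ck k.+1 f -> Ck k f.
Proof.
elim: k f => [|k IH] f; first by case.
move=> [cf h]; split => // i; have [df Cf] := h i; split => //.
exact: IH.
Qed.

Lemma pderivE i f x l : is_derive x (e_ i) f l -> pderiv i f x = l.
Proof. by move=> h; rewrite /pderiv derive_val. Qed.

Lemma CkS k f (F : 'I_d -> Rd -> R) : continuous f ->
 (forall i x, is_derive x (e_ i) f (F i x)) -> (forall i, Ck k (F i)) -> Ck k.+1 f.
Proof.
move=> cf fF CF; split => // i; split.
 by move=> x; have [] := fF i x.
rewrite (_ : pderiv i f = F i)//.
by apply/funext => x; exact: pderivE.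
Qed.

Lemma Ck_derive k f : Ck k.+1 f ->
 (forall i x, is_derive x (e_ i) f (pderiv i f x)) /\ (forall i, Ck k (pderiv i f)).
Proof.
move=> [cf h]; split=> [i x|i]; last by have [] := h i.
by have [df _] := h i; apply: DeriveDef.
Qed.

Lemma Coo_derive f i x : Coo f -> is_derive x (e_ i) f (pderiv i f x).
Proof. by move=> /(_ 1%N)/Ck_derive[h _]; exact: h. Qed.

Lemma Coo_pderiv f i : Coo f -> Coo (pderiv i f).
Proof. by move=> h k; have /Ck_derive[_] := h k.+1; exact. Qed.

Lemma Ck_cst k (c : R) : Ck k (fun _ : Rd => c).
Proof.
elim: k c => [|k IH] c; first by split => //; exact: cst_continuous.
by apply: (@CkS k _ (fun _ _ => 0)) => //; exact: cst_continuous.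
Qed.

Lemma CkD k f g : Ck k f -> Ck k g -> Ck k (fun x => f x + g x).
Proof.
elim: k f g => [|k IH] f g.
 by move=> [cf _] [cg _]; split => //; exact: fun_continuousD.
move=> Cf Cg; have cf := Ck_continuous Cf; have cg := Ck_continuous Cg.
have [df Df] := Ck_derive Cf; have [dg Dg] := Ck_derive Cg.
apply: (@CkS k _ (fun i x => pderiv i f x + pderiv i g x)).
- exact: fun_continuousD.
- by move=> i; apply: IH.
Qed.

Lemma CkM k f g : Ck k f -> Ck k g -> Ck k (fun x => f x * g x).
Proof.
elim: k f g => [|k IH] f g.
 by move=> [cf _] [cg _]; split => //; exact: fun_continuousM.
move=> Cf Cg; have cf := Ck_continuous Cf; have cg := Ck_continuous Cg.
have [df Df] := Ck_derive Cf; have [dg Dg] := Ck_derive Cg.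
have Cf' := CkW Cf; have Cg' := CkW Cg.
apply: (@CkS k _ (fun i x => f x * pderiv i g x + g x * pderiv i f x)).
- exact: fun_continuousM.
- by move=> i; apply: CkD; apply: IH.
Qed.

Lemma CkZ k (c : R) f : Ck k f -> Ck k (fun x => c * f x).
Proof. by move=> Cf; apply: CkM => //; exact: Ck_cst. Qed.

Lemma CkN k f : Ck k f -> Ck k (fun x => - f x).
Proof.
move=> /(CkZ (-1)); rewrite (_ : (fun x => -1 * f x) = fun x => - f x)//.
by apply/funext => x; rewrite mulN1r.
Qed.

Lemma CkB k f g : Ck k f -> Ck k g -> Ck k (fun x => f x - g x).
Proof. by move=> Cf Cg; apply: CkD => //; exact: CkN. Qed.

(** Directional derivatives become derivatives in one variable along a line, which opens the way to
    the one-dimensional chain rule and mean value theorem. *)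
Lemma line_derive f (v x : Rd) (t l : R) : is_derive (x + t *: v) v f l ->
 is_derive t 1 (fun s : R => f (x + s *: v)) l.
Proof.
move=> [df Df].
have E : (fun h : R => h^-1 *: (((fun s : R => f (x + s *: v)) \o shift t) (h *: 1) - f (x + t *: v)))
  = (fun h : R => h^-1 *: ((f \o shift (x + t *: v)) (h *: v) - f (x + t *: v))).
 apply/funext => h /=; congr (_ *: (f _ - _)).
 by rewrite [h *: 1]mulr1 scalerDl addrCA.
by split; rewrite ?/derivable ?/derive E.
Qed.

Lemma line_deriveP f (v x : Rd) (l : R) :
 is_derive (0 : R) 1 (fun s : R => f (x + s *: v)) l -> is_derive x v f l.
Proof.
move=> [df Df].
have E : (fun h : R => h^-1 *: (((fun s : R => f (x + s *: v)) \o shift 0) (h *: 1) - f (x + 0 *: v)))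
  = (fun h : R => h^-1 *: ((f \o shift x) (h *: v) - f x)).
 apply/funext => h /=; congr (_ *: (f _ - f _)); last by rewrite scale0r addr0.
 by rewrite [h *: 1]mulr1 addr0 addrC.
by split; rewrite ?/derivable ?/derive -E.
Qed.

Lemma is_derive_comp (p : R -> R) f (x v : Rd) (a b : R) :
 is_derive (f x) 1 p a -> is_derive x v f b -> is_derive x v (fun y => p (f y)) (a * b).
Proof.
move=> dp df; apply: line_deriveP.
apply: (@is_derive1_comp _ p (fun s => f (x + s *: v))).
 by rewrite scale0r addr0.
by apply: line_derive; rewrite scale0r addr0.
Qed.

Lemma Ck_comp k (p : R -> R) f : S1 k p -> Ck k f -> Ck k (fun x => p (f x)).
Proof.
elim: k p f => [|k IH] p f.
 by move=> cp [cf _]; split => // x; apply: continuous_comp; [exact: cf|exact: cp].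
move=> Sp Cf; have cf := Ck_continuous Cf; have cp := S1_continuous Sp.
have [df Df] := Ck_derive Cf; case: Sp => [p' [pp' Sp']].
apply: (@CkS k _ (fun i x => p' (f x) * pderiv i f x)).
- by move=> x; apply: continuous_comp; [exact: cf|exact: cp].
- by move=> i x; exact: is_derive_comp.
- by move=> i; apply: CkM => //; apply: IH => //; exact: CkW.
Qed.

Lemma is_derive_coord (v x : Rd) (j : 'I_d) : is_derive x v (fun y : Rd => y ord0 j) (v ord0 j).
Proof.
apply: line_deriveP.
rewrite (_ : (fun s : R => _) = fun s : R => x ord0 j + v ord0 j * s); last first.
 by apply/funext => s; rewrite !mxE mulrC.
have h := is_deriveD (is_derive_cst (x ord0 j) (0 : R) (1 : R))
  (is_deriveM (is_derive_cst (v ord0 j) (0 : R) (1 : R)) (is_derive_id (0 : R) (1 : R))).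
apply: is_derive_eq h _.
by rewrite -![_ *: _]/(_ * _) mulr0 addr0 add0r mulr1.
Qed.

Lemma Ck_coord k (j : 'I_d) : Ck k (fun y : Rd => y ord0 j).
Proof.
have c : continuous (fun y : Rd => y ord0 j) by move=> x; exact: coord_continuous.
case: k => [|k]; first by split.
apply: (@CkS k _ (fun i _ => e_ i ord0 j)) => //.
- by move=> i x; exact: is_derive_coord.
- by move=> i; exact: Ck_cst.
Qed.

Lemma Ck_prod k (I : Type) (r : seq I) (F : I -> Rd -> R) :
 (forall i, Ck k (F i)) -> Ck k (fun x => \prod_(i <- r) F i x).
Proof.
move=> CF; elim: r => [|i r IH]; first by under eq_fun do rewrite big_nil; exact: Ck_cst.
by under eq_fun do rewrite big_cons; exact: CkM.
Qed.

Lemma Ck_sum k (I : Type) (r : seq I) (F : I -> Rd -> R) :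
 (forall i, Ck k (F i)) -> Ck k (fun x => \sum_(i <- r) F i x).
Proof.
move=> CF; elim: r => [|i r IH]; first by under eq_fun do rewrite big_nil; exact: Ck_cst.
by under eq_fun do rewrite big_cons; exact: CkD.
Qed.

Lemma Coo_comp (p : R -> R) f : smooth p -> Coo f -> Coo (fun x => p (f x)).
Proof. by move=> sp cf k; exact: Ck_comp. Qed.

Lemma CooD f g : Coo f -> Coo g -> Coo (fun x => f x + g x).
Proof. by move=> cf cg k; exact: CkD. Qed.

Lemma CooB f g : Coo f -> Coo g -> Coo (fun x => f x - g x).
Proof. by move=> cf cg k; exact: CkB. Qed.

Lemma CooM f g : Coo f -> Coo g -> Coo (fun x => f x * g x).
Proof. by move=> cf cg k; exact: CkM. Qed.

Lemma Coo_cst c : Coo (fun=> c).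
Proof. by move=> k; exact: Ck_cst. Qed.

Lemma pderiv_comp (p p' : R -> R) f i x : (forall s : R, is_derive s 1 p (p' s)) -> Coo f ->
 pderiv i (fun y => p (f y)) x = p' (f x) * pderiv i f x.
Proof. by move=> pp' cf; apply/pderivE/is_derive_comp => //; exact: Coo_derive. Qed.

Lemma pderivM f g i x : Coo f -> Coo g ->
 pderiv i (fun y => f y * g y) x = f x * pderiv i g x + g x * pderiv i f x.
Proof. by move=> cf cg; apply/pderivE/is_deriveM; exact: Coo_derive. Qed.

Lemma pderivB f g i x : Coo f -> Coo g ->
 pderiv i (fun y => f y - g y) x = pderiv i f x - pderiv i g x.
Proof. by move=> cf cg; apply/pderivE/is_deriveB; exact: Coo_derive. Qed.

Lemma pderiv_cst (c : R) i (x : Rd) : pderiv i (fun _ : Rd => c) x = 0.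
Proof. by apply: pderivE. Qed.

Lemma near_pderiv f g i x : (\near x, f x = g x) -> pderiv i f x = pderiv i g x.
Proof.
move=> fg; have v0 : e_ i != 0.
 apply/eqP => /matrixP/(_ ord0 i); rewrite !mxE !eqxx => /eqP.
 by rewrite oner_eq0.
exact: near_eq_derive.
Qed.

Lemma supportP f x : ~ support f x -> f x = 0.
Proof.
move=> h; apply: contrapT => fx; apply: h.
by apply: subset_closure; exact/eqP.
Qed.

Lemma support_sub f (K : set Rd) : closed K -> (forall x, ~ K x -> f x = 0) -> support f `<=` K.
Proof.
move=> cK h; move/closure_id : (cK) => ->; apply: closure_subset => y /= fy.
by apply: contrapT => /h fy0; rewrite fy0 eqxx in fy.
Qed.

Lemma pderiv_support f i x : ~ support f x -> pderiv i f x = 0.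
Proof.
move=> h; rewrite -(@pderiv_cst 0 i x); apply: near_pderiv.
have : nbhs x (~` support f).
 by apply: open_nbhs_nbhs; split => //; apply: closed_openC; exact: closed_closure.
by apply: filterS => y /supportP.
Qed.

Lemma closed_compact_rV (K : set Rd) : compact K -> closed K.
Proof. by apply: compact_closed; exact: norm_hausdorff. Qed.

Lemma test_funI (V K : set Rd) f : Coo f -> compact K -> (forall x, ~ K x -> f x = 0) ->
 K `<=` V -> test_fun V f.
Proof.
move=> cf cK fK KV; have sK : support f `<=` K by apply: support_sub => //; exact: closed_compact_rV.
split => //; last exact: subset_trans KV.
by apply: (subclosed_compact _ cK sK); exact: closed_closure.
Qed.

Lemma test_Coo V f : test_fun V f -> Coo f. Proof. by case. Qed.

Lemma test_out V f x : test_fun V f -> ~ V x -> f x = 0.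
Proof. by move=> [_ _ sV] Vx; apply: supportP => /sV. Qed.

Lemma test_funS (V W : set Rd) f : V `<=` W -> test_fun V f -> test_fun W f.
Proof. by move=> VW [? ? h]; split => //; exact: subset_trans VW. Qed.

Lemma test_funW V f g : test_fun V f -> Coo g -> (forall x, ~ support f x -> g x = 0) ->
 test_fun V g.
Proof. by move=> [cf kf sV] cg h; apply: (@test_funI _ (support f)). Qed.

Lemma test_pderiv V f i : test_fun V f -> test_fun V (pderiv i f).
Proof.
move=> tf; apply: (test_funW tf); first by apply: Coo_pderiv; exact: test_Coo tf.
by move=> x; exact: pderiv_support.
Qed.

Lemma test_funM V f g : test_fun V f -> Coo g -> test_fun V (fun x => f x * g x).
Proof.
move=> tf cg; apply: (test_funW tf); first by apply: CooM => //; exact: test_Coo tf.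
by move=> x /supportP ->; rewrite mul0r.
Qed.

Lemma test_funMr V f g : test_fun V f -> Coo g -> test_fun V (fun x => g x * f x).
Proof.
move=> tf cg; apply: (test_funW tf); first by apply: CooM => //; exact: test_Coo tf.
by move=> x /supportP ->; rewrite mulr0.
Qed.

Lemma test_funZ V c f : test_fun V f -> test_fun V (fun x => c * f x).
Proof. by move=> tf; apply: test_funMr => //; exact: Coo_cst. Qed.

Lemma test_comp V f (p : R -> R) : test_fun V f -> smooth p -> p 0 = 0 ->
 test_fun V (fun x => p (f x)).
Proof.
move=> tf sp p0; apply: (test_funW tf); first by apply: Coo_comp => //; exact: test_Coo tf.
by move=> x /supportP ->.
Qed.

Lemma test_funD V f g : test_fun V f -> test_fun V g -> test_fun V (fun x => f x + g x).
Proof.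
move=> [cf kf sf] [cg kg sg]; apply: (@test_funI _ (support f `|` support g)).
- exact: CooD.
- exact: compactU.
- by move=> x /not_orP[/supportP -> /supportP ->]; rewrite addr0.
- by move=> x [/sf|/sg].
Qed.

Lemma test_funB V f g : test_fun V f -> test_fun V g -> test_fun V (fun x => f x - g x).
Proof.
move=> tf /(@test_funZ V (-1)) tg.
rewrite (_ : (fun x => _) = fun x => f x + -1 * g x); first exact: test_funD.
by apply/funext => x; rewrite mulN1r.
Qed.

End smooth_rV.

(** * Lebesgue measure on row vectors and its translation invariance *)

Section lebesgue_rV_theory.
Context {R : realType} {d : nat}.
Local Notation Rd := 'rV[R]_d.
Local Notation leb := (lebesgue_rV R d).
Implicit Types (x y z : Rd).

Lemma ball_rV x e y : ball x e y <-> 0 < e /\ forall i, `|x ord0 i - y ord0 i| < e.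
Proof.
split=> [[e0 h]|[e0 h]]; first by split => // i; exact: h.
by split => // i j; rewrite ord1; exact: h.
Qed.

Lemma norm_coord x i : `|x ord0 i| <= `|x|.
Proof.
rewrite [leRHS]/Num.Def.normr/= mx_normrE.
exact: (le_bigmax_cond _ (fun i : 'I_1 * 'I_d => `|x i.1 i.2|) (j := (ord0, i))).
Qed.

Definition cube (r : R) : set Rd := [set x | forall i, `|x ord0 i| <= r].

Lemma cube_compact r : compact (cube r).
Proof.
have -> : cube r = [set x : Rd | forall i, `[-r, r]%classic (x ord0 i)].
 by apply/seteqP; split => x h i; have := h i; rewrite /= in_itv/= ler_norml.
by apply: (@rV_compact R d (fun _ => `[-r, r]%classic)) => _; exact: segment_compact.
Qed.

Lemma cube_closed r : closed (cube r).
Proof. by apply: closed_compact_rV; exact: cube_compact. Qed.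

Lemma compact_cube (K : set Rd) : compact K -> exists2 r, 0 < r & K `<=` cube r.
Proof.
move=> /compact_bounded[M [Mr hM]]; exists (`|M| + 1); first by rewrite ltr_wpDl.
move=> x Kx i; apply: le_trans (norm_coord x i) _; apply: hM => //.
by apply: le_lt_trans (ler_norm M) _; rewrite ltrDl.
Qed.

Lemma fun_measurable (f : Rd -> R) : continuous f -> meas f.
Proof.
move=> cf; apply: (measurability (@RGenOpens.G R)); first exact: RGenOpens.measurableE.
move=> _ [_ [a [b ->]] <-]; rewrite setTI; apply: open_measurable_rV.
by apply: open_comp => [x _|]; [exact: cf|exact: interval_open].
Qed.

Lemma rV_measurable (f : Rd -> Rd) : continuous f -> meas f.
Proof.
move=> cf; apply: (measurability (@open Rd)) => //.
move=> _ [U oU <-]; rewrite setTI; apply: open_measurable_rV.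
by apply: open_comp => // x _; exact: cf.
Qed.

Lemma closed_measurable_rV (K : set Rd) : closed K -> measurable K.
Proof.
move=> cK; rewrite -[K]setCK; apply: measurableC; apply: open_measurable_rV.
exact: closed_openC.
Qed.

Lemma compact_measurable_rV (K : set Rd) : compact K -> measurable K.
Proof. by move=> /closed_compact_rV; exact: closed_measurable_rV. Qed.

Definition boxes : set (set Rd) := [set B | exists a b : Rd, B = box a b].

Lemma boxes_setI : setI_closed boxes.
Proof.
move=> _ _ [a [b ->]] [a' [b' ->]].
exists (\row_i Num.max (a ord0 i) (a' ord0 i)), (\row_i Num.min (b ord0 i) (b' ord0 i)).
apply/seteqP; split => x.
 move=> [h h'] i; have := h i; have := h' i; rewrite !mxE gt_max le_min.
 by move=> /andP[-> ->] /andP[-> ->].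
by move=> h; split => i; have := h i; rewrite !mxE gt_max le_min =>
 /andP[/andP[h1 h2] /andP[h3 h4]]; apply/andP; split.
Qed.

Definition bigbox (n : nat) : set Rd := box (const_mx (- n%:R)) (const_mx n%:R).

Lemma bigbox_cover : \bigcup_n bigbox n = setT.
Proof.
apply/seteqP; split => // x _.
exists (Num.bound (`|x| : R)).+1 => //= i; rewrite !mxE.
have h : `|x ord0 i| < (Num.bound (`|x| : R)).+1%:R.
 apply: le_lt_trans (norm_coord x i) _; apply: lt_trans (archi_boundP _) _ => //.
 by rewrite ltr_nat.
by move: h; rewrite ltr_norml => /andP[-> /ltW ->].
Qed.

Lemma cube_bigbox r : exists n, cube r `<=` bigbox n.
Proof.
exists (Num.bound `|r|).+1 => x h i; rewrite !mxE.
have hr : `|x ord0 i| < (Num.bound `|r|).+1%:R.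
 apply: le_lt_trans (h i) _; apply: le_lt_trans (ler_norm r) _.
 by apply: lt_trans (archi_boundP _) _ => //; rewrite ltr_nat.
by move: hr; rewrite ltr_norml => /andP[-> /ltW ->].
Qed.

Lemma ball_boxes x e : <<s boxes >> (ball x e).
Proof.
have [e0|e0] := ltP 0 e; last first.
 rewrite (_ : ball x e = set0); first exact: sigma_algebra0.
 by apply/seteqP; split => // y /ball_rV[]; rewrite ltNge e0.
(* Boxes contain their upper faces but not their lower ones, so only the upper corner has to
   approach the ball from inside. *)
rewrite (_ : ball x e = \bigcup_n box (\row_i (x ord0 i - e)) (\row_i (x ord0 i + e - n.+1%:R^-1))).
 by apply: sigma_algebra_bigcup => n; apply: sub_sigma_algebra; exists
  (\row_i (x ord0 i - e)), (\row_i (x ord0 i + e - n.+1%:R^-1)).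
apply/seteqP; split => y.
- move=> /ball_rV[_ h].
 have /choice[N hN] : forall i, exists n : nat, n.+1%:R^-1 < e - (y ord0 i - x ord0 i).
  move=> i; have := h i; rewrite ltr_norml => /andP[h1 h2].
  have e1 : 0 < e - (y ord0 i - x ord0 i) by lra.
  have [k _ /(_ k (leqnn k))/= hk] := near_infty_natSinv_lt (PosNum e1).
  by exists k.
 exists (\max_i N i)%N => // i; rewrite !mxE; have := h i; rewrite ltr_norml => /andP[h1 h2].
 have le : (\max_i N i).+1%:R^-1 <= (N i).+1%:R^-1 :> R.
  by rewrite lef_pV2 ?posrE// ler_nat ltnS leq_bigmax.
 move: (hN i) le; move: (_^-1) => u; move: (_^-1) => v ? ?.
 by apply/andP; split; lra.
- move=> [n _ h]; apply/ball_rV; split => // i; have := h i; rewrite !mxE => /andP[h1 h2].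
 have n0 : 0 < n.+1%:R^-1 :> R by rewrite invr_gt0.
 move: h2 n0; move: (_^-1) => u h2 n0.
 by rewrite ltr_norml; apply/andP; split; lra.
Qed.

(** Open sets are countable unions of rational balls, and balls are countable unions of boxes. The
    boxes thus form a generating pi-system, ready for uniqueness and Dynkin arguments. *)
Lemma measurable_boxes : (@measurable _ Rd) = <<s boxes >>.
Proof.
apply/seteqP; split; last first.
 apply: smallest_sub; first exact: sigma_algebra_measurable.
 by move=> _ [a [b ->]]; exact: measurable_box.
apply: smallest_sub; first exact: smallest_sigma_algebra.
move=> U oU; rewrite (open_rV_bigcup_ball oU) bigcup_mkcond.
pose F (qk : 'rV[rat]_d * nat) : set Rd := if qk \in [set qk : 'rV[rat]_d * nat |
  ball (map_mx ratr qk.1 : 'rV[R]_d) (qk.2.+1%:R^-1) `<=` U] then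
  ball (map_mx ratr qk.1 : 'rV[R]_d) (qk.2.+1%:R^-1) else set0.
pose G (n : nat) := if unpickle n is Some qk then F qk else set0.
rewrite (_ : \bigcup_i _ = \bigcup_n G n); last first.
 apply/seteqP; split => x.
  by move=> [qk _ h]; exists (pickle qk) => //; rewrite /G pickleK.
 by move=> [n _]; rewrite /G; case: (unpickle n) => // qk h; exists qk.
apply: sigma_algebra_bigcup => n; rewrite /G; case: (unpickle n) => [qk|]; last exact: sigma_algebra0.
by rewrite /F; case: ifPn => _; [exact: ball_boxes|exact: sigma_algebra0].
Qed.

Lemma leb_box_lty (a b : Rd) : (leb (box a b) < +oo)%E.
Proof.
pose b' : Rd := \row_i Num.max (a ord0 i) (b ord0 i).
apply: le_lt_trans (_ : leb (box a b') < +oo)%E.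
 apply: le_measure; rewrite ?inE; [exact: measurable_box|exact: measurable_box|].
 by move=> x h i; have := h i; rewrite !mxE le_max => /andP[-> ->]; rewrite orbT.
rewrite lebesgue_rV_box ?ltry// => i; by rewrite mxE le_max lexx.
Qed.

Lemma leb_compact_lty (K : set Rd) : compact K -> (leb K < +oo)%E.
Proof.
move=> cK; have [r r0 Kr] := compact_cube cK; have [n hn] := cube_bigbox r.
apply: le_lt_trans (leb_box_lty (const_mx (- n%:R)) (const_mx n%:R)).
apply: le_measure; rewrite ?inE; [exact: compact_measurable_rV|exact: measurable_box|].
exact: subset_trans hn.
Qed.

Lemma shift_measurable z : meas (fun x : Rd => x + z).
Proof.
apply: measurable_fun_rV => y e.
rewrite (_ : _ @^-1` _ = ball (y - z) e).
 have [e0|e0] := ltP 0 e; first by apply: open_measurable_rV; exact: ball_open.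
 rewrite (_ : ball _ _ = set0); first exact: measurable0.
 by apply/seteqP; split => // x /ball_rV[]; rewrite ltNge e0.
apply/seteqP; split => x /=.
 by move=> /ball_rV[e0 h]; apply/ball_rV; split => // i; have := h i;
  rewrite !mxE opprD addrA addrAC.
by move=> /ball_rV[e0 h]; apply/ball_rV; split => // i; have := h i;
 rewrite !mxE opprD addrA addrAC.
Qed.

(** The iterated product that defines the measure does not display its invariance. The measure and
    its image agree on boxes, a generating pi-system containing an exhaustion by sets of finite
    measure. *)
Lemma leb_shift z (A : set Rd) : measurable A ->
 pushforward leb (fun x : Rd => x + z) A = leb A.
Proof.
have ms := shift_measurable z.
pose phi : {mfun Rd >-> Rd} := HB.pack (fun x : Rd => x + z)
 (isMeasurableFun.Build _ _ _ _ _ ms).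
have pre (a b : Rd) : pushforward leb phi (box a b) = leb (box (a - z) (b - z)).
 rewrite /pushforward; congr (leb _); apply/seteqP.
 by split => x h i; have := h i; rewrite /= !mxE ltrBlDr lerBrDr.
move=> mA; apply: (@measure_unique _ R Rd boxes bigbox measurable_boxes boxes_setI _
 bigbox_cover (pushforward leb phi) leb) => //.
- by move=> n; exists (const_mx (- n%:R)), (const_mx n%:R).
- move=> _ [a [b ->]]; transitivity (leb (box (a - z) (b - z))); first exact: pre.
 have [ab|/existsNP[i /negP ab]] := pselect (forall i, a ord0 i <= b ord0 i).
  rewrite [RHS]lebesgue_rV_box// lebesgue_rV_box; last by move=> i; rewrite !mxE lerD2r.
  by congr EFin; apply: eq_bigr => i _; rewrite !mxE; ring.
 have e (a' b' : Rd) : ~~ (a' ord0 i <= b' ord0 i) -> box a' b' = set0.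
  move=> h; apply/seteqP; split => // x /(_ i) /andP[h1 h2].
  by move/negP : h; apply; apply: le_trans (ltW h1) h2.
 by rewrite !e ?measure0// !mxE lerD2r.
- move=> n; exact: (eq_ind_r (fun u => (u < +oo)%E) (leb_box_lty _ _) (pre _ _)).
Qed.

End lebesgue_rV_theory.

(** * Integration of test functions and integration by parts *)

Section lebesgue_rV_integral.
Context {R : realType} {d : nat}.
Local Notation Rd := 'rV[R]_d.
Local Notation leb := (lebesgue_rV R d).
Implicit Types (x y z : Rd) (f g : Rd -> R).

Lemma Int_shift z f : ibl leb f ->
 ibl leb (fun x => f (x + z)) /\ Int leb (fun x => f (x + z)) = Int leb f.
Proof.
move=> hf; have mf := ibl_meas hf; have ms := @shift_measurable R d z.
have mfs : meas (fun x : Rd => f (x + z)) by exact: (measurableT_comp mf ms).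
pose sh (x : Rd) : Rd := x + z.
have e (g : Rd -> \bar R) : (\int[pushforward leb sh]_x g x = \int[leb]_x g x)%E.
 by apply: eq_measure_integral => A mA _; exact: leb_shift.
have i : ibl leb (fun x => f (x + z)).
 move/integrableP : (hf) => [_ hf']; apply/integrableP; split; first exact/measurable_EFinP.
 apply: le_lt_trans hf'; rewrite -[leRHS]e.
 rewrite (@ge0_integral_pushforward _ _ _ _ _ sh ms leb setT
  (fun x => `|(EFin \o f) x|%E))//.
 by apply: measurableT_comp => //; exact/measurable_EFinP.
split => //; rewrite /Int /Rintegral; congr fine.
rewrite -[RHS]e (@integral_pushforward _ _ _ _ _ sh ms leb setT
 (EFin \o f))//; exact/measurable_EFinP.
Qed.

Lemma ibl_indic (K : set Rd) : compact K -> ibl leb (\1_K : Rd -> R).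
Proof.
move=> cK; have mK := compact_measurable_rV cK.
apply/integrableP; split; first by apply/measurable_EFinP; exact: measurable_indic.
rewrite (eq_integral (fun x => (\1_K x)%:E)); last first.
 by move=> x _ /=; rewrite ger0_norm.
by rewrite integral_indic// setIT; exact: leb_compact_lty.
Qed.

Lemma indicE_in (K : set Rd) x : K x -> \1_K x = 1 :> R.
Proof. by move=> Kx; rewrite indicE mem_set. Qed.

Lemma indicE_out (K : set Rd) x : ~ K x -> \1_K x = 0 :> R.
Proof. by move=> Kx; rewrite indicE memNset. Qed.

Lemma indic_meas (K : set Rd) : measurable K -> meas (\1_K : Rd -> R).
Proof. by move=> mK; exact: measurable_indic. Qed.

Lemma indic_le1 (K : set Rd) x : `|\1_K x : R| <= 1.
Proof. by rewrite indicE; case: (_ \in _); rewrite ?normr1 ?normr0. Qed.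

Lemma indic_ge0 (K : set Rd) x : 0 <= \1_K x :> R.
Proof. by rewrite indicE; case: (_ \in _). Qed.

Lemma ibl_bounded (K : set Rd) f M : compact K -> meas f ->
 (forall x, K x -> `|f x| <= M) -> (forall x, ~ K x -> f x = 0) -> ibl leb f.
Proof.
move=> cK mf fM f0; apply: (@ibl_le _ _ _ _ _ (fun x => `|M| * \1_K x)) => //.
 move=> x; have [Kx|Kx] := pselect (K x); last by rewrite f0// normr0 mulr_ge0 ?indic_ge0.
 by rewrite indicE_in// mulr1; apply: le_trans (fM _ Kx) (ler_norm _).
by apply: iblZ; exact: ibl_indic.
Qed.

Lemma compact_fun_bounded (K : set Rd) f : compact K -> continuous f ->
 exists2 M, 0 <= M & forall x, K x -> `|f x| <= M.
Proof.
move=> cK cf; have cfK : compact (f @` K).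
 by apply: continuous_compact => //; exact: continuous_subspaceT.
have [M [_ hM]] := compact_bounded cfK.
exists (`|M| + 1) => [|x Kx]; first by rewrite addr_ge0.
apply: hM; last by exists x.
by apply: le_lt_trans (ler_norm M) _; rewrite ltrDl.
Qed.

Lemma test_bounded V f : test_fun V f -> exists2 M, 0 <= M & forall x, `|f x| <= M.
Proof.
move=> tf; have [cf kf _] := tf; have [M M0 hM] := compact_fun_bounded kf (Coo_continuous cf).
exists M => // x; have [|/supportP ->] := pselect (support f x); first exact: hM.
by rewrite normr0.
Qed.

Lemma test_measurable V f : test_fun V f -> meas f.
Proof. by move=> [cf _ _]; apply: fun_measurable; exact: Coo_continuous. Qed.

Lemma Coo_measurable f : Coo f -> meas f.
Proof. by move=> cf; apply: fun_measurable; exact: Coo_continuous. Qed.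

Lemma test_ibl V f : test_fun V f -> ibl leb f.
Proof.
move=> tf; have [cf kf _] := tf; have [M M0 hM] := test_bounded tf.
by apply: (@ibl_bounded (support f) f M) => //; [exact: test_measurable tf|move=> x /supportP].
Qed.

(** Pointwise [t^n <= 1 + t^q] for [t >= 0] and [n <= q], and constants are integrable over a
    compact set. *)
Lemma Lloc_pow (q : R) f n (K : set Rd) : 1 <= q -> (0 < n)%N -> n%:R <= q -> Lloc q f -> compact K ->
 ibl leb (fun x => `|f x| ^+ n * \1_K x).
Proof.
move=> q1 n0 nq [mf hf] cK; have mK := compact_measurable_rV cK.
have h := Lfun_integrable q1 (hf K cK).
apply: (@ibl_le _ _ _ _ _ (fun x => \1_K x + `|(f \* \1_K) x| `^ q)).
- apply: measurable_funM; last exact: indic_meas.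
 by apply: measurable_funX; exact: measurableT_comp.
- move=> x /=; rewrite ger0_norm; last by rewrite mulr_ge0 ?exprn_ge0 ?indic_ge0.
 have [Kx|Kx] := pselect (K x).
  rewrite !indicE_in// !mulr1; have [y1|y1] := leP `|f x| 1.
   by apply: le_trans (_ : 1 <= _); [exact: exprn_ile1|rewrite lerDl powR_ge0].
  rewrite -powR_mulrn// -[leLHS]add0r lerD// ler_powR//; exact: ltW.
 by rewrite indicE_out// mulr0 add0r powR_ge0.
- by apply: iblD => //; exact: ibl_indic.
Qed.

Lemma Lloc_ibl (q : R) f (K : set Rd) : 1 <= q -> Lloc q f -> compact K ->
 ibl leb (fun x => f x * \1_K x).
Proof.
move=> q1 Lf cK; have [mf _] := Lf.
have h := @Lloc_pow q f 1 K q1 isT q1 Lf cK.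
apply: ibl_le h; last by move=> x; rewrite expr1 normrM (ger0_norm (indic_ge0 _ _)).
by apply: measurable_funM => //; apply: indic_meas; exact: compact_measurable_rV.
Qed.

Lemma Lloc_iblM (q : R) f g (K : set Rd) M : 1 <= q -> Lloc q f -> compact K ->
 meas g -> (forall x, `|g x| <= M) -> (forall x, ~ K x -> g x = 0) ->
 ibl leb (fun x => f x * g x).
Proof.
move=> q1 Lf cK mg gM g0.
apply: (@eq_ibl _ _ _ _ (fun x => (f x * \1_K x) * g x)).
 move=> x; have [Kx|Kx] := pselect (K x); first by rewrite indicE_in// mulr1.
 by rewrite g0// !mulr0.
by apply: iblMb gM => //; exact: (Lloc_ibl q1).
Qed.

Lemma Lloc_test (q : R) f V g : 1 <= q -> Lloc q f -> test_fun V g ->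
 ibl leb (fun x => f x * g x).
Proof.
move=> q1 Lf tg; have [M M0 hM] := test_bounded tg; have [_ kg _] := tg.
by apply: (Lloc_iblM q1 Lf kg _ hM); [exact: test_measurable tg|move=> x /supportP].
Qed.

Lemma line_mvt f i x (t : R) : Coo f -> 0 < t ->
 exists2 c, 0 < c < t & f (x + t *: delta_mx ord0 i) - f x =
  pderiv i f (x + c *: delta_mx ord0 i) * t.
Proof.
move=> cf t0; pose g s := f (x + s *: delta_mx ord0 i).
have dg (s : R) : is_derive s 1 g (pderiv i f (x + s *: delta_mx ord0 i)).
 by apply: line_derive; exact: Coo_derive.
have [|c] := @MVT _ g _ 0 t t0 (fun s _ => dg s).
 by apply: continuous_subspaceT; exact: is_derive_continuous dg.
by rewrite in_itv /= => ct; rewrite subr0 /g scale0r addr0 => h; exists c.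
Qed.

Lemma cvg_line f i x (c : nat -> R) : continuous f -> c n @[n --> \oo] --> 0 ->
 f (x + c n *: delta_mx ord0 i) @[n --> \oo] --> f x.
Proof.
move=> cf c0; apply: continuous_cvg; first exact: cf.
apply/cvgrPdist_lt => e e0; have [N hN] := cvg0_eN c0 e0.
exists N => // n /= Nn; rewrite opprD addrA subrr sub0r normrN normrZ.
apply: le_lt_trans (hN n Nn); rewrite ler_piMr//.
rewrite /Num.Def.normr/= mx_normrE bigmax_le// => -[a b] _ /=; rewrite mxE.
by case: (_ && _); rewrite ?normr1 ?normr0.
Qed.

Lemma cvg_harmonic t : t / n.+1%:R @[n --> \oo] --> (0 : R).
Proof.
rewrite -[0](mulr0 t); apply: cvgM; first exact: cvg_cst.
exact: cvg_harmonic.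
Qed.

(* The derivative is the dominated limit of the difference quotients. *)
Lemma test_quotient V f i (t : R) : test_fun V f -> 0 < t ->
 exists g : Rd -> R, [/\ ibl leb g, forall x, `|pderiv i f x| <= g x &
  [/\ forall n x, `|(f (x + (t / n.+1%:R) *: delta_mx ord0 i) - f x) / (t / n.+1%:R)| <= g x,
   forall x, exists M, forall y, g y <= M &
  forall x, (f (x + (t / n.+1%:R) *: delta_mx ord0 i) - f x) / (t / n.+1%:R)
   @[n --> \oo] --> pderiv i f x]].
Proof.
move=> tf t0; have [cf kf _] := tf.
have [M M0 hM] := test_bounded (test_pderiv i tf).
have [r r0 fr] := compact_cube kf.
(* With this enlargement the whole segment from [x] to [x + t e_i] avoids the support as soon as [x]
   lies outside [K]. *)
pose K : set Rd := cube (r + t).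
have cK : compact K by exact: cube_compact.
exists (fun x => M * \1_K x).
have fout x (s : R) : ~ K x -> 0 <= s <= t ->
  f (x + s *: delta_mx ord0 i) = 0 /\ pderiv i f (x + s *: delta_mx ord0 i) = 0.
 move=> Kx /andP[s0 st]; suff ns : ~ support f (x + s *: delta_mx ord0 i).
  by split; [exact: supportP|exact: pderiv_support].
 move=> /fr h; apply: Kx => j; have := h j; rewrite !mxE.
 have dj : 0 <= s * ((ord0 == ord0 :> 'I_1) && (j == i))%:R <= t.
  by rewrite eqxx /=; case: (j == i) => /=; rewrite ?mulr1 ?mulr0 ?s0 ?lexx ?st ?ltW.
 move: dj; set u := s * _ => /andP[u0 ut]; rewrite !ler_norml => /andP[a b].
 by apply/andP; split; lra.
have tn n : 0 < t / n.+1%:R <= t.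
 by rewrite divr_gt0//= ler_pdivrMr// ler_peMr ?ler1n// ltW.
split.
- by apply: iblZ; exact: ibl_indic.
- move=> x; have [Kx|Kx] := pselect (K x); first by rewrite indicE_in// mulr1.
 have [_] := fout x 0 Kx ltac:(by rewrite lexx ltW).
 by rewrite scale0r addr0 => ->; rewrite normr0 mulr_ge0 ?indic_ge0.
split.
- move=> n x; have /andP[n0 nt] := tn n.
 have [Kx|Kx] := pselect (K x).
  rewrite indicE_in// mulr1; have [c _ ->] := @line_mvt f i x _ cf n0.
  by rewrite mulfK ?gt_eqF.
 have [f1 _] := fout x (t / n.+1%:R) Kx ltac:(by rewrite nt andbT ltW).
 have [f2 _] := fout x 0 Kx ltac:(by rewrite lexx ltW).
 move: f2; rewrite scale0r addr0 => ->.
 by rewrite f1 subr0 mul0r normr0 mulr_ge0 ?indic_ge0.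
- move=> _; exists M => y; have := indic_le1 K y; rewrite ger0_norm ?indic_ge0// => h.
 by rewrite ler_piMr.
- move=> x; have /choice[c hc] : forall n, exists c, 0 < c < t / n.+1%:R /\
  (f (x + (t / n.+1%:R) *: delta_mx ord0 i) - f x) / (t / n.+1%:R) =
   pderiv i f (x + c *: delta_mx ord0 i).
  move=> n; have /andP[n0 nt] := tn n; have [c ct E] := @line_mvt f i x _ cf n0.
  by exists c; split => //; rewrite E mulfK// gt_eqF.
 rewrite (_ : (fun n => _) = fun n => pderiv i f (x + c n *: delta_mx ord0 i)); last first.
  by apply/funext => n; have [_ ->] := hc n.
 apply: cvg_line; first by apply: Coo_continuous; exact: Coo_pderiv.
 apply: cvg0_le (cvg_harmonic t) => n; have [/andP[c0 ct] _] := hc n.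
 by rewrite ger0_norm ltW.
Qed.

Lemma shift_measurableM z f : meas f -> meas (fun x : Rd => f (x + z)).
Proof. by move=> mf; exact: (measurableT_comp mf (@shift_measurable R d z)). Qed.

(** Each difference quotient has integral 0 by translation invariance, and the quotients converge to
    the derivative under domination. *)
Lemma Int_pderiv V f i : test_fun V f -> Int leb (pderiv i f) = 0.
Proof.
move=> tf; have [g [ig gf [gn _ qf]]] := test_quotient i tf ltr01.
have mf := test_measurable tf; have If := test_ibl tf.
have h := Int_dom (fun n => _) _ (aeW _ qf) ig gn.
have mq n : meas (fun x =>
  (f (x + (1 / n.+1%:R) *: delta_mx ord0 i) - f x) / (1 / n.+1%:R)).
 by apply: measurable_funM => //; apply: measurable_funB => //; exact: shift_measurableM.
have {}h := h mq (test_measurable (test_pderiv i tf)).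
apply: (cvg_unique (@norm_hausdorff _ R) h).
rewrite (_ : (fun n => _) = fun=> 0); first exact: cvg_cst.
apply/funext => n; have [i1 E] := Int_shift ((1 / n.+1%:R) *: delta_mx ord0 i) If.
rewrite (@eq_Int _ _ _ _ _ (fun x => (1 / n.+1%:R)^-1 *
 (f (x + (1 / n.+1%:R) *: delta_mx ord0 i) - f x))); last by move=> x; rewrite mulrC.
by rewrite IntZ ?IntB ?E ?subrr ?mulr0//; exact: iblB.
Qed.

Lemma Int_byparts V f g i : test_fun V f -> Coo g ->
 Int leb (fun x => g x * pderiv i f x) = - Int leb (fun x => pderiv i g x * f x).
Proof.
move=> tf cg; have cf := test_Coo tf; have tfg := test_funMr tf cg.
have h := Int_pderiv i tfg.
have E : pderiv i (fun x => g x * f x) =1 fun x => g x * pderiv i f x + pderiv i g x * f x.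
 by move=> x; rewrite pderivM// [f x * _]mulrC.
rewrite (eq_Int _ E) IntD in h.
- by move/eqP : h; rewrite addr_eq0 => /eqP.
- by apply: (@test_ibl V); apply: test_funMr => //; exact: test_pderiv.
- by apply: (@test_ibl V); apply: test_funMr => //; exact: Coo_pderiv.
Qed.

End lebesgue_rV_integral.

Section real_limits.
Context {R : realType}.
Implicit Types (a b : nat -> R).

Lemma cvg_leN a b (l l' : R) N : (forall n, (N <= n)%N -> a n <= b n) ->
 a n @[n --> \oo] --> l -> b n @[n --> \oo] --> l' -> l <= l'.
Proof.
move=> ab al bl; rewrite leNgt; apply/negP => ll.
have e0 : 0 < (l - l') / 2 by rewrite divr_gt0// subr_gt0.
have [N1 h1] := cvg_eN al e0; have [N2 h2] := cvg_eN bl e0.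
have n1 : (N1 <= N + N1 + N2)%N by rewrite -addnA addnCA leq_addr.
have n2 : (N2 <= N + N1 + N2)%N by rewrite leq_addl.
have := ab (N + N1 + N2)%N; rewrite -addnA leq_addr addnA => /(_ isT).
move: (h1 _ n1) (h2 _ n2); rewrite !ltr_norml => /andP[? ?] /andP[? ?].
lra.
Qed.

Lemma cvg_le a b (l l' : R) : (forall n, a n <= b n) ->
 a n @[n --> \oo] --> l -> b n @[n --> \oo] --> l' -> l <= l'.
Proof. by move=> ab; apply: (@cvg_leN _ _ _ _ 0). Qed.

Lemma cvg_ge_cst a (c l : R) : (forall n, c <= a n) -> a n @[n --> \oo] --> l -> c <= l.
Proof. by move=> h al; apply: (cvg_le h _ al); exact: cvg_cst. Qed.

Lemma cvg_le_cst a (c l : R) : (forall n, a n <= c) -> a n @[n --> \oo] --> l -> l <= c.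
Proof. by move=> h al; apply: (cvg_le h al); exact: cvg_cst. Qed.

Lemma cvg_uniq a (l l' : R) : a n @[n --> \oo] --> l -> a n @[n --> \oo] --> l' -> l = l'.
Proof. by move=> h h'; apply/eqP; rewrite eq_le !(@cvg_le a a)//. Qed.

End real_limits.

(** * Differences under translation bounded by derivatives *)

Section translation_estimates.
Context {R : realType} {d : nat}.
Local Notation Rd := 'rV[R]_d.
Local Notation leb := (lebesgue_rV R d).
Local Notation e_ i := (delta_mx ord0 i : Rd).
Implicit Types (x y z : Rd) (f g : Rd -> R).

Lemma sqr_sum_le n (a : 'I_n -> R) : (\sum_i a i) ^+ 2 <= n%:R * \sum_i a i ^+ 2.
Proof.
elim: n a => [|n IH] a; first by rewrite !big_ord0 expr0n mul0r.
rewrite !big_ord_recl; set s := \sum_(i < n) _; set q := \sum_(i < n) _.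
have h := IH (fun i => a (lift ord0 i)); rewrite -/s -/q in h.
rewrite -natr1; set N : R := n%:R in h *; set b := a ord0.
have N0 : 0 <= N by exact: ler0n.
have q0 : 0 <= q by apply: sumr_ge0 => i _; exact: sqr_ge0.
have [N00|Npos] := eqVneq N 0.
 have s0 : s ^+ 2 <= 0 by move: h; rewrite N00 mul0r.
 have : s = 0 by apply/eqP; rewrite -sqrf_eq0 eq_le s0 sqr_ge0.
 by move=> ->; rewrite N00 addr0 add0r mul1r lerDl.
have Np : 0 < N by rewrite lt_neqAle eq_sym Npos.
have : 0 <= (N * b - s) ^+ 2 / N by rewrite divr_ge0 ?sqr_ge0.
rewrite (_ : _ / N = N * b ^+ 2 - 2 * b * s + s ^+ 2 / N); last by field.
have : s ^+ 2 / N <= q by rewrite ler_pdivrMr// mulrC.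
by nra.
Qed.

Lemma test_shift_sqr V f z : test_fun V f ->
 ibl leb (fun x => (f (x + z) - f x) ^+ 2).
Proof.
move=> tf; have mf := test_measurable tf; have If := test_ibl tf.
have [M M0 hM] := test_bounded tf; have [ifz _] := Int_shift z If.
have mfz : meas (fun x => f (x + z)) by exact: shift_measurableM.
rewrite (_ : (fun x => _) = fun x => (f (x + z) - f x) * (f (x + z) - f x)); last first.
 by apply/funext => x; rewrite expr2.
apply: (@iblMb _ _ _ _ _ _ (M + M)); [exact: iblB|exact: measurable_funB|].
by move=> x; apply: le_trans (ler_normB _ _) _; exact: lerD.
Qed.

(** The increment over the length [t] telescopes into [n + 1] increments of length
    [h = t / (n + 1)]. Cauchy-Schwarz costs a factor [n + 1]; shifting each increment back to the
    origin turns the weight [a] into at most [b]. Altogether [(n + 1)^2 h^2 = t^2] stands before the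
    weighted square of the quotient, whose limit is the derivative. *)
Lemma shift_estimate_weighted V f (a b : Rd -> R) i (t : R) : test_fun V f -> 0 < t ->
 meas a -> (forall x, 0 <= a x <= 1) ->
 meas b -> (forall x, 0 <= b x <= 1) ->
 (forall s x, 0 <= s <= t -> a (x - s *: e_ i) <= b x) ->
 Int leb (fun x => a x * (f (x + t *: e_ i) - f x) ^+ 2) <=
 t ^+ 2 * Int leb (fun x => b x * pderiv i f x ^+ 2).
Proof.
move=> tf t0 ma a01 mb b01 ab; have mf := test_measurable tf.
have an x : `|a x| <= 1 by have /andP[? ?] := a01 x; rewrite ger0_norm.
have bn x : `|b x| <= 1 by have /andP[? ?] := b01 x; rewrite ger0_norm.
have [g [ig gf [gn gM qf]]] := test_quotient i tf t0.
have g0 x : 0 <= g x by apply: le_trans (gf x).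
have [M gb] := gM 0.
have mq n : meas (fun x => (f (x + (t / n.+1%:R) *: e_ i) - f x) / (t / n.+1%:R)).
 by apply: measurable_funM => //; apply: measurable_funB => //; exact: shift_measurableM.
have mp : meas (pderiv i f) by exact: test_measurable (test_pderiv i tf).
have ig2 : ibl leb (fun x => g x * g x).
 by apply: (iblMb ig (ibl_meas ig)) => x; rewrite ger0_norm.
have cL : Int leb (fun x => b x * ((f (x + (t / n.+1%:R) *: e_ i) - f x) / (t / n.+1%:R)) ^+ 2)
  @[n --> \oo] --> Int leb (fun x => b x * pderiv i f x ^+ 2).
 apply: (@Int_dom _ _ _ _ _ _ (fun x => g x * g x)) => //.
 - by move=> n; apply: measurable_funM => //; exact: measurable_funX.
 - by apply: measurable_funM => //; exact: measurable_funX.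
 - apply: aeW => x; apply: cvgM; first exact: cvg_cst.
  by under eq_fun do rewrite expr2; rewrite expr2; apply: cvgM; exact: qf.
 - move=> n x; rewrite normrM -[leRHS]mul1r; apply: ler_pM => //.
  by rewrite normrX expr2 ler_pM.
have key n : Int leb (fun x => a x * (f (x + t *: e_ i) - f x) ^+ 2) <=
  t ^+ 2 * Int leb (fun x => b x * ((f (x + (t / n.+1%:R) *: e_ i) - f x) / (t / n.+1%:R)) ^+ 2).
 set h := t / n.+1%:R; have hn : h * n.+1%:R = t by rewrite /h divfK.
 have hp : 0 < h by rewrite divr_gt0.
 have h0 : h != 0 by rewrite gt_eqF.
 have i1 := test_shift_sqr (h *: e_ i) tf.
 have ib1 : ibl leb (fun x => b x * (f (x + h *: e_ i) - f x) ^+ 2) by exact: iblbM i1 mb bn.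
 have E x : f (x + t *: e_ i) - f x =
   \sum_(k < n.+1) (f (x + (h * k%:R) *: e_ i + h *: e_ i) - f (x + (h * k%:R) *: e_ i)).
  have := @telescope_sumr _ 0 n.+1 (fun k => f (x + (h * k%:R) *: e_ i)) (leq0n _).
  rewrite hn mulr0 scale0r addr0 big_mkord => <-; apply: eq_bigr => k _.
  by rewrite -natr1 mulrDr mulr1 scalerDl addrA.
 have hk (k : 'I_n.+1) : 0 <= h * k%:R <= t.
  rewrite mulr_ge0 ?(ltW hp)//= -hn ler_pM2l// ler_nat; exact: ltnW (ltn_ord k).
 have jk (k : 'I_n.+1) : ibl leb (fun x => a x * (f (x + (h * k%:R) *: e_ i + h *: e_ i) - f (x + (h * k%:R) *: e_ i)) ^+ 2).
  exact: iblbM (Int_shift ((h * k%:R) *: e_ i) i1).1 ma an.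
 apply: (@le_trans _ _ (Int leb (fun x => n.+1%:R * \sum_(k < n.+1)
   a x * (f (x + (h * k%:R) *: e_ i + h *: e_ i) - f (x + (h * k%:R) *: e_ i)) ^+ 2))).
  apply: Int_le; first exact: iblbM (test_shift_sqr _ tf) ma an.
   by apply: iblZ; apply: ibl_sum => k _; exact: jk.
  move=> x; rewrite -mulr_sumr [leRHS]mulrCA; apply: ler_wpM2l; first by have /andP[] := a01 x.
  by rewrite E; exact: sqr_sum_le.
 rewrite IntZ; last by apply: ibl_sum => k _; exact: jk.
 rewrite Int_sum; last by move=> k _; exact: jk.
 apply: (@le_trans _ _ (n.+1%:R * \sum_(k < n.+1) Int leb (fun x => b x * (f (x + h *: e_ i) - f x) ^+ 2))).
  apply: ler_wpM2l => //; apply: ler_sum => k _.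
  have sh := Int_shift (- ((h * k%:R) *: e_ i)) (jk k).
  rewrite -sh.2; apply: Int_le; [exact: sh.1|exact: ib1|] => x; rewrite subrK.
  by apply: ler_wpM2r; [exact: sqr_ge0|exact: ab].
 rewrite sumr_const card_ord -mulr_natl.
 rewrite (@eq_Int _ _ _ _ (fun x => b x * ((f (x + h *: e_ i) - f x) / h) ^+ 2)
  (fun x => h ^- 2 * (b x * (f (x + h *: e_ i) - f x) ^+ 2))); last first.
  by move=> x; rewrite exprMn exprVn [in LHS]mulrA mulrC.
 rewrite (IntZ (h ^- 2) ib1) -hn; apply: eq_ler.
 by move: (Int leb _) => I; field; rewrite h0.
by apply: (cvg_ge_cst key); apply: cvgM => //; exact: cvg_cst.
Qed.

Lemma shift_estimate_coord V f i (t : R) : test_fun V f -> 0 < t ->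
 Int leb (fun x => (f (x + t *: e_ i) - f x) ^+ 2) <=
 t ^+ 2 * Int leb (fun x => pderiv i f x ^+ 2).
Proof.
move=> tf t0; have one (x : Rd) : 0 <= (1 : R) <= 1 by rewrite ler01 lexx.
have := @shift_estimate_weighted V f (fun=> 1) (fun=> 1) i t tf t0 (measurable_cst _) one (measurable_cst _) one (fun _ _ _ => lexx 1).
rewrite (@eq_Int _ _ _ _ (fun x => 1 * (f (x + t *: e_ i) - f x) ^+ 2) (fun x => (f (x + t *: e_ i) - f x) ^+ 2)).
 by rewrite (@eq_Int _ _ _ _ (fun x => 1 * pderiv i f x ^+ 2) (fun x => pderiv i f x ^+ 2)) // => x; rewrite mul1r.
by move=> x; rewrite mul1r.
Qed.

(** The translation is performed one coordinate at a time: Cauchy-Schwarz over the [d] steps gives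
    the factor [d], and translation invariance removes the earlier steps from each term. *)
Lemma shift_estimate V f z (b : R) : test_fun V f -> (forall i, `|z ord0 i| <= b) ->
 Int leb (fun x => (f (x + z) - f x) ^+ 2) <=
 d%:R * (b ^+ 2 * Int leb (fun x => \sum_i pderiv i f x ^+ 2)).
Proof.
move=> tf zb; have iS := test_shift_sqr _ tf.
have ip i : ibl leb (fun x => pderiv i f x ^+ 2).
 have tp := test_pderiv i tf.
 by apply: eq_ibl (test_ibl (test_funM tp (test_Coo tp))) => x; rewrite expr2.
have I0 i : 0 <= Int leb (fun x => pderiv i f x ^+ 2).
 by apply: Int_ge0 => x; exact: sqr_ge0.
have one i t : `|t| <= b ->
  Int leb (fun x => (f (x + t *: e_ i) - f x) ^+ 2) <= b ^+ 2 * Int leb (fun x => pderiv i f x ^+ 2).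
 move=> tb; have tb2 : t ^+ 2 <= b ^+ 2.
  by rewrite -[t ^+ 2]real_normK ?num_real// lerXn2r ?nnegrE//; apply: le_trans tb.
 have [t0|t0|->] := ltgtP t 0.
 - have nt0 : 0 < - t by rewrite oppr_gt0.
  rewrite -((Int_shift ((- t) *: e_ i) (iS (t *: e_ i))).2).
  rewrite (@eq_Int _ _ _ _ _ (fun x => (f (x + (- t) *: e_ i) - f x) ^+ 2)); last first.
   by move=> x; rewrite -addrA -scalerDl addNr scale0r addr0 -sqrrN opprB.
  apply: le_trans (shift_estimate_coord _ tf nt0) _.
  by rewrite sqrrN ler_wpM2r.
 - apply: le_trans (shift_estimate_coord _ tf t0) _; exact: ler_wpM2r.
 - rewrite (@eq_Int _ _ _ _ _ (fun=> 0)) ?Int0; last first.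
   by move=> x; rewrite scale0r addr0 subrr expr0n.
  by rewrite mulr_ge0// sqr_ge0.
pose zk (k : nat) : Rd := \sum_(i < d | (i < k)%N) z ord0 i *: e_ i.
have zkS (k : 'I_d) : zk k.+1 = zk k + z ord0 k *: e_ k.
 rewrite /zk (bigD1 k)/= ?ltnS// addrC; congr (_ + _); apply: eq_bigl => i.
 by rewrite ltnS [in RHS]ltn_neqAle andbC.
have zk0 : zk 0 = 0 by rewrite /zk big_pred0.
have zkd : zk d = z.
 rewrite [RHS]row_sum_delta /zk; apply: eq_big => // i; exact: ltn_ord.
have E x : f (x + z) - f x = \sum_(k < d) (f (x + zk k + z ord0 k *: e_ k) - f (x + zk k)).
 have := @telescope_sumr _ 0 d (fun k => f (x + zk k)) (leq0n _).
 by rewrite zkd zk0 addr0 big_mkord => <-; apply: eq_bigr => k _; rewrite zkS addrA.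
have ik (k : 'I_d) := Int_shift (zk k) (iS (z ord0 k *: e_ k)).
apply: (@le_trans _ _ (Int leb (fun x => d%:R * \sum_(k < d)
  (f (x + zk k + z ord0 k *: e_ k) - f (x + zk k)) ^+ 2))).
 apply: Int_le; first exact: test_shift_sqr tf.
  by apply: iblZ; apply: ibl_sum => k _; exact: (ik k).1.
 by move=> x; rewrite E; exact: sqr_sum_le.
rewrite IntZ; last by apply: ibl_sum => k _; exact: (ik k).1.
rewrite ler_wpM2l ?ler0n// Int_sum; last by move=> k _; exact: (ik k).1.
rewrite Int_sum// mulr_sumr; apply: ler_sum => k _.
by rewrite (ik k).2; exact: one.
Qed.

End translation_estimates.

(** * Symmetry of second derivatives *)

Section schwarz.
Context {R : realType} {d : nat}.
Local Notation Rd := 'rV[R]_d.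
Local Notation e_ i := (delta_mx ord0 i : Rd).
Implicit Types (x y z : Rd) (f g : Rd -> R).

Lemma is_derive_shiftV f z x v (l : R) : is_derive (x + z) v f l ->
 is_derive x v (fun y => f (y + z)) l.
Proof.
move=> [df Df].
have E : (fun h : R => h^-1 *: (((fun y => f (y + z)) \o shift x) (h *: v) - f (x + z)))
  = (fun h : R => h^-1 *: ((f \o shift (x + z)) (h *: v) - f (x + z))).
 by apply/funext => h /=; rewrite addrA.
by split; rewrite ?/derivable ?/derive E.
Qed.

Lemma fun_continuous_shift f z : continuous f -> continuous (fun y => f (y + z)).
Proof.
move=> cf x; apply: (@continuous_comp _ _ _ (fun y : Rd => y + z) f); last exact: cf.
by apply: continuousD; [exact: cvg_id|exact: cst_continuous].
Qed.

Lemma Coo_shift f z : Coo f -> Coo (fun y => f (y + z)).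
Proof.
suff H k : forall f, Ck k f -> Ck k (fun y => f (y + z)) by move=> cf k; exact: H.
elim: k => [|k IH] {}f; first by move=> [cf _]; split => //; exact: fun_continuous_shift.
move=> Cf; have cf := Ck_continuous Cf; have [df Df] := Ck_derive Cf.
apply: (@CkS _ _ k _ (fun i x => pderiv i f (x + z))).
- exact: fun_continuous_shift.
- by move=> i x; exact: is_derive_shiftV.
- by move=> i; exact: IH.
Qed.

Lemma pderiv_shift f z i x : Coo f -> pderiv i (fun y => f (y + z)) x = pderiv i f (x + z).
Proof. by move=> cf; apply/pderivE/is_derive_shiftV/Coo_derive. Qed.

Lemma norm_delta (i : 'I_d) : `|e_ i| <= 1 :> R.
Proof.
rewrite /Num.Def.normr/= mx_normrE bigmax_le// => -[a b] _ /=; rewrite mxE.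
by case: (_ && _); rewrite ?normr1 ?normr0.
Qed.

(** The second difference over a small square is symmetric in the two directions, and two
    applications of the mean value theorem turn it into a mixed derivative at a nearby point, in
    either order. *)
Lemma pderivC f i j x : Coo f -> pderiv i (pderiv j f) x = pderiv j (pderiv i f) x.
Proof.
move: i j => i0 j0 cf; have key i j : forall n : nat, exists u : Rd, `|u - x| <= 2 / n.+1%:R /\
  f (x + n.+1%:R^-1 *: e_ i + n.+1%:R^-1 *: e_ j) - f (x + n.+1%:R^-1 *: e_ i)
  - f (x + n.+1%:R^-1 *: e_ j) + f x = pderiv j (pderiv i f) u * (n.+1%:R^-1 ^+ 2).
 move=> n; set t : R := n.+1%:R^-1; have t0 : 0 < t by rewrite invr_gt0.
 pose p y := f (y + t *: e_ j) - f y.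
 have cp : Coo p by apply: CooB => //; exact: Coo_shift.
 have [c /andP[c0 ct] Ec] := line_mvt i x cp t0.
 have [c' /andP[c'0 c't] Ec'] := line_mvt j (x + c *: e_ i) (Coo_pderiv i cf) t0.
 exists (x + c *: e_ i + c' *: e_ j); split.
  rewrite addrAC [x + _]addrC addrK; apply: le_trans (ler_normD _ _) _.
  rewrite !normrZ !gtr0_norm// mulr_natl mulr2n lerD//.
   by apply: le_trans (_ : c * 1 <= _); [rewrite ler_wpM2l ?norm_delta// ltW|rewrite mulr1 ltW].
  by apply: le_trans (_ : c' * 1 <= _); [rewrite ler_wpM2l ?norm_delta// ltW|rewrite mulr1 ltW].
 rewrite expr2 mulrA -Ec'.
 rewrite (_ : pderiv i f (x + c *: e_ i + t *: e_ j) - pderiv i f (x + c *: e_ i) =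
   pderiv i p (x + c *: e_ i)); last first.
  by rewrite pderivB// ?pderiv_shift//; exact: Coo_shift.
 by rewrite -Ec /p; ring.
have lim i j : (f (x + n.+1%:R^-1 *: e_ i + n.+1%:R^-1 *: e_ j) - f (x + n.+1%:R^-1 *: e_ i)
  - f (x + n.+1%:R^-1 *: e_ j) + f x) / (n.+1%:R^-1 ^+ 2)
  @[n --> \oo] --> pderiv j (pderiv i f) x.
 have /choice[u hu] := key i j.
 rewrite (_ : (fun n => _) = fun n => pderiv j (pderiv i f) (u n)); last first.
  by apply/funext => n; have [_ ->] := hu n; rewrite mulfK// expf_neq0// invr_neq0.
 apply: continuous_cvg; first by apply: Coo_continuous; do 2 apply: Coo_pderiv.
 apply/cvgrPdist_lt => e e0; have [N hN] := cvg0_eN (cvg_harmonic 2) e0.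
 exists N => // n /= Nn; rewrite distrC; apply: le_lt_trans (hu n).1 _.
 by apply: le_lt_trans (hN n Nn); exact: ler_norm.
apply: cvg_uniq (lim j0 i0) _; apply: cvg_trans (lim i0 j0); apply: near_eq_cvg; apply: nearW => n.
by congr (_ / _); rewrite [x + _ + _]addrAC; ring.
Qed.

End schwarz.

(** * Density of test functions in mean *)

Section density.
Context {R : realType} {d : nat}.
Local Notation Rd := 'rV[R]_d.
Local Notation leb := (lebesgue_rV R d).
Implicit Types (x y z : Rd) (f g : Rd -> R).

Lemma S1_affine (a b : R) k : S1 k (fun s => a + b * s).
Proof. by apply: S1D; [exact: S1_cst|apply: S1Z; exact: S1_id]. Qed.

Lemma indic01 (A : set Rd) x : 0 <= (\1_A x : R) <= 1.
Proof. by rewrite indicE; case: (_ \in _); rewrite ?lexx ler01. Qed.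

Lemma indic_setC (A : set Rd) x : \1_(~` A) x = 1 - \1_A x :> R.
Proof.
have [hA|hA] := pselect (A x).
 by rewrite (indicE_in hA) indicE_out ?subrr//; exact.
by rewrite (indicE_out hA) indicE_in ?subr0.
Qed.

Lemma indic_setU (S S' : set Rd) x :
 \1_(S `|` S') x = 1 - (1 - \1_S x) * (1 - \1_S' x) :> R.
Proof.
have [hS|hS] := pselect (S x); have [hS'|hS'] := pselect (S' x).
- by rewrite (indicE_in hS) (indicE_in hS') indicE_in; [ring|left].
- by rewrite (indicE_in hS) (indicE_out hS') indicE_in; [ring|left].
- by rewrite (indicE_out hS) (indicE_in hS') indicE_in; [ring|right].
- by rewrite (indicE_out hS) (indicE_out hS') indicE_out; [ring|case].
Qed.

Lemma abs_sub01 (a b : R) : 0 <= a <= 1 -> 0 <= b <= 1 -> `|a - b| <= 1.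
Proof. by move=> /andP[? ?] /andP[? ?]; rewrite ler_norml; apply/andP; split; lra. Qed.

Lemma onem01 (a : R) : 0 <= a <= 1 -> `|1 - a| <= 1.
Proof. by move=> h; apply: abs_sub01 => //; rewrite ler01 lexx. Qed.

(** The 1 added in the second factor keeps the value 1 on the closed end [b], so that the limit is
    the indicator of the half-open box at every point, faces included. *)
Definition box_fun (a b : Rd) (n : nat) x : R :=
 \prod_i (step (n.+1%:R * (x ord0 i - a ord0 i)) * step (1 + n.+1%:R * (b ord0 i - x ord0 i))).

Lemma box_fun_Coo a b n : Coo (box_fun a b n).
Proof.
move=> k; apply: Ck_prod => i; apply: CkM.
 apply: (@Ck_comp _ _ k (fun s => step (n.+1%:R * (s - a ord0 i)))); last exact: Ck_coord.
 apply: (@S1_comp _ k step); first exact: smooth_step.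
 by apply: S1Z; apply: S1B; [exact: S1_id|exact: S1_cst].
apply: (@Ck_comp _ _ k (fun s => step (1 + n.+1%:R * (b ord0 i - s)))); last exact: Ck_coord.
apply: (@S1_comp _ k step); first exact: smooth_step.
apply: S1D; first exact: S1_cst.
by apply: S1Z; apply: S1B; [exact: S1_cst|exact: S1_id].
Qed.

Lemma box_fun01 a b n x : 0 <= box_fun a b n x <= 1.
Proof.
apply/andP; split; first by apply: prodr_ge0 => i _; rewrite mulr_ge0 ?step_ge0.
by apply: prodr_ile1 => i _; rewrite mulr_ge0 ?step_ge0//= mulr_ile1 ?step_ge0 ?step_le1.
Qed.

Lemma box_fun_cvg a b x : box_fun a b n x @[n --> \oo] --> (\1_(box a b) x : R).
Proof.
have [bx|/existsNP[i nx]] := pselect (box a b x).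
 rewrite indicE_in//; apply: cvg0_sub; apply: cvg0P => e e0.
 have [N hN] : exists N : nat, forall n, (N <= n)%N -> forall i, 1 <= n.+1%:R * (x ord0 i - a ord0 i).
  have /choice[N hN] : forall i, exists N : nat, forall n, (N <= n)%N -> 1 <= n.+1%:R * (x ord0 i - a ord0 i).
   move=> i; have /andP[ax _] := bx i; have u0 : 0 < x ord0 i - a ord0 i by rewrite subr_gt0.
   exists (Num.bound (x ord0 i - a ord0 i)^-1) => n Nn; rewrite -ler_pdivrMr// div1r.
   apply: ltW; apply: lt_le_trans (archi_boundP _) _; first by rewrite invr_ge0 ltW.
   by rewrite ler_nat leqW.
  exists (\max_i N i)%N => n Nn i; apply: hN; apply: leq_trans Nn; exact: leq_bigmax.
 exists N => n Nn; rewrite /box_fun big1 ?subrr ?normr0// => i _.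
 rewrite !step_ge1 ?mulr1//; last exact: hN.
 by rewrite lerDl mulr_ge0// subr_ge0; have /andP[] := bx i.
rewrite indicE_out; last by move=> h; exact/nx/h.
apply: cvg0P => e e0.
have nn n : 0 <= n.+1%:R :> R by exact: ler0n.
have [N hN] : exists N : nat, forall n, (N <= n)%N -> box_fun a b n x = 0.
 have [ax|xa] := ltP (a ord0 i) (x ord0 i); last first.
  exists 0%N => n _; rewrite /box_fun (bigD1 i)//= step_le0 ?mul0r//.
  by rewrite mulr_ge0_le0// subr_le0.
 have bx : b ord0 i < x ord0 i by rewrite ltNge; apply/negP => xb; apply: nx; apply/andP.
 have u0 : 0 < x ord0 i - b ord0 i by rewrite subr_gt0.
 exists (Num.bound (x ord0 i - b ord0 i)^-1) => n Nn.
 rewrite /box_fun (bigD1 i)//= [X in _ * X * _]step_le0 ?mulr0 ?mul0r//.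
 rewrite -opprB mulrN subr_le0 -ler_pdivrMr// div1r.
 apply: ltW; apply: lt_le_trans (archi_boundP _) _; first by rewrite invr_ge0 ltW.
 by rewrite ler_nat leqW.
by exists N => n /hN ->; rewrite normr0.
Qed.

Lemma box_fun_out a b : exists r, forall n x, ~ cube r x -> box_fun a b n x = 0.
Proof.
exists (`|a| + `|b| + 1) => n x /existsNP[i /negP]; rewrite -ltNge => h.
have ha := norm_coord a i; have hb := norm_coord b i.
have n0 : 0 < n.+1%:R :> R by rewrite ltr0n.
move: ha hb; rewrite !ler_norml => /andP[ha _] /andP[_ hb].
have na := normr_ge0 a; have nb := normr_ge0 b.
rewrite /box_fun (bigD1 i)//=; have [x0|x0] := ltP 0 (x ord0 i).
 rewrite gtr0_norm// in h; rewrite [X in _ * X * _]step_le0 ?mulr0 ?mul0r//.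
 rewrite -opprB mulrN subr_le0; apply: (@le_trans _ _ (n.+1%:R * 1)).
  by rewrite mulr1 ler1n.
 by rewrite ler_wpM2l ?ltW//; lra.
rewrite ler0_norm// in h; rewrite step_le0 ?mul0r//.
by rewrite mulr_ge0_le0 ?ltW//; lra.
Qed.

Lemma box_fun_test a b n : testT (box_fun a b n).
Proof.
have [r hr] := box_fun_out a b.
by apply: (@test_funI _ _ _ (cube r)) => //; [exact: box_fun_Coo|exact: cube_compact|exact: hr].
Qed.

Lemma box_fun_L1 a b : Int leb (fun x => `|box_fun a b n x - \1_(box a b) x|) @[n --> \oo] --> 0.
Proof.
have [r hr] := box_fun_out a b; have mb := @measurable_box R d a b.
have bc x : ~ cube r x -> \1_(box a b) x = 0 :> R.
 move=> cx; have h := @box_fun_cvg a b x.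
 have E : (fun n => box_fun a b n x) = fun=> 0 by apply/funext => n; exact: hr.
 rewrite E in h; exact: (cvg_uniq h (cvg_cst _)).
rewrite -[X in _ --> X](@Int0 _ _ _ leb).
apply: (Int_dom (g := fun x => \1_(cube r) x)) => //.
- move=> n; apply: measurableT_comp => //; apply: measurable_funB; last exact: indic_meas.
 exact: Coo_measurable (box_fun_Coo _ _ _).
- apply: aeW => x; have h := @box_fun_cvg a b x.
 have {}h : box_fun a b n x - \1_(box a b) x @[n --> \oo] --> (0 : R).
  by rewrite -(subrr (\1_(box a b) x)); apply: cvgB => //; exact: cvg_cst.
 by rewrite -(normr0 R); exact: cvg_norm.
- by apply: ibl_indic; exact: cube_compact.
- move=> n x; rewrite normr_id; have [cx|cx] := pselect (cube r x); last first.
  by rewrite hr// bc// subrr normr0 indic_ge0.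
 by rewrite (indicE_in cx); exact: abs_sub01 (box_fun01 _ _ _ _) (indic01 _ _).
Qed.

Let approx N (A : set Rd) := forall e : R, 0 < e -> exists f, [/\ Coo f, forall x, 0 <= f x <= 1 &
 Int leb (fun x => \1_(bigbox N) x * `|f x - \1_A x|) < e].

Lemma ibl_bigbox N : ibl leb (\1_(bigbox N) : Rd -> R).
Proof.
have mb : measurable (bigbox N : set Rd) by exact: measurable_box.
apply/integrableP; split; first by apply/measurable_EFinP; exact: measurable_indic.
rewrite (eq_integral (fun x => (\1_(bigbox N) x)%:E)); last first.
 by move=> x _ /=; rewrite ger0_norm ?indic_ge0.
by rewrite integral_indic// setIT; exact: leb_box_lty.
Qed.

Lemma ibl_bigboxM N g (M : R) : meas g -> (forall x, `|g x| <= M) ->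
 ibl leb (fun x => \1_(bigbox N) x * g x).
Proof. by move=> mg gM; apply: (iblMb (ibl_bigbox N) mg gM). Qed.

Let bnd f (A : set Rd) x : 0 <= f x <= 1 -> `|f x - \1_A x| <= 1.
Proof. by move=> h; exact: abs_sub01 h (indic01 _ _). Qed.

Let iapp N f (A : set Rd) : Coo f -> measurable A -> (forall x, 0 <= f x <= 1) ->
 ibl leb (fun x => \1_(bigbox N) x * `|f x - \1_A x|).
Proof.
move=> cf mA f01; apply: (@ibl_bigboxM _ _ 1) => [|x]; last by rewrite normr_id; exact: bnd.
apply: measurableT_comp => //; apply: measurable_funB; last exact: indic_meas.
exact: Coo_measurable.
Qed.

(** Dynkin induction over the boxes. The approximating functions are smooth without compact support,
    so that [f] may be replaced by [1 - f] for complements; finite unions correspond to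
    [1 - (1 - f)(1 - g)], and countable ones to pointwise limits of indicators inside a box of
    finite measure. *)
Lemma approx_measurable N (A : set Rd) : measurable A -> approx N A.
Proof.
rewrite {1}measurable_boxes.
have PC S : measurable S -> approx N S -> approx N (~` S).
 move=> mS aS e /aS[f [cf f01 fS]]; exists (fun x => 1 - f x); split.
 - by apply: CooB => //; exact: Coo_cst.
 - by move=> x; have /andP[? ?] := f01 x; apply/andP; split; lra.
 - rewrite (@eq_Int _ _ _ _ _ (fun x => \1_(bigbox N) x * `|f x - \1_S x|))// => x.
  congr (_ * _); rewrite indic_setC -[LHS]normrN; congr (`|_|); ring.
have PU S S' : measurable S -> measurable S' -> approx N S -> approx N S' -> approx N (S `|` S').
 move=> mS mS' aS aS' e e0; have e2 : 0 < e / 2 by rewrite divr_gt0.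
 have [f [cf f01 fS]] := aS _ e2; have [g [cg g01 gS]] := aS' _ e2.
 have i1 := iapp N cf mS f01; have i2 := iapp N cg mS' g01.
 have c1 : Coo (fun x => 1 - (1 - f x) * (1 - g x)).
  by apply: CooB; [exact: Coo_cst|apply: CooM; apply: CooB => //; exact: Coo_cst].
 have c01 x : 0 <= 1 - (1 - f x) * (1 - g x) <= 1.
  by have /andP[? ?] := f01 x; have /andP[? ?] := g01 x; apply/andP; split; nra.
 exists (fun x => 1 - (1 - f x) * (1 - g x)); split => //.
 rewrite [e]splitr; apply: le_lt_trans (ltrD fS gS); rewrite -IntD//.
 apply: Int_le; [by apply: iapp => //; exact: measurableU|exact: iblD|move=> x].
 rewrite -mulrDr ler_wpM2l ?indic_ge0//.
 rewrite indic_setU (_ : _ - _ = (f x - \1_S x) * (1 - g x) + (g x - \1_S' x) * (1 - \1_S x)); last by ring.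
 apply: le_trans (ler_normD _ _) _; rewrite !normrM lerD// ler_piMr//.
  exact: onem01.
 by apply: onem01; exact: indic01.
have PL (S : nat -> set Rd) S' : (forall n, measurable (S n)) -> measurable S' ->
  (forall x, \1_(S n) x @[n --> \oo] --> (\1_S' x : R)) ->
  (forall n, approx N (S n)) -> approx N S'.
 move=> mS mS' SS aS e e0; have e2 : 0 < e / 2 by rewrite divr_gt0.
 have b n x : `|\1_(S n) x - \1_S' x : R| <= 1.
  exact: abs_sub01 (indic01 _ _) (indic01 _ _).
 have mm n : meas (fun x => `|\1_(S n) x - \1_S' x : R|).
  by apply: measurableT_comp => //; apply: measurable_funB; exact: indic_meas.
 have im n : ibl leb (fun x => \1_(bigbox N) x * `|\1_(S n) x - \1_S' x : R|).
  by apply: (@ibl_bigboxM _ _ 1) => // x; rewrite normr_id.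
 have h : Int leb (fun x => \1_(bigbox N) x * `|\1_(S n) x - \1_S' x|) @[n --> \oo] --> 0.
  rewrite -[X in _ --> X](@Int0 _ _ _ leb).
  apply: (Int_dom (g := fun x => \1_(bigbox N) x)) => //.
  - by move=> n; exact: ibl_meas (im n).
  - apply: aeW => x; rewrite -(mulr0 (\1_(bigbox N) x)); apply: cvgM; first exact: cvg_cst.
   rewrite -(normr0 R) -(subrr (\1_S' x)); apply: cvg_norm; apply: cvgB => //; exact: cvg_cst.
  - exact: ibl_bigbox.
  - by move=> n x; rewrite normrM normr_id ger0_norm ?indic_ge0// ler_piMr ?indic_ge0.
 have [n0 hn] := cvg0_eN h e2; have {}hn := hn _ (leqnn _).
 have [f [cf f01 fS]] := aS n0 _ e2; exists f; split => //.
 rewrite ger0_norm in hn; last by apply: Int_ge0 => x; rewrite mulr_ge0 ?indic_ge0.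
 rewrite [e]splitr; apply: le_lt_trans (ltrD fS hn); rewrite -IntD//; last exact: iapp.
 apply: Int_le; [exact: iapp|by apply: iblD => //; exact: iapp|move=> x].
 by rewrite -mulrDr ler_wpM2l ?indic_ge0// ler_distD.
apply: (@dynkin_induction _ Rd boxes (approx N) measurable_boxes boxes_setI).
- move=> e e0; exists (fun=> 1); split; [exact: Coo_cst|by move=> x; rewrite ler01 lexx|].
 rewrite (@eq_Int _ _ _ _ _ (fun=> 0)) ?Int0// => x.
 by rewrite indicE_in// subrr normr0 mulr0.
- move=> _ [a [b ->]] e e0; have [n hn] := cvg0_eN (box_fun_L1 a b) e0.
 have {}hn := hn _ (leqnn n); exists (box_fun a b n); split; [exact: box_fun_Coo|exact: box_fun01|].
 rewrite ger0_norm in hn; last exact: Int_ge0.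
 apply: le_lt_trans hn; apply: Int_le.
 + by apply: iapp; [exact: box_fun_Coo|exact: measurable_box|exact: box_fun01].
 + have [r hr] := box_fun_out a b.
  apply: ibl_abs; apply: iblB; first exact: test_ibl (box_fun_test a b n).
  apply/integrableP; split.
   by apply/measurable_EFinP; apply: measurable_indic; exact: measurable_box.
  rewrite (eq_integral (fun x => (\1_(box a b) x)%:E)); last first.
   by move=> x _ /=; rewrite ger0_norm ?indic_ge0.
  by rewrite integral_indic ?setIT; [exact: leb_box_lty| |exact: measurable_box].
 + by move=> x; rewrite ler_piMl//; have /andP[] := indic01 (bigbox N) x.
- exact: PC.
- move=> F mF _ aF.
 pose S n := \big[setU/set0]_(k < n) F k.
 have mS n : measurable (S n) by apply: bigsetU_measurable => k _; exact: mF.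
 apply: (PL S) => //.
 + exact: bigcupT_measurable.
 + move=> x; have [[k _ Fkx]|nx] := pselect ((\bigcup_k F k) x).
   rewrite indicE_in; last by exists k.
   apply: cvg0_sub; apply: cvg0P => e e0; exists k.+1 => n kn.
   rewrite indicE_in ?subrr ?normr0// /S -bigcup_mkord; exists k => //=.
  rewrite indicE_out//; apply: cvg0P => e e0; exists 0%N => n _.
  rewrite indicE_out ?normr0// /S -bigcup_mkord => -[k _ Fkx].
  by apply: nx; exists k.
 + elim=> [|n IH]; last first.
   by rewrite /S big_ord_recr; apply: PU => //; exact: mS.
  move=> e e0; exists (fun=> 0); split; [exact: Coo_cst|by move=> x; rewrite ler01 lexx|].
  rewrite (@eq_Int _ _ _ _ _ (fun=> 0)) ?Int0// => x.
  by rewrite /S big_ord0 indicE_out// subrr normr0 mulr0.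
Qed.

(** Compact support is restored by a factor [box_fun] that is close in mean to the indicator of the
    big box. *)
Lemma test_dense N (A : set Rd) (e : R) : measurable A -> 0 < e ->
 exists f, [/\ testT f, forall x, 0 <= f x <= 1 &
  Int leb (fun x => `|f x - \1_(A `&` bigbox N) x|) < e].
Proof.
move=> mA e0; have e2 : 0 < e / 2 by rewrite divr_gt0.
have [f [cf f01 fA]] := approx_measurable N mA e2.
pose a : Rd := const_mx (- N%:R); pose b : Rd := const_mx N%:R.
have [n hn] := cvg0_eN (box_fun_L1 a b) e2; have {}hn := hn _ (leqnn n).
rewrite ger0_norm in hn; last exact: Int_ge0.
have tX := box_fun_test a b n; have X01 x := box_fun01 a b n x.
pose X := box_fun a b n; rewrite -/X in tX hn X01.
exists (fun x => X x * f x); split.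
- exact: test_funM.
- move=> x; have /andP[? ?] := f01 x; have /andP[? ?] := X01 x.
 by apply/andP; split; nra.
- have i1 : ibl leb (fun x => `|X x - \1_(box a b) x|).
  apply: ibl_abs; apply: iblB; first exact: test_ibl tX.
  exact: (ibl_bigbox N).
 rewrite [e]splitr; apply: le_lt_trans (ltrD fA hn); rewrite -IntD//; last exact: iapp.
 have mAb : measurable (A `&` bigbox N) by apply: measurableI => //; exact: measurable_box.
 apply: Int_le.
 + apply: ibl_abs; apply: iblB; first by apply: (@test_ibl _ _ setT); exact: test_funM.
  apply: (@eq_ibl _ _ _ _ (fun x => \1_(bigbox N) x * \1_A x)).
   by move=> x; rewrite mulrC indicI.
  by apply: (@ibl_bigboxM _ _ 1); [exact: indic_meas|move=> x; exact: indic_le1].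
 + by apply: iblD => //; exact: iapp.
 + move=> x; rewrite -/(bigbox N); have /andP[f0 f1] := f01 x; have /andP[X0 X1] := X01 x.
  have [bx|bx] := pselect (bigbox N x).
   have -> : \1_(A `&` bigbox N) x = \1_A x :> R by rewrite indicI /= (indicE_in bx) mulr1.
   rewrite (indicE_in bx) mul1r (_ : _ - _ = (f x - \1_A x) + (X x - 1) * f x); last by ring.
   by apply: le_trans (ler_normD _ _) _; rewrite lerD// normrM ler_piMr// ger0_norm.
  rewrite (indicE_out bx) mul0r add0r !subr0 indicE_out; last by case.
  by rewrite subr0 normrM ler_piMr// ger0_norm.
Qed.

End density.

(** * Cutoffs and the fundamental lemma of the calculus of variations *)

Section mollification.
Context {R : realType} {d : nat}.
Local Notation Rd := 'rV[R]_d.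
Local Notation leb := (lebesgue_rV R d).
Implicit Types (x y z : Rd) (f g : Rd -> R).

Definition cutoff (r : R) x : R := \prod_i bump (x ord0 i / r).

Lemma cutoff_Coo r : Coo (cutoff r).
Proof.
move=> k; apply: Ck_prod => i.
apply: (@Ck_comp _ _ k (fun s => bump (s / r))); last exact: Ck_coord.
apply: (@S1_comp _ k bump); first exact: smooth_bump.
by apply: S1M; [exact: S1_id|exact: S1_cst].
Qed.

Lemma cutoff01 r x : 0 <= cutoff r x <= 1.
Proof.
apply/andP; split; first by apply: prodr_ge0 => i _; exact: bump_ge0.
by apply: prodr_ile1 => i _; rewrite bump_ge0 bump_le1.
Qed.

Lemma cutoff_in r x : 0 < r -> cube r x -> cutoff r x = 1.
Proof.
move=> r0 cx; rewrite /cutoff big1// => i _; apply: bump_eq1.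
by rewrite normrM normfV (gtr0_norm r0) ler_pdivrMr// mul1r; exact: cx.
Qed.

Lemma cutoff_out r x : 0 < r -> ~ cube (2 * r) x -> cutoff r x = 0.
Proof.
move=> r0 /existsNP[i /negP]; rewrite -ltNge => h.
rewrite /cutoff (bigD1 i)//= bump_eq0 ?mul0r//.
by rewrite normrM normfV (gtr0_norm r0) ler_pdivlMr// ltW.
Qed.

Lemma cutoff_test r : 0 < r -> testT (cutoff r).
Proof.
move=> r0; apply: (@test_funI _ _ _ (cube (2 * r))) => //;
 [exact: cutoff_Coo|exact: cube_compact|by move=> x; exact: cutoff_out].
Qed.

Lemma cutoffN r x : cutoff r (- x) = cutoff r x.
Proof. by apply: eq_bigr => i _; rewrite mxE mulNr bumpN. Qed.

Lemma superlevel_measurable f (c : R) : meas f -> measurable [set x | c < f x].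
Proof.
move=> mf; have := mf measurableT _ (measurable_itv `]c, +oo[); rewrite setTI.
rewrite (_ : f @^-1` _ = [set x | c < f x])//.
by apply/seteqP; split => x /=; rewrite in_itv/= andbT.
Qed.

Lemma leb_ball_gt0 x (e : R) : 0 < e -> (0 < leb (ball x e))%E.
Proof.
move=> e0; pose a : Rd := \row_i (x ord0 i - e / 2); pose b : Rd := \row_i (x ord0 i + e / 2).
apply: lt_le_trans (_ : leb (box a b) <= _)%E.
 rewrite lebesgue_rV_box; last by move=> i; rewrite !mxE; lra.
 by rewrite lte_fin; apply: prodr_gt0 => i _; rewrite !mxE; lra.
apply: le_measure; rewrite ?inE; [exact: measurable_box|by apply: open_measurable_rV; exact: ball_open|].
move=> y h; apply/ball_rV; split => // i; have := h i; rewrite !mxE => /andP[? ?].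
by rewrite ltr_norml; apply/andP; split; lra.
Qed.

Lemma ae_ball (P : set Rd) x (e : R) : 0 < e -> {ae leb, forall y, P y} -> exists2 y, ball x e y & P y.
Proof.
move=> e0 [N [mN N0 hN]]; apply: contrapT => h.
have : (leb (ball x e) <= leb N)%E.
 apply: le_measure; rewrite ?inE; [by apply: open_measurable_rV; exact: ball_open|exact: mN|].
 by move=> y xy; apply: hN => /= Py; apply: h; exists y.
by rewrite N0 leNgt leb_ball_gt0.
Qed.

Lemma continuous_ae_ge0 f : continuous f -> {ae leb, forall x, 0 <= f x} -> forall x, 0 <= f x.
Proof.
move=> cf fae x; rewrite leNgt; apply/negP => fx.
have : nbhs x [set y | f y < 0].
 exact: (cf x [set s | s < 0] (lt_nbhsl fx)).
move=> /nbhs_ballP[e /= e0 he]; have [y xy fy] := ae_ball x e0 fae.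
by have := he y xy; rewrite /= ltNge fy.
Qed.

Lemma continuous_ae_eq f g : continuous f -> continuous g ->
 {ae leb, forall x, f x = g x} -> f =1 g.
Proof.
move=> cf cg fg x; apply/eqP; rewrite eq_le; apply/andP; split; rewrite -subr_ge0.
- apply: (@continuous_ae_ge0 (fun x => g x - f x)); last by apply: filterS fg => y ->; rewrite subrr.
 by move=> y; exact: (continuousB (cg y) (cf y)).
- apply: (@continuous_ae_ge0 (fun x => f x - g x)); last by apply: filterS fg => y ->; rewrite subrr.
 by move=> y; exact: (continuousB (cf y) (cg y)).
Qed.

Lemma Lloc1P f : meas f ->
 (forall K : set Rd, compact K -> ibl leb (fun x => f x * \1_K x)) -> Lloc 1 f.
Proof. by move=> mf h; split => // K cK; apply/Lfun1_integrable; exact: h. Qed.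

Lemma Lloc_1 (q : R) f : 1 <= q -> Lloc q f -> Lloc 1 f.
Proof. by move=> q1 Lf; apply: Lloc1P => [|K cK]; [case: Lf|exact: Lloc_ibl Lf cK]. Qed.

Lemma continuous_Lloc f : continuous f -> Lloc 1 f.
Proof.
move=> cf; apply: Lloc1P => [|K cK]; first exact: fun_measurable.
have [M M0 hM] := compact_fun_bounded cK cf.
apply: (@ibl_bounded _ _ K _ M) => //.
- by apply: measurable_funM; [exact: fun_measurable|apply: indic_meas; exact: compact_measurable_rV].
- by move=> x Kx; rewrite indicE_in// mulr1; exact: hM.
- by move=> x Kx; rewrite indicE_out// mulr0.
Qed.

Lemma weak_pderivE i f g phi : Lloc 1 f -> Lloc 1 g -> weak_pderiv i f g -> testT phi ->
 Int leb (fun x => f x * pderiv i phi x) = - Int leb (fun x => g x * phi x).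
Proof.
move=> Lf Lg fg tp; have := fg _ tp.
rewrite !ibl_integral ?oppeE//; last 2 first.
- exact: Lloc_test Lg tp.
- by apply: Lloc_test Lf (test_pderiv i tp).
by case.
Qed.

Lemma weak_pderivI i f g : Lloc 1 f -> Lloc 1 g ->
 (forall phi, testT phi ->
  Int leb (fun x => f x * pderiv i phi x) = - Int leb (fun x => g x * phi x)) ->
 weak_pderiv i f g.
Proof.
move=> Lf Lg h phi tp; rewrite !ibl_integral ?h//; first exact: Lloc_test Lg tp.
by apply: Lloc_test Lf (test_pderiv i tp).
Qed.

(* Test functions approximate indicators in mean, hence [g] has zero integral
  over every bounded measurable set. *)
Lemma ae_eq0_test g : Lloc 1 g ->
 (forall phi, testT phi -> Int leb (fun x => g x * phi x) = 0) ->
 {ae leb, forall x, g x = 0}.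
Proof.
move=> Lg hg; have [mg _] := Lg.
have key N (A : set Rd) : measurable A -> Int leb (fun x => g x * \1_(A `&` bigbox N) x) = 0.
 move=> mA; pose r : R := N%:R + 1; have r0 : 0 < r by rewrite ltr_wpDl.
 have tX := cutoff_test r0; have X01 := cutoff01 r.
 have XB x : bigbox N x -> cutoff r x = 1.
  move=> bx; apply: cutoff_in => // i; have := bx i; rewrite !mxE /r => /andP[? ?].
  by rewrite ler_norml; apply/andP; split; lra.
 have mAb : measurable (A `&` bigbox N) by apply: measurableI => //; exact: measurable_box.
 have /choice[f hf] : forall n : nat, exists f, [/\ testT f, forall x, 0 <= f x <= 1 &
   Int leb (fun x => `|f x - \1_(A `&` bigbox N) x|) < n.+1%:R^-1].
  by move=> n; apply: test_dense => //; rewrite invr_gt0.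
 pose w x := g x * \1_(cube (2 * r)) x.
 have iw : ibl leb w by apply: Lloc_ibl Lg _; [exact: lexx|exact: cube_compact].
 (* The product [w * z n] is [g] times a test function minus [g] times the indicator. The first part
    integrates to 0, so the integral over the set is, up to sign, the integral of [w * z n], which
    tends to 0. *)
 pose z n x := cutoff r x * (f n x - \1_(A `&` bigbox N) x).
 have iAb : ibl leb (\1_(A `&` bigbox N) : Rd -> R).
  apply: (@eq_ibl _ _ _ _ (fun x => \1_(bigbox N) x * \1_A x)).
   by move=> x; rewrite mulrC indicI.
  by apply: (@ibl_bigboxM _ _ _ _ 1); [exact: indic_meas|move=> x; exact: indic_le1].
 have id n : ibl leb (fun x => f n x - \1_(A `&` bigbox N) x).
  by apply: iblB => //; have [tf _ _] := hf n; exact: test_ibl tf.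
 have X1 x : `|cutoff r x| <= 1 by have /andP[? ?] := X01 x; rewrite ger0_norm.
 have iz n : ibl leb (z n).
  by apply: iblbM (id n) (test_measurable tX) X1.
 have zb n x : `|z n x| <= 1.
  rewrite normrM mulr_ile1//; have [_ f01 _] := hf n.
  exact: abs_sub01 (f01 _) (indic01 _ _).
 have z0 : Int leb (fun x => `|z n x|) @[n --> \oo] --> 0.
  apply: (cvg0_le _ (cvg_harmonic 1)) => n; rewrite ger0_norm; last exact: Int_ge0.
  have [_ _ h] := hf n; rewrite mul1r; apply: ltW; apply: le_lt_trans h.
  apply: Int_le; [exact: ibl_abs|exact: ibl_abs|move=> x].
  by rewrite normrM ler_piMl.
 have h := Int_wcvg0 iw iz zb z0.
 have E n x : w x * z n x = g x * (cutoff r x * f n x) - g x * \1_(A `&` bigbox N) x.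
  rewrite /w /z; have [cx|cx] := pselect (cube (2 * r) x).
   rewrite (indicE_in cx) mulr1.
   have [bx|bx] := pselect ((A `&` bigbox N) x).
    by have [_ /XB ->] := bx; ring.
   by rewrite (indicE_out bx); ring.
  have nb : ~ (A `&` bigbox N) x.
   by move=> [_ bx]; have := XB _ bx; rewrite cutoff_out// => /eqP; rewrite eq_sym oner_eq0.
  by rewrite (indicE_out cx) (indicE_out nb) cutoff_out//; ring.
 have igA : ibl leb (fun x => g x * \1_(A `&` bigbox N) x).
  apply: (@eq_ibl _ _ _ _ (fun x => w x * \1_(A `&` bigbox N) x)).
   move=> x; rewrite /w; have [cx|cx] := pselect (cube (2 * r) x).
    by rewrite (indicE_in cx) mulr1.
   rewrite [\1_(A `&` _) x]indicE_out ?mulr0//.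
   by move=> [_ bx]; have := XB _ bx; rewrite cutoff_out// => /eqP; rewrite eq_sym oner_eq0.
  by apply: (iblMb (C := 1) iw); [exact: indic_meas|move=> x; exact: indic_le1].
 have tXf n : testT (fun x => cutoff r x * f n x).
  by apply: test_funM => //; have [tf _ _] := hf n; exact: test_Coo tf.
 have Iw n : Int leb (fun x => w x * z n x) = - Int leb (fun x => g x * \1_(A `&` bigbox N) x).
  rewrite (eq_Int _ (E n)) IntB//; first by rewrite (hg _ (tXf n)) sub0r.
  exact: (Lloc_test (lexx _) Lg (tXf n)).
 apply/eqP; rewrite -normr_le0; apply: (cvg_ge_cst _ h) => n.
 rewrite -normrN -(Iw n); apply: Int_abs.
 by apply: (iblMb (C := 1) iw); [exact: ibl_meas (iz n)|exact: zb].
(* Both signs at once: on the set where [s * g > 0] the integrand has a sign, and its integral over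
   the bounded part of this set is 0. *)
have pos N (s : R) : s = 1 \/ s = -1 -> {ae leb, forall x, bigbox N x -> s * g x <= 0}.
 move=> s1; pose A := [set x | 0 < s * g x].
 have msg : meas (fun x => s * g x) by exact: measurable_funM.
 have mA : measurable A.
  exact: superlevel_measurable.
 have h := key N A mA.
 have igA : ibl leb (fun x => g x * \1_(A `&` bigbox N) x).
  have [r hr] : exists r, bigbox N `<=` (cube r : set Rd).
   exists N%:R => x bx i; have := bx i; rewrite !mxE ler_norml => /andP[? ?].
   by apply/andP; split => //; apply: ltW.
  apply: (@Lloc_iblM _ _ 1 g _ (cube r) 1) => //; [exact: cube_compact| | |].
  - by apply: indic_meas; apply: measurableI => //; exact: measurable_box.
  - by move=> x; exact: indic_le1.
  - by move=> x cx; rewrite indicE_out// => -[_ /hr].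
 have E : Int leb (fun x => s * (g x * \1_(A `&` bigbox N) x)) = 0.
  by rewrite IntZ// h mulr0.
 have p x : 0 <= s * (g x * \1_(A `&` bigbox N) x).
  have [[Ax _]|nx] := pselect ((A `&` bigbox N) x).
   by rewrite mulrA mulr_ge0 ?indic_ge0// ltW.
  by rewrite (indicE_out nx) !mulr0.
 apply: filterS (Int_eq0 (iblZ s igA) p E) => x /= hx bx; rewrite leNgt; apply/negP => sg.
 move: hx; rewrite indicE_in//.
 by rewrite mulr1 => h0; rewrite h0 ltxx in sg.
have all : {ae leb, forall x, forall N, bigbox N x -> g x = 0}.
 apply: ae_foralln => N.
 have p1 := pos N 1 (or_introl erefl); have p2 := pos N (-1) (or_intror erefl).
 apply: filterS2 p1 p2 => x h1 h2 bx; apply/eqP; rewrite eq_le.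
 by have := h1 bx; have := h2 bx; rewrite mul1r mulN1r oppr_le0 => -> ->.
apply: filterS all => x hx; have : (\bigcup_n bigbox n) x by rewrite bigbox_cover.
by move=> [N _ /hx].
Qed.

End mollification.

(** * Mollifiers and the product rule for weak derivatives *)

Section product_rule.
Context {R : realType} {d : nat}.
Local Notation Rd := 'rV[R]_d.
Local Notation leb := (lebesgue_rV R d).
Implicit Types (x y z : Rd) (f g : Rd -> R).

(** Fubini's theorem for [u(x) v(y) k(x, y)], absolutely integrable because [k] is bounded. The
    factors stay outside the inner integrals, as convolutions require. *)
Lemma Int_swap (u v : Rd -> R) (k : Rd * Rd -> R) (M : R) :
 ibl leb u -> ibl leb v -> meas k -> (forall p, `|k p| <= M) ->
 [/\ ibl leb (fun x => u x * Int leb (fun y => v y * k (x, y))),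
   ibl leb (fun y => v y * Int leb (fun x => u x * k (x, y))) &
   Int leb (fun x => u x * Int leb (fun y => v y * k (x, y))) =
   Int leb (fun y => v y * Int leb (fun x => u x * k (x, y)))].
Proof.
move=> iu iv mk kM; have mu := ibl_meas iu; have mv := ibl_meas iv.
pose F (z : Rd * Rd) : R := u z.1 * (v z.2 * k z).
have mF : meas F.
 apply: measurable_funM; first exact: (measurableT_comp mu measurable_fst).
 by apply: measurable_funM => //; exact: (measurableT_comp mv measurable_snd).
have k1 x : meas (fun y => k (x, y)).
 by apply: (measurableT_comp mk); exact: measurable_pair1.
have k2 y : meas (fun x => k (x, y)).
 by apply: (measurableT_comp mk); exact: measurable_pair2.
have ivk x : ibl leb (fun y => v y * k (x, y)) by exact: (iblMb (C := M)).
have iuk y : ibl leb (fun x => u x * k (x, y)) by exact: (iblMb (C := M)).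
have iF : (leb \x leb)%E.-integrable setT (EFin \o F).
 apply/integrable12ltyP; first exact/measurable_EFinP.
 apply: (@le_lt_trans _ _ (\int[leb]_x (`|u x| * (`|M| * Int leb (fun y => `|v y|)))%:E)%E).
  apply: ge0_le_integral => //.
  - by move=> x _; apply: integral_ge0.
  - apply: (measurable_fun_fubini_tonelli_F (fun p => `|(F p)%:E|%E)) => //.
   by apply: measurableT_comp => //; exact/measurable_EFinP.
  - by apply/measurable_EFinP; apply: measurable_funM => //; exact: measurableT_comp.
  - move=> x _; rewrite (eq_integral (fun y => (`|u x * (v y * k (x, y))|)%:E))//.
   rewrite ibl_integral; last by apply: ibl_abs; exact: iblZ.
   rewrite lee_fin mulrA -IntZ; last exact: ibl_abs.
   apply: Int_le; [by apply: ibl_abs; exact: iblZ|by apply: iblZ; exact: ibl_abs|].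
   move=> y; rewrite !normrM -mulrA ler_wpM2l// mulrC ler_wpM2r//.
   exact: le_trans (kM _) (ler_norm _).
 rewrite ibl_integral ?ltry//.
 by apply: iblZr; exact: ibl_abs.
have E1 x : (\int[leb]_y (EFin \o F) (x, y) = (u x * Int leb (fun y => v y * k (x, y)))%:E)%E.
 by rewrite -IntZ// -ibl_integral//; exact: iblZ.
have E2 y : (\int[leb]_x (EFin \o F) (x, y) = (v y * Int leb (fun x => u x * k (x, y)))%:E)%E.
 rewrite -IntZ// -ibl_integral; last exact: iblZ.
 by apply: eq_integral => x _ /=; rewrite /F /=; congr EFin; ring.
have B1 x : `|Int leb (fun y => v y * k (x, y))| <= M * Int leb (fun y => `|v y|).
 apply: le_trans (Int_abs (ivk x)) _; rewrite -IntZ; last exact: ibl_abs.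
 apply: Int_le; [exact: ibl_abs|by apply: iblZ; exact: ibl_abs|].
 by move=> y; rewrite normrM mulrC ler_wpM2r.
have B2 y : `|Int leb (fun x => u x * k (x, y))| <= M * Int leb (fun x => `|u x|).
 apply: le_trans (Int_abs (iuk y)) _; rewrite -IntZ; last exact: ibl_abs.
 apply: Int_le; [exact: ibl_abs|by apply: iblZ; exact: ibl_abs|].
 by move=> x; rewrite normrM mulrC ler_wpM2r.
have m1 : meas (fun x => u x * Int leb (fun y => v y * k (x, y))).
 apply/measurable_EFinP; apply: eq_measurable_fun (measurable_fubini_F iF).
 by move=> x _; exact: E1.
have m2 : meas (fun y => v y * Int leb (fun x => u x * k (x, y))).
 apply/measurable_EFinP; apply: eq_measurable_fun (measurable_fubini_G iF).
 by move=> y _; exact: E2.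
split.
- apply: ibl_le m1 _ (iblZ (M * Int leb (fun y => `|v y|)) (ibl_abs iu)) => x.
 by rewrite normrM mulrC ler_wpM2r.
- apply: ibl_le m2 _ (iblZ (M * Int leb (fun x => `|u x|)) (ibl_abs iv)) => y.
 by rewrite normrM mulrC ler_wpM2r.
- rewrite {1 3}/Int /Rintegral; congr fine.
 under [LHS]eq_integral do rewrite -E1; under [RHS]eq_integral do rewrite -E2.
 exact: Fubini.
Qed.

(** An unnormalised bump with values in [0, 1], supported where all coordinates are at most
    [2 / (n + 1)]; the division by its mass is made when the limit is taken. *)
Definition moll (n : nat) : Rd -> R := cutoff n.+1%:R^-1.
Definition moll_mass (n : nat) : R := Int leb (moll n).

Let rn n : 0 < n.+1%:R^-1 :> R. Proof. by rewrite invr_gt0. Qed.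

Lemma moll_test n : testT (moll n). Proof. exact: cutoff_test. Qed.

Lemma moll01 n x : 0 <= moll n x <= 1. Proof. exact: cutoff01. Qed.

Lemma moll_abs n x : `|moll n x| <= 1.
Proof. by have /andP[? ?] := moll01 n x; rewrite ger0_norm. Qed.

Lemma mollN n x : moll n (- x) = moll n x. Proof. exact: cutoffN. Qed.

Lemma moll_out n x i : 2 / n.+1%:R < `|x ord0 i| -> moll n x = 0.
Proof. by move=> h; apply: cutoff_out => // /(_ i); rewrite leNgt h. Qed.

Lemma moll_mass_gt0 n : 0 < moll_mass n.
Proof.
rewrite lt_neqAle eq_sym; apply/andP; split; last first.
 by apply: Int_ge0 => x; have /andP[] := moll01 n x.
apply/eqP => h; have := Int_eq0 (test_ibl (moll_test n)) _ h.
move=> /(_ (fun x => (andP (moll01 n x)).1)) h0.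
have [y /ball_rV[_ yr] y0] := ae_ball 0 (rn n) h0.
have : moll n y = 1.
 by apply: cutoff_in => // i; have := yr i; rewrite mxE sub0r normrN => /ltW.
by rewrite y0 => /eqP; rewrite eq_sym oner_eq0.
Qed.

Lemma sub_measurable : meas (fun z : Rd * Rd => z.1 - z.2).
Proof.
apply: measurable_fun_rV => x e; have [e0|e0] := leP e 0.
 rewrite (_ : _ @^-1` _ = set0); first exact: measurable0.
 by apply/seteqP; split=> // y /ball_rV[]; rewrite ltNge e0.
rewrite (_ : _ @^-1` _ = \bigcap_(i in [set: 'I_d])
 ((fun z : Rd * Rd => `|x ord0 i - (z.1 ord0 i - z.2 ord0 i)|) @^-1` `]-oo, e[)); last first.
 apply/seteqP; split => z.
  by move=> /ball_rV[_ h] i _; have := h i; rewrite /= in_itv/= !mxE.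
 by move=> h; apply/ball_rV; split => // i; have := h i I; rewrite /= in_itv/= !mxE.
apply: fin_bigcap_measurable => // i _.
rewrite -[_ @^-1` _]setTI.
suff m : meas (fun z : Rd * Rd => `|x ord0 i - (z.1 ord0 i - z.2 ord0 i)|) by exact: m.
apply: measurableT_comp => //; apply: measurable_funB => //; apply: measurable_funB.
 exact: (measurableT_comp (@measurable_coord R d i) measurable_fst).
exact: (measurableT_comp (@measurable_coord R d i) measurable_snd).
Qed.

Lemma moll_mass_shift n y : Int leb (fun x => moll n (x - y)) = moll_mass n.
Proof. exact: (Int_shift (- y) (test_ibl (moll_test n))).2. Qed.

Lemma moll_ibl n y : ibl leb (fun x => moll n (x - y)).
Proof. exact: (Int_shift (- y) (test_ibl (moll_test n))).1. Qed.

(* Convolution with a continuous bounded [c] converges to [c] pointwise. *)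
Lemma moll_cvg (w c : Rd -> R) (M : R) : ibl leb w -> continuous c -> (forall x, `|c x| <= M) ->
 Int leb (fun y => w y * (Int leb (fun x => c x * moll n (x - y)) / moll_mass n))
  @[n --> \oo] --> Int leb (fun y => w y * c y).
Proof.
move=> iw cc cM; have mw := ibl_meas iw; have mc := fun_measurable cc.
have ic n y : ibl leb (fun x => c x * moll n (x - y)).
 by apply: (iblbM (C := M) (moll_ibl n y)).
pose C n y := Int leb (fun x => c x * moll n (x - y)) / moll_mass n.
have CM n y : `|C n y| <= M.
 rewrite /C normrM normfV (gtr0_norm (moll_mass_gt0 n)) ler_pdivrMr ?moll_mass_gt0//.
 apply: le_trans (Int_abs (ic n y)) _; rewrite -(moll_mass_shift n y) -IntZ; last exact: moll_ibl.
 apply: Int_le; [exact: ibl_abs|by apply: iblZ; exact: moll_ibl|move=> x].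
 have /andP[m0 _] := moll01 n (x - y); rewrite normrM (ger0_norm m0) ler_wpM2r//.
(* The kernel [c(x) moll(x - y)] need not be integrable in both variables together, so measurability
   in [y] comes from Tonelli's theorem for its positive and negative parts. *)
have mC n : meas (C n).
 apply: measurable_funM => //.
 have mF (F : Rd -> \bar R) : meas F -> meas (fine \o F).
  by move=> mF; exact: measurableT_comp.
 pose G (z : Rd * Rd) : R := c z.1 * moll n (z.1 - z.2) .
 have mG : meas G.
  apply: measurable_funM; first exact: (measurableT_comp mc measurable_fst).
  by apply: (measurableT_comp (test_measurable (moll_test n)) sub_measurable).
 have E y : Int leb (fun x => c x * moll n (x - y)) =
   fine (\int[leb]_x (Num.max (G (x, y)) 0)%:E)%E - fine (\int[leb]_x (Num.max (- G (x, y)) 0)%:E)%E.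
  have ip : ibl leb (fun x => Num.max (G (x, y)) 0).
   apply: ibl_le (ibl_abs (ic n y)).
    by apply: measurable_maxr => //; exact: ibl_meas (ic n y).
   by move=> x; rewrite ger0_norm ?le_max ?lexx ?orbT// ge_max normr_ge0 ler_norm.
  have im : ibl leb (fun x => Num.max (- G (x, y)) 0).
   apply: ibl_le (ibl_abs (ic n y)).
    apply: measurable_maxr => //; exact: ibl_meas (iblN (ic n y)).
   by move=> x; rewrite ger0_norm ?le_max ?lexx ?orbT// ge_max normr_ge0 -normrN ler_norm.
  rewrite -/(Rintegral leb setT _) -/(Rintegral leb setT _) -[_ - _](IntB ip im).
  apply: eq_Int => x; rewrite /G/=; set t := c x * _.
  by rewrite /Num.max; case: ltP => h; case: ltP => h'; lra.
 rewrite (funext E).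
 apply: measurable_funB; apply: mF.
  apply: (measurable_fun_fubini_tonelli_G (fun p => (Num.max (G p) 0)%:E)); last first.
   by move=> z; rewrite lee_fin le_max lexx orbT.
  by apply/measurable_EFinP; exact: measurable_maxr.
 apply: (measurable_fun_fubini_tonelli_G (fun p => (Num.max (- G p) 0)%:E)); last first.
  by move=> z; rewrite lee_fin le_max lexx orbT.
 apply/measurable_EFinP; apply: measurable_maxr => //; exact: measurable_funN.
have Cc y : C n y @[n --> \oo] --> c y.
 apply: cvg0_sub; apply: cvg0P => e e0.
 have /cvgrPdist_lt/(_ (e / 2)) := cc y; rewrite divr_gt0// => /(_ isT).
 move=> /nbhs_ballP[r /= r0 hr].
 have [N hN] := cvg0_eN (cvg_harmonic 2) r0.
 exists N => n Nn; have mn := moll_mass_gt0 n.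
 have i0 := moll_ibl n y.
 have -> : C n y - c y = Int leb (fun x => (c x - c y) * moll n (x - y)) / moll_mass n.
  have -> : Int leb (fun x => (c x - c y) * moll n (x - y)) =
    Int leb (fun x => c x * moll n (x - y)) - c y * moll_mass n.
   rewrite -(moll_mass_shift n y) -IntZ// -IntB//; last exact: iblZ.
   by apply: eq_Int => x; rewrite mulrBl.
  by rewrite /C mulrBl mulfK// gt_eqF.
 have i1 : ibl leb (fun x => (c x - c y) * moll n (x - y)).
  apply: (@eq_ibl _ _ _ _ (fun x => c x * moll n (x - y) - c y * moll n (x - y))).
   by move=> x; rewrite mulrBl.
  by apply: iblB => //; exact: iblZ.
 rewrite normrM normfV (gtr0_norm mn) ltr_pdivrMr//.
 apply: le_lt_trans (Int_abs i1) _.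
 apply: (@le_lt_trans _ _ (e / 2 * moll_mass n)); last first.
  by rewrite ltr_pM2r// gtr_pMr// invf_lt1// ltr1n.
 rewrite -(moll_mass_shift n y) -IntZ//; apply: Int_le; [exact: ibl_abs|exact: iblZ|move=> x].
 have /andP[m0 _] := moll01 n (x - y); rewrite normrM (ger0_norm m0).
 have [xy|/existsNP[i xy]] := pselect (forall i, `|y ord0 i - x ord0 i| < r).
  by rewrite ler_wpM2r// distrC; apply/ltW/hr/ball_rV.
 rewrite (@moll_out n (x - y) i) ?mulr0// !mxE distrC.
 apply: lt_le_trans (_ : r <= _); last by rewrite leNgt; apply/negP.
 by apply: le_lt_trans (hN n Nn); exact: ler_norm.
apply: (Int_dom (g := fun y => `|M| * `|w y|)).
- by move=> n; apply: measurable_funM => //; exact: mC.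
- exact: measurable_funM.
- by apply: aeW => y; apply: cvgM; [exact: cvg_cst|exact: Cc].
- by apply: iblZ; exact: ibl_abs.
- move=> n y; rewrite normrM mulrC ler_wpM2r//.
 exact: le_trans (CM n y) (ler_norm _).
Qed.

Opaque Int pderiv.

Lemma is_derive_oppV f x v (l : R) : is_derive (- x) v f l -> is_derive x v (fun y => f (- y)) (- l).
Proof.
move=> df; apply: line_deriveP.
have h : is_derive (- 0 : R) 1 (fun s : R => f (- x + s *: v)) l.
 by apply: line_derive; rewrite oppr0 scale0r addr0.
have := @is_derive1_comp _ (fun s : R => f (- x + s *: v)) -%R 0 _ _ h (is_deriveNid (0 : R) (1 : R)).
rewrite mulrN1; congr (is_derive _ _ _ _); apply/funext => s /=.
by rewrite opprD scaleNr.
Qed.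

Lemma pderiv_mollN n j z : pderiv j (moll n) (- z) = - pderiv j (moll n) z.
Proof.
have cm : Coo (moll n) by exact: cutoff_Coo.
apply/eqP; rewrite eq_sym eqr_oppLR; apply/eqP.
have E : moll n = fun y => moll n (- y) by apply/funext => y; rewrite mollN.
rewrite {1}E; apply: pderivE; apply: is_derive_oppV; exact: Coo_derive.
Qed.

Lemma test_fun_shift f z : testT f -> testT (fun x => f (x + z)).
Proof.
move=> [cf kf _]; have [r r0 hr] := compact_cube kf.
apply: (@test_funI _ _ _ (cube (r + `|z|))) => //.
- exact: Coo_shift.
- exact: cube_compact.
- move=> x nx; apply: supportP => /hr h; apply: nx => i; have := h i; rewrite mxE => hi.
 have := norm_coord z i; have := ler_normB (x ord0 i + z ord0 i) (z ord0 i).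
 by rewrite addrK; lra.
Qed.

Lemma ibl_compact f (r : R) : continuous f -> (forall x, ~ cube r x -> f x = 0) ->
 ibl leb f /\ exists M, forall x, `|f x| <= M.
Proof.
move=> cf f0; have [M M0 hM] := compact_fun_bounded (@cube_compact _ _ r) cf; split.
 by apply: (@ibl_bounded _ _ (cube r) f M) => //; [exact: cube_compact|exact: fun_measurable].
exists M => x; have [cx|cx] := pselect (cube r x); first exact: hM.
by rewrite f0// normr0.
Qed.

(* Doubling of variables: test [rho] and [a] separately against
  [moll (x - y) g x], whose derivatives in [x] and [y] add up to
  [moll (x - y) (pderiv j g) x]. *)
Lemma product_rule j (a rho al r g : Rd -> R) : continuous a -> continuous rho ->
 Lloc 1 al -> Lloc 1 r -> weak_pderiv j a al -> weak_pderiv j rho r -> testT g ->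
 Int leb (fun x => rho x * a x * pderiv j g x) =
 - Int leb (fun x => (rho x * al x + a x * r x) * g x).
Proof.
move=> ca cr Lal Lr wa wr tg; have [cg kg _] := tg.
have cdg : Coo (pderiv j g) by exact: Coo_pderiv.
have [s s0 gs] := compact_cube kg.
have g0 x : ~ cube s x -> g x = 0 by move=> nx; apply: supportP => /gs.
have dg0 x : ~ cube s x -> pderiv j g x = 0 by move=> nx; apply: pderiv_support => /gs.
have s2 : 0 < s + 2 by rewrite addr_gt0.
(* The mollifiers vanish at points with a coordinate larger than 2. For [x] in [cube s], cutting [a]
   and [al] off outside [cube (s + 2)] thus changes no convolution and makes both integrable. *)
pose X := cutoff (s + 2) : Rd -> R.
have tX : testT X by exact: cutoff_test.
have cX : continuous X by apply: Coo_continuous; exact: cutoff_Coo.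
have La := continuous_Lloc ca; have Lrho := continuous_Lloc cr.
have [X1 X0] : (forall x, cube (s + 2) x -> X x = 1) /\ forall x, ~ cube (2 * (s + 2)) x -> X x = 0.
 by split => x; [exact: cutoff_in|exact: cutoff_out].
have opq (f : Rd -> R) : {h | forall x, h x = f x} by exists f.
have [u uE] := opq (fun x => rho x * g x); have [up upE] := opq (fun x => rho x * pderiv j g x).
have [ur urE] := opq (fun x => r x * g x).
have [aX aXE] := opq (fun x => a x * X x); have [alX alXE] := opq (fun x => al x * X x).
have cu : continuous u by rewrite (funext uE); apply: fun_continuousM => //; exact: Coo_continuous.
have cup : continuous up by rewrite (funext upE); apply: fun_continuousM => //; exact: Coo_continuous.
have caX : continuous aX by rewrite (funext aXE); exact: fun_continuousM.
have [iu [Mu hMu]] : ibl leb u /\ exists M, forall x, `|u x| <= M.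
 by apply: (@ibl_compact _ s) => // x /g0 gx; rewrite uE gx mulr0.
have [iup [Mup hMup]] : ibl leb up /\ exists M, forall x, `|up x| <= M.
 by apply: (@ibl_compact _ s) => // x /dg0 gx; rewrite upE gx mulr0.
have [iaX [Ma hMa]] : ibl leb aX /\ exists M, forall x, `|aX x| <= M.
 by apply: (@ibl_compact _ (2 * (s + 2))) => // x /X0 gx; rewrite aXE gx mulr0.
have iur : ibl leb ur by rewrite (funext urE); exact: (Lloc_test (lexx _) Lr tg).
have ialX : ibl leb alX by rewrite (funext alXE); exact: (Lloc_test (lexx _) Lal tX).
(* Before the limit: [al] is the weak derivative of [a] in [y]; since the kernel depends on [x - y],
   its derivative moves to [x], where the weak derivative of [rho] is tested with [g] times the
   kernel. *)
have step_n n : Int leb (fun y => alX y * Int leb (fun x => u x * moll n (x - y))) =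
  - Int leb (fun x => ur x * Int leb (fun y => aX y * moll n (y - x)))
  - Int leb (fun y => aX y * Int leb (fun x => up x * moll n (x - y))).
 have tk := moll_test n; have cm : Coo (moll n) := test_Coo tk.
 have tdk := test_pderiv j tk; have [Md Md0 hMd] := test_bounded tdk.
 have n2 : 2 / n.+1%:R <= 2 :> R by rewrite ler_pdivrMr// ler_peMr// ler1n.
 have near x y z : cube s x -> z = y - x -> ~ cube (s + 2) y -> exists i, 2 / n.+1%:R < `|z ord0 i|.
  move=> cx -> /existsNP[i /negP]; rewrite -ltNge => hy; exists i.
  have := cx i; rewrite !mxE => hx.
  have := ler_normD (y ord0 i - x ord0 i) (x ord0 i); rewrite subrK.
  by move: n2; move: (2 / _) => t ? ?; lra.
 have kX (b : Rd -> R) x : cube s x -> forall y, b y * moll n (y - x) = (b y * X y) * moll n (y - x).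
  move=> cx y; have [cy|cy] := pselect (cube (s + 2) y); first by rewrite X1// mulr1.
  by have [i hi] := near x y _ cx erefl cy; rewrite (moll_out hi) !mulr0.
 have dkX (b : Rd -> R) x : cube s x -> forall y, b y * pderiv j (moll n) (y - x) = (b y * X y) * pderiv j (moll n) (y - x).
  move=> cx y; have [cy|cy] := pselect (cube (s + 2) y); first by rewrite X1// mulr1.
  have [i hi] := near x y _ cx erefl cy; rewrite pderiv_support ?mulr0// => sk.
  have : support (moll n) `<=` cube (2 / n.+1%:R).
   by apply: support_sub; [exact: cube_closed|move=> z nz; exact: cutoff_out].
  by move=> /(_ _ sk i); rewrite leNgt hi.
 have S2 x : cube s x -> Int leb (fun y => aX y * pderiv j (moll n) (y - x)) =
   - Int leb (fun y => alX y * moll n (y - x)).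
  move=> cx; have tkx : testT (fun y => moll n (y - x)) by exact: test_fun_shift.
  have := weak_pderivE La Lal wa tkx.
  have -> : Int leb (fun y => al y * moll n (y - x)) = Int leb (fun y => alX y * moll n (y - x)).
   by apply: eq_Int => y; rewrite alXE (kX al x cx).
  by move=> <-; apply: eq_Int => y; rewrite pderiv_shift// (dkX a x cx) aXE.
 have S1 y : Int leb (fun x => u x * pderiv j (moll n) (x - y)) =
   - Int leb (fun x => ur x * moll n (x - y)) - Int leb (fun x => up x * moll n (x - y)).
  have cky : Coo (fun x => moll n (x - y)) by exact: Coo_shift.
  have tky : testT (fun x => g x * moll n (x - y)) by exact: test_funM.
  have := weak_pderivE Lrho Lr wr tky.
  rewrite (@eq_Int _ _ _ _ _ (fun x => u x * pderiv j (moll n) (x - y) + up x * moll n (x - y))); last first.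
   by move=> x; rewrite pderivM// pderiv_shift// uE upE; ring.
  rewrite IntD; last 2 first.
  - by apply: (iblMb iu _ (fun x => hMd (x - y))); apply: shift_measurableM; exact: test_measurable tdk.
  - by apply: (iblbM (C := Mup) (moll_ibl n y)) => //; exact: ibl_meas iup.
  rewrite (@eq_Int _ _ _ _ (fun x => r x * (g x * moll n (x - y))) (fun x => ur x * moll n (x - y))).
   by move=> <-; rewrite addrK.
  by move=> x; rewrite urE mulrA.
 have mk (k : Rd -> R) : meas k -> meas (fun p : Rd * Rd => k (p.2 - p.1)).
  move=> mk.
  exact: (measurableT_comp (measurableT_comp mk sub_measurable) (@measurable_swap _ _ Rd Rd)).
 have mdk := mk _ (test_measurable tdk); have mmk := mk _ (test_measurable tk).
 have mC (h : Rd -> R) y : Int leb (fun x => h x * moll n (y - x)) = Int leb (fun x => h x * moll n (x - y)).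
  by apply: eq_Int => x; rewrite -mollN opprB.
 have E1 : Int leb (fun x => u x * Int leb (fun y => alX y * moll n (y - x))) =
   Int leb (fun y => alX y * Int leb (fun x => u x * moll n (y - x))).
  by have [_ _] := Int_swap iu ialX mmk (fun p => moll_abs n (p.2 - p.1)).
 have [i1 i2 E2] : [/\ ibl leb (fun x => u x * Int leb (fun y => aX y * pderiv j (moll n) (y - x))),
   ibl leb (fun y => aX y * Int leb (fun x => u x * pderiv j (moll n) (y - x))) &
   Int leb (fun x => u x * Int leb (fun y => aX y * pderiv j (moll n) (y - x))) =
   Int leb (fun y => aX y * Int leb (fun x => u x * pderiv j (moll n) (y - x)))].
  exact: Int_swap iu iaX mdk (fun p => hMd (p.2 - p.1)).
 have [_ i3 E3] : [/\ ibl leb (fun x => ur x * Int leb (fun y => aX y * moll n (y - x))),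
   ibl leb (fun y => aX y * Int leb (fun x => ur x * moll n (y - x))) &
   Int leb (fun x => ur x * Int leb (fun y => aX y * moll n (y - x))) =
   Int leb (fun y => aX y * Int leb (fun x => ur x * moll n (y - x)))].
  exact: Int_swap iur iaX mmk (fun p => moll_abs n (p.2 - p.1)).
 have [_ i4 _] : [/\ ibl leb (fun x => up x * Int leb (fun y => aX y * moll n (y - x))),
   ibl leb (fun y => aX y * Int leb (fun x => up x * moll n (y - x))) &
   Int leb (fun x => up x * Int leb (fun y => aX y * moll n (y - x))) =
   Int leb (fun y => aX y * Int leb (fun x => up x * moll n (y - x)))].
  exact: Int_swap iup iaX mmk (fun p => moll_abs n (p.2 - p.1)).
 have E4 : Int leb (fun y => aX y * Int leb (fun x => up x * moll n (x - y))) =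
   Int leb (fun y => aX y * Int leb (fun x => up x * moll n (y - x))).
  by apply: eq_Int => y; rewrite mC.
 have E5 : Int leb (fun x => u x * Int leb (fun y => alX y * moll n (y - x))) =
   Int leb (fun x => - (u x * Int leb (fun y => aX y * pderiv j (moll n) (y - x)))).
  apply: eq_Int => x; have [cx|cx] := pselect (cube s x); first by rewrite (S2 x cx) mulrN opprK.
  by rewrite uE (g0 x cx) mulr0 !mul0r oppr0.
 have E6 : Int leb (fun y => aX y * Int leb (fun x => u x * pderiv j (moll n) (y - x))) =
   Int leb (fun y => aX y * Int leb (fun x => ur x * moll n (y - x)) +
            aX y * Int leb (fun x => up x * moll n (y - x))).
  apply: eq_Int => y.
  have e1 : Int leb (fun x => u x * pderiv j (moll n) (y - x)) =
    Int leb (fun x => - (u x * pderiv j (moll n) (x - y))).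
   by apply: eq_Int => x; rewrite -[y - x]opprB pderiv_mollN mulrN.
  have e2 : ibl leb (fun x => u x * pderiv j (moll n) (x - y)).
   by apply: (iblMb iu _ (fun x => hMd (x - y))); apply: shift_measurableM; exact: test_measurable tdk.
  have e3 := etrans e1 (etrans (IntN e2) (congr1 -%R (S1 y))).
  apply: etrans (congr1 ( *%R (aX y)) e3) _; rewrite opprD !opprK mulrDr.
  exact: (congr2 (fun s t => aX y * s + aX y * t) (esym (mC ur y)) (esym (mC up y))).
 have E7 := IntD i3 i4; have E8 := IntN i1.
 apply: etrans (_ : Int leb (fun y => alX y * Int leb (fun x => u x * moll n (y - x))) = _).
  by apply: eq_Int => y; rewrite mC.
 apply: etrans (esym E1) _; apply: etrans E5 _; apply: etrans E8 _.
 apply: etrans (congr1 -%R (etrans E2 (etrans E6 E7))) _.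
 by apply: etrans (opprD _ _) _; apply: esym; exact: (congr2 (fun s t => - s - t) E3 E4).
have L1 := moll_cvg ialX cu hMu; have L2 := moll_cvg iur caX hMa; have L3 := moll_cvg iaX cup hMup.
have ib (w c : Rd -> R) M n : ibl leb w -> ibl leb c -> (forall x, `|c x| <= M) ->
  ibl leb (fun y => w y * Int leb (fun x => c x * moll n (x - y))).
 move=> iw ic cM; have tk := moll_test n.
 have mk : meas (fun p : Rd * Rd => moll n (p.1 - p.2)).
  exact: (measurableT_comp (test_measurable tk) sub_measurable).
 by have [_ i _] := Int_swap ic iw mk (fun p => moll_abs n (p.1 - p.2)).
have dv (w c : Rd -> R) M n : ibl leb w -> ibl leb c -> (forall x, `|c x| <= M) ->
  Int leb (fun y => w y * (Int leb (fun x => c x * moll n (x - y)) / moll_mass n)) =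
  Int leb (fun y => w y * Int leb (fun x => c x * moll n (x - y))) / moll_mass n.
 move=> iw ic cM; have e := IntZ (moll_mass n)^-1 (ib w c M n iw ic cM).
 by apply: etrans (etrans _ e) (mulrC _ _); apply: eq_Int => y; ring.
have L : Int leb (fun y => alX y * (Int leb (fun x => u x * moll n (x - y)) / moll_mass n))
  @[n --> \oo] --> - Int leb (fun x => ur x * aX x) - Int leb (fun y => aX y * up y).
 rewrite (_ : (fun n => _) = fun n =>
   - Int leb (fun y => ur y * (Int leb (fun x => aX x * moll n (x - y)) / moll_mass n))
   - Int leb (fun y => aX y * (Int leb (fun x => up x * moll n (x - y)) / moll_mass n))).
  by apply: cvgB => //; exact: cvgN.
 apply/funext => n; rewrite (dv _ _ Mu)// (dv _ _ Ma)// (dv _ _ Mup)// step_n.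
 by rewrite mulrBl mulNr.
have E := cvg_uniq L1 L.
have Xg x : X x * g x = g x.
 have [cx|cx] := pselect (cube s x); last by rewrite g0// mulr0.
 by rewrite X1 ?mul1r// => i; apply: le_trans (cx i) _; rewrite lerDl.
have Xdg x : X x * pderiv j g x = pderiv j g x.
 have [cx|cx] := pselect (cube s x); last by rewrite dg0// mulr0.
 by rewrite X1 ?mul1r// => i; apply: le_trans (cx i) _; rewrite lerDl.
rewrite (@eq_Int _ _ _ _ (fun x => rho x * a x * pderiv j g x) (fun y => aX y * up y)); last first.
 by move=> x; rewrite aXE upE -{1}Xdg; ring.
rewrite [in RHS](@eq_Int _ _ _ _ _ (fun x => alX x * u x + ur x * aX x)); last first.
 by move=> x; rewrite alXE uE urE aXE -[in LHS]Xg; ring.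
rewrite IntD; first by rewrite E; ring.
- by apply: (iblMb ialX _ hMu); exact: ibl_meas iu.
- by apply: (iblMb iur _ hMa); exact: ibl_meas iaX.
Qed.

End product_rule.
Transparent Int pderiv.

(** * Lp norms expressed by integrals *)

Section Lp_bridge.
Context {R : realType} {d : nat}.
Local Notation Rd := 'rV[R]_d.
Variable mu : {measure set Rd -> \bar R}.
Implicit Types (f g : Rd -> R).

Lemma fun_continuousV f : continuous f -> (forall x, f x != 0) -> continuous (fun x => (f x)^-1).
Proof.
move=> cf f0 x; exact: (cvgV (f0 x) (cf x)).
Qed.

Lemma Lfun_meas (q : \bar R) f : f \in Lfun mu q -> meas f.
Proof. by rewrite inE => /andP[/[!inE]]. Qed.

Lemma Lfun1P f : f \in Lfun mu 1%:E <-> ibl mu f.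
Proof. exact: Lfun1_integrable. Qed.

Lemma Lpnorm1 f : ibl mu f -> Lpnorm mu 1%:E f = (Int mu (fun x => `|f x|))%:E.
Proof. by move=> hf; rewrite /Lpnorm Lnorm1 -ibl_integral//; exact: ibl_abs. Qed.

Lemma Lpcvg1P (fn : nat -> Rd -> R) f : (forall n, ibl mu (fn n)) -> ibl mu f ->
 Lp_cvg mu 1%:E fn f <-> Int mu (fun x => `|fn n x - f x|) @[n --> \oo] --> 0.
Proof.
move=> hfn hf; rewrite /Lp_cvg.
have -> : (fun n => Lpnorm mu 1%:E (fn n \- f)) = fun n => (Int mu (fun x => `|fn n x - f x|))%:E.
 by apply/funext => n; rewrite Lpnorm1//; exact: iblB.
split; first by move=> /fine_cvgP[].
by move=> h; apply/fine_cvgP; split => //; exact: nearW.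
Qed.

Lemma Lpcvg2 (fn : nat -> Rd -> R) f : (forall n, ibl mu (fun x => (fn n x - f x) ^+ 2)) ->
 (forall n, meas (fun x => fn n x - f x)) ->
 Lp_cvg mu 2%:E fn f <-> Int mu (fun x => (fn n x - f x) ^+ 2) @[n --> \oo] --> 0.
Proof.
move=> h2 mf; rewrite /Lp_cvg.
have E n : Lpnorm mu 2%:E (fn n \- f) = (Num.sqrt (Int mu (fun x => (fn n x - f x) ^+ 2)))%:E.
 rewrite /Lpnorm unlock /=.
 rewrite (eq_integral (fun x => ((fn n x - f x) ^+ 2)%:E)); last first.
  by move=> x _ /=; rewrite powR_mulrn// real_normK ?num_real.
 rewrite ibl_integral// poweR_EFin powR12_sqrt//.
 by apply: Int_ge0 => x; exact: sqr_ge0.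
rewrite (funext E).
have I0 n : 0 <= Int mu (fun x => (fn n x - f x) ^+ 2) by apply: Int_ge0 => x; exact: sqr_ge0.
split => [/fine_cvgP[_ h]|h].
 rewrite (_ : (fun n => Int mu _) = fun n => Num.sqrt (Int mu (fun x => (fn n x - f x) ^+ 2)) *
   Num.sqrt (Int mu (fun x => (fn n x - f x) ^+ 2))); last first.
  by apply/funext => n; rewrite -expr2 sqr_sqrtr.
 by rewrite -[0](mulr0 (0 : R)); apply: cvgM; exact: h.
apply/fine_cvgP; split; first exact: nearW.
apply: cvg0P => e e0; have [N hN] := cvg0_eN h (exprn_gt0 2 e0).
exists N => n /hN; rewrite /= ger0_norm// => hn; rewrite ger0_norm ?sqrtr_ge0//.
by rewrite -(ger0_norm (ltW e0)) -sqrtr_sqr ltr_sqrt// exprn_gt0.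
Qed.

Lemma bounded_Lfun_oo f (M : R) : meas f -> (forall x, `|f x| <= M) ->
 f \in Lfun mu +oo%E.
Proof.
move=> mf fM; rewrite inE; apply/andP; split; rewrite inE//= /finite_norm unlock.
case: ifPn => // _; apply: le_lt_trans (ltry M); apply/ess_sup_inf.ess_supP.
by apply: aeW => x /=; rewrite lee_fin.
Qed.

End Lp_bridge.

(** * Integrals against a measure with a density *)

Section density_measure.
Context {R : realType} {d : nat}.
Local Notation Rd := 'rV[R]_d.
Local Notation leb := (lebesgue_rV R d).
Variables (mu : {measure set Rd -> \bar R}) (rho : Rd -> R).
Hypothesis rho_cont : continuous rho.
Hypothesis rho_pos : forall x, 0 < rho x.
Hypothesis mu_rho : forall D, measurable D -> mu D = (\int[leb]_(x in D) (rho x)%:E)%E.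

Import HBNNSimple.

Let rho_meas : meas rho. Proof. exact: fun_measurable. Qed.
Let mEr : meas (fun x => (rho x)%:E). Proof. exact/measurable_EFinP. Qed.
Let r0 x : 0 <= rho x. Proof. exact: ltW. Qed.

Let nnsfun_density (f : {nnsfun Rd >-> R}) :
 (\int[mu]_x (f x)%:E = \int[leb]_x (f x * rho x)%:E)%E.
Proof.
under [LHS]eq_integral do rewrite fimfunE -fsumEFin//.
rewrite [LHS]ge0_integral_fsum//; last 2 first.
 - by move=> r; exact/measurable_EFinP/measurableT_comp.
 - by move=> n x _; rewrite EFinM nnfun_muleindic_ge0.
under [RHS]eq_integral.
 move=> x xD; rewrite EFinM fimfunE -fsumEFin// muleC ge0_mule_fsumr; last first.
  by move=> r; rewrite EFinM nnfun_muleindic_ge0.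
 over.
rewrite [RHS]ge0_integral_fsum//; last 2 first.
 - move=> r; apply: emeasurable_funM => //.
  by apply/measurable_EFinP; exact/measurableT_comp.
 - by move=> n x _; apply: mule_ge0; [rewrite lee_fin|rewrite EFinM nnfun_muleindic_ge0].
apply: eq_fsbigr => r _.
under [RHS]eq_integral do rewrite EFinM muleCA.
have [rn|rn] := leP 0 r; last first.
 have E x : \1_(f @^-1` [set r]) x = 0 :> R.
  rewrite indicE memNset//= => fr; have : 0 <= f x by [].
  by rewrite fr leNgt rn.
 transitivity (0 : \bar R)%E; first by apply: integral0_eq => x _; rewrite E mulr0.
 by apply/esym; apply: integral0_eq => x _; rewrite E mule0 mule0.
rewrite integralZl_indic_nnsfun//= ge0_integralZl//; last 2 first.
 - by apply: emeasurable_funM => //; apply/measurable_EFinP; exact: measurable_indic.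
 - by move=> x _; rewrite mule_ge0 ?lee_fin.
congr (_ * _)%E; rewrite integral_indic//= setIT mu_rho// integral_mkcond.
apply: eq_integral => x _; rewrite patchE indicE.
by case: ifPn => _; rewrite ?mule1 ?mule0.
Qed.

(** [mu] is known through its values on sets; simple functions and monotone convergence carry this
    over to integrals. *)
Lemma ge0_integral_density (f : Rd -> R) : meas f -> (forall x, 0 <= f x) ->
 (\int[mu]_x (f x)%:E = \int[leb]_x (f x * rho x)%:E)%E.
Proof.
move=> mf f0; have mEf : meas (EFin \o f) by exact/measurable_EFinP.
have f0' x : setT x -> (0 <= (EFin \o f) x)%E by rewrite lee_fin.
pose f_ := nnsfun_approx measurableT mEf.
have fx x : (fun n => (f_ n x)%:E) @ \oo --> (f x)%:E by exact: cvg_nnsfun_approx.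
have nd x : {homo (fun n => (f_ n x)%:E) : n m / (n <= m)%N >-> (n <= m)%E}.
 by move=> n m nm; rewrite lee_fin; exact/lefP/nd_nnsfun_approx.
transitivity (limn (fun n => \int[mu]_x (f_ n x)%:E)%E).
 rewrite -monotone_convergence//=.
 - by apply: eq_integral => x _; apply/esym/cvg_lim.
 - by move=> n; exact/measurable_EFinP.
 - by move=> n x _; rewrite lee_fin.
transitivity (limn (fun n => \int[leb]_x (f_ n x * rho x)%:E)%E); last first.
 rewrite -monotone_convergence//=.
 - apply: eq_integral => x _; apply/cvg_lim => //; rewrite EFinM.
  under eq_fun do rewrite EFinM.
  by apply: cvgeM; [exact: mule_def_fin|exact: fx|exact: cvg_cst].
 - by move=> n; apply/measurable_EFinP; exact: measurable_funM.
 - by move=> n x _; rewrite lee_fin mulr_ge0.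
 - by move=> x _ n m nm; rewrite lee_fin ler_wpM2r// -lee_fin nd.
by congr (limn _); apply/funext => n; exact: nnsfun_density.
Qed.

Lemma ibl_density f : ibl mu f <-> ibl leb (fun x => f x * rho x).
Proof.
have E (g : Rd -> R) : meas g -> (\int[mu]_x `|(g x)%:E| = \int[leb]_x `|(g x * rho x)%:E|)%E.
 move=> mg; transitivity (\int[mu]_x (`|g x|)%:E)%E; first by apply: eq_integral.
 rewrite ge0_integral_density//; last exact: measurableT_comp.
 by apply: eq_integral => x _ /=; rewrite normrM (ger0_norm (r0 x)).
split => /integrableP[/measurable_EFinP mf hf]; apply/integrableP.
 split; first by apply/measurable_EFinP; exact: measurable_funM.
 by apply: le_lt_trans hf; rewrite -E.
have mf' : meas f.
 rewrite (_ : f = fun x => (f x * rho x) * (rho x)^-1); last first.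
  by apply/funext => x; rewrite mulfK// gt_eqF.
 apply: (@measurable_funM _ _ _ _ (fun x => f x * rho x) (fun x => (rho x)^-1)) => //.
 by apply: fun_measurable; apply: fun_continuousV => // x; rewrite gt_eqF.
by split; [exact/measurable_EFinP|apply: le_lt_trans hf; rewrite -E].
Qed.

Lemma Int_density f : ibl mu f -> Int mu f = Int leb (fun x => f x * rho x).
Proof.
move=> hf; have mf := ibl_meas hf.
pose fp x := Num.max (f x) 0; pose fm x := Num.max (- f x) 0.
have mp : meas fp by exact: measurable_maxr.
have mm : meas fm by apply: measurable_maxr => //; exact: measurable_funN.
have p0 x : 0 <= fp x by rewrite le_max lexx orbT.
have m0 x : 0 <= fm x by rewrite le_max lexx orbT.
have ip : ibl mu fp.
 by apply: ibl_le (ibl_abs hf) => // x; rewrite ger0_norm// ge_max normr_ge0 ler_norm.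
have im : ibl mu fm.
 by apply: ibl_le (ibl_abs hf) => // x; rewrite ger0_norm// ge_max normr_ge0 -normrN ler_norm.
have E (g : Rd -> R) : meas g -> (forall x, 0 <= g x) -> Int mu g = Int leb (fun x => g x * rho x).
 by move=> mg g0; rewrite /Int /Rintegral; congr fine; exact: ge0_integral_density.
have fE x : f x = fp x - fm x.
 by rewrite /fp /fm /Num.max; case: ltP => h; case: ltP => h'; lra.
rewrite (eq_Int _ fE) IntB// !E// -IntB; [|exact/ibl_density|exact/ibl_density].
by apply: eq_Int => x; rewrite -mulrBl -fE.
Qed.

Lemma ae_density (P : Rd -> Prop) : {ae mu, forall x, P x} <-> {ae leb, forall x, P x}.
Proof.
split=> -[N [mN N0 hN]]; exists N; split => //.
 rewrite mu_rho// in N0; apply/eqP; rewrite eq_le measure_ge0 andbT leNgt; apply/negP => N1.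
 have h : ibl leb (fun x => \1_N x * rho x).
  apply/ibl_density; apply/integrableP; split.
   by apply/measurable_EFinP; exact: measurable_indic.
  rewrite (eq_integral (fun x => (\1_N x)%:E)); last first.
   by move=> x _ /=; rewrite ger0_norm ?indic_ge0.
  by rewrite integral_indic// setIT mu_rho// N0 ltry.
 have E : Int leb (fun x => \1_N x * rho x) = 0.
  rewrite /Int /Rintegral (_ : \int[leb]_x _ = 0)%E// -[RHS]N0 [RHS]integral_mkcond.
  apply: eq_integral => x _; rewrite patchE indicE.
  by case: ifPn => _; rewrite ?mul1r ?mul0r.
 have [M [mM M0 hM]] := Int_eq0 h (fun x => mulr_ge0 (indic_ge0 _ _) (r0 x)) E.
 have : (leb N <= leb M)%E.
  apply: le_measure; rewrite ?inE// => x Nx; apply: hM => /=; rewrite indicE_in// mul1r => h0.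
  by have := rho_pos x; rewrite h0 ltxx.
 by rewrite M0 leNgt N1.
rewrite mu_rho//; apply: null_set_integral => //.
exact: measurable_funTS.
Qed.

End density_measure.

(** * Local integrability and weak derivatives *)

Section locally_integrable_powers.
Context {R : realType} {d : nat}.
Local Notation Rd := 'rV[R]_d.
Local Notation leb := (lebesgue_rV R d).
Implicit Types (x : Rd) (f g : Rd -> R) (K : set Rd).

(** The space L^n_loc for integer exponents. The values 1, 2 and [d] occur, and powers stay
    polynomial. *)
Definition powloc n f := meas f /\
 forall K, compact K -> ibl leb (fun x => `|f x| ^+ n * \1_K x).

Lemma powloc_meas n f : powloc n f -> meas f. Proof. by case. Qed.

Lemma meas_pow_indic n f K : meas f -> compact K ->
 meas (fun x => `|f x| ^+ n * \1_K x).
Proof.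
move=> mf cK; apply: measurable_funM; last by apply: indic_meas; exact: compact_measurable_rV.
by apply: measurable_funX; exact: measurableT_comp.
Qed.

Lemma powloc_Lloc q n f : 1 <= q -> (0 < n)%N -> n%:R <= q -> Lloc q f -> powloc n f.
Proof. by move=> q1 n0 nq Lf; split; [case: Lf|move=> K; exact: (@Lloc_pow _ _ q)]. Qed.

Lemma powloc1 n f : (0 < n)%N -> powloc n f -> powloc 1 f.
Proof.
move=> n0 [mf hf]; split => // K cK.
apply: (@ibl_le _ _ _ _ _ (fun x => \1_K x + `|f x| ^+ n * \1_K x)).
- exact: meas_pow_indic.
- move=> x; rewrite expr1 normrM normr_id (ger0_norm (indic_ge0 K x)).
 rewrite -{2}[\1_K x]mul1r -mulrDl ler_wpM2r ?indic_ge0//.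
 have [f1|f1] := leP `|f x| 1; first by rewrite (le_trans f1)// lerDl exprn_ge0.
 by apply: le_trans (_ : `|f x| ^+ n <= _); [exact/ler_eXnr/ltW|rewrite lerDr].
- by apply: iblD; [exact: ibl_indic|exact: hf].
Qed.

Lemma powloc_Lloc1 f : powloc 1 f -> Lloc 1 f.
Proof.
move=> [mf hf]; apply: Lloc1P => // K cK; apply: ibl_le (hf K cK).
 by apply: measurable_funM => //; apply: indic_meas; exact: compact_measurable_rV.
by move=> x; rewrite normrM (ger0_norm (indic_ge0 K x)) expr1.
Qed.

Lemma powloc_ae n f g : meas g -> {ae leb, forall x, f x = g x} ->
 powloc n f -> powloc n g.
Proof.
move=> mg fg [mf hf]; split => // K cK; apply: ae_eq_ibl (hf K cK); first exact: meas_pow_indic.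
by apply: filterS fg => x ->.
Qed.

Lemma expr_add_le n (a b : R) : 0 <= a -> 0 <= b -> (a + b) ^+ n <= 2 ^+ n * (a ^+ n + b ^+ n).
Proof.
move=> a0 b0.
wlog ab : a b a0 b0 / a <= b.
 move=> h; have [|/ltW] := leP a b; first exact: h.
 by rewrite [a + b]addrC [a ^+ n + _]addrC; exact: h.
apply: le_trans (_ : (2 * b) ^+ n <= _).
 by apply: lerXn2r; rewrite ?nnegrE ?addr_ge0 ?mulr_ge0//; lra.
by rewrite exprMn ler_wpM2l ?exprn_ge0// lerDr exprn_ge0.
Qed.

Lemma powlocD n f g : powloc n f -> powloc n g -> powloc n (fun x => f x + g x).
Proof.
move=> [mf hf] [mg hg]; have mD := measurable_funD mf mg; split => // K cK.
apply: (@ibl_le _ _ _ _ _ (fun x => 2 ^+ n * (`|f x| ^+ n * \1_K x + `|g x| ^+ n * \1_K x))).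
- exact: meas_pow_indic.
- move=> x; rewrite normrM (ger0_norm (indic_ge0 K x)) -mulrDl mulrA ler_wpM2r ?indic_ge0//.
 rewrite normrX normr_id; apply: le_trans (expr_add_le n (normr_ge0 _) (normr_ge0 _)).
 by apply: lerXn2r; rewrite ?nnegrE ?addr_ge0// ler_normD.
- by apply: iblZ; apply: iblD; [exact: hf|exact: hg].
Qed.

Lemma powloc_cM n (c : Rd -> R) f : continuous c -> powloc n f -> powloc n (fun x => c x * f x).
Proof.
move=> cc [mf hf]; have mc := fun_measurable cc; have mM := measurable_funM mc mf.
split => // K cK; have [M M0 hM] := compact_fun_bounded cK cc.
apply: (@ibl_le _ _ _ _ _ (fun x => M ^+ n * (`|f x| ^+ n * \1_K x))).
- exact: meas_pow_indic.
- move=> x; have [Kx|Kx] := pselect (K x); last by rewrite indicE_out// !mulr0 normr0.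
 rewrite indicE_in// !mulr1 normrX normr_id normrM exprMn ler_wpM2r ?exprn_ge0//.
 by apply: lerXn2r; rewrite ?nnegrE// hM.
- by apply: iblZ; exact: hf.
Qed.

Lemma powlocZ n (c : R) f : powloc n f -> powloc n (fun x => c * f x).
Proof. exact: (powloc_cM (@cst_continuous _ _ c)). Qed.

Lemma powlocN n f : powloc n f -> powloc n (fun x => - f x).
Proof.
move=> hf; have [mf h] := powlocZ (-1) hf; split.
 by move: mf; congr (measurable_fun _ _); apply/funext => x; rewrite mulN1r.
by move=> K cK; apply: eq_ibl (h K cK) => x; rewrite mulN1r.
Qed.

Lemma powloc0 n : (0 < n)%N -> powloc n (fun=> 0 : R).
Proof.
move=> n0; split; first exact: measurable_cst.
move=> K cK; have e0 : ibl leb (fun=> 0 : R) by exact: ibl0.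
by apply: eq_ibl e0 => x; rewrite normr0 expr0n gtn_eqF// mul0r.
Qed.

Lemma powloc_sum n (F : 'I_d -> Rd -> R) : (0 < n)%N -> (forall i, powloc n (F i)) ->
 powloc n (fun x => \sum_i F i x).
Proof.
move=> n0 hF; have h (s : seq 'I_d) : powloc n (fun x => \sum_(i <- s) F i x).
 elim: s => [|i s IH].
  under eq_fun do rewrite big_nil.
  exact: powloc0.
 under eq_fun do rewrite big_cons.
 exact: powlocD.
exact: h.
Qed.

Lemma Lloc1_powloc f : Lloc 1 f -> powloc 1 f.
Proof. exact: powloc_Lloc. Qed.

Lemma powloc_test f V g : powloc 1 f -> test_fun V g -> ibl leb (fun x => f x * g x).
Proof. by move=> /powloc_Lloc1 Lf tg; exact: Lloc_test Lf tg. Qed.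

Lemma weak_pderiv_unique i f g h : Lloc 1 f -> Lloc 1 g -> Lloc 1 h ->
 weak_pderiv i f g -> weak_pderiv i f h -> {ae leb, forall x, g x = h x}.
Proof.
move=> Lf Lg Lh wg wh.
have L : Lloc 1 (fun x => g x - h x).
 by apply: powloc_Lloc1; apply: powlocD; [|apply: powlocN]; exact: Lloc1_powloc.
have : {ae leb, forall x, g x - h x = 0}.
 apply: ae_eq0_test => // phi tp.
 have e1 := weak_pderivE Lf Lg wg tp; have e2 := weak_pderivE Lf Lh wh tp.
 have e3 := IntB (Lloc_test (lexx _) Lg tp) (Lloc_test (lexx _) Lh tp).
 have e4 : Int leb (fun x => g x * phi x) = Int leb (fun x => h x * phi x).
  by apply: oppr_inj; exact: etrans (esym e1) e2.
 apply: etrans (_ : Int leb (fun x => g x * phi x - h x * phi x) = _).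
  by apply: eq_Int => x; rewrite mulrBl.
 by apply: etrans e3 _; apply/eqP; rewrite subr_eq0; apply/eqP.
by apply: filterS => x /eqP; rewrite subr_eq0 => /eqP.
Qed.

Lemma wpderivP i f g : Lloc 1 g -> weak_pderiv i f g -> Lloc 1 f ->
 [/\ Lloc 1 (wpderiv i f), weak_pderiv i f (wpderiv i f) & {ae leb, forall x, g x = wpderiv i f x}].
Proof.
move=> Lg wg Lf; have : [set h | Lloc 1 h /\ weak_pderiv i f h] !=set0 by exists g.
by move=> /getPex [Lw ww]; split => //; exact: weak_pderiv_unique ww.
Qed.

(** [wpderiv] selects some L^1_loc representative; uniqueness of weak derivatives hands it the
    better integrability of the witness contained in [H1loc]. *)
Lemma H1loc_wpderiv q n f i : 1 <= q -> (0 < n)%N -> n%:R <= q -> H1loc q f ->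
 powloc n (wpderiv i f) /\ weak_pderiv i f (wpderiv i f).
Proof.
move=> q1 n0 nq [Lf /(_ i)[g Lg wg]].
have [Lw ww gw] := wpderivP (Lloc_1 q1 Lg) wg (Lloc_1 q1 Lf); split => //.
by apply: powloc_ae gw _; [case: Lw|exact: powloc_Lloc Lg].
Qed.

Lemma weak_pderivD i f f' g g' (c : R) : Lloc 1 f -> Lloc 1 f' -> Lloc 1 g -> Lloc 1 g' ->
 weak_pderiv i f g -> weak_pderiv i f' g' ->
 weak_pderiv i (fun x => f x + c * f' x) (fun x => g x + c * g' x).
Proof.
move=> Lf Lf' Lg Lg' wf wf'.
have LL (a b : Rd -> R) : Lloc 1 a -> Lloc 1 b -> Lloc 1 (fun x => a x + c * b x).
 by move=> La Lb; apply: powloc_Lloc1; apply: powlocD; [|apply: powlocZ]; exact: Lloc1_powloc.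
apply: weak_pderivI; [exact: LL|exact: LL|] => phi tp; have td := test_pderiv i tp.
have E (a b t : Rd -> R) : Lloc 1 a -> Lloc 1 b -> testT t ->
  Int leb (fun x => (a x + c * b x) * t x) =
  Int leb (fun x => a x * t x) + c * Int leb (fun x => b x * t x).
 move=> La Lb tt; have ia := Lloc_test (lexx _) La tt; have ib := Lloc_test (lexx _) Lb tt.
 apply: etrans (_ : Int leb (fun x => a x * t x + c * (b x * t x)) = _).
  by apply: eq_Int => x; rewrite mulrDl mulrA.
 by apply: etrans (IntD ia (iblZ c ib)) _; congr (_ + _); exact: IntZ.
rewrite (E _ _ _ Lf Lf' td) (E _ _ _ Lg Lg' tp) (weak_pderivE Lf Lg wf tp) (weak_pderivE Lf' Lg' wf' tp).
by rewrite opprD mulrN.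
Qed.

End locally_integrable_powers.

Section double_sums.
Context {R : realType} {n : nat}.
Implicit Types (a b : 'I_n -> 'I_n -> R).

Lemma sum2D a b : \sum_i \sum_j (a i j + b i j) = \sum_i \sum_j a i j + \sum_i \sum_j b i j.
Proof. by rewrite -big_split; apply: eq_bigr => i _; rewrite big_split. Qed.

Lemma sum2_exchange_mulr a b (r : R) : (forall i j, a j i * r = b i j) ->
 (\sum_i \sum_j a i j) * r = \sum_i \sum_j b i j.
Proof.
move=> ab; rewrite exchange_big /= mulr_suml; apply: eq_bigr => i _.
by rewrite mulr_suml; apply: eq_bigr => j _.
Qed.

End double_sums.

(** * The drift as a divergence-free field *)

Section drift_identities.
Context {R : realType} {d : nat}.
Local Notation Rd := 'rV[R]_d.
Local Notation leb := (lebesgue_rV R d).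
Variables (A C : Rd -> 'M[R]_d) (H : Rd -> Rd) (rho : Rd -> R).
Variables (mu : {measure set Rd -> \bar R}) (p : R).
Hypotheses (d2 : (2 <= d)%N) (dp : d%:R < p).
Hypotheses (hA : assumption_a A C H p) (hmu : invariant_density A C H rho mu p).
Implicit Types (x : Rd) (f F psi : Rd -> R) (i j : 'I_d).

Let rc := rho_continuous hmu.
Let d0 : (0 < d)%N := ltn_trans (ltn0Sn 0) d2.

Let p1 : 1 <= p.
Proof. by apply: le_trans (ltW dp); rewrite ler1n. Qed.

Let p2 : 2%:R <= p.
Proof. by apply: le_trans (ltW dp); rewrite ler_nat. Qed.

Lemma rho_wpderiv n i : (0 < n)%N -> (n <= d)%N ->
 powloc n (wpderiv i rho) /\ weak_pderiv i rho (wpderiv i rho).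
Proof.
move=> n0 nd; apply: H1loc_wpderiv (rho_sobolev hmu) => //.
by apply: le_trans (ltW dp); rewrite ler_nat.
Qed.

Lemma A_wpderiv i j k :
 powloc 2 (wpderiv k (fun y => A y i j)) /\ weak_pderiv k (fun y => A y i j) (wpderiv k (fun y => A y i j)).
Proof. by apply: H1loc_wpderiv (A_sobolev hA i j) => //; rewrite ler1n. Qed.

Lemma AC_wpderiv i j k :
 powloc 2 (wpderiv k (fun y => (A y + (C y)^T) i j)) /\
 weak_pderiv k (fun y => (A y + (C y)^T) i j) (wpderiv k (fun y => (A y + (C y)^T) i j)).
Proof.
have -> : (fun y => (A y + (C y)^T) i j) = fun y => A y i j + 1 * C y j i.
 by apply/funext => y; rewrite !mxE mul1r.
have [LA /(_ k)[g Lg wg]] := A_sobolev hA i j; have [LC /(_ k)[h Lh wh]] := C_sobolev hA j i.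
have q1 : 1 <= 2 :> R by rewrite ler1n.
have pw (f : Rd -> R) : Lloc 2 f -> powloc 2 f by apply: powloc_Lloc.
have pg : powloc 2 (fun x => g x + 1 * h x) by apply: powlocD; [|apply: powlocZ]; exact: pw.
have pf : powloc 2 (fun x => A x i j + 1 * C x j i) by apply: powlocD; [|apply: powlocZ]; exact: pw.
have w := weak_pderivD 1 (Lloc_1 q1 LA) (Lloc_1 q1 LC) (Lloc_1 q1 Lg) (Lloc_1 q1 Lh) wg wh.
have L2 (f : Rd -> R) : powloc 2 f -> Lloc 1 f by move=> /(@powloc1 _ _ 2 _ isT); exact: powloc_Lloc1.
have [Lw ww gw] := wpderivP (L2 _ pg) w (L2 _ pf).
by split => //; apply: powloc_ae gw pg; case: Lw.
Qed.

(** This is [rho B] minus the field with components [1/2 sum_j D_j (rho c_ji)]. The derivatives of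
    [A] and [C] cancel and only [rho H] and the gradient of [rho] remain, which lie in L^d_loc
    because [p > d]; [rho B] itself is only placed in L^2_loc. *)
Definition flux i x := rho x * H x ord0 i - 2^-1 * \sum_j (A x i j + C x j i) * wpderiv j rho x.

(** A representative of [D_j c_ji]. It is taken as a difference because the drift contains the
    chosen derivative of the entries of [A + C^T], not those of [C]. *)
Definition Cdiff i j x := wpderiv j (fun y => (A y + (C y)^T) i j) x - wpderiv j (fun y => A y i j) x.

Lemma Cdiff_weak i j : powloc 2 (Cdiff i j) /\ weak_pderiv j (fun x => C x j i) (Cdiff i j).
Proof.
have [pa wa] := A_wpderiv i j j; have [pc wc] := AC_wpderiv i j j.
have L2 (f : Rd -> R) : powloc 2 f -> Lloc 1 f by move=> /(@powloc1 _ _ 2 _ isT); exact: powloc_Lloc1.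
split; first by apply: powlocD => //; exact: powlocN.
have q1 : 1 <= 2 :> R by rewrite ler1n.
have LA := Lloc_1 q1 (A_sobolev hA i j).1.
have LAC : Lloc 1 (fun y => (A y + (C y)^T) i j).
 rewrite (_ : (fun y => (A y + (C y)^T) i j) = fun y => A y i j + C y j i); last first.
  by apply/funext => y; rewrite !mxE.
 apply: powloc_Lloc1; apply: powlocD; apply: Lloc1_powloc => //.
 exact: Lloc_1 q1 (C_sobolev hA j i).1.
have := weak_pderivD (-1) LAC LA (L2 _ pc) (L2 _ pa) wc wa.
rewrite (_ : (fun x => (A x + (C x)^T) i j + -1 * A x i j) = fun x => C x j i); last first.
 by apply/funext => y; rewrite !mxE mulN1r addrAC subrr add0r.
by congr weak_pderiv; apply/funext => y; rewrite mulN1r.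
Qed.

Lemma flux_powloc i : powloc d (flux i).
Proof.
apply: powlocD; first by apply: powloc_cM => //; apply: (@powloc_Lloc _ _ p) (H_Lploc hA i) => //; exact: ltW.
apply: powlocN; apply: powlocZ; apply: powloc_sum => // j.
apply: powloc_cM; last by have [] := rho_wpderiv j d0 (leqnn d).
by apply: fun_continuousD; [exact: A_continuous hA i j|exact: C_continuous hA j i].
Qed.

Lemma flux_powloc1 i : powloc 1 (flux i).
Proof. exact: powloc1 d0 (flux_powloc i). Qed.

Let Adiv i x := 2^-1 * \sum_j (rho x * wpderiv j (fun y => A y i j) x + A x i j * wpderiv j rho x).

Lemma BfieldE i x : Bfield A C H rho x ord0 i * rho x = drift A C H x ord0 i * rho x - Adiv i x.
Proof.
rewrite !mxE mulrBl; congr (_ - _); rewrite /Adiv -mulrA; congr (_ * _).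
rewrite mulr_suml; apply: eq_bigr => j _; rewrite mulrDl [_ * rho x]mulrC; congr (_ + _).
by rewrite -!mulrA mulVf ?mulr1// gt_eqF// (rho_gt0 hmu).
Qed.

Lemma Bfield_flux i x : Bfield A C H rho x ord0 i * rho x =
 flux i x + 2^-1 * \sum_j (rho x * Cdiff i j x + C x j i * wpderiv j rho x).
Proof.
rewrite BfieldE /Adiv /flux !mxE mulrDl.
have e1 : \sum_j (rho x * wpderiv j (fun y => A y i j) x + A x i j * wpderiv j rho x) =
  rho x * \sum_j wpderiv j (fun y => A y i j) x + \sum_j A x i j * wpderiv j rho x.
 by rewrite big_split /= mulr_sumr.
have e2 : \sum_j (A x i j + C x j i) * wpderiv j rho x =
  \sum_j A x i j * wpderiv j rho x + \sum_j C x j i * wpderiv j rho x.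
 by rewrite -big_split /=; apply: eq_bigr => j _; rewrite mulrDl.
have e3 : \sum_j (rho x * Cdiff i j x + C x j i * wpderiv j rho x) =
  rho x * (\sum_j wpderiv j (fun y => (A y + (C y)^T) i j) x - \sum_j wpderiv j (fun y => A y i j) x)
  + \sum_j C x j i * wpderiv j rho x.
 by rewrite big_split /= -mulr_sumr; congr (_ * _ + _); rewrite -sumrB.
by rewrite e1 e2 e3; ring.
Qed.

Lemma drift_powloc i : powloc 1 (fun x => drift A C H x ord0 i).
Proof.
rewrite (_ : (fun x => _) = fun x => 2^-1 * \sum_j wpderiv j (fun y => (A y + (C y)^T) i j) x + H x ord0 i).
 apply: (@powloc1 _ _ 2) => //; apply: powlocD; last by apply: (@powloc_Lloc _ _ p) (H_Lploc hA i).
 by apply: powlocZ; apply: powloc_sum => // j; have [] := AC_wpderiv i j j.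
by apply/funext => x; rewrite !mxE.
Qed.

Lemma Bfield_powloc i : powloc 2 (fun x => Bfield A C H rho x ord0 i * rho x).
Proof.
rewrite (_ : (fun x => _) = fun x => flux i x + 2^-1 * \sum_j (rho x * Cdiff i j x + C x j i * wpderiv j rho x)).
 have hr (j : 'I_d) : powloc 2 (wpderiv j rho) by have [] := rho_wpderiv j (isT : 0 < 2)%N d2.
 apply: powlocD.
  apply: powlocD; first by apply: powloc_cM => //; apply: (@powloc_Lloc _ _ p) (H_Lploc hA i).
  apply: powlocN; apply: powlocZ; apply: powloc_sum => // j; apply: powloc_cM => //.
  by apply: fun_continuousD; [exact: A_continuous hA i j|exact: C_continuous hA j i].
 apply: powlocZ; apply: powloc_sum => // j; apply: powlocD; apply: powloc_cM => //.
  by have [] := Cdiff_weak i j.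
 exact: C_continuous hA j i.
by apply/funext => x; exact: Bfield_flux.
Qed.

(** The two fields differ by weak derivatives of [rho C / 2], which the product rule moves onto
    [g]. *)
Lemma Int_Bfield (g : 'I_d -> Rd -> R) : (forall i, testT (g i)) ->
 Int leb (fun x => \sum_i Bfield A C H rho x ord0 i * rho x * g i x) =
 Int leb (fun x => \sum_i flux i x * g i x)
 - 2^-1 * \sum_i \sum_j Int leb (fun x => rho x * C x j i * pderiv j (g i) x).
Proof.
move=> tg; have hf i : ibl leb (fun x => flux i x * g i x) := powloc_test (flux_powloc1 i) (tg i).
have hq i j : ibl leb (fun x => (rho x * Cdiff i j x + C x j i * wpderiv j rho x) * g i x).
 apply: powloc_test (tg i); apply: powlocD; apply: powloc_cM => //.
 - by apply: (@powloc1 _ _ 2) => //; have [] := Cdiff_weak i j.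
 - exact: C_continuous hA j i.
 - by have [] := rho_wpderiv j (isT : 0 < 1)%N d0.
have L1 f : powloc 2 f -> Lloc 1 f by move=> /(@powloc1 _ _ 2 _ isT); exact: powloc_Lloc1.
have E1 i j : Int leb (fun x => (rho x * Cdiff i j x + C x j i * wpderiv j rho x) * g i x) =
  - Int leb (fun x => rho x * C x j i * pderiv j (g i) x).
 have [pc wc] := Cdiff_weak i j; have [pr wr] := rho_wpderiv j (isT : 0 < 2)%N d2.
 have e := product_rule (C_continuous hA (i:=j) (j:=i)) rc (L1 _ pc) (L1 _ pr) wc wr (tg i).
 by apply: oppr_inj; rewrite opprK; exact: esym e.
apply: etrans (_ : Int leb (fun x => \sum_i flux i x * g i x +
  2^-1 * \sum_i \sum_j (rho x * Cdiff i j x + C x j i * wpderiv j rho x) * g i x) = _).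
 apply: eq_Int => x; rewrite mulr_sumr -big_split /=; apply: eq_bigr => i _.
 by rewrite Bfield_flux mulrDl -mulrA mulr_suml.
have h1 : ibl leb (fun x => \sum_i flux i x * g i x) by apply: ibl_sum => i _; exact: hf.
have h2 i : ibl leb (fun x => \sum_j (rho x * Cdiff i j x + C x j i * wpderiv j rho x) * g i x).
 by apply: ibl_sum => j _; exact: hq.
have h3 : ibl leb (fun x => \sum_i \sum_j (rho x * Cdiff i j x + C x j i * wpderiv j rho x) * g i x).
 by apply: ibl_sum => i _; exact: h2.
apply: etrans (IntD h1 (iblZ _ h3)) _; congr (_ + _); apply: etrans (IntZ _ h3) _.
rewrite -mulrN; congr (_ * _); apply: etrans (Int_sum _ (fun i _ => h2 i)) _.
rewrite -sumrN; apply: eq_bigr => i _; apply: etrans (Int_sum _ (fun j _ => hq i j)) _.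
by rewrite -sumrN; apply: eq_bigr => j _; exact: E1.
Qed.

(** Integration by parts against [rho] turns the second-order part of [Lop f] into the field
    [- rho beta] paired with the gradient of [f]. What is left of the invariance of [mu] is that
    [rho B] is divergence free. *)
Lemma Int_Bfield_grad f : testT f ->
 Int leb (fun x => \sum_i Bfield A C H rho x ord0 i * rho x * pderiv i f x) = 0.
Proof.
move=> tf; have td i : testT (pderiv i f) := test_pderiv i tf.
have L1 (g : Rd -> R) : powloc 2 g -> Lloc 1 g by move=> /(@powloc1 _ _ 2 _ isT); exact: powloc_Lloc1.
have hr j : powloc 1 (wpderiv j rho) by have [] := rho_wpderiv j (isT : 0 < 1)%N d0.
have ha i j : powloc 1 (fun x => rho x * wpderiv j (fun y => A y i j) x + A x i j * wpderiv j rho x).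
 apply: powlocD; apply: powloc_cM => //; last exact: A_continuous hA i j.
 by apply: (@powloc1 _ _ 2) => //; have [] := A_wpderiv i j j.
have iA i j : ibl leb (fun x => rho x * A x i j * pderiv j (pderiv i f) x).
 apply: (powloc_test _ (test_pderiv j (td i))); apply: Lloc1_powloc; apply: continuous_Lloc.
 by apply: fun_continuousM => //; exact: A_continuous hA i j.
have iD i : ibl leb (fun x => drift A C H x ord0 i * rho x * pderiv i f x).
 have h : powloc 1 (fun x => rho x * drift A C H x ord0 i) by exact: powloc_cM (drift_powloc i).
 by apply: eq_ibl (powloc_test h (td i)) => x; rewrite [rho x * _]mulrC.
have iad i j : ibl leb (fun x => (rho x * wpderiv j (fun y => A y i j) x + A x i j * wpderiv j rho x) * pderiv i f x).
 exact: powloc_test (ha i j) (td i).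
have E i j : Int leb (fun x => rho x * A x i j * pderiv j (pderiv i f) x) =
  - Int leb (fun x => (rho x * wpderiv j (fun y => A y i j) x + A x i j * wpderiv j rho x) * pderiv i f x).
 have [pa wa] := A_wpderiv i j j; have [pr wr] := rho_wpderiv j (isT : 0 < 2)%N d2.
 exact (product_rule (A_continuous hA (i:=i) (j:=j)) rc (L1 _ pa) (L1 _ pr) wa wr (td i)).
have LE x : Lop A C H f x * rho x = 2^-1 * \sum_i \sum_j rho x * A x i j * pderiv j (pderiv i f) x
  + \sum_i drift A C H x ord0 i * rho x * pderiv i f x.
 rewrite /Lop mulrDl -mulrA; congr (_ * _ + _).
  by apply: sum2_exchange_mulr => i j; rewrite (A_sym hA x i j); ring.
 by rewrite /dot mulr_suml; apply: eq_bigr => i _; rewrite /grad mxE; ring.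
have i2 i : ibl leb (fun x => \sum_j rho x * A x i j * pderiv j (pderiv i f) x).
 by apply: ibl_sum => j _; exact: iA.
have i3 : ibl leb (fun x => \sum_i \sum_j rho x * A x i j * pderiv j (pderiv i f) x).
 by apply: ibl_sum => i _; exact: i2.
have i4 : ibl leb (fun x => \sum_i drift A C H x ord0 i * rho x * pderiv i f x).
 by apply: ibl_sum => i _; exact: iD.
have i5 i : ibl leb (fun x => \sum_j (rho x * wpderiv j (fun y => A y i j) x + A x i j * wpderiv j rho x) * pderiv i f x).
 by apply: ibl_sum => j _; exact: iad.
have i6 : ibl leb (fun x => \sum_i \sum_j (rho x * wpderiv j (fun y => A y i j) x + A x i j * wpderiv j rho x) * pderiv i f x).
 by apply: ibl_sum => i _; exact: i5.
have iL : ibl leb (fun x => Lop A C H f x * rho x).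
 by apply: eq_ibl (iblD (iblZ 2^-1 i3) i4) => x; rewrite LE.
have iLm : ibl mu (Lop A C H f) := (ibl_density rc (rho_gt0 hmu) (@mu_density _ _ _ _ _ _ _ _ hmu) _).2 iL.
have ZL : Int leb (fun x => Lop A C H f x * rho x) = 0.
 apply: etrans (esym (Int_density rc (rho_gt0 hmu) (@mu_density _ _ _ _ _ _ _ _ hmu) iLm)) _.
 by have := mu_invariant hmu tf; rewrite (ibl_integral iLm) => -[].
apply: etrans ZL; apply: esym.
apply: etrans (eq_Int _ LE) _; apply: etrans (IntD (iblZ 2^-1 i3) i4) _.
have e3 : Int leb (fun x => 2^-1 * \sum_i \sum_j rho x * A x i j * pderiv j (pderiv i f) x) =
  - Int leb (fun x => 2^-1 * \sum_i \sum_j (rho x * wpderiv j (fun y => A y i j) x + A x i j * wpderiv j rho x) * pderiv i f x).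
 apply: etrans (IntZ _ i3) _; apply: etrans _ (congr1 -%R (esym (IntZ _ i6))).
 rewrite -mulrN; congr (_ * _); apply: etrans (Int_sum _ (fun i _ => i2 i)) _.
 apply: etrans _ (congr1 -%R (esym (Int_sum _ (fun i _ => i5 i)))); rewrite -sumrN.
 apply: eq_bigr => i _; apply: etrans (Int_sum _ (fun j _ => iA i j)) _.
 apply: etrans _ (congr1 -%R (esym (Int_sum _ (fun j _ => iad i j)))); rewrite -sumrN.
 by apply: eq_bigr => j _; exact: E.
rewrite e3 addrC; apply: etrans (esym (IntB i4 (iblZ 2^-1 i6))) _; apply: eq_Int => x.
rewrite mulr_sumr -sumrB; apply: eq_bigr => i _.
by rewrite BfieldE mulrBl; congr (_ - _); rewrite /Adiv -mulrA mulr_suml.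
Qed.

Lemma Int_C_sym (S : 'I_d -> 'I_d -> Rd -> R) : (forall i j x, S i j x = S j i x) ->
 (forall i j, testT (S i j)) ->
 \sum_i \sum_j Int leb (fun x => rho x * C x j i * S i j x) = 0.
Proof.
move=> Ss tS.
have iS i j : ibl leb (fun x => rho x * C x j i * S i j x).
 apply: (powloc_test _ (tS i j)); apply: Lloc1_powloc; apply: continuous_Lloc.
 by apply: fun_continuousM => //; exact: C_continuous hA j i.
have E i j : Int leb (fun x => rho x * C x j i * S i j x) = - Int leb (fun x => rho x * C x i j * S j i x).
 apply: etrans _ (IntN (iS j i)); apply: eq_Int => x.
 by rewrite (Ss j i) -[C x j i](C_antisym hA); ring.
have : \sum_i \sum_j Int leb (fun x => rho x * C x j i * S i j x) =
  - \sum_i \sum_j Int leb (fun x => rho x * C x j i * S i j x).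
 rewrite {1}exchange_big /= -sumrN; apply: eq_bigr => i _; rewrite -sumrN; apply: eq_bigr => j _.
 exact: E.
by move: (\sum_i _) => s; lra.
Qed.

(** Subtracting the divergence of an antisymmetric matrix changes nothing, because this matrix pairs
    to 0 with the symmetric Hessian of [f]. *)
Lemma Int_flux_grad f : testT f -> Int leb (fun x => \sum_i flux i x * pderiv i f x) = 0.
Proof.
move=> tf; have td i : testT (pderiv i f) := test_pderiv i tf.
have Z : \sum_i \sum_j Int leb (fun x => rho x * C x j i * pderiv j (pderiv i f) x) = 0.
 apply: (@Int_C_sym (fun i j => pderiv j (pderiv i f))) => [i j x|i j]; last exact: test_pderiv.
 by apply: pderivC; exact: test_Coo tf.
have := Int_Bfield td; rewrite Z mulr0 subr0 => <-; exact: Int_Bfield_grad.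
Qed.

(** Testing [flux] with the gradient of [F psi] moves the derivative from [F] to [psi], and
    antisymmetry removes the Hessian of [F] from the other part. In the result the unbounded field
    meets [F] only, and the gradient of [F] meets only the continuous matrix [C]: the drift has
    become a lower-order term. *)
Lemma Bfield_by_parts F psi : Coo F -> testT psi ->
 Int leb (fun x => \sum_i Bfield A C H rho x ord0 i * rho x * (pderiv i F x * psi x)) =
 - Int leb (fun x => F x * \sum_i flux i x * pderiv i psi x)
 - 2^-1 * Int leb (fun x => rho x * \sum_i \sum_j C x j i * (pderiv i F x * pderiv j psi x)).
Proof.
move=> cF tp; have cp := test_Coo tp.
have cdF i : Coo (pderiv i F) by exact: Coo_pderiv.
have tg i : testT (fun x => pderiv i F x * psi x) by exact: test_funMr.
have tdp i : testT (pderiv i psi) by exact: test_pderiv.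
apply: etrans (Int_Bfield tg) _; congr (_ - _ * _).
 have tFp : testT (fun x => F x * psi x) by exact: test_funMr.
 have i1 : ibl leb (fun x => \sum_i flux i x * (pderiv i F x * psi x)).
  by apply: ibl_sum => i _; exact: powloc_test (flux_powloc1 i) (tg i).
 have i2 : ibl leb (fun x => F x * \sum_i flux i x * pderiv i psi x).
  have h : ibl leb (fun x => \sum_i flux i x * (F x * pderiv i psi x)).
   by apply: ibl_sum => i _; apply: powloc_test (flux_powloc1 i) _; exact: test_funMr.
  by apply: eq_ibl h => x; rewrite mulr_sumr; apply: eq_bigr => i _; ring.
 apply/eqP; rewrite -addr_eq0; apply/eqP; apply: etrans (esym (IntD i1 i2)) _.
 apply: etrans (Int_flux_grad tFp); apply: eq_Int => x; rewrite mulr_sumr -big_split /=.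
 by apply: eq_bigr => i _; rewrite pderivM//; ring.
have iC i j (t : Rd -> R) : testT t -> ibl leb (fun x => rho x * C x j i * t x).
 move=> tt; apply: (powloc_test _ tt); apply: Lloc1_powloc; apply: continuous_Lloc.
 by apply: fun_continuousM => //; exact: C_continuous hA j i.
have tS i j : testT (fun x => pderiv j (pderiv i F) x * psi x).
 by apply: test_funMr => //; exact: Coo_pderiv.
have tP i j : testT (fun x => pderiv i F x * pderiv j psi x) by exact: test_funMr.
have Ss i j x : pderiv j (pderiv i F) x * psi x = pderiv i (pderiv j F) x * psi x by rewrite (pderivC j i).
have Z := @Int_C_sym (fun i j x => pderiv j (pderiv i F) x * psi x) Ss tS.
have i2 i : ibl leb (fun x => \sum_j rho x * C x j i * (pderiv i F x * pderiv j psi x)).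
 by apply: ibl_sum => j _; exact: iC.
apply: etrans (_ : \sum_i \sum_j (Int leb (fun x => rho x * C x j i * (pderiv j (pderiv i F) x * psi x))
  + Int leb (fun x => rho x * C x j i * (pderiv i F x * pderiv j psi x))) = _).
 apply: eq_bigr => i _; apply: eq_bigr => j _; apply: etrans _ (IntD (iC _ _ _ (tS i j)) (iC _ _ _ (tP i j))).
 by apply: eq_Int => x; rewrite pderivM//; ring.
apply: etrans (_ : \sum_i \sum_j Int leb (fun x => rho x * C x j i * (pderiv i F x * pderiv j psi x)) = _).
 by apply: etrans (sum2D _ _) _; rewrite -[RHS]add0r; congr (_ + _); exact: Z.
apply: esym; apply: etrans (_ : Int leb (fun x => \sum_i \sum_j rho x * C x j i * (pderiv i F x * pderiv j psi x)) = _).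
 apply: eq_Int => x; rewrite mulr_sumr; apply: eq_bigr => i _; rewrite mulr_sumr; apply: eq_bigr => j _.
 by rewrite mulrA.
apply: etrans (Int_sum _ (fun i _ => i2 i)) _; apply: eq_bigr => i _.
by apply: etrans (Int_sum _ (fun j _ => iC i j _ (tP i j))) _.
Qed.

End drift_identities.

Section real_sequences_aux.
Context {R : realType}.
Implicit Types (a b : nat -> R).

Lemma cvg_ext a b (l : R) : (forall n, a n = b n) -> a n @[n --> \oo] --> l -> b n @[n --> \oo] --> l.
Proof. by move=> /funext ->. Qed.

Lemma cvg_mull (c : R) a (l : R) : a n @[n --> \oo] --> l -> c * a n @[n --> \oo] --> c * l.
Proof. by move=> h; apply: cvgM => //; exact: cvg_cst. Qed.

Lemma cvg_add a b (l l' : R) : a n @[n --> \oo] --> l -> b n @[n --> \oo] --> l' ->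
 a n + b n @[n --> \oo] --> l + l'.
Proof. by move=> ha hb; exact: (@cvgD _ _ _ _ _ a b l l'). Qed.

Lemma abs_lt_sqr (s e : R) : 0 < e -> s ^+ 2 < e ^+ 2 -> `|s| < e.
Proof.
move=> e0 h; rewrite -(@ltr_pXn2r _ 2) ?nnegrE ?normr_ge0 ?(ltW e0)//.
by rewrite real_normK ?num_real.
Qed.

Lemma abs_sub_le2 (s t M : R) : `|s| <= M -> `|t| <= M -> `|s - t| <= 2 * M.
Proof. by move=> hs ht; apply: le_trans (ler_normB _ _) _; lra. Qed.

Lemma mul_lt_bound (s t K E : R) : 0 <= s -> t <= K -> s * (1 + K) < E -> s * t < E.
Proof. by move=> s0 tK h; nra. Qed.

End real_sequences_aux.

(** * Convergence in mean square *)

Section L2_convergence.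
Context {dsp} {T : measurableType dsp} {R : realType}.
Variable m : {measure set T -> \bar R}.
Implicit Types (f g h : T -> R).

Definition L2fun f := meas f /\ ibl m (fun x => f x ^+ 2).

Definition L2cvg (fs : nat -> T -> R) f := [/\ forall n, L2fun (fs n), L2fun f &
 Int m (fun x => (fs n x - f x) ^+ 2) @[n --> \oo] --> 0].

Lemma L2funD f g : L2fun f -> L2fun g -> L2fun (fun x => f x + g x).
Proof. by move=> [mf f2] [mg g2]; split; [exact: measurable_funD|exact: iblD2]. Qed.

Lemma L2funZb f (c : T -> R) (M : R) : meas c -> (forall x, `|c x| <= M) ->
 L2fun f -> L2fun (fun x => c x * f x).
Proof.
move=> mc cM [mf f2]; split; first exact: measurable_funM.
have h : ibl m (fun x => c x ^+ 2 * f x ^+ 2).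
 apply: (iblbM (C := M ^+ 2) f2) => [|x]; first exact: measurable_funX.
 by rewrite normrX; apply: lerXn2r; rewrite ?nnegrE// (le_trans _ (cM x)).
by apply: eq_ibl h => x; rewrite exprMn.
Qed.

Lemma L2funN f : L2fun f -> L2fun (fun x => - f x).
Proof.
move=> hf; have := L2funZb (@measurable_cst _ _ T R setT (-1)) (fun=> lexx `|-1|) hf.
by congr L2fun; apply/funext => x; rewrite mulN1r.
Qed.

Lemma L2funB f g : L2fun f -> L2fun g -> L2fun (fun x => f x - g x).
Proof. by move=> hf /L2funN; exact: L2funD. Qed.

Lemma L2fun_ae f g : meas g -> {ae m, forall x, f x = g x} -> L2fun f -> L2fun g.
Proof.
move=> mg fg [mf f2]; split => //; apply: ae_eq_ibl f2; first exact: measurable_funX.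
by apply: filterS fg => x ->.
Qed.

Lemma L2cvg_ae fs f g : meas g -> {ae m, forall x, f x = g x} ->
 L2cvg fs f -> L2cvg fs g.
Proof.
move=> mg fg [h1 h2 h3]; have hg := L2fun_ae mg fg h2; split => //.
apply: cvg_ext h3 => n; apply: ae_eq_Int; [| |by apply: filterS fg => x ->].
 by apply: measurable_funX; have [] := L2funB (h1 n) h2.
by apply: measurable_funX; have [] := L2funB (h1 n) hg.
Qed.

Lemma sqrD_le (a b : R) : (a + b) ^+ 2 <= 2 * a ^+ 2 + 2 * b ^+ 2.
Proof. by have := sqr_ge0 (a - b); lra. Qed.

Lemma L2cvg_cauchy fs f : L2cvg fs f -> forall e : R, 0 < e ->
 exists N, forall p q, (N <= p)%N -> (N <= q)%N -> Int m (fun x => (fs p x - fs q x) ^+ 2) < e.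
Proof.
move=> [h1 h2 h3] e e0; have e4 : 0 < e / 4 by rewrite divr_gt0.
have [N hN] := cvg0_eN h3 e4; exists N => p q /hN hp /hN hq.
have [_ i1] := L2funB (h1 p) h2; have [_ i2] := L2funB (h1 q) h2; have [_ i3] := L2funB (h1 p) (h1 q).
apply: le_lt_trans (_ : 2 * Int m (fun x => (fs p x - f x) ^+ 2) + 2 * Int m (fun x => (fs q x - f x) ^+ 2) < _).
 apply: le_trans (Int_le i3 (iblD (iblZ 2 i1) (iblZ 2 i2)) _) _.
  by move=> x; have := sqrD_le (fs p x - f x) (- (fs q x - f x)); rewrite sqrrN opprB addrA subrK.
 by rewrite IntD; [rewrite !IntZ|exact: iblZ|exact: iblZ].
move: hp hq; move/(le_lt_trans (ler_norm _)) => hp /(le_lt_trans (ler_norm _)) hq.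
by move: hp hq; move: (Int _ _) (Int _ _) => s t hs ht; lra.
Qed.

Lemma L2cvg_Int fs f g : L2cvg fs f -> L2fun g ->
 Int m (fun x => fs n x * g x) @[n --> \oo] --> Int m (fun x => f x * g x).
Proof.
move=> [h1 h2 h3] hg; have [mg g2] := hg.
have iM a b : L2fun a -> L2fun b -> ibl m (fun x => a x * b x) by move=> [? ?] [? ?]; exact: iblM2.
apply: cvg0_sub; apply: cvg0P => e e0.
have G0 : 0 <= Int m (fun x => g x ^+ 2) by apply: Int_ge0 => x; exact: sqr_ge0.
have e1 : 0 < e ^+ 2 / (1 + Int m (fun x => g x ^+ 2)) by rewrite divr_gt0 ?exprn_gt0//; lra.
have [N hN] := cvg0_eN h3 e1; exists N => n /hN hn.
have hfn := L2funB (h1 n) h2.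
have E : Int m (fun x => fs n x * g x) - Int m (fun x => f x * g x) = Int m (fun x => (fs n x - f x) * g x).
 apply: etrans (esym (IntB (iM _ _ (h1 n) hg) (iM _ _ h2 hg))) _.
 by apply: eq_Int => x; rewrite mulrBl.
rewrite E; apply: abs_lt_sqr => //.
have [mn n2] := hfn; apply: le_lt_trans (CauchySchwarz mn mg n2 g2) _.
move/(le_lt_trans (ler_norm _)) : hn; rewrite ltr_pdivlMr; last by lra.
by apply: mul_lt_bound (lexx _); apply: Int_ge0 => x; exact: sqr_ge0.
Qed.

Lemma L2cvg_IntM fs f gs g : L2cvg fs f -> L2cvg gs g ->
 Int m (fun x => fs n x * gs n x) @[n --> \oo] --> Int m (fun x => f x * g x).
Proof.
move=> hf hg; have [f1 f2 f3] := hf; have [g1 g2 g3] := hg.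
have iM a b : L2fun a -> L2fun b -> ibl m (fun x => a x * b x) by move=> [? ?] [? ?]; exact: iblM2.
have Lg : Int m (fun x => f x * gs n x) @[n --> \oo] --> Int m (fun x => f x * g x).
 have := L2cvg_Int hg f2; under eq_fun do under eq_Int do rewrite mulrC.
 by rewrite (@eq_Int _ _ _ _ (fun x => g x * f x) (fun x => f x * g x))// => x; rewrite mulrC.
have Z : Int m (fun x => (fs n x - f x) * gs n x) @[n --> \oo] --> 0.
 have [N hN] := cvg0_eN g3 ltr01.
 have G0 : 0 <= Int m (fun x => g x ^+ 2) by apply: Int_ge0 => x; exact: sqr_ge0.
 pose K := 2 + 2 * Int m (fun x => g x ^+ 2).
 have hK n : (N <= n)%N -> Int m (fun x => gs n x ^+ 2) <= K.
  move=> /hN /(le_lt_trans (ler_norm _)) hn; have [_ i1] := L2funB (g1 n) g2; have [_ i2] := g2.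
  have [_ i3] := g1 n.
  apply: le_trans (Int_le i3 (iblD (iblZ 2 i1) (iblZ 2 i2)) _) _.
   by move=> x; have := sqrD_le (gs n x - g x) (g x); rewrite subrK.
  rewrite IntD; [rewrite !IntZ// /K|exact: iblZ|exact: iblZ].
  by move: hn; move: (Int _ _) (Int _ _) => s t hs; lra.
 apply: cvg0P => e e0; have e1 : 0 < e ^+ 2 / (1 + K) by rewrite divr_gt0 ?exprn_gt0// /K; lra.
 have [N' hN'] := cvg0_eN f3 e1; exists (maxn N N') => n; rewrite geq_max => /andP[/hK hn /hN' hn'].
 apply: abs_lt_sqr => //.
 have [mn n2] := L2funB (f1 n) f2; have [mg gg] := g1 n.
 apply: le_lt_trans (CauchySchwarz mn mg n2 gg) _.
 move/(le_lt_trans (ler_norm _)) : hn'; rewrite ltr_pdivlMr; last by rewrite /K; lra.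
 by apply: mul_lt_bound => //; apply: Int_ge0 => x; exact: sqr_ge0.
have := cvg_add Z Lg; rewrite add0r; apply: cvg_ext => n /=.
apply: etrans (esym (IntD (iM _ _ (L2funB (f1 n) f2) (g1 n)) (iM _ _ f2 (g1 n)))) _.
by apply: eq_Int => x; rewrite -mulrDl subrK.
Qed.

Lemma L2cvgD fs f gs g : L2cvg fs f -> L2cvg gs g ->
 L2cvg (fun n x => fs n x + gs n x) (fun x => f x + g x).
Proof.
move=> [f1 f2 f3] [g1 g2 g3]; split => [n||]; [exact: L2funD|exact: L2funD|].
have := cvg_add (@cvg_mull _ 2 _ _ f3) (@cvg_mull _ 2 _ _ g3); rewrite mulr0 addr0; apply: cvg0_le => n.
have [_ i1] := L2funB (f1 n) f2; have [_ i2] := L2funB (g1 n) g2.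
have [_ i3] := L2funB (L2funD (f1 n) (g1 n)) (L2funD f2 g2).
rewrite ger0_norm; last by apply: Int_ge0 => x; exact: sqr_ge0.
apply: le_trans (Int_le i3 (iblD (iblZ 2 i1) (iblZ 2 i2)) _) _.
 by move=> x; have := sqrD_le (fs n x - f x) (gs n x - g x); rewrite opprD addrACA.
by rewrite IntD; [rewrite !IntZ|exact: iblZ|exact: iblZ].
Qed.

(** The error splits as [z_n (f_n - f) + f (z_n - z)]. In the second term the integrable weight
    [f^2] multiplies a bounded sequence converging in mean, to which [Int_wcvg0] applies. *)
Lemma L2cvgMb fs f (zs : nat -> T -> R) (z : T -> R) (M : R) : L2cvg fs f ->
 (forall n, meas (zs n)) -> meas z ->
 (forall n x, `|zs n x| <= M) -> (forall x, `|z x| <= M) ->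
 (forall n, ibl m (fun x => (zs n x - z x) ^+ 2)) ->
 Int m (fun x => (zs n x - z x) ^+ 2) @[n --> \oo] --> 0 ->
 L2cvg (fun n x => zs n x * fs n x) (fun x => z x * f x).
Proof.
move=> [f1 f2 f3] mzs mz bzs bz iz z0.
have L n : L2fun (fun x => zs n x * fs n x) := L2funZb (mzs n) (bzs n) (f1 n).
have L' : L2fun (fun x => z x * f x) := L2funZb mz bz f2.
split => //; have [mf ff] := f2.
have M0 (x : T) : 0 <= M by apply: le_trans (bz x).
have W : Int m (fun x => `|f x ^+ 2 * (zs n x - z x) ^+ 2|) @[n --> \oo] --> 0.
 apply: (@Int_wcvg0 _ _ _ _ _ _ ((2 * M) ^+ 2)) => //.
  move=> n x; rewrite normrX; apply: lerXn2r; rewrite ?nnegrE ?mulr_ge0// ?(M0 x)//.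
  exact: abs_sub_le2.
 apply: cvg_ext z0 => n.
 by apply: eq_Int => x; rewrite ger0_norm ?sqr_ge0.
have := cvg_add (@cvg_mull _ (2 * M ^+ 2) _ _ f3) (@cvg_mull _ 2 _ _ W); rewrite !mulr0 addr0; apply: cvg0_le => n.
have [_ i1] := L2funB (f1 n) f2; have [_ i3] := L2funB (L n) L'.
have i2 : ibl m (fun x => `|f x ^+ 2 * (zs n x - z x) ^+ 2|).
 apply: ibl_abs; apply: (iblMb (C := (2 * M) ^+ 2) ff).
  by apply: measurable_funX; exact: measurable_funB.
 move=> x; rewrite normrX; apply: lerXn2r; rewrite ?nnegrE ?mulr_ge0// ?(M0 x)//.
 exact: abs_sub_le2.
rewrite ger0_norm; last by apply: Int_ge0 => x; exact: sqr_ge0.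
apply: le_trans (Int_le i3 (iblD (iblZ (2 * M ^+ 2) i1) (iblZ 2 i2)) _) _; last first.
 by rewrite IntD; [rewrite !IntZ|exact: iblZ|exact: iblZ].
move=> x; rewrite (_ : zs n x * fs n x - z x * f x = zs n x * (fs n x - f x) + f x * (zs n x - z x)); last by ring.
apply: le_trans (sqrD_le _ _) _; rewrite exprMn -mulrA; apply: lerD; last first.
 by rewrite exprMn ler_wpM2l// ler_norm.
rewrite ler_wpM2l// ler_wpM2r ?sqr_ge0// -[_ ^+ 2]real_normK ?num_real//.
by apply: lerXn2r; rewrite ?nnegrE ?(M0 x).
Qed.

Lemma L2cvg_bM fs f (c : T -> R) (M : R) : meas c -> (forall x, `|c x| <= M) ->
 L2cvg fs f -> L2cvg (fun n x => c x * fs n x) (fun x => c x * f x).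
Proof.
move=> mc cM hf; apply: (L2cvgMb hf (M := M)) => // [n|].
 by apply: eq_ibl (ibl0 m) => x; rewrite subrr expr0n.
have E : Int m (fun x => (c x - c x) ^+ 2) = 0.
 by rewrite -[RHS](Int0 m); apply: eq_Int => x; rewrite subrr expr0n.
by rewrite E; exact: cvg_cst.
Qed.

End L2_convergence.

Lemma cvg_sum_fin {R : realType} {I : finType} (a : I -> nat -> R) (l : I -> R) :
 (forall i, a i n @[n --> \oo] --> l i) -> \sum_i a i n @[n --> \oo] --> \sum_i l i.
Proof.
move=> h; have h' (s : seq I) : \sum_(i <- s) a i n @[n --> \oo] --> \sum_(i <- s) l i.
 elim: s => [|i s IH]; first by rewrite big_nil; under eq_fun do rewrite big_nil; exact: cvg_cst.
 rewrite big_cons; under eq_fun do rewrite big_cons.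
 by apply: cvg_add.
exact: h'.
Qed.

(** * Approximation in the domain of the local forms *)

Section form_approximation.
Context {R : realType} {d : nat}.
Local Notation Rd := 'rV[R]_d.
Local Notation leb := (lebesgue_rV R d).
Variables (A C : Rd -> 'M[R]_d) (H : Rd -> Rd) (rho : Rd -> R).
Variables (mu : {measure set Rd -> \bar R}) (p : R).
Hypotheses (hA : assumption_a A C H p) (hmu : invariant_density A C H rho mu p).
Implicit Types (x : Rd) (f g u v w psi : Rd -> R) (i j : 'I_d) (V : set Rd).

Let rc := rho_continuous hmu.
Let r0 := rho_gt0 hmu.
Let ac i j : continuous (fun x => A x i j) := A_continuous hA (i:=i) (j:=j).

Lemma ibl_mu f : ibl mu f <-> ibl leb (fun x => f x * rho x).
Proof. exact: ibl_density rc r0 (@mu_density _ _ _ _ _ _ _ _ hmu) f. Qed.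

Lemma Int_mu f : ibl mu f -> Int mu f = Int leb (fun x => f x * rho x).
Proof. exact: Int_density rc r0 (@mu_density _ _ _ _ _ _ _ _ hmu) f. Qed.

Lemma ae_mu (P : Rd -> Prop) : {ae mu, forall x, P x} <-> {ae leb, forall x, P x}.
Proof. exact: ae_density rc r0 (@mu_density _ _ _ _ _ _ _ _ hmu) P. Qed.

Lemma rho_bounds (r : R) : exists c M : R, 0 < c /\ forall x, cube r x -> c <= rho x <= M.
Proof.
have cr := @cube_compact R d r; have rn x : rho x != 0 by rewrite gt_eqF.
have [M _ hM] := compact_fun_bounded cr rc.
have [N N0 hN] := compact_fun_bounded cr (fun_continuousV rc rn).
exists (1 + N)^-1, M; split => [|x cx]; first by rewrite invr_gt0; lra.
rewrite (le_trans (ler_norm _) (hM x cx)) andbT.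
have := hN x cx; rewrite ger0_norm ?invr_ge0; last exact: ltW.
move=> h.
by rewrite -[leRHS]invrK lef_pV2 ?posrE ?invr_gt0//; lra.
Qed.

Lemma relc_cube V : relatively_compact V -> exists2 r : R, 0 < r & V `<=` cube r.
Proof.
move=> /compact_cube[r r0' hr]; exists r => // x Vx; apply: hr; exact: subset_closure.
Qed.

Lemma L2fun_Lfun f : L2fun mu f <-> f \in Lfun mu 2%:E.
Proof.
split=> [[mf f2]|hf]; last by split; [exact: Lfun_meas hf|exact: Lfun2_integrable_sqr].
rewrite inE; apply/andP; split; rewrite inE//= /finite_norm unlock /= poweR_lty//.
rewrite (eq_integral (fun x => (f x ^+ 2)%:E)) ?ibl_integral ?ltry// => x _ /=.
by rewrite powR_mulrn// real_normK ?num_real.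
Qed.

Lemma L2_rho_le V f r c M : V `<=` cube r -> 0 < c -> (forall x, cube r x -> c <= rho x <= M) ->
 (forall x, ~ V x -> f x = 0) -> meas f ->
 (ibl mu (fun x => f x ^+ 2) <-> ibl leb (fun x => f x ^+ 2)) /\
 (ibl leb (fun x => f x ^+ 2) -> c * Int leb (fun x => f x ^+ 2) <= Int mu (fun x => f x ^+ 2) <= M * Int leb (fun x => f x ^+ 2)).
Proof.
move=> Vr c0 hcM f0 mf.
have B x : c * f x ^+ 2 <= f x ^+ 2 * rho x <= M * f x ^+ 2.
 have [Vx|Vx] := pselect (V x); last by rewrite f0// expr0n mul0r !mulr0 lexx.
 have /andP[h1 h2] := hcM x (Vr x Vx); have := sqr_ge0 (f x).
 by move: (f x ^+ 2) => s s0; apply/andP; split; nra.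
have mf2 : meas (fun x => f x ^+ 2) by exact: measurable_funX.
have m2 : meas (fun x => f x ^+ 2 * rho x).
 by apply: measurable_funM => //; exact: fun_measurable.
have E : ibl mu (fun x => f x ^+ 2) <-> ibl leb (fun x => f x ^+ 2).
 rewrite ibl_mu; split => h.
  apply: (@ibl_le _ _ _ _ _ (fun x => c^-1 * (f x ^+ 2 * rho x))) (iblZ _ h) => // x.
  by rewrite ger0_norm ?sqr_ge0// ler_pdivlMl//; have /andP[] := B x.
 apply: (@ibl_le _ _ _ _ _ (fun x => M * f x ^+ 2)) (iblZ _ h) => // x.
 by rewrite ger0_norm; [have /andP[] := B x|rewrite mulr_ge0 ?sqr_ge0// ltW].
split => // h; have h' := (E.2 h); have h'' := (ibl_mu _).1 h'; rewrite (Int_mu h') -!IntZ//.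
by apply/andP; split; apply: Int_le => //; [exact: iblZ|move=> x; have /andP[] := B x|exact: iblZ|move=> x; have /andP[] := B x].
Qed.

Definition Aform f g x := \sum_i \sum_j A x i j * (pderiv j f x * pderiv i g x).
Local Notation qf := Aform.

Lemma qfE f g x : dot (mxapply (A x) (grad f x)) (grad g x) = qf f g x.
Proof.
apply: eq_bigr => i _; rewrite /mxapply !mxE mulr_suml; apply: eq_bigr => j _.
by rewrite !mxE; ring.
Qed.

Lemma qf_bounds r : exists2 nu : R, 0 < nu & forall f x, cube r x ->
 nu^-1 * \sum_i pderiv i f x ^+ 2 <= qf f f x <= nu * \sum_i pderiv i f x ^+ 2.
Proof.
have cr : relatively_compact (cube r : set Rd).
 by rewrite /relatively_compact -(closure_id _).1; [exact: cube_compact|exact: cube_closed].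
have [nu nu0 h] := A_elliptic hA cr; exists nu => // f x cx; have := h (grad f x) x cx.
rewrite qfE /dot (eq_bigr (fun i => pderiv i f x ^+ 2))// => i _.
by rewrite !mxE expr2.
Qed.

Lemma test_ibl_c V f (c : Rd -> R) : continuous c -> test_fun V f -> ibl leb (fun x => c x * f x).
Proof. by move=> cc tf; apply: Lloc_test (lexx _) _ tf; exact: continuous_Lloc. Qed.

Lemma test_L2fun V f : test_fun V f -> L2fun leb f.
Proof.
move=> tf; split; first exact: test_measurable tf.
by have := test_ibl (test_funM tf (test_Coo tf)); apply: eq_ibl => x; rewrite expr2.
Qed.

Lemma qf_test V f g i j : test_fun V f -> test_fun V g ->
 ibl leb (fun x => rho x * A x i j * (pderiv j f x * pderiv i g x)).
Proof.
move=> tf tg; apply: (@test_ibl_c V); first exact: fun_continuousM.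
by apply: test_funM; [exact: test_pderiv|exact: test_Coo (test_pderiv i tg)].
Qed.

Lemma rho_qfE f g x : rho x * qf f g x = \sum_i \sum_j rho x * A x i j * (pderiv j f x * pderiv i g x).
Proof.
rewrite mulr_sumr; apply: eq_bigr => i _; rewrite mulr_sumr; apply: eq_bigr => j _.
by rewrite mulrA.
Qed.

Lemma Int_qf V f g : test_fun V f -> test_fun V g -> ibl leb (fun x => rho x * qf f g x) /\
 Int leb (fun x => rho x * qf f g x) =
 \sum_i \sum_j Int leb (fun x => rho x * A x i j * (pderiv j f x * pderiv i g x)).
Proof.
move=> tf tg; have h i j := qf_test i j tf tg.
have h1 i : ibl leb (fun x => \sum_j rho x * A x i j * (pderiv j f x * pderiv i g x)).
 by apply: ibl_sum => j _; exact: h.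
have h2 : ibl leb (fun x => \sum_i \sum_j rho x * A x i j * (pderiv j f x * pderiv i g x)).
 by apply: ibl_sum => i _; exact: h1.
split; first by apply: eq_ibl h2 => x; rewrite rho_qfE.
apply: etrans (eq_Int _ (rho_qfE f g)) _; apply: etrans (Int_sum _ (fun i _ => h1 i)) _.
by apply: eq_bigr => i _; exact: Int_sum.
Qed.

Lemma pderiv_out V f i x : test_fun V f -> ~ V x -> pderiv i f x = 0.
Proof. by move=> tf Vx; exact: test_out (test_pderiv i tf) Vx. Qed.

Lemma energyE V f g : test_fun V f -> test_fun V g ->
 energy A mu V f g = (2^-1 * Int leb (fun x => rho x * qf f g x))%:E.
Proof.
move=> tf tg; have [h _] := Int_qf tf tg.
have hm : ibl mu (fun x => 2^-1 * qf f g x).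
 by apply/ibl_mu; apply: eq_ibl (iblZ 2^-1 h) => x; ring.
rewrite /energy integral_mkcond (eq_integral (fun x => (2^-1 * qf f g x)%:E)); last first.
 move=> x _; rewrite patchE qfE; case: ifPn => //; rewrite notin_setE => Vx.
 rewrite /Aform big1 ?mulr0// => i _; apply: big1 => j _.
 by rewrite (pderiv_out j tf Vx) mul0r mulr0.
rewrite ibl_integral// Int_mu// -IntZ//; congr EFin; apply: eq_Int => x; ring.
Qed.

Section approximants.
Variables (V : set Rd) (un : nat -> Rd -> R) (u : Rd -> R).
Hypotheses (Vc : relatively_compact V) (hu : form_approx A mu V un u).

Let tu n : test_fun V (un n). Proof. by case: hu. Qed.

Lemma form_approx_L2 : L2cvg leb un u.
Proof.
have [r _ Vr] := relc_cube Vc; have [c [M [c0 hcM]]] := rho_bounds r.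
have [_ [/L2fun_Lfun hL u0] cv _] := hu; have [mu_ u2] := hL.
have un0 n x : ~ V x -> un n x = 0 by exact: test_out.
have k f := @L2_rho_le V f r c M Vr c0 hcM.
have hLl : L2fun leb u by split => //; apply/(k u u0 mu_).1.
have L n := L2funB (test_L2fun (tu n)) hLl.
have d0 n x : ~ V x -> un n x - u x = 0 by move=> Vx; rewrite un0// u0// subrr.
split => //; first by move=> n; exact: test_L2fun (tu n).
have hm n := (k _ (d0 n) (L n).1).
have := (Lpcvg2 (fun n => (hm n).1.2 (L n).2) (fun n => (L n).1)).1 cv.
move=> /(@cvg_mull _ c^-1 _ 0); rewrite mulr0; apply: cvg0_le => n.
rewrite ger0_norm ?ler_pdivlMl//; last by apply: Int_ge0 => x; exact: sqr_ge0.
by have [_ /(_ (L n).2)/andP[]] := hm n.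
Qed.

(** Ellipticity bounds differences of gradients by energies, so the gradients are Cauchy in mean
    square. Integration by parts identifies the limit as a weak derivative of [u], hence as
    [wpderiv i u] almost everywhere. *)
Lemma form_approx_grad i : L2cvg leb (fun n => pderiv i (un n)) (wpderiv i u).
Proof.
have [r _ Vr] := relc_cube Vc; have [c [M [c0 hcM]]] := rho_bounds r.
have [nu nu0 hnu] := qf_bounds r; have [_ _ _ cau] := hu.
have td n : test_fun V (pderiv i (un n)) := test_pderiv i (tu n).
have Lu := form_approx_L2; have [_ uL _] := Lu.
have [g [mg g2 cg]] : exists g, [/\ meas g, ibl leb (fun x => g x ^+ 2) &
  Int leb (fun x => (pderiv i (un n) x - g x) ^+ 2) @[n --> \oo] --> 0].
 apply: L2_complete; [by move=> n; exact: (test_L2fun (td n)).1|by move=> n; exact: (test_L2fun (td n)).2|].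
 move=> e e0; have e1 : 0 < e * c / (2 * nu) by rewrite divr_gt0 ?mulr_gt0.
 have [N hN] := cau _ e1; exists N => a b Na Nb; have := hN a b Na Nb.
 have tab : test_fun V (un a \- un b) by exact: test_funB.
 rewrite (energyE tab tab) lte_fin; have [hq _] := Int_qf tab tab.
 have i1 : ibl leb (fun x => (pderiv i (un a) x - pderiv i (un b) x) ^+ 2).
  exact: (L2funB (test_L2fun (td a)) (test_L2fun (td b))).2.
 have : Int leb (fun x => (pderiv i (un a) x - pderiv i (un b) x) ^+ 2) <=
   (nu / c) * Int leb (fun x => rho x * qf (un a \- un b) (un a \- un b) x).
  rewrite -IntZ//; apply: Int_le => //; first exact: iblZ.
  move=> x; rewrite -pderivB; [|exact: test_Coo (tu _)|exact: test_Coo (tu _)].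
  have [Vx|Vx] := pselect (V x); last first.
   rewrite (pderiv_out i tab Vx) expr0n /Aform big1 ?mulr0// => k _; apply: big1 => l _.
   by rewrite (pderiv_out l tab Vx) mul0r mulr0.
  have /andP[h1 _] := hnu (un a \- un b) x (Vr x Vx); have /andP[h2 _] := hcM x (Vr x Vx).
  have h3 : pderiv i (un a \- un b) x ^+ 2 <= \sum_k pderiv k (un a \- un b) x ^+ 2.
   by rewrite (bigD1 i)//= lerDl; apply: sumr_ge0 => k _; exact: sqr_ge0.
  have h4 : 0 <= pderiv i (un a \- un b) x ^+ 2 by exact: sqr_ge0.
  rewrite mulrAC ler_pdivlMr// mulrC; rewrite ler_pdivrMl// in h1.
  by move: h1 h2 h3 h4; move: (qf _ _ _) (pderiv _ _ _ ^+ 2) (\sum_k _) (rho x) => q s t y; nra.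
 move=> h1 h2; apply: le_lt_trans h1 _; rewrite mulrAC ltr_pdivrMr// mulrC -ltr_pdivlMr//.
 by move: h2; rewrite ltr_pdivlMr ?mulr_gt0// ltr_pdivlMr//; lra.
have Lg : L2cvg leb (fun n => pderiv i (un n)) g by split => // n; exact: test_L2fun (td n).
have LL f : L2fun leb f -> Lloc 1 f.
 move=> [mf f2]; apply: powloc_Lloc1; apply: (@powloc1 _ _ 2) => //; split => // K cK.
 have h : ibl leb (fun x => f x ^+ 2 * \1_K x).
  by apply: (iblMb (C := 1) f2) => [|x]; [apply: indic_meas; exact: compact_measurable_rV|exact: indic_le1].
 by apply: eq_ibl h => x; rewrite real_normK ?num_real.
have wg : weak_pderiv i u g.
 apply: weak_pderivI; [exact: LL|exact: LL|] => phi tp.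
 have l1 := L2cvg_Int Lu (test_L2fun (test_pderiv i tp)).
 have l2 := L2cvg_Int Lg (test_L2fun tp).
 apply: cvg_uniq l1 _; apply: cvg_ext (cvgN l2) => n /=.
 have cun := test_Coo (tu n).
 exact: esym (Int_byparts i tp cun).
have [Lw _ ae] := wpderivP (LL g (conj mg g2)) wg (LL u uL).
by apply: L2cvg_ae ae Lg; case: Lw.
Qed.

End approximants.

Lemma cutoff_weight r (c : Rd -> R) : 0 < r -> continuous c ->
 exists2 M, meas (fun x => c x * cutoff r x) & forall x, `|c x * cutoff r x| <= M.
Proof.
move=> rp cc; have cX : continuous (fun x => c x * cutoff r x).
 by apply: fun_continuousM => //; apply: Coo_continuous; exact: cutoff_Coo.
have [_ [M hM]] := @ibl_compact R d (fun x => c x * cutoff r x) (2 * r) cX (fun x nx => etrans (congr1 ( *%R (c x)) (cutoff_out rp nx)) (mulr0 _)).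
by exists M => //; exact: fun_measurable.
Qed.

Lemma energy_cvg V un u vn v : relatively_compact V -> form_approx A mu V un u ->
 form_approx A mu V vn v -> exists l : R, forall un' vn', form_approx A mu V un' u ->
 form_approx A mu V vn' v ->
 2^-1 * Int leb (fun x => rho x * qf (un' n) (vn' n) x) @[n --> \oo] --> l.
Proof.
move=> Vc _ _; have [r rp Vr] := relc_cube Vc.
(* Written with the weak gradients of [u] and [v], the limit is the same for all approximating
   sequences. The cutoff equals 1 on [V] and makes the coefficients bounded. *)
exists (2^-1 * \sum_i \sum_j Int leb (fun x => (rho x * A x i j * cutoff r x * wpderiv j u x) * wpderiv i v x)).
move=> un' vn' hu hv; apply: cvg_mull.
have tu n : test_fun V (un' n) by case: hu. have tv n : test_fun V (vn' n) by case: hv.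
have L i j : Int leb (fun x => rho x * A x i j * (pderiv j (un' n) x * pderiv i (vn' n) x)) @[n --> \oo]
  --> Int leb (fun x => (rho x * A x i j * cutoff r x * wpderiv j u x) * wpderiv i v x).
 have [M mX hM] := cutoff_weight rp (fun_continuousM rc (@ac i j)).
 have := L2cvg_IntM (L2cvg_bM mX hM (form_approx_grad Vc hu j)) (form_approx_grad Vc hv i).
 apply: cvg_ext => n; apply: eq_Int => x; have [Vx|Vx] := pselect (V x).
  by rewrite cutoff_in//; [ring|exact: Vr].
 by rewrite (pderiv_out j (tu n) Vx); ring.
apply: cvg_ext (cvg_sum_fin (fun i => cvg_sum_fin (fun j => L i j))) => n.
by apply: esym; have [_] := Int_qf (tu n) (tv n).
Qed.

(** [form_val] speaks of some pair of approximating sequences; by [energy_cvg] its value is reached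
    along every other pair. *)
Lemma form_val_cvg V un u vn v (s : R) : relatively_compact V -> form_approx A mu V un u ->
 form_approx A mu V vn v -> form_val A mu V u v s%:E ->
 2^-1 * Int leb (fun x => rho x * qf (un n) (vn n) x) @[n --> \oo] --> s.
Proof.
move=> Vc hu hv [un' [vn' [hu' hv' /fine_cvgP[_ h]]]].
have [l hl] := energy_cvg Vc hu hv; have l1 := hl _ _ hu hv; have l2 := hl _ _ hu' hv'.
suff -> : s = l by [].
apply: cvg_uniq l2; apply: cvg_ext h => n /=.
by rewrite energyE//; [case: hu'|case: hv'].
Qed.

End form_approximation.

(** * Nonlinear profiles *)

Section profiles_and_L2.
Context {R : realType}.

(** The equation for [u] is tested with [f1(u) psi]. The bounds and Lipschitz conditions make
    [f1(u_n) psi] and its gradient converge in mean square whenever [u_n] and its gradient do. *)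
Record profile (f0 f1 f2 : R -> R) (L : R) : Prop := Profile {
 pf_smooth0 : smooth f0; pf_smooth1 : smooth f1; pf_smooth2 : smooth f2;
 pf_derive0 : forall s : R, is_derive s 1 f0 (f1 s);
 pf_derive1 : forall s : R, is_derive s 1 f1 (f2 s);
 pf_bound1 : forall s, `|f1 s| <= L;
 pf_bound2 : forall s, `|f2 s| <= L;
 pf_lip0 : forall s t, `|f0 s - f0 t| <= L * `|s - t|;
 pf_lip1 : forall s t, `|f1 s - f1 t| <= L * `|s - t|;
 pf_lip2 : forall s t, `|f2 s - f2 t| <= L * `|s - t| }.

Context {dsp} {T : measurableType dsp}.
Variable m : {measure set T -> \bar R}.

Lemma L2cvg_cst (f : T -> R) : L2fun m f -> L2cvg m (fun _ => f) f.
Proof.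
move=> hf; split => //; apply: cvg_ext (cvg_cst 0) => n /=.
by rewrite -[LHS](Int0 m); apply: eq_Int => x; rewrite subrr expr0n.
Qed.

Lemma L2cvg_comp (fs us : nat -> T -> R) (f u : T -> R) (g : R -> R) (L : R) :
 continuous g -> (forall s, `|g s| <= L) -> (forall s t, `|g s - g t| <= L * `|s - t|) ->
 L2cvg m us u -> L2cvg m fs f ->
 L2cvg m (fun n x => g (us n x) * fs n x) (fun x => g (u x) * f x).
Proof.
move=> cg gL lip [u1 u2 u3] hf.
have mg (h : T -> R) : meas h -> meas (fun x => g (h x)).
 by move=> mh; apply: (@measurableT_comp _ _ _ _ _ _ g) => //; exact: continuous_measurable_fun.
have B n x : (g (us n x) - g (u x)) ^+ 2 <= L ^+ 2 * (us n x - u x) ^+ 2.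
 rewrite -[leLHS]real_normK ?num_real// -[X in _ * X]real_normK ?num_real// -exprMn.
 by apply: lerXn2r; rewrite ?nnegrE// (le_trans _ (lip _ _)).
have mu1 n : meas (fun x => g (us n x) - g (u x)).
 by apply: measurable_funB; apply: mg; [have [] := u1 n|have [] := u2].
have i1 n : ibl m (fun x => (g (us n x) - g (u x)) ^+ 2).
 have [_ i] := L2funB (u1 n) u2.
 apply: ibl_le (iblZ (L ^+ 2) i) => [|x]; first exact: measurable_funX.
 by rewrite ger0_norm ?sqr_ge0.
apply: (L2cvgMb hf (M := L)) => //.
- by move=> n; apply: mg; have [] := u1 n.
- by apply: mg; have [] := u2.
have := @cvg_mull _ (L ^+ 2) _ _ u3; rewrite mulr0; apply: cvg0_le => n.
rewrite ger0_norm; last by apply: Int_ge0 => x; exact: sqr_ge0.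
have [_ i] := L2funB (u1 n) u2; rewrite -IntZ//; apply: Int_le => //; exact: iblZ.
Qed.

End profiles_and_L2.

(** * The integrated equation for local operators *)

Section local_identity.
Context {R : realType} {d : nat}.
Local Notation Rd := 'rV[R]_d.
Local Notation leb := (lebesgue_rV R d).
Variables (A C : Rd -> 'M[R]_d) (H : Rd -> Rd) (rho : Rd -> R).
Variables (mu : {measure set Rd -> \bar R}) (p : R).
Hypotheses (d2 : (2 <= d)%N) (dp : d%:R < p).
Hypotheses (hA : assumption_a A C H p) (hmu : invariant_density A C H rho mu p).
Implicit Types (x : Rd) (f g u v w psi : Rd -> R) (i j : 'I_d) (V : set Rd).

Let rc := rho_continuous hmu.
Let r0 := rho_gt0 hmu.
Let ac i j : continuous (fun x => A x i j) := A_continuous hA (i:=i) (j:=j).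
Let cc i j : continuous (fun x => C x i j) := C_continuous hA (i:=i) (j:=j).
Local Notation qf := (Aform A).
Local Notation flux := (flux A C H rho).

Definition qC f g x := \sum_i \sum_j C x j i * (pderiv i f x * pderiv j g x).

(** Formally the [mu]-integral of [L f] times [f1(f) psi] after all integrations by parts, with
    [f0], [f1], [f2] successive derivatives. No derivative of a coefficient occurs, and [flux]
    multiplies [f0(f)] rather than the gradient of [f]. *)
Definition Jform (f0 f1 f2 : R -> R) psi f :=
 - (2^-1 * Int leb (fun x => rho x * (f2 (f x) * psi x * qf f f x)))
 - 2^-1 * Int leb (fun x => rho x * (f1 (f x) * qf f psi x))
 - Int leb (fun x => f0 (f x) * \sum_i flux i x * pderiv i psi x)
 - 2^-1 * Int leb (fun x => rho x * (f1 (f x) * qC f psi x)).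

Lemma ibl_qf_weight (t : 'I_d -> 'I_d -> Rd -> R) (c : 'I_d -> 'I_d -> Rd -> R) :
 (forall i j, continuous (c i j)) -> (forall i j, testT (t i j)) ->
 ibl leb (fun x => rho x * \sum_i \sum_j c i j x * t i j x).
Proof.
move=> ccc tt; have h i j : ibl leb (fun x => rho x * c i j x * t i j x).
 by apply: (test_ibl_c _ (tt i j)); exact: fun_continuousM.
have h2 : ibl leb (fun x => \sum_i \sum_j rho x * c i j x * t i j x).
 by apply: ibl_sum => i _; apply: ibl_sum => j _; exact: h.
apply: eq_ibl h2 => x; rewrite mulr_sumr; apply: eq_bigr => i _; rewrite mulr_sumr.
by apply: eq_bigr => j _; rewrite mulrA.
Qed.

Lemma ibl_qf t f g : testT t -> Coo f -> Coo g -> ibl leb (fun x => rho x * (t x * qf f g x)).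
Proof.
move=> tt cf cg.
have h := @ibl_qf_weight (fun i j x => t x * (pderiv j f x * pderiv i g x)) (fun i j x => A x i j).
apply: eq_ibl (h _ _) => [x|i j|i j].
- congr (_ * _); rewrite mulr_sumr; apply: eq_bigr => i _; rewrite mulr_sumr.
 by apply: eq_bigr => j _; ring.
- exact: ac.
- by apply: test_funM => //; apply: CooM; exact: Coo_pderiv.
Qed.

Lemma ibl_qC t f psi : Coo t -> Coo f -> testT psi -> ibl leb (fun x => rho x * (t x * qC f psi x)).
Proof.
move=> ct cf tp.
have h := @ibl_qf_weight (fun i j x => t x * (pderiv i f x * pderiv j psi x)) (fun i j x => C x j i).
apply: eq_ibl (h _ _) => [x|i j|i j].
- congr (_ * _); rewrite mulr_sumr; apply: eq_bigr => i _; rewrite mulr_sumr.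
 by apply: eq_bigr => j _; ring.
- exact: cc.
- by apply: test_funMr => //; apply: test_funMr; [exact: test_pderiv|exact: Coo_pderiv].
Qed.

Lemma ibl_qf1 t f psi : Coo t -> Coo f -> testT psi -> ibl leb (fun x => rho x * (t x * qf f psi x)).
Proof.
move=> ct cf tp.
have h := @ibl_qf_weight (fun i j x => t x * (pderiv j f x * pderiv i psi x)) (fun i j x => A x i j).
apply: eq_ibl (h _ _) => [x|i j|i j].
- congr (_ * _); rewrite mulr_sumr; apply: eq_bigr => i _; rewrite mulr_sumr.
 by apply: eq_bigr => j _; ring.
- exact: ac.
- by apply: test_funMr => //; apply: test_funMr; [exact: test_pderiv|exact: Coo_pderiv].
Qed.

Lemma Jform_algebra (h a b c e : R) : - (h * a) - h * b - c - h * e = - (h * (a + b)) + (- c - h * e).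
Proof. by ring. Qed.

Section with_profile.
Variables (f0 f1 f2 : R -> R) (L : R).
Hypothesis pf : profile f0 f1 f2 L.

Let L0 : 0 <= L. Proof. exact: le_trans (normr_ge0 _) (pf_bound1 pf 0). Qed.

Lemma pderiv_profile_test f psi i x : Coo f -> Coo psi ->
 pderiv i (fun y => f1 (f y) * psi y) x = psi x * (f2 (f x) * pderiv i f x) + f1 (f x) * pderiv i psi x.
Proof.
move=> cf cp; have c1 := Coo_comp (pf_smooth1 pf) cf.
by rewrite pderivM// (pderiv_comp _ _ (pf_derive1 pf) cf) addrC.
Qed.

Lemma JformE f psi : Coo f -> testT psi ->
 Jform f0 f1 f2 psi f = - (2^-1 * Int leb (fun x => rho x * qf f (fun y => f1 (f y) * psi y) x))
 + Int leb (fun x => \sum_i Bfield A C H rho x ord0 i * rho x * (f1 (f x) * pderiv i f x * psi x)).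
Proof.
move=> cf tp; have cp := test_Coo tp.
have c1 := Coo_comp (pf_smooth1 pf) cf; have c2 := Coo_comp (pf_smooth2 pf) cf.
have cF := Coo_comp (pf_smooth0 pf) cf.
have B := Bfield_by_parts d2 dp hA hmu cF tp.
have dF i x : pderiv i (fun y => f0 (f y)) x = f1 (f x) * pderiv i f x.
 by rewrite (pderiv_comp _ _ (pf_derive0 pf) cf).
have B' : Int leb (fun x => \sum_i Bfield A C H rho x ord0 i * rho x * (f1 (f x) * pderiv i f x * psi x)) =
  - Int leb (fun x => f0 (f x) * \sum_i flux i x * pderiv i psi x)
  - 2^-1 * Int leb (fun x => rho x * (f1 (f x) * qC f psi x)).
 apply: etrans (etrans _ B) _.
  by apply: eq_Int => x; apply: eq_bigr => i _; rewrite dF.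
 congr (_ - _ * _); apply: eq_Int => x; congr (_ * _); rewrite mulr_sumr; apply: eq_bigr => i _.
 by rewrite mulr_sumr; apply: eq_bigr => j _; rewrite dF; ring.
have i1 : ibl leb (fun x => rho x * (f2 (f x) * psi x * qf f f x)).
 by apply: (ibl_qf (t := fun x => f2 (f x) * psi x)) => //; exact: test_funMr.
have i2 : ibl leb (fun x => rho x * (f1 (f x) * qf f psi x)) by exact: ibl_qf1.
rewrite B' /Jform; have -> : Int leb (fun x => rho x * qf f (fun y => f1 (f y) * psi y) x) =
 Int leb (fun x => rho x * (f2 (f x) * psi x * qf f f x)) + Int leb (fun x => rho x * (f1 (f x) * qf f psi x)).
 apply: etrans (etrans _ (IntD i1 i2)) (erefl _); apply: eq_Int => x; rewrite -mulrDr; congr (_ * _).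
 rewrite /Aform !mulr_sumr -big_split /=; apply: eq_bigr => i _; rewrite !mulr_sumr -big_split /=.
 by apply: eq_bigr => j _; rewrite pderiv_profile_test//; ring.
exact: Jform_algebra.
Qed.

(** Makes [f1(u) psi] admissible in the form on [V]. Support inside [V] comes from [psi], or else
    from [f1 0 = 0], which lets [f1(u_n)] vanish with [u_n]. The energies are Cauchy because the
    chain rule expresses the gradients by bounded Lipschitz functions of [u_n]. *)
Lemma profile_approx V un u psi : relatively_compact V -> form_approx A mu V un u ->
 testT psi -> test_fun V psi \/ f1 0 = 0 ->
 form_approx A mu V (fun n x => f1 (un n x) * psi x) (fun x => f1 (u x) * psi x).
Proof.
move=> Vc hu tp adm; have cp := test_Coo tp.
have [r rp Vr] := relc_cube Vc; have [c [M [c0 hcM]]] := rho_bounds hmu r.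
have [nu nu0 hnu] := qf_bounds hA r.
have [tu [hLu u0] _ _] := hu; have Lu := form_approx_L2 hmu Vc hu.
have [Mp Mp0 hMp] := test_bounded tp.
have c1 := smooth_continuous (pf_smooth1 pf); have c2 := smooth_continuous (pf_smooth2 pf).
have tv n : test_fun V (fun x => f1 (un n x) * psi x).
 have cu := test_Coo (tu n).
 case: adm => h; first by apply: test_funMr => //; exact: Coo_comp (pf_smooth1 pf) cu.
 apply: test_funM => //; exact: test_comp (pf_smooth1 pf) h.
have v0 x : ~ V x -> f1 (u x) * psi x = 0.
 by move=> Vx; case: adm => h; [rewrite (test_out h Vx) mulr0|rewrite u0// h mul0r].
have cv : L2cvg leb (fun n x => f1 (un n x) * psi x) (fun x => f1 (u x) * psi x).
 exact: (L2cvg_comp c1 (pf_bound1 pf) (pf_lip1 pf) Lu (L2cvg_cst (test_L2fun tp))).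
have [cv1 cv2 cv3] := cv; have d0 n x : ~ V x -> f1 (un n x) * psi x - f1 (u x) * psi x = 0.
 by move=> Vx; rewrite (test_out (tv n) Vx) v0// subr0.
have Ln n := L2funB (cv1 n) cv2; have k n := L2_rho_le hmu Vr c0 hcM (d0 n) (Ln n).1.
split => //.
- split => //; apply/L2fun_Lfun; have [mv iv] := cv2; split => //.
 by apply/(L2_rho_le hmu Vr c0 hcM v0 mv).1.
- apply/Lpcvg2; [by move=> n; exact/(k n).1/(Ln n).2|by move=> n; exact: (Ln n).1|].
 have := @cvg_mull _ M _ _ cv3; rewrite mulr0; apply: cvg0_le => n.
 rewrite ger0_norm; last by apply: Int_ge0 => x; exact: sqr_ge0.
 by have [_ /(_ (Ln n).2)/andP[]] := k n.
move=> eps e0.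
have cd i : L2cvg leb (fun n => pderiv i (fun y => f1 (un n y) * psi y))
  (fun x => psi x * (f2 (u x) * wpderiv i u x) + f1 (u x) * pderiv i psi x).
 have h1 := L2cvg_comp c2 (pf_bound2 pf) (pf_lip2 pf) Lu (form_approx_grad hA hmu Vc hu i).
 have h2 := L2cvg_bM (test_measurable tp) hMp h1.
 have h3 := L2cvg_comp c1 (pf_bound1 pf) (pf_lip1 pf) Lu (L2cvg_cst (test_L2fun (test_pderiv i tp))).
 have := L2cvgD h2 h3; congr (L2cvg _ _ _); apply/funext => n; apply/funext => x.
 by rewrite pderiv_profile_test//; exact: test_Coo (tu n).
have k0 : 0 <= 2^-1 * (M * nu).
 have /hcM/andP[h1 h2] : cube r (0 : Rd) by move=> i; rewrite mxE normr0 ltW.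
 by rewrite !mulr_ge0 ?(ltW nu0)//; move: (rho _) h1 h2 => s h1 h2; lra.
(* The 1 in the denominator leaves a full [e1] to spare, which makes the final inequality strict. *)
set e1 := eps / (1 + 2^-1 * (M * nu) * d%:R).
have kd : 0 <= 2^-1 * (M * nu) * d%:R by rewrite mulr_ge0.
have K0 : 0 < 1 + 2^-1 * (M * nu) * d%:R by lra.
have ec : 0 < e1 by rewrite divr_gt0.
have /choice[N hN] i : exists N, forall a b, (N <= a)%N -> (N <= b)%N ->
 Int leb (fun x => (pderiv i (fun y => f1 (un a y) * psi y) x - pderiv i (fun y => f1 (un b y) * psi y) x) ^+ 2) < e1.
 by have [N hN] := L2cvg_cauchy (cd i) ec; exists N.
exists (\max_i N i)%N => a b Na Nb.
set f := (fun x => f1 (un a x) * psi x) \- (fun x => f1 (un b x) * psi x).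
have tf : test_fun V f by exact: test_funB.
have [iq _] := Int_qf hA hmu tf tf; rewrite (energyE hA hmu tf tf) lte_fin.
have i2 i : ibl leb (fun x => pderiv i f x ^+ 2) := (test_L2fun (test_pderiv i tf)).2.
have is2 : ibl leb (fun x => \sum_i pderiv i f x ^+ 2) by apply: ibl_sum => i _; exact: i2.
have h1 : Int leb (fun x => rho x * qf f f x) <= (M * nu) * \sum_i Int leb (fun x => pderiv i f x ^+ 2).
 have E := Int_sum (P := xpredT) (index_enum 'I_d) (fun i _ => i2 i).
 rewrite -E -IntZ//; apply: Int_le => //; first exact: iblZ.
 move=> x; have [Vx|Vx] := pselect (V x); last first.
  rewrite /Aform !big1 ?mulr0// => i _; first by rewrite (pderiv_out i tf Vx) expr0n.
  by apply: big1 => j _; rewrite (pderiv_out j tf Vx) mul0r mulr0.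
 have /andP[h1 h2] := hnu f x (Vr x Vx); have /andP[h3 h4] := hcM x (Vr x Vx).
 have s0 : 0 <= \sum_i pderiv i f x ^+ 2 by apply: sumr_ge0 => i _; exact: sqr_ge0.
 have q0 : 0 <= qf f f x by apply: le_trans h1; rewrite mulr_ge0// invr_ge0 ltW.
 rewrite -mulrA; apply: ler_pM => //; exact: ltW.
have h2 : \sum_i Int leb (fun x => pderiv i f x ^+ 2) <= d%:R * e1.
 apply: le_trans (_ : \sum_(i < d) e1 <= _); last by rewrite sumr_const card_ord mulr_natl.
 apply: ler_sum => i _; apply: ltW; apply: le_lt_trans (hN i a b _ _).
 - apply: eq_ler; apply: eq_Int => x.
  by rewrite pderivB//; exact: test_Coo (tv _).
 - by apply: leq_trans Na; exact: leq_bigmax.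
 - by apply: leq_trans Nb; exact: leq_bigmax.
have h3 : eps = e1 + 2^-1 * (M * nu) * d%:R * e1 by rewrite -[X in X + _]mul1r -mulrDl mulrC /e1 divfK// gt_eqF.
rewrite {1}h3; apply: le_lt_trans (_ : 2^-1 * (M * nu) * d%:R * e1 < _); last by rewrite ltrDr.
apply: le_trans (ler_wpM2l _ h1) _; first by rewrite invr_ge0.
by rewrite mulrA -[leRHS]mulrA; exact: ler_wpM2l.
Qed.

End with_profile.

(** The form value is pinned by [form_val_cvg], and the gradient in the drift term is a mean-square
    limit. The left-hand side is kept along the test functions [un], so that later chain rules and
    integrations by parts act on smooth functions. *)
Lemma local_identity V u w : relatively_compact V -> local_op A C H rho mu V u w ->
 exists un, [/\ forall n, test_fun V (un n), L2cvg leb un u &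
  forall (f0 f1 f2 : R -> R) (L : R) psi, profile f0 f1 f2 L -> testT psi ->
   test_fun V psi \/ f1 0 = 0 ->
   Jform f0 f1 f2 psi (un n) @[n --> \oo] --> Int mu (fun x => w x * (f1 (u x) * psi x))].
Proof.
move=> Vc [w0 [[[un hu] [/L2fun_Lfun hw0 w00] hform] _ [/Lfun1P hw w_out] hB]].
have [tu [_ u0] _ _] := hu; have Lu := form_approx_L2 hmu Vc hu.
have Lg i := form_approx_grad hA hmu Vc hu i.
exists un; split => // f0 f1 f2 L psi pf tp adm.
have hv := profile_approx pf Vc hu tp adm.
have cp := test_Coo tp; have [Mp Mp0 hMp] := test_bounded tp.
have [v vE] : {v | forall x, v x = f1 (u x) * psi x} by exists (fun x => f1 (u x) * psi x).
rewrite -(funext vE) in hv.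
have [_ [/L2fun_Lfun hLv v0] _ _] := hv.
have c1 := smooth_continuous (pf_smooth1 pf).
have mu1 : meas (fun x => f1 (u x)).
 apply: (@measurableT_comp _ _ _ _ _ _ f1); first exact: continuous_measurable_fun.
 by have [_ []] := Lu.
have [mv _] := hLv; have [mw0 _] := hw0.
have bv x : `|v x| <= L * Mp by rewrite vE normrM ler_pM// (pf_bound1 pf).
have iw : ibl mu (fun x => w x * v x) by exact: iblMb hw mv bv.
have iw0 : ibl mu (fun x => w0 x * v x) by have [? ?] := hw0; have [? ?] := hLv; exact: iblM2.
have F : form_val A mu V u v (- Int mu (fun x => w0 x * v x))%:E.
 have hdv : form_dom A mu V v by eexists; exact: hv.
 have := hform v hdv; congr (form_val _ _ _ _ _ _).
 rewrite integral_mkcond EFinN -ibl_integral//; congr (- _)%E.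
 apply: eq_integral => x _; rewrite patchE; case: ifPn => //; rewrite notin_setE => Vx.
 by rewrite w00// mul0r.
have k1 := form_val_cvg hA hmu Vc hu hv F.
have mB i : meas (fun x => Bfield A C H rho x ord0 i * rho x).
 exact: powloc_meas (Bfield_powloc d2 dp hA hmu i).
(* [rho B] is locally square integrable and [psi] has compact support, so convergence of the
   gradients in mean square suffices in the drift term. *)
have LB i : L2fun leb (fun x => Bfield A C H rho x ord0 i * rho x * psi x).
 have [_ hb] := Bfield_powloc d2 dp hA hmu i.
 split; first by apply: measurable_funM => //; exact: test_measurable tp.
 have [_ kp _] := tp.
 have h := hb _ kp; have mp2 : meas (fun x => psi x ^+ 2).
  by apply: measurable_funX; exact: test_measurable tp.
 have bp x : `|psi x ^+ 2| <= Mp ^+ 2 by rewrite normrX; apply: lerXn2r; rewrite ?nnegrE.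
 apply: eq_ibl (iblMb h mp2 bp) => x; rewrite exprMn real_normK ?num_real//.
 have [sx|sx] := pselect (support psi x); first by rewrite indicE_in// mulr1.
 by rewrite (supportP sx) expr0n !mulr0.
have k2 : Int leb (fun x => \sum_i Bfield A C H rho x ord0 i * rho x * (f1 (un n x) * pderiv i (un n) x * psi x))
  @[n --> \oo] --> \sum_i Int leb (fun x => f1 (u x) * wpderiv i u x * (Bfield A C H rho x ord0 i * rho x * psi x)).
 have h i := L2cvg_Int (L2cvg_comp c1 (pf_bound1 pf) (pf_lip1 pf) Lu (Lg i)) (LB i).
 apply: cvg_ext (cvg_sum_fin h) => n.
 have hi i : ibl leb (fun x => f1 (un n x) * pderiv i (un n) x * (Bfield A C H rho x ord0 i * rho x * psi x)).
  have [LBm LB2] := LB i.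
  have t1 : test_fun V (fun x => f1 (un n x) * pderiv i (un n) x).
   apply: test_funMr (test_pderiv i (tu n)) _; apply: Coo_comp (pf_smooth1 pf) _; exact: test_Coo (tu n).
  by have [? ?] := test_L2fun t1; exact: iblM2.
 apply: etrans (esym (Int_sum (P := xpredT) (index_enum 'I_d) (fun i _ => hi i))) _.
 by apply: eq_Int => x; apply: eq_bigr => i _; ring.
have hi i : ibl leb (fun x => f1 (u x) * wpderiv i u x * (Bfield A C H rho x ord0 i * rho x * psi x)).
 have [_ hh _] := L2cvg_comp c1 (pf_bound1 pf) (pf_lip1 pf) Lu (Lg i).
 by have [? ?] := hh; have [? ?] := LB i; exact: iblM2.
have k3 : Int mu (fun x => w x * v x) = Int mu (fun x => w0 x * v x) +
  \sum_i Int leb (fun x => f1 (u x) * wpderiv i u x * (Bfield A C H rho x ord0 i * rho x * psi x)).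
 have iw0l := (ibl_mu hmu _).1 iw0; have iwl := (ibl_mu hmu _).1 iw.
 have iS : ibl leb (fun x => \sum_i f1 (u x) * wpderiv i u x * (Bfield A C H rho x ord0 i * rho x * psi x)).
  by apply: ibl_sum => i _; exact: hi.
 rewrite (Int_mu hmu iw) (Int_mu hmu iw0).
 have e1 := Int_sum (P := xpredT) (index_enum 'I_d) (fun i _ => hi i).
 apply: etrans _ (congr1 (fun s => _ + s) e1); apply: etrans _ (IntD iw0l iS).
 apply: ae_eq_Int; [exact: ibl_meas iwl|exact: ibl_meas (iblD iw0l iS)|].
 move/(ae_mu hmu) : hB; apply: filterS => x hx; have [Vx|Vx] := pselect (V x); last first.
  rewrite v0// !mulr0 !mul0r add0r big1// => i _.
  by case: adm => h; [rewrite (test_out h Vx)|rewrite u0// h]; ring.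
 rewrite hx// !mulrDl; congr (_ + _); rewrite /dot !mulr_suml; apply: eq_bigr => i _.
 by rewrite vE /wgrad !mxE; ring.
have -> : Int mu (fun x => w x * (f1 (u x) * psi x)) = Int mu (fun x => w x * v x).
 by apply: eq_Int => x; rewrite vE.
rewrite k3 -[X in _ --> X + _]opprK; apply: cvg_ext (cvg_add (cvgN k1) k2) => n /=.
rewrite (JformE pf (test_Coo (tu n)) tp); congr (- (_ * _) + _).
Qed.

End local_identity.

Lemma small_pos {R : realType} (a b : R) : 0 < a -> 0 < b -> exists t : R, [/\ 0 < t, t < a & t < b].
Proof.
move=> a0 b0; have m0 : 0 < Num.min a b by rewrite lt_min a0.
have : Num.min a b / 2 < Num.min a b by rewrite ltr_pdivrMr// ltr_pMr// ltr1n.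
by rewrite lt_min => /andP[h1 h2]; exists (Num.min a b / 2); split => //; rewrite divr_gt0.
Qed.

(** The pointwise inequality behind [gen_unique]: [p], [q], [r] are values of [u], [v], [w], while
    [b] and [c] are values of [S t u] and [S t v], and [a] is the value of [S t |u - v|], which
    dominates their difference. *)
Lemma dissip_real {R : realType} (t a b c p q r : R) : 0 < t -> b - c <= a -> c - b <= a ->
 (1 + t) * `|p - q| <= `|a| + t * `| `|t^-1 * (b - p) - r| + `|t^-1 * (c - q) - (q - (p - r))| |.
Proof.
move=> t0 q1 q2; rewrite [X in _ + _ * X]ger0_norm ?addr_ge0// mulrDr.
have E s : t * `|s| = `|t * s| by rewrite normrM gtr0_norm.
rewrite !E; have -> : t * (t^-1 * (b - p) - r) = b - p - t * r by field; rewrite gt_eqF.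
have -> : t * (t^-1 * (c - q) - (q - (p - r))) = c - q - t * (q - p + r) by field; rewrite gt_eqF.
have n0 := ler_norm a.
have n1 := ler_norm (b - p - t * r); have n2 := ler_norm (c - q - t * (q - p + r)).
have n3 := ler_norm (- (b - p - t * r)); have n4 := ler_norm (- (c - q - t * (q - p + r))).
rewrite !normrN in n3 n4.
have [pq|pq] := leP 0 (p - q); [rewrite (ger0_norm pq)|rewrite (ltr0_norm pq)]; nra.
Qed.

(** For [gen_bounds]: [v] solves the resolvent equation with right-hand side [f], [b] is a value of
    [S t v], and [a] is that of [S t] applied to the negative part of [v]. *)
Lemma dissip_lower {R : realType} (t a b v f : R) : 0 < t -> - b <= a -> 0 <= f -> 0 <= a ->
 (1 + t) * Num.max (- v) 0 <= `|a| + t * `|t^-1 * (b - v) - (v - f)|.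
Proof.
move=> t0 ba f0 a0; have E s : t * `|s| = `|t * s| by rewrite normrM gtr0_norm.
rewrite E; have -> : t * (t^-1 * (b - v) - (v - f)) = b - v - t * (v - f) by field; rewrite gt_eqF.
have n1 := ler_norm (b - v - t * (v - f)); have n0 := normr_ge0 (b - v - t * (v - f)).
have tf : 0 <= t * f by rewrite mulr_ge0// ltW.
by rewrite (ger0_norm a0) /Num.max; case: ltP => h; lra.
Qed.

(** Here [a] comes from [S t] applied to the excess of [v] over 1, so that [b - a] comes from a
    function with values in [0, 1]. *)
Lemma dissip_upper {R : realType} (t a b v f : R) : 0 < t -> b - a <= 1 -> f <= 1 -> 0 <= a ->
 (1 + t) * Num.max (v - 1) 0 <= `|a| + t * `|t^-1 * (b - v) - (v - f)|.
Proof.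
move=> t0 ba f0 a0; have E s : t * `|s| = `|t * s| by rewrite normrM gtr0_norm.
rewrite E; have -> : t * (t^-1 * (b - v) - (v - f)) = b - v - t * (v - f) by field; rewrite gt_eqF.
have := ler_norm (- (b - v - t * (v - f))); rewrite normrN => n1.
have n0 := normr_ge0 (b - v - t * (v - f)).
have tf : 0 <= t * (1 - f) by rewrite mulr_ge0 ?subr_ge0// ltW.
by rewrite (ger0_norm a0) /Num.max; case: ltP => h; lra.
Qed.

(** * Semigroups on L^1: positivity, generator and resolvent equation *)

Section semigroup_facts.
Context {R : realType} {d : nat}.
Local Notation Rd := 'rV[R]_d.
Variables (mu : {measure set Rd -> \bar R}) (S : R -> (Rd -> R) -> Rd -> R).
Hypothesis hS : submarkov_C0_contraction mu setT S.
Implicit Types (f g u v w : Rd -> R) (s t : R).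

Lemma Lp_onT f : Lp_on mu 1%:E setT f <-> ibl mu f.
Proof. by split=> [[/Lfun1P]//|/Lfun1P h]; split => // x /(_ I). Qed.

Lemma Lpnorm_right_eps (F : R -> Rd -> R) : (forall t, 0 < t -> ibl mu (F t)) ->
 Lpnorm mu 1%:E (F t) @[t --> 0^'+] --> 0%E ->
 forall e : R, 0 < e -> exists2 dl : R, 0 < dl &
  forall t, 0 < t -> t < dl -> Int mu (fun x => `|F t x|) < e.
Proof.
move=> iF /fine_cvgP[_ /cvgrPdist_lt h] e e0; have := h e e0.
move=> /nbhs_ballP[dl dl0 hdl]; exists dl => // t t0 tdl.
have /hdl /(_ t0) : ball (0 : R) dl t by rewrite /ball /= sub0r normrN gtr0_norm.
rewrite /= (Lpnorm1 (iF t t0)) /= sub0r normrN; apply: le_lt_trans; exact: ler_norm.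
Qed.

Lemma sgL1 t f : 0 < t -> ibl mu f -> ibl mu (S t f).
Proof. by move=> t0 /Lp_onT/(sg_L1 hS t0)/Lp_onT. Qed.

Lemma sg_norm t f : 0 < t -> ibl mu f -> Int mu (fun x => `|S t f x|) <= Int mu (fun x => `|f x|).
Proof.
move=> t0 hf; have := sg_contraction hS t0 ((Lp_onT f).2 hf).
by rewrite !Lpnorm1// ?lee_fin//; exact: sgL1.
Qed.

Lemma sg_aD t (a : R) f g : 0 < t -> ibl mu f -> ibl mu g ->
 {ae mu, forall x, S t (fun y => a * f y + g y) x = a * S t f x + S t g x}.
Proof. by move=> t0 /Lp_onT hf /Lp_onT hg; exact: (sg_linear hS). Qed.

Lemma Int0_ae f : ibl mu f -> Int mu (fun x => `|f x|) <= 0 -> {ae mu, forall x, f x = 0}.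
Proof.
move=> hf h; have : {ae mu, forall x, `|f x| = 0}.
 apply: Int_eq0 => //; first exact: ibl_abs.
 by apply/eqP; rewrite eq_le h Int_ge0.
by apply: filterS => x /eqP; rewrite normr_eq0 => /eqP.
Qed.

Lemma ae_Int0 f : meas f -> {ae mu, forall x, f x = 0} -> Int mu (fun x => `|f x|) = 0.
Proof.
move=> mf h; rewrite -[RHS](Int0 mu); apply: ae_eq_Int => //; first exact: measurableT_comp.
by apply: filterS h => x ->; rewrite normr0.
Qed.

Lemma sg0 t f : 0 < t -> ibl mu f -> {ae mu, forall x, f x = 0} -> {ae mu, forall x, S t f x = 0}.
Proof.
move=> t0 hf f0; apply: Int0_ae; first exact: sgL1.
by apply: le_trans (sg_norm t0 hf) _; rewrite (ae_Int0 (ibl_meas hf) f0).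
Qed.

Lemma sg_B t f g : 0 < t -> ibl mu f -> ibl mu g ->
 {ae mu, forall x, S t (fun y => f y - g y) x = S t f x - S t g x}.
Proof.
move=> t0 hf hg; have := sg_aD (-1) t0 hg hf.
rewrite (_ : (fun y => -1 * g y + f y) = fun y => f y - g y).
 by apply: filterS => x ->; rewrite mulN1r addrC.
by apply/funext => y; rewrite mulN1r addrC.
Qed.

(** [S t] acts on functions rather than on classes; contractivity makes it respect equality almost
    everywhere. *)
Lemma sg_ext t f g : 0 < t -> ibl mu f -> ibl mu g -> {ae mu, forall x, f x = g x} ->
 {ae mu, forall x, S t f x = S t g x}.
Proof.
move=> t0 hf hg fg; have h0 : {ae mu, forall x, f x - g x = 0}.
 by apply: filterS fg => x ->; rewrite subrr.
have := sg0 t0 (iblB hf hg) h0; apply: filterS2 (sg_B t0 hf hg) => x -> /eqP.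
by rewrite subr_eq0 => /eqP.
Qed.

Lemma sg_Z t (a : R) f : 0 < t -> ibl mu f -> {ae mu, forall x, S t (fun y => a * f y) x = a * S t f x}.
Proof.
move=> t0 hf; have z := sg0 t0 (ibl0 mu) (aeW _ (fun x => erefl 0)).
have := sg_aD a t0 hf (ibl0 mu); rewrite (_ : (fun y => a * f y + 0) = fun y => a * f y).
 by apply: filterS2 z => x -> ->; rewrite addr0.
by apply/funext => y; rewrite addr0.
Qed.

Lemma ae_lim_ge0 (fs : nat -> Rd -> R) f : (forall n, ibl mu (fs n)) -> ibl mu f ->
 (forall n, {ae mu, forall x, 0 <= fs n x}) ->
 Int mu (fun x => `|fs n x - f x|) @[n --> \oo] --> 0 -> {ae mu, forall x, 0 <= f x}.
Proof.
move=> ifs hf pos cv; pose g x := Num.max (- f x) 0.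
have mg : meas g by apply: measurable_maxr => //; exact: measurable_funN (ibl_meas hf).
have ig : ibl mu g.
 apply: ibl_le (ibl_abs hf) => // x; rewrite /g ger0_norm ?le_max ?lexx ?orbT//.
 by rewrite ge_max normr_ge0 andbT -normrN ler_norm.
have g0 x : 0 <= g x by rewrite /g le_max lexx orbT.
have h n : Int mu g <= Int mu (fun x => `|fs n x - f x|).
 apply: ae_le_Int => //; first by apply: ibl_abs; exact: iblB.
 apply: filterS (pos n) => x p; rewrite /g ge_max normr_ge0 andbT.
 by apply: le_trans (ler_norm _); rewrite lerDr.
have G0 : Int mu g <= 0 by exact: cvg_ge_cst h cv.
have : {ae mu, forall x, g x = 0} by apply: Int_eq0 => //; apply/eqP; rewrite eq_le G0 Int_ge0.
apply: filterS => x /eqP; rewrite /g eq_le => /andP[].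
by rewrite ge_max => /andP[]; rewrite oppr_le0.
Qed.

Lemma sg_Int_cvg t (fs : nat -> Rd -> R) f : 0 < t -> (forall n, ibl mu (fs n)) -> ibl mu f ->
 Int mu (fun x => `|fs n x - f x|) @[n --> \oo] --> 0 ->
 Int mu (fun x => `|S t (fs n) x - S t f x|) @[n --> \oo] --> 0.
Proof.
move=> t0 ifs hf; apply: cvg0_le => n; rewrite ger0_norm; last exact: Int_ge0.
apply: le_trans (sg_norm t0 (iblB (ifs n) hf)).
apply: eq_ler; apply: ae_eq_Int.
- by apply: measurableT_comp => //; exact: ibl_meas (iblB (sgL1 t0 (ifs n)) (sgL1 t0 hf)).
- by apply: measurableT_comp => //; exact: ibl_meas (sgL1 t0 (iblB (ifs n) hf)).
- by apply: filterS (sg_B t0 (ifs n) hf) => x ->.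
Qed.

Lemma trunc_cvg f : ibl mu f -> (forall x, 0 <= f x) ->
 (forall n, ibl mu (fun x => Num.min (f x) n%:R)) /\
 Int mu (fun x => `|Num.min (f x) n%:R - f x|) @[n --> \oo] --> 0.
Proof.
move=> hf f0; have mf := ibl_meas hf.
have mn n : meas (fun x => Num.min (f x) n%:R) by exact: measurable_minr.
have b n x : 0 <= Num.min (f x) n%:R <= f x by rewrite le_min f0 ler0n ge_min lexx.
split=> [n|]; first by apply: ibl_le hf => // x; have /andP[b1 b2] := b n x; rewrite ger0_norm.
rewrite -[X in _ --> X](Int0 mu); apply: (@Int_dom _ _ _ _ _ _ f) => //.
- by move=> n; apply: measurableT_comp => //; exact: measurable_funB.
- apply: aeW => x; apply: cvg0P => e e0; exists (Num.bound (f x)) => n hn.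
 rewrite min_l ?subrr ?normr0// (le_trans (ltW (archi_boundP (f0 x))))// ler_nat//.
- move=> n x; rewrite normr_id distrC ger0_norm ?subr_ge0; last by have /andP[] := b n x.
 by have /andP[b1 b2] := b n x; rewrite lerBlDr lerDl.
Qed.

(** The sub-Markov property concerns functions with values in [0, 1]. Truncation and scaling reach
    bounded functions, and continuity in mean reaches all integrable ones. *)
Lemma sg_ge0 t f : 0 < t -> ibl mu f -> {ae mu, forall x, 0 <= f x} -> {ae mu, forall x, 0 <= S t f x}.
Proof.
move=> t0 hf f0; pose g x := `|f x|; have ig : ibl mu g by exact: ibl_abs.
have fg : {ae mu, forall x, f x = g x} by apply: filterS f0 => x h; rewrite /g ger0_norm.
suff h : {ae mu, forall x, 0 <= S t g x} by apply: filterS2 (sg_ext t0 hf ig fg) h => x ->.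
have [i1 cv] := trunc_cvg ig (fun x => normr_ge0 (f x)).
apply: (ae_lim_ge0 _ (sgL1 t0 ig) _ (sg_Int_cvg t0 i1 ig cv)) => n; first exact: sgL1.
(* Dividing by [n + 1] instead of [n] also covers [n = 0]. *)
pose h x := (n.+1%:R)^-1 * Num.min (g x) n%:R.
have ih : ibl mu h by exact: iblZ.
have hb : {ae mu, forall x, 0 <= h x <= 1}.
 apply: aeW => x; rewrite /h; have m0 : 0 <= Num.min (g x) n%:R by rewrite le_min normr_ge0 ler0n.
 rewrite mulr_ge0 ?invr_ge0//= ler_pdivrMl ?ltr0n// mulr1.
 by apply: le_trans (_ : n%:R <= _); [rewrite ge_min lexx orbT|rewrite ler_nat].
have [_ _ _ _ _ sm] := hS; have := sm t h t0 ((Lp_onT h).2 ih) hb.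
apply: filterS2 (sg_Z (n.+1%:R)^-1 t0 (i1 n)) => x /= -> /andP[+ _].
by rewrite pmulr_rge0// invr_gt0 ltr0n.
Qed.

Lemma sg_le t f g : 0 < t -> ibl mu f -> ibl mu g -> {ae mu, forall x, f x <= g x} ->
 {ae mu, forall x, S t f x <= S t g x}.
Proof.
move=> t0 hf hg fg; have := sg_ge0 t0 (iblB hg hf) _.
have h : {ae mu, forall x, 0 <= g x - f x} by apply: filterS fg => x; rewrite subr_ge0.
by move=> /(_ h); apply: filterS2 (sg_B t0 hg hf) => x ->; rewrite subr_ge0.
Qed.

Lemma sg_le1 t f : 0 < t -> ibl mu f -> {ae mu, forall x, 0 <= f x <= 1} -> {ae mu, forall x, 0 <= S t f x <= 1}.
Proof. by move=> t0 /Lp_onT hf h; have [_ _ _ _ _ sm] := hS; exact: sm. Qed.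

Lemma sg_cont0 f (e : R) : ibl mu f -> 0 < e -> exists2 dl : R, 0 < dl &
 forall t, 0 < t -> t < dl -> Int mu (fun x => `|S t f x - f x|) < e.
Proof.
move=> hf; apply: (@Lpnorm_right_eps (fun t => S t f \- f)).
 by move=> t t0; apply: iblB => //; exact: sgL1.
by apply: (sg_C0 hS); exact/Lp_onT.
Qed.

Lemma gen_eps u w : generator mu setT S u w -> [/\ ibl mu u, ibl mu w &
 forall e : R, 0 < e -> exists2 dl : R, 0 < dl &
 forall t, 0 < t -> t < dl -> Int mu (fun x => `|t^-1 * (S t u x - u x) - w x|) < e].
Proof.
move=> [/Lp_onT hu /Lp_onT hw h]; split => //.
apply: (@Lpnorm_right_eps (fun t x => t^-1 * (S t u x - u x) - w x)) => // t t0.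
by apply: iblB => //; apply: iblZ; apply: iblB => //; exact: sgL1.
Qed.

Lemma genI u w : ibl mu u -> ibl mu w -> (forall e : R, 0 < e -> exists2 dl : R, 0 < dl &
 forall t, 0 < t -> t < dl -> Int mu (fun x => `|t^-1 * (S t u x - u x) - w x|) < e) ->
 generator mu setT S u w.
Proof.
move=> hu hw h; split; [exact/Lp_onT|exact/Lp_onT|].
have it t : 0 < t -> ibl mu (fun x => t^-1 * (S t u x - u x) - w x).
 by move=> t0; apply: iblB => //; apply: iblZ; apply: iblB => //; exact: sgL1.
apply/fine_cvgP; split.
 apply: filterS (nbhs_right_gt 0) => t t0; rewrite Lpnorm1//; exact: it.
apply/cvgrPdist_lt => e e0; have [dl dl0 hdl] := h e e0.
apply: filterS2 (nbhs_right_gt 0) (nbhs_right_lt dl0) => t t0 tdl.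
rewrite /= Lpnorm1; last exact: it.
by rewrite /= sub0r normrN ger0_norm ?hdl// Int_ge0.
Qed.

(** [S t] commutes with the difference quotients up to null sets and contracts their error. *)
Lemma gen_sg u w t : 0 < t -> generator mu setT S u w -> generator mu setT S (S t u) (S t w).
Proof.
move=> t0 /gen_eps[hu hw h]; apply: genI; [exact: sgL1|exact: sgL1|] => e e0.
have [dl dl0 hdl] := h e e0; exists dl => // s s0 sdl.
have i1 : ibl mu (fun x => S s u x - u x) by apply: iblB => //; exact: sgL1.
have i2 : ibl mu (fun x => s^-1 * (S s u x - u x)) by exact: iblZ.
have i3 := iblB i2 hw; have iSt := sgL1 t0 hu; have iSs := sgL1 s0 hu.
apply: le_lt_trans (hdl s s0 sdl); apply: le_trans (sg_norm t0 i3).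
apply: eq_ler; apply: ae_eq_Int.
- apply: measurableT_comp => //; apply: ibl_meas (iblB (iblZ s^-1 (iblB (sgL1 s0 iSt) iSt)) (sgL1 t0 hw)).
- by apply: measurableT_comp => //; exact: ibl_meas (sgL1 t0 i3).
have a1 := sg_add hS s0 t0 ((Lp_onT u).2 hu); have a2 := sg_add hS t0 s0 ((Lp_onT u).2 hu).
have b1 := sg_B t0 i2 hw; have b2 := sg_Z s^-1 t0 i1; have b3 := sg_B t0 iSs hu.
near=> x; congr `|_|.
have -> : S s (S t u) x = S t (S s u) x.
 have <- : S (s + t) u x = S s (S t u) x by near: x.
 by rewrite addrC; near: x.
have -> : S t (fun x => s^-1 * (S s u x - u x) - w x) x =
  S t (fun x => s^-1 * (S s u x - u x)) x - S t w x by near: x.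
have -> : S t (fun x => s^-1 * (S s u x - u x)) x = s^-1 * S t (fun x => S s u x - u x) x by near: x.
by have -> : S t (fun x => S s u x - u x) x = S t (S s u) x - S t u x by near: x.
Unshelve. all: by end_near.
Qed.

(* The resolvent equation makes [(1 + t) g] dominated by [S t g] up to [o(t)],
  which contractivity only allows for [g = 0]. *)
Lemma gen_dissip g : ibl mu g -> (forall x, 0 <= g x) ->
 (forall e : R, 0 < e -> exists (t : R) r, [/\ 0 < t, ibl mu r, Int mu (fun x => `|r x|) < e &
   {ae mu, forall x, (1 + t) * g x <= `|S t g x| + t * `|r x|}]) ->
 {ae mu, forall x, g x = 0}.
Proof.
move=> ig g0 h; apply: Int_eq0 => //; apply/eqP; rewrite eq_le Int_ge0// andbT.
rewrite leNgt; apply/negP => gp; have [t [r [t0 ir hr ae]]] := h _ gp.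
have ig' : Int mu (fun x => `|g x|) = Int mu g by apply: eq_Int => x; rewrite ger0_norm.
have := ae_le_Int (iblZ (1 + t) ig) (iblD (ibl_abs (sgL1 t0 ig)) (iblZ t (ibl_abs ir))) ae.
rewrite IntD; [|exact: ibl_abs (sgL1 t0 ig)|exact: iblZ (ibl_abs ir)].
rewrite !IntZ//; last exact: ibl_abs.
move=> h1; have h2 := sg_norm t0 ig; rewrite ig' in h2.
by move: hr h1 h2; move: (Int _ _) (Int _ _) (Int _ _) => a b c; nra.
Qed.

(** Both [u] and [v] solve the resolvent equation with right-hand side [u - w], and dissipativity
    forces [|u - v|] to vanish. In this way a domain element is recognised as a value of the
    resolvent, the one object known to be a limit of local ones. *)
Lemma gen_unique u w v : generator mu setT S u w -> generator mu setT S v (fun x => v x - (u x - w x)) ->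
 {ae mu, forall x, u x = v x}.
Proof.
move=> /gen_eps[hu hw eu] /gen_eps[hv hv' ev].
have iD := iblB hu hv; have ia := ibl_abs iD.
suff : {ae mu, forall x, `|u x - v x| = 0}.
 by apply: filterS => x /eqP; rewrite normr_eq0 subr_eq0 => /eqP.
apply: gen_dissip => // e e0.
have e2 : 0 < e / 2 by rewrite divr_gt0.
have [d1 d10 h1] := eu _ e2; have [d3 d30 h3] := ev _ e2.
have [t [t0 td1 td3]] := small_pos d10 d30.
have iu : ibl mu (fun x => t^-1 * (S t u x - u x) - w x).
 by apply: iblB => //; apply: iblZ; apply: iblB => //; exact: sgL1.
have iv : ibl mu (fun x => t^-1 * (S t v x - v x) - (v x - (u x - w x))).
 by apply: iblB => //; apply: iblZ; apply: iblB => //; exact: sgL1.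
exists t, (fun x => `|t^-1 * (S t u x - u x) - w x| + `|t^-1 * (S t v x - v x) - (v x - (u x - w x))|).
split => //; first by apply: iblD; exact: ibl_abs.
 have -> : Int mu (fun x => `| `|t^-1 * (S t u x - u x) - w x| + `|t^-1 * (S t v x - v x) - (v x - (u x - w x))| |) =
  Int mu (fun x => `|t^-1 * (S t u x - u x) - w x| + `|t^-1 * (S t v x - v x) - (v x - (u x - w x))|).
  by apply: eq_Int => x; rewrite ger0_norm// addr_ge0.
 rewrite IntD; [|exact: ibl_abs|exact: ibl_abs].
 by have := h1 t t0 td1; have := h3 t t0 td3; move: (Int _ _) (Int _ _) => a b; lra.
have B := sg_B t0 hu hv.
have P1 : {ae mu, forall x, u x - v x <= `|u x - v x|} by apply: aeW => x; exact: ler_norm.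
have P2 : {ae mu, forall x, v x - u x <= `|u x - v x|} by apply: aeW => x; rewrite distrC ler_norm.
have Q1 := sg_le t0 iD ia P1; have Q2 := sg_le t0 (iblB hv hu) ia P2; have B' := sg_B t0 hv hu.
near=> x.
have b1 : S t (fun y => u y - v y) x = S t u x - S t v x by near: x.
have b2 : S t (fun y => v y - u y) x = S t v x - S t u x by near: x.
have q1 : S t (fun y => u y - v y) x <= S t (fun y => `|u y - v y|) x by near: x.
have q2 : S t (fun y => v y - u y) x <= S t (fun y => `|u y - v y|) x by near: x.
by rewrite b1 in q1; rewrite b2 in q2; exact: dissip_real.
Unshelve. all: by end_near.
Qed.

(** The resolvent is given by its equation only, so its sub-Markov property comes from [gen_dissip],
    applied to the negative part of [v] and to its excess over 1. *)
Lemma gen_bounds f v : ibl mu f -> {ae mu, forall x, 0 <= f x <= 1} ->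
 generator mu setT S v (fun x => v x - f x) -> {ae mu, forall x, 0 <= v x <= 1}.
Proof.
move=> hf f01 /gen_eps[hv hv' ev]; have mv := ibl_meas hv.
have mp (c : R) (h : Rd -> R) : meas h -> meas (fun x => Num.max (h x) c).
 by move=> mh; exact: measurable_maxr.
have it t : 0 < t -> ibl mu (fun x => t^-1 * (S t v x - v x) - (v x - f x)).
 by move=> t0; apply: iblB => //; apply: iblZ; apply: iblB => //; exact: sgL1.
pose g x := Num.max (- v x) 0; have g0 x : 0 <= g x by rewrite /g le_max lexx orbT.
have ig : ibl mu g.
 apply: ibl_le (ibl_abs hv) => [|x]; first by apply: mp; exact: measurable_funN.
 by rewrite ger0_norm// /g ge_max normr_ge0 andbT -normrN ler_norm.
have vg : {ae mu, forall x, g x = 0}.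
 apply: gen_dissip => // e e0; have [dl dl0 hdl] := ev _ e0.
 have [t [t0 tdl _]] := small_pos dl0 dl0.
 exists t, (fun x => t^-1 * (S t v x - v x) - (v x - f x)); split => //; [exact: it|exact: hdl|].
 have P : {ae mu, forall x, - 1 * v x <= g x}.
  by apply: aeW => x; rewrite mulN1r /g le_max lexx.
 have Q := sg_le t0 (iblZ (-1) hv) ig P; have Q' := sg_ge0 t0 ig (aeW _ g0).
 near=> x; have q : S t (fun y => -1 * v y) x <= S t g x by near: x.
 have qz : S t (fun y => -1 * v y) x = -1 * S t v x by near: x; exact: sg_Z.
 have /andP[f0 _] : 0 <= f x <= 1 by near: x.
 have q0 : 0 <= S t g x by near: x.
 rewrite qz mulN1r in q; exact: dissip_lower.
pose k x := Num.max (v x - 1) 0; have k0 x : 0 <= k x by rewrite /k le_max lexx orbT.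
have v0 : {ae mu, forall x, 0 <= v x}.
 apply: filterS vg => x /eqP; rewrite /g eq_le => /andP[].
 by rewrite ge_max => /andP[]; rewrite oppr_le0.
have kv x : k x <= `|v x|.
 by rewrite /k ge_max normr_ge0 andbT; apply: le_trans (ler_norm _); rewrite lerBlDr lerDl.
have mk : meas k by apply: mp; exact: measurable_funB.
have ik : ibl mu k by apply: ibl_le (ibl_abs hv) => // x; rewrite ger0_norm.
have kz : {ae mu, forall x, k x = 0}.
 apply: gen_dissip => // e e0; have [dl dl0 hdl] := ev _ e0.
 have [t [t0 tdl _]] := small_pos dl0 dl0.
 exists t, (fun x => t^-1 * (S t v x - v x) - (v x - f x)); split => //; [exact: it|exact: hdl|].
 have ivk := iblB hv ik.
 have P : {ae mu, forall x, 0 <= v x - k x <= 1}.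
  apply: filterS v0 => x h; rewrite /k /Num.max; case: ltP => h'; last by apply/andP; split; lra.
  by apply/andP; split; lra.
 have Q := sg_le1 t0 ivk P; have B := sg_B t0 hv ik; have Q' := sg_ge0 t0 ik (aeW _ k0).
 near=> x; have /andP[_ q] : 0 <= S t (fun y => v y - k y) x <= 1 by near: x.
 have qb : S t (fun y => v y - k y) x = S t v x - S t k x by near: x.
 have /andP[_ f1] : 0 <= f x <= 1 by near: x.
 have q0 : 0 <= S t k x by near: x.
 rewrite qb in q; exact: dissip_upper.
apply: filterS2 v0 kz => x h1 /eqP; rewrite /k eq_le => /andP[].
by rewrite ge_max => /andP[]; rewrite subr_le0 h1.
Unshelve. all: by end_near.
Qed.

End semigroup_facts.

(** * The penalty function as a profile *)

Section trap_profile.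
Context {R : realType}.

Lemma lip_of_derive (f f' : R -> R) (L : R) : (forall s : R, is_derive s 1 f (f' s)) ->
 (forall s, `|f' s| <= L) -> forall s t, `|f s - f t| <= L * `|s - t|.
Proof.
move=> df fL; have cf := is_derive_continuous df.
have h s t : s < t -> `|f t - f s| <= L * `|t - s|.
 move=> st; have [|c _ ->] := @MVT R f f' s t st (fun x _ => df x).
  by apply: continuous_subspaceT => x; exact: cf.
 by rewrite normrM ler_wpM2r.
move=> s t; have [st|st|->] := ltgtP s t; last by rewrite !subrr normr0 mulr0.
- by rewrite distrC [X in _ * X]distrC; exact: h.
- exact: h.
Qed.

Lemma flat_Xn n (s : R) : 0 <= flat ('X^(n.+1) : {poly R}) s <= (n.+1)`!%:R.
Proof.
rewrite /flat; case: ifPn => [s0|_]; last by rewrite lexx ler0n.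
rewrite !hornerE expRN; have y0 : 0 <= s^-1 by rewrite invr_ge0 ltW.
rewrite divr_ge0 ?expR_ge0 ?exprn_ge0//= ler_pdivrMr ?expR_gt0//.
have h := expR_ge1Dxn n y0.
have {}h : s^-1 ^+ n.+1 / (n.+1)`!%:R <= expR s^-1 by apply: le_trans h; rewrite lerDr.
by rewrite mulrC -ler_pdivrMr ?ltr0n ?fact_gt0.
Qed.

Lemma flatE p (s : R) : flat p s = p.[s^-1] * flat 1 s.
Proof. by rewrite /flat; case: ifPn => _; rewrite ?mulr0// -polyC1 hornerC mul1r. Qed.

Lemma ramp2_derive : exists2 r3 : R -> R, (forall s : R, is_derive s 1 ramp2 (r3 s)) &
 forall s, `|r3 s| <= 200.
Proof.
exists (flat ('X^2 * ('X^3 - ('X^3)^`()))) => [s|s]; first exact: flat_derive.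
have -> : flat ('X^2 * ('X^3 - ('X^3)^`())) s = flat 'X^5 s - 3 * flat 'X^4 s.
 rewrite (flatE (_ * _) s) (flatE 'X^5 s) (flatE 'X^4 s) derivXn hornerM hornerD hornerN hornerMn !hornerXn -[_ *+ 3]mulr_natl /=.
 by move: (flat 1 s) (s^-1) => a b; ring.
(* The two [flat] terms lie between 0 and 5! = 120 and between 0 and 4! = 24, which keeps the
   combination within 200. *)
have := flat_Xn 4 s; have := flat_Xn 3 s.
rewrite (_ : 5`!%:R = 120 :> R) 1?(_ : 4`!%:R = 24 :> R)// => /andP[a b] /andP[c e].
by rewrite ler_norml; apply/andP; split; lra.
Qed.

Lemma trap_lip2 : exists L, forall s t : R, `|trap2 s - trap2 t| <= L * `|s - t|.
Proof.
have [r3 d3 b3] := ramp2_derive; have lip := lip_of_derive d3 b3.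
exists 400 => s t; rewrite /trap2.
have h1 := lip (s - 1) (t - 1); have h2 := lip (- s) (- t).
have e1 : s - 1 - (t - 1) = s - t by ring.
have e2 : `|- s - - t| = `|s - t| by rewrite -normrN; congr `|_|; ring.
rewrite e1 in h1; rewrite e2 in h2.
by rewrite opprD addrACA; apply: le_trans (ler_normD _ _) _; lra.
Qed.

Lemma trap_profile : exists L, profile trap trap1 trap2 (L : R).
Proof.
have [L3 l3] := @trap_lip2.
pose L := Num.max 12 L3; have L12 : 12 <= L by rewrite /L le_max lexx.
have b1 s : `|trap1 s| <= 12 :> R by apply: le_trans (trap1_le s) _; lra.
have b2 s : `|trap2 s| <= 12 :> R by rewrite ger0_norm ?trap2_ge0 ?trap2_le.
have up (f : R -> R) l : l <= L -> (forall s t, `|f s - f t| <= l * `|s - t|) -> forall s t, `|f s - f t| <= L * `|s - t|.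
 by move=> lL h s t; apply: le_trans (h s t) _; rewrite ler_wpM2r.
have s1 : smooth (@trap1 R).
 move=> k; exact: (S1B (S1_comp (@smooth_ramp1 R k) (S1B (S1_id k) (S1_cst k 1))) (S1_comp (@smooth_ramp1 R k) (S1N (S1_id k)))).
exists L; split => //.
- exact: smooth_trap.
- exact: smooth_trap2.
- exact: is_derive_trap.
- exact: is_derive_trap1.
- by move=> s; apply: le_trans (b1 s) L12.
- by move=> s; apply: le_trans (b2 s) L12.
- exact: up L12 (lip_of_derive is_derive_trap b1).
- exact: up L12 (lip_of_derive is_derive_trap1 b2).
- by apply: up l3; rewrite /L le_max lexx orbT.
Qed.

End trap_profile.

(** * Profiles for Caccioppoli estimates *)

Section modified_profiles.
Context {R : realType}.

(* [h1 ^+ 2 <= f2] is needed on [0, 1] only: off this interval [trap2] is positive, and its energy along the approximants of [gen_test_approx] tends to zero. *)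
Record mprofile (f0 f1 f2 h h1 m : R -> R) (L c : R) : Prop := MProfile {
 mp_profile : profile f0 f1 f2 L;
 mp_bound0 : forall s, `|f0 s| <= L;
 mp_smooth : smooth h; mp_smooth1 : smooth h1; mp_cont : continuous m;
 mp_derive : forall s : R, is_derive s 1 h (h1 s);
 mp_f1 : forall s, f1 s = m s * h1 s;
 mp_c : 0 <= c;
 mp_slack : forall s, h1 s ^+ 2 <= f2 s + c * trap2 s;
 mp_hb : forall s, `|h s| <= L; mp_hl : forall s t, `|h s - h t| <= L * `|s - t|;
 mp_mb : forall s, `|m s| <= L; mp_ml : forall s t, `|m s - m t| <= L * `|s - t| }.

Lemma bilin_bound {n : nat} (K : R) (a : 'I_n -> 'I_n -> R) (v g : 'I_n -> R) :
 (forall i j, `|a i j| <= K) ->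
 `|\sum_i \sum_j a i j * (v j * g i)| <= K * ((\sum_j `|v j|) * (\sum_i `|g i|)).
Proof.
move=> aK; apply: le_trans (ler_norm_sum _ _ _) _.
rewrite [X in _ * X]mulrC mulr_suml mulr_sumr; apply: ler_sum => i _.
apply: le_trans (ler_norm_sum _ _ _) _; rewrite !mulr_sumr; apply: ler_sum => j _.
by rewrite !normrM [`|v j| * _]mulrC ler_wpM2r ?mulr_ge0.
Qed.

(* Young's inequality with the weight that lets the gradient part be absorbed
  by a quarter of the energy. *)
Lemma young_absorb (n : nat) (nu K M r m h e v P q : R) : (0 < n)%N -> 0 < nu -> 0 <= K -> 0 <= M -> 0 <= r ->
 0 <= e -> v ^+ 2 <= n%:R * P -> P <= nu * q ->
 r * (`|m * h| * (K * (v * (e * M)))) <= 4^-1 * (r * (h ^+ 2 * e ^+ 2 * q)) + (n%:R * nu * K ^+ 2) * (M ^+ 2 * (r * m ^+ 2)).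
Proof.
move=> n0 nu0 K0 M0 r0 e0 vP Pq.
have nn : 0 < n%:R :> R by rewrite ltr0n.
have dl0 : 0 < n%:R * nu by rewrite mulr_gt0.
have vq : v ^+ 2 <= (n%:R * nu) * q.
 by apply: le_trans vP _; rewrite -mulrA ler_wpM2l// ltW.
have vq' : (n%:R * nu)^-1 * v ^+ 2 <= q by rewrite ler_pdivrMl.
have -> : 4^-1 * (r * (h ^+ 2 * e ^+ 2 * q)) + n%:R * nu * K ^+ 2 * (M ^+ 2 * (r * m ^+ 2)) =
 r * (4^-1 * (h ^+ 2 * e ^+ 2) * q + n%:R * nu * (K * M * m) ^+ 2) by ring.
rewrite ler_wpM2l//; apply: le_trans (_ : 4^-1 * (h ^+ 2 * e ^+ 2) * ((n%:R * nu)^-1 * v ^+ 2) + n%:R * nu * (K * M * m) ^+ 2 <= _); last first.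
 by rewrite lerD2r ler_wpM2l// mulr_ge0// mulr_ge0// sqr_ge0.
have -> : `|m * h| * (K * (v * (e * M))) = (`|h| * e * v) * (K * M * `|m|) by rewrite normrM; ring.
have -> : h ^+ 2 = `|h| ^+ 2 by rewrite real_normK ?num_real.
have -> : (K * M * m) ^+ 2 = (K * M * `|m|) ^+ 2 by rewrite !exprMn real_normK ?num_real.
move: (K * M * `|m|) (`|h|) => y a; move: (n%:R * nu) dl0 => D D0.
have h0 := sqr_ge0 (a * e * v - 2 * D * y).
have Dn : D != 0 by rewrite gt_eqF.
have {}h0 : 0 <= D^-1 * (a * e * v - 2 * D * y) ^+ 2 by rewrite mulr_ge0// invr_ge0 ltW.
have E : D^-1 * (a * e * v - 2 * D * y) ^+ 2 =
  4 * (4^-1 * (a ^+ 2 * e ^+ 2) * (D^-1 * v ^+ 2) + D * y ^+ 2) - 4 * (a * e * v * y) by field.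
by rewrite E in h0; lra.
Qed.

Lemma slack_real (a1 a2 a3 a4 : R) : 0 <= a3 -> a3 <= 1 -> 0 <= a4 -> a1 <= a2 + a4 ->
 a1 * a3 <= a2 * a3 + a4.
Proof. by move=> h0 h1 h4 h; nra. Qed.

Lemma cross_bound (r f b1 b2 K D v e : R) : 0 <= r ->
 `|b1| <= K * (v * (D * (2 * e))) -> `|b2| <= K * (v * (D * (2 * e))) ->
 - (2^-1 * (r * (f * b1))) - 2^-1 * (r * (f * b2)) <= r * (`|f| * (2 * K * D * (v * e))).
Proof.
move=> r0 h1 h2; rewrite (_ : _ - _ = r * (f * (- 2^-1 * (b1 + b2)))); last by ring.
rewrite ler_wpM2l//; apply: le_trans (ler_norm _) _; rewrite normrM ler_wpM2l// normrM normrN.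
rewrite [`|2^-1|]ger0_norm ?invr_ge0//; have := ler_normD b1 b2.
by move: `|b1 + b2| `|b1| `|b2| h1 h2 => s t u ? ? ?; lra.
Qed.

(** [T1] to [T4] are the four integrals of [Jform], [X] the energy of [h(U)], [E] the penalty
    energy, [Y] and [Z] the error integrals and [G] the localized gradient integral. Half of [X] is
    bounded by [T1 / 2] and a quarter of it is absorbed; the quarter left over explains the factor 4
    in [K1]. *)
Lemma gradient_algebra (nu c0 K1 K3 M X T1 T2 T3 T4 E Y Z G c : R) :
 0 < nu -> 0 < c0 -> 0 <= K3 -> 0 <= M -> 0 <= c -> 0 <= E -> 0 <= Y -> 0 <= Z ->
 K1 = 4 * nu / c0 ->
 X <= T1 + c * E -> - (2^-1 * T2) - 2^-1 * T4 <= 4^-1 * X + K3 * M ^+ 2 * Y -> - T3 <= 2 * M * Z ->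
 G <= nu / c0 * X ->
 G <= K1 * (- (- (2^-1 * T1) - 2^-1 * T2 - T3 - 2^-1 * T4) + c * E)
   + K1 * (K3 + 2) * (M ^+ 2 * Y + M * Z).
Proof.
move=> nu0 c00 K30 M0 cg0 E0 Y0 Z0 K1E I1 I2 I3 I4.
have [J JE] : {J | J = - (2^-1 * T1) - 2^-1 * T2 - T3 - 2^-1 * T4} by exists (- (2^-1 * T1) - 2^-1 * T2 - T3 - 2^-1 * T4).
have XJ : X <= 4 * (- J + K3 * M ^+ 2 * Y + 2 * M * Z + c * E).
 have cE : 0 <= c * E by exact: mulr_ge0.
 by rewrite JE; lra.
have k0 : 0 <= nu / c0 by rewrite divr_ge0// ltW.
have MZ : 0 <= M * Z by exact: mulr_ge0.
have MY : 0 <= M ^+ 2 * Y by rewrite mulr_ge0 ?sqr_ge0.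
have K10 : 0 <= K1 by rewrite K1E -mulrA mulr_ge0.
apply: le_trans I4 (le_trans (ler_wpM2l k0 XJ) _).
have -> : nu / c0 * (4 * (- J + K3 * M ^+ 2 * Y + 2 * M * Z + c * E)) =
  K1 * (- J + c * E) + K1 * (K3 * (M ^+ 2 * Y) + 2 * (M * Z)) by rewrite K1E; ring.
have h1 : K3 * (M ^+ 2 * Y) + 2 * (M * Z) <= (K3 + 2) * (M ^+ 2 * Y + M * Z).
 by have := mulr_ge0 K30 MZ; lra.
by rewrite -JE lerD2l -mulrA ler_wpM2l.
Qed.

End modified_profiles.

(** * Construction of the logarithmic and sublevel profiles *)

Section profile_construction.
Context {R : realType}.
Implicit Types (f g h m : R -> R) (s t : R).

Definition is_deriv f (f1 : R -> R) := forall s : R, is_derive s 1 f (f1 s).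

Lemma deriv_near f g s (a b : R) : (\near s, f s = g s) -> is_derive s 1 f a ->
 is_derive s 1 g b -> a = b.
Proof. by move=> fg [_ <-] [_ <-]; exact: near_eq_derive. Qed.

Lemma is_deriv_uniq f (f1 f2 : R -> R) : is_deriv f f1 -> is_deriv f f2 -> forall s, f1 s = f2 s.
Proof. by move=> d1 d2 s; have [_ <-] := d1 s; have [_ <-] := d2 s. Qed.

Lemma deriv_itv f g (f1 g1 : R -> R) (a b : R) : is_deriv f f1 -> is_deriv g g1 ->
 (forall s, a < s < b -> f s = g s) -> forall s, a < s < b -> f1 s = g1 s.
Proof.
move=> df dg fg s /andP[h1 h2]; apply: (deriv_near _ (df s) (dg s)).
have n1 : nbhs s [set y : R | a < y] by apply: open_nbhs_nbhs; split => //; exact: open_gt.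
have n2 : nbhs s [set y : R | y < b] by apply: open_nbhs_nbhs; split => //; exact: open_lt.
by apply: filterS2 n1 n2 => y /= y1 y2; apply: fg; rewrite y1.
Qed.

(** Makes all derivatives vanish outside a compact interval, so that each function involved is
    bounded and Lipschitz on the whole line. *)
Definition eqoff f := exists k, forall s, ~~ (-2 <= s <= 3) -> f s = k.

Lemma off_derive f (f1 : R -> R) : is_deriv f f1 -> eqoff f -> forall s, ~~ (-2 <= s <= 3) -> f1 s = 0.
Proof.
move=> df [k hk] s; rewrite negb_and -!ltNge => /orP[h|h].
 have dc : is_deriv (fun=> k) (fun=> 0) by move=> y; exact: is_derive_cst.
 apply: (@deriv_itv f (fun=> k) f1 (fun=> 0) (s - 1) (-2) df dc) => [y /andP[_ y2]|].
  by apply: hk; rewrite negb_and -!ltNge y2.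
 by rewrite h andbT; lra.
have dc : is_deriv (fun=> k) (fun=> 0) by move=> y; exact: is_derive_cst.
apply: (@deriv_itv f (fun=> k) f1 (fun=> 0) 3 (s + 1) df dc) => [y /andP[y1 _]|].
 by apply: hk; rewrite negb_and -!ltNge y1 orbT.
by rewrite h /=; lra.
Qed.

Lemma off_bounded f : continuous f -> eqoff f -> exists2 M, 0 <= M & forall s, `|f s| <= M.
Proof.
move=> cf [k hk]; have [M M0 hM] := continuous_itv_bounded (-2) 3 cf.
exists (M + `|k|) => [|s]; first exact: addr_ge0.
have [h|h] := boolP (-2 <= s <= 3); first by apply: le_trans (hM s h) _; rewrite lerDl.
by rewrite hk// lerDr.
Qed.

(** Bounds and Lipschitz constants come from compactness, and [trap2_slack] extends the convexity
    inequality beyond [[- dlt, 1 + dlt]]. The last two conditions quantify over arbitrary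
    derivatives, so that explicit formulas on an open interval suffice to check them. *)
Lemma mprofile_build (f0 h m : R -> R) (dlt : R) : smooth f0 -> smooth h -> smooth m ->
 eqoff f0 -> eqoff h -> eqoff m -> 0 < dlt ->
 (forall f1 h1, is_deriv f0 f1 -> is_deriv h h1 -> forall s, f1 s = m s * h1 s) ->
 (forall f1 f2 h1, is_deriv f0 f1 -> is_deriv f1 f2 -> is_deriv h h1 ->
  forall s, - dlt <= s <= 1 + dlt -> h1 s ^+ 2 <= f2 s) ->
 exists f1 f2 h1 L c, mprofile f0 f1 f2 h h1 m L c.
Proof.
move=> s0 sh sm o0 oh om d0 H1 H2.
have [f1 [df0 s1]] := smooth_derive s0; have [f2 [df1 s2]] := smooth_derive s1.
have [f3 [df2 s3]] := smooth_derive s2; have [h1 [dh sh1]] := smooth_derive sh.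
have [m1 [dm sm1]] := smooth_derive sm.
have o1 : eqoff f1 by exists 0; exact: off_derive df0 o0.
have o2 : eqoff f2 by exists 0; exact: off_derive df1 o1.
have o3 : eqoff f3 by exists 0; exact: off_derive df2 o2.
have oh1 : eqoff h1 by exists 0; exact: off_derive dh oh.
have om1 : eqoff m1 by exists 0; exact: off_derive dm om.
have bd f : smooth f -> eqoff f -> exists2 M, 0 <= M & forall s, `|f s| <= M.
 by move=> sf; apply: off_bounded; exact: smooth_continuous.
have [b0 p0 B0] := bd _ s0 o0; have [b1 p1 B1] := bd _ s1 o1; have [b2 p2 B2] := bd _ s2 o2.
have [b3 p3 B3] := bd _ s3 o3; have [b4 p4 B4] := bd _ sh oh; have [b5 p5 B5] := bd _ sh1 oh1.
have [b6 p6 B6] := bd _ sm om; have [b7 p7 B7] := bd _ sm1 om1.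
have [L [L0 L1 L2 L3 [L4 L5 L6 L7]]] : exists L, [/\ b0 <= L, b1 <= L, b2 <= L, b3 <= L &
  [/\ b4 <= L, b5 <= L, b6 <= L & b7 <= L]].
 by exists (b0 + b1 + b2 + b3 + b4 + b5 + b6 + b7); split; [lra|lra|lra|lra|split; lra].
have ca : continuous (fun s => f2 s - h1 s ^+ 2).
 by apply: smooth_continuous => k; apply: S1B; [exact: s2|apply: S1M; exact: sh1].
have [||c c0 hc] := trap2_slack ca d0.
- by move=> s hs; rewrite subr_ge0; exact: H2 hs.
- by move=> s hs; rewrite (off_derive df1 o1 hs) (off_derive dh oh hs) expr0n subrr.
have up f l : l <= L -> (forall s, `|f s| <= l) -> forall s, `|f s| <= L.
 by move=> lL hf s; apply: le_trans (hf s) lL.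
exists f1, f2, h1, L, c; split => //.
- split => //; [exact: up B1|exact: up B2|..].
 + by apply: lip_of_derive df0 _; exact: up B1.
 + by apply: lip_of_derive df1 _; exact: up B2.
 + by apply: lip_of_derive df2 _; exact: up B3.
- exact: up B0.
- exact: smooth_continuous.
- exact: H1.
- by move=> s; have := hc s; rewrite addrAC subr_ge0.
- exact: up B4.
- by apply: lip_of_derive dh _; exact: up B5.
- exact: up B6.
- by apply: lip_of_derive dm _; exact: up B7.
Qed.

Lemma is_deriv_shift f (f1 : R -> R) (a b : R) : is_deriv f f1 -> is_deriv (fun s => f (a + b * s)) (fun s => b * f1 (a + b * s)).
Proof.
move=> df s.
have d1 : is_derive s 1 (fun s => a + b * s) b.
 have := @is_deriveD _ _ _ (fun=> a) (fun s : R => b * s) s 1 0 b (is_derive_cst _ _ _).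
 rewrite add0r; apply; have := @is_deriveZ _ _ _ id b s 1 1 (is_derive_id _ _).
 by rewrite /= [_ *: _]mulr1.
by have := @is_derive1_comp _ f (fun s => a + b * s) s _ _ (df _) d1; rewrite mulrC.
Qed.

(** The profile [- ln (eps + s)] satisfies [f2 = f1^2] near [0, 1], so it can play both roles [f0]
    and [h], with [m = 1]. The work lies in extending it smoothly to the whole line. *)
Lemma log_profile (eps : R) : 0 < eps -> eps <= 1 -> exists f0 f1 f2 h1 L c,
 [/\ mprofile f0 f1 f2 f0 h1 (fun=> 1) L c,
   forall s, 0 <= s <= 1 -> f0 s = - ln (eps + s) &
   forall s, 0 <= s <= 1 -> f1 s = - (eps + s)^-1].
Proof.
(* [be] is 1 between [- eps / 4] and 2, and 0 below [- eps / 2] and above 3. Hence [ze] is [eps + s]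
   near [0, 1], equals [eps] far away and stays positive in between. *)
move=> e0 e1; pose be (s : R) := step (2 + 4 / eps * s) * step (3 + (-1) * s).
pose ze s := eps + s * be s.
have aff (a b : R) : smooth (fun s => step (a + b * s)).
 by move=> k; apply: (S1_comp (@smooth_step R k)); exact: S1_affine.
have sze : smooth ze by move=> k; apply: S1D; [exact: S1_cst|apply: S1M; [exact: S1_id|apply: S1M; exact: aff]].
have be0 s : 0 <= be s by rewrite /be mulr_ge0 ?step_ge0.
have be1 s : be s <= 1 by rewrite /be mulr_ile1 ?step_ge0 ?step_le1.
have ie : 0 < 4 / eps by rewrite divr_gt0.
have bz s : s <= - (eps / 2) -> be s = 0.
 move=> hs; rewrite /be step_le0 ?mul0r//.
 have : 4 / eps * s <= 4 / eps * - (eps / 2) by rewrite ler_pM2l.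
 by rewrite (_ : 4 / eps * - (eps / 2) = - 2); [lra|field; rewrite gt_eqF].
have bo s : - (eps / 4) < s < 2 -> be s = 1.
 move=> /andP[h1 h2]; rewrite /be !step_ge1 ?mulr1//; first by lra.
 have : 4 / eps * - (eps / 4) <= 4 / eps * s by rewrite ler_pM2l// ltW.
 by rewrite (_ : 4 / eps * - (eps / 4) = - 1); [lra|field; rewrite gt_eqF].
have zp s : 0 < ze s.
 rewrite /ze; have [hs|hs] := leP s (- (eps / 2)); first by rewrite bz// mulr0 addr0.
 have [s0|s0] := leP 0 s; first by rewrite ltr_pwDl// mulr_ge0.
 by have := be0 s; have := be1 s; nra.
have zi s : - (eps / 4) < s < 2 -> ze s = eps + s by move=> hs; rewrite /ze bo// mulr1.
pose f0 s := - ln (ze s).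
have s0 : smooth f0 by move=> k; apply: S1N; apply: S1_ln.
have o0 : eqoff f0.
 exists (- ln eps) => s; rewrite negb_and -!ltNge => /orP[h|h]; rewrite /f0 /ze.
  by rewrite bz ?mulr0 ?addr0//; lra.
 have -> : be s = 0 by rewrite /be (@step_le0 _ (3 + (-1) * s)) ?mulr0//; lra.
 by rewrite mulr0 addr0.
have dl : forall f1, is_deriv f0 f1 -> forall s, - (eps / 4) < s < 2 -> f1 s = - (eps + s)^-1.
 move=> f1 df s hs; have /andP[hs1 hs2] := hs; have ep : 0 < eps + s by lra.
 apply: (@deriv_near f0 (fun s => - ln (eps + s)) s _ _ _ (df s)).
  have n1 : nbhs s [set y : R | - (eps / 4) < y] by apply: open_nbhs_nbhs; split => //; exact: open_gt.
  have n2 : nbhs s [set y : R | y < 2] by apply: open_nbhs_nbhs; split => //; exact: open_lt.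
  by apply: filterS2 n1 n2 => y /= y1 y2; rewrite /f0 zi// y1.
 apply: is_deriveN.
 have d1 : is_derive s 1 (fun s => eps + s) 1.
  have := @is_deriveD _ _ _ (fun=> eps) id s 1 0 1 (is_derive_cst _ _ _) (is_derive_id _ _).
  by rewrite add0r.
 by have := @is_derive1_comp _ (@ln R) (fun s => eps + s) s _ _ (is_derive1_ln ep) d1; rewrite ?mul1r ?mulr1.
have di : forall f1 f2, is_deriv f0 f1 -> is_deriv f1 f2 -> forall s, - (eps / 4) < s < 2 -> f2 s = (eps + s) ^- 2.
 move=> f1 f2 df df1 s hs; have /andP[hs1 hs2] := hs; have ep : 0 < eps + s by lra.
 apply: (@deriv_near f1 (fun s => - (eps + s)^-1) s _ _ _ (df1 s)).
  have n1 : nbhs s [set y : R | - (eps / 4) < y] by apply: open_nbhs_nbhs; split => //; exact: open_gt.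
  have n2 : nbhs s [set y : R | y < 2] by apply: open_nbhs_nbhs; split => //; exact: open_lt.
  by apply: filterS2 n1 n2 => y /= y1 y2; apply: dl => //; rewrite y1.
 have d1 : is_derive s 1 (fun s => eps + s) 1.
  have := @is_deriveD _ _ _ (fun=> eps) id s 1 0 1 (is_derive_cst _ _ _) (is_derive_id _ _).
  by rewrite add0r.
 have := is_deriveN (is_deriveV (lt0r_neq0 ep) d1).
 by rewrite [_ *: 1]mulr1 opprK.
(* [eps / 8] keeps the closed interval [[- dlt, 1 + dlt]] inside the open one on which the
   logarithmic formulas hold. *)
have [|||||||||f1 [f2 [h1 [L [c mp]]]]] := @mprofile_build f0 f0 (fun=> 1) (eps / 8) => //.
- by move=> k; exact: S1_cst.
- by exists 1.
- by rewrite divr_gt0.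
- by move=> f1 h1 d1 d2 s; rewrite mul1r; exact: is_deriv_uniq d1 d2 s.
- move=> f1 f2 h1 d1 d2 d3 s /andP[hs1 hs2].
 have hs : - (eps / 4) < s < 2 by apply/andP; split; lra.
 by rewrite (di _ _ d1 d2 s hs) (dl _ d3 s hs) sqrrN exprVn.
exists f0, f1, f2, h1, L, c; split => // s /andP[a b]; have hs : - (eps / 4) < s < 2 by apply/andP; split; lra.
- by rewrite /f0 zi.
- by apply: dl => //; exact: (pf_derive0 (mp_profile mp)).
Qed.

Lemma ramp_mono s t : s <= t -> ramp s <= ramp t.
Proof.
rewrite le_eqVlt => /orP[/eqP -> //|st].
have [|c _ e] := @MVT R (@ramp R) (@ramp1 R) s t st (fun x _ => is_derive_ramp x).
 exact/continuous_subspaceT/smooth_continuous/smooth_ramp.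
by rewrite -subr_ge0 e mulr_ge0 ?ramp1_ge0// subr_ge0 ltW.
Qed.

(** On [s >= 0], [h] is a smooth convex substitute for the positive part of [k - s], rounded at the
    scale [kap], with slope between -1 and 0. For [f0 = h^2 / 2] one gets [f1 = h h'], hence
    [m = h], and [f2 = h'^2 + h h''] is at least [h'^2] by convexity. *)
Lemma sublevel_profile (k kap : R) : 0 < k -> k <= 1 -> 0 < kap -> exists f0 f1 f2 h h1 L c,
 [/\ mprofile f0 f1 f2 h h1 h L c,
   forall s, f0 s = 2^-1 * h s ^+ 2,
   forall s, 0 <= s -> h s = kap * ramp (kap^-1 * (k - s)) &
   forall s, 0 <= s <= 1 -> f1 s <= 0 /\ - f1 s <= h s].
Proof.
move=> k0 k1 kp; have ik : 0 < kap^-1 by rewrite invr_gt0.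
pose rr s := kap * ramp (kap^-1 * k + (- kap^-1) * s).
(* The extra factor stops the linear growth towards minus infinity; it is 1 for [s >= -1]. *)
pose h s := rr s * step (2 + 1 * s); pose f0 s := 2^-1 * h s ^+ 2.
have sr : smooth rr.
 by move=> n; apply: S1Z; apply: (S1_comp (@smooth_ramp R n)); exact: S1_affine.
have sh : smooth h.
 by move=> n; apply: S1M; [exact: sr|apply: (S1_comp (@smooth_step R n)); exact: S1_affine].
have s0 : smooth f0 by move=> n; apply: S1Z; apply: S1M; exact: sh.
have oh : eqoff h.
 exists 0 => s; rewrite negb_and -!ltNge => /orP[hs|hs]; rewrite /h.
  by rewrite [X in _ * X]step_le0 ?mulr0//; lra.
 rewrite /rr ramp_le0 ?mulr0 ?mul0r// mulNr -mulrBr; apply: mulr_ge0_le0; [exact: ltW|lra].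
have o0 : eqoff f0 by have [c hc] := oh; exists (2^-1 * c ^+ 2) => s /hc; rewrite /f0 => ->.
pose r1 s := - ramp1 (kap^-1 * k + (- kap^-1) * s).
pose r2 s := kap^-1 * ramp2 (kap^-1 * k + (- kap^-1) * s).
have dr : is_deriv rr r1.
 move=> s; have := @is_deriveZ _ _ _ _ kap s 1 _ (@is_deriv_shift _ _ (kap^-1 * k) (- kap^-1) (@is_derive_ramp R) s).
 by rewrite /= [_ *: (_ * _)]mulrA mulrN mulfV ?gt_eqF// mulN1r.
have dr1 : is_deriv r1 r2.
 move=> s; have := is_deriveN (@is_deriv_shift _ _ (kap^-1 * k) (- kap^-1) (@is_derive_ramp1 R) s).
 by rewrite mulNr opprK.
have hr s : -1 < s < 4 -> h s = rr s by move=> /andP[a b]; rewrite /h step_ge1 ?mulr1//; lra.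
have dhr h1 : is_deriv h h1 -> forall s, -1 < s < 4 -> h1 s = r1 s.
 by move=> dh; exact: deriv_itv dh dr hr.
have d0 h1 : is_deriv h h1 -> is_deriv f0 (fun s => h s * h1 s).
 move=> dh s; have := @is_deriveZ _ _ _ _ 2^-1 s 1 _ (is_deriveM (dh s) (dh s)).
 rewrite (_ : 2^-1 *: (h s *: h1 s + h s *: h1 s) = h s * h1 s); first exact.
 by rewrite /GRing.scale/=; field.
have d1 h1 f1 : is_deriv h h1 -> is_deriv f0 f1 -> forall s, f1 s = h s * h1 s.
 by move=> dh df; exact: is_deriv_uniq df (d0 _ dh).
have rr0 s : 0 <= rr s by rewrite mulr_ge0 ?ramp_ge0// ltW.
have r20 s : 0 <= r2 s by rewrite mulr_ge0 ?ramp2_ge0// ltW.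
have [|||||||||f1 [f2 [h1 [L [c mp]]]]] := @mprofile_build f0 h h (1 / 2) => //.
- by move=> f1 h1 df dh s; exact: d1.
- move=> f1 f2 h1 df df1 dh s /andP[hs1 hs2].
 have hs : -1 < s < 4 by apply/andP; split; lra.
 have dq : is_deriv (fun s => rr s * r1 s) (fun s => rr s * r2 s + r1 s * r1 s).
  by move=> y; exact: is_deriveM (dr y) (dr1 y).
 have e12 y : -1 < y < 4 -> f1 y = rr y * r1 y.
  by move=> hy; rewrite (d1 _ _ dh df) (hr _ hy) (dhr _ dh _ hy).
 rewrite (deriv_itv df1 dq e12 hs).
 by rewrite (dhr _ dh s hs) expr2 lerDr mulr_ge0.
exists f0, f1, f2, h, h1, L, c; split => //.
 move=> s s_ge0; rewrite /h step_ge1 ?mulr1 /rr; last by lra.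
 by congr (_ * ramp _); ring.
move=> s /andP[a b]; have hs : -1 < s < 4 by apply/andP; split; lra.
rewrite (mp_f1 mp) (dhr _ (mp_derive mp) s hs) hr// /r1.
have := rr0 s; have := @ramp1_ge0 R (kap^-1 * k + (- kap^-1) * s).
have := @ramp1_le1 R (kap^-1 * k + (- kap^-1) * s).
by move: (ramp1 _) (rr s) => a1 a2; nra.
Qed.

End profile_construction.

(** * Localizing functions *)

Section localized_shifts.
Context {R : realType} {d : nat}.
Local Notation Rd := 'rV[R]_d.
Local Notation leb := (lebesgue_rV R d).
Local Notation e_ i := (delta_mx ord0 i : Rd).
Implicit Types (x y z : Rd) (f g a b : Rd -> R) (i j : 'I_d).

Definition localizer (Q : set Rd) (eta : Rd -> R) (M : R) := [/\ testT eta, closed Q, forall x, ~ Q x -> eta x = 0,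
 forall x, 0 <= eta x <= 1 & forall i x, `|pderiv i eta x| <= M].

Definition cube_at x0 (r : R) : set Rd := [set x | cube r (x - x0)].

Definition coord_cut (s : R -> R) x0 x : R := \prod_i s (x ord0 i - x0 ord0 i).

Lemma cube_at_closed x0 r : closed (cube_at x0 r).
Proof.
apply: (@closed_comp _ _ (fun x : Rd => x - x0) (cube r)); last exact: cube_closed.
by move=> x _; apply: continuousB; [exact: cvg_id|exact: cst_continuous].
Qed.

Lemma cube_at_cube x0 r : cube_at x0 r `<=` cube (r + `|x0|).
Proof.
move=> x h i; have := h i; rewrite !mxE => hi.
rewrite -[x ord0 i](subrK (x0 ord0 i)); apply: le_trans (ler_normD _ _) _.
by apply: lerD => //; exact: norm_coord.
Qed.

Lemma coord_cut_localizer (s s1 : R -> R) x0 (r M : R) : smooth s -> is_deriv s s1 ->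
 (forall t, 0 <= s t <= 1) -> (forall t, `|s1 t| <= M) -> (forall t, r < `|t| -> s t = 0) ->
 localizer (cube_at x0 r) (coord_cut s x0) M.
Proof.
move=> ss ds s01 sM s0.
have cC : Coo (coord_cut s x0).
 move=> k; apply: Ck_prod => i; apply: Ck_comp; first exact: ss.
 by apply: CkB; [exact: Ck_coord|exact: Ck_cst].
have out x : ~ cube_at x0 r x -> coord_cut s x0 x = 0.
 move=> /existsNP[i]; rewrite !mxE => /negP; rewrite -ltNge => h.
 by rewrite /coord_cut (bigD1 i)//= s0 ?mul0r.
have te : testT (coord_cut s x0).
 by apply: (test_funI (K := cube (r + `|x0|))) => // [|x h];
  [exact: cube_compact|apply: out => /cube_at_cube].
split => //; first exact: cube_at_closed.
 move=> x; apply/andP; split; first by apply: prodr_ge0 => i _; have /andP[] := s01 (x ord0 i - x0 ord0 i).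
 by apply: prodr_ile1 => i; have := s01 (x ord0 i - x0 ord0 i).
(* The derivative is bounded through its difference quotients: one factor of the product moves, and
   the others lie in [0, 1]. *)
move=> i x; have [g [_ _ [_ _ qf]]] := test_quotient i te ltr01.
apply: (cvg_le_cst (a := fun n => `|(coord_cut s x0 (x + (1 / n.+1%:R) *: e_ i) - coord_cut s x0 x) / (1 / n.+1%:R)|)); last first.
 by apply: cvg_norm; exact: qf.
move=> n; set t := 1 / n.+1%:R; have tp : 0 < t by rewrite divr_gt0.
rewrite normrM normfV (gtr0_norm tp) ler_pdivrMr//.
have E u : coord_cut s x0 (x + u *: e_ i) = s (x ord0 i + u - x0 ord0 i) * \prod_(j | j != i) s (x ord0 j - x0 ord0 j).
 rewrite /coord_cut (bigD1 i)//= !mxE !eqxx mulr1; congr (_ * _); apply: eq_bigr => j /negPf ji.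
 by rewrite !mxE ji andbF mulr0 addr0.
have E0 : coord_cut s x0 x = s (x ord0 i - x0 ord0 i) * \prod_(j | j != i) s (x ord0 j - x0 ord0 j).
 by rewrite -{1}[x]addr0 -(scale0r (e_ i)) E addr0.
rewrite E E0 -mulrBl normrM; apply: (@le_trans _ _ (`|s (x ord0 i + t - x0 ord0 i) - s (x ord0 i - x0 ord0 i)| * 1)).
 apply: ler_wpM2l => //; rewrite ger0_norm; last by apply: prodr_ge0 => j _; have /andP[] := s01 (x ord0 j - x0 ord0 j).
 by apply: prodr_ile1 => j; have := s01 (x ord0 j - x0 ord0 j).
rewrite mulr1; apply: le_trans (lip_of_derive ds sM _ _) _.
by rewrite (_ : x ord0 i + t - x0 ord0 i - (x ord0 i - x0 ord0 i) = t) ?gtr0_norm//; ring.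
Qed.

Lemma cutoff_localizer (r : R) : 0 < r -> exists M, localizer (cube (2 * r)) (@cutoff R d r) M.
Proof.
move=> r0; have te := @cutoff_test R d r r0.
have /choice[m hm] i : exists M : R, 0 <= M /\ forall x, `|pderiv i (cutoff r) x| <= M.
 by have [M M0 hM] := test_bounded (test_pderiv i te); exists M.
exists (\sum_i m i); split => //; [exact: cube_closed|by move=> x; exact: cutoff_out|exact: cutoff01|].
move=> i x; apply: le_trans ((hm i).2 x) _; rewrite (bigD1 i)//= lerDl.
by apply: sumr_ge0 => j _; exact: (hm j).1.
Qed.

End localized_shifts.

Lemma log_final_real {R : realType} (K1 K3 I le ib X : R) : 0 <= K1 -> 0 <= K3 -> le <= 0 -> 0 <= ib ->
 K1 * X <= 1 -> 0 <= I ->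
 K1 * (2 * ((1 - le) * I) * ib + X) + K3 * (2 - le) <= (K1 * (2 * I) + K3) * (2 - le) * (1 + ib) + 1.
Proof.
move=> h1 h3 hl hi hX hI.
have e : K1 * (2 * ((1 - le) * I) * ib + X) = (K1 * (2 * I)) * (1 - le) * ib + K1 * X by ring.
rewrite e; have p0 : 0 <= K1 * (2 * I) by rewrite mulr_ge0// mulr_ge0.
move: (K1 * (2 * I)) (K1 * X) p0 hX => Z Y p0 hX.
have a1 : 0 <= Z * ib by rewrite mulr_ge0.
have a2 : 0 <= K3 * ((2 - le) * ib) by rewrite !mulr_ge0//; lra.
have a3 : 0 <= Z * (2 - le) by rewrite !mulr_ge0//; lra.
have -> : (Z + K3) * (2 - le) * (1 + ib) + 1 = Z * (1 - le) * ib + Z * ib + Z * (2 - le) + K3 * (2 - le) + K3 * ((2 - le) * ib) + 1 by ring.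
lra.
Qed.

(** * Translation-invariant sets *)

Section translation_invariance.
Context {R : realType} {d : nat}.
Local Notation Rd := 'rV[R]_d.
Local Notation leb := (lebesgue_rV R d).
Local Notation e_ i := (delta_mx ord0 i : Rd).
Implicit Types (x y z : Rd) (f g : Rd -> R) (i : 'I_d).

Lemma ae_shift (P : Rd -> Prop) z : {ae leb, forall x, P x} -> {ae leb, forall x, P (x + z)}.
Proof.
move=> [N [mN N0 hN]]; exists ((fun x => x + z) @^-1` N); split.
- by rewrite -[_ @^-1` _]setTI; exact: shift_measurable.
- by have := leb_shift z mN; rewrite /pushforward N0.
- by move=> x /= h; apply: hN.
Qed.

Definition invariant_shift f z := {ae leb, forall x, f (x + z) = f x}.

Lemma invariant_shiftD f z z' : invariant_shift f z -> invariant_shift f z' -> invariant_shift f (z + z').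
Proof.
by move=> h /(ae_shift z) h'; move: h h'; apply: filterS2 => x e e'; rewrite addrA e' e.
Qed.

Lemma invariant_shiftN f z : invariant_shift f z -> invariant_shift f (- z).
Proof. by move=> /(ae_shift (- z)); apply: filterS => x; rewrite subrK. Qed.

Lemma invariant_shift0 f : invariant_shift f 0.
Proof. by apply: aeW => x; rewrite addr0. Qed.

(** The shifts that leave [f] invariant form a group, and any shift along an axis is a multiple of
    one of length at most 1. *)
Lemma invariant_shift_all f : (forall i t, 0 < t -> t <= 1 -> invariant_shift f (t *: e_ i)) ->
 forall z, invariant_shift f z.
Proof.
move=> h; have hp i t : 0 < t -> invariant_shift f (t *: e_ i).
 move=> t0; pose n := (Num.bound t).+1; have n0 : 0 < n%:R :> R by rewrite ltr0n.
 have h1 : invariant_shift f ((t / n%:R) *: e_ i).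
  apply: h; first by rewrite divr_gt0.
  rewrite ler_pdivrMr// mul1r ltW//; apply: lt_le_trans (archi_boundP (ltW t0)) _.
  by rewrite ler_nat leqnSn.
 have : invariant_shift f (\sum_(k < n) (t / n%:R) *: e_ i).
  elim/big_ind : _ => //; [exact: invariant_shift0|exact: invariant_shiftD].
 by rewrite sumr_const card_ord -scaler_nat scalerA mulrC divfK ?gt_eqF.
have ha i t : invariant_shift f (t *: e_ i).
 have [t0|t0|->] := ltgtP t 0; [|exact: hp|by rewrite scale0r; exact: invariant_shift0].
 by rewrite -[t]opprK scaleNr; apply: invariant_shiftN; apply: hp; rewrite oppr_gt0.
move=> z; rewrite [z]row_sum_delta; elim/big_ind : _ => //; [exact: invariant_shift0|exact: invariant_shiftD].
Qed.

Lemma add_measurable : meas (fun z : Rd * Rd => z.1 + z.2).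
Proof.
have h : meas (fun z : Rd * Rd => (z.1, - z.2)).
 apply/measurable_fun_pairP; split; first exact: measurable_fst.
 apply: (@measurableT_comp _ _ _ _ _ _ (fun x : Rd => - x)); last exact: measurable_snd.
 by apply: rV_measurable; exact: opp_continuous.
have := measurableT_comp (@sub_measurable R d) h.
by apply: eq_measurable_fun => z _ /=; rewrite opprK.
Qed.

(** Let [u] and [v] indicate, inside a cube, the sets [q = 1] and [q = 0]. The product of their
    integrals is the double integral of [u(x) v(x + y)], and for each [y] the integrand vanishes for
    almost every [x] by invariance. Hence one of the two sets is null in every cube. *)
Lemma invariant_const z (q : Rd -> R) : meas q -> (forall x, q x = 0 \/ q x = 1) ->
 (forall y, invariant_shift q y) -> {ae leb, forall x, q x = 0} \/ {ae leb, forall x, q x = 1}.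
Proof.
move=> mq q01 hq; pose b (n : nat) : Rd -> R := \1_(cube n%:R).
have bin n x : cube n%:R x -> b n x = 1 by exact: indicE_in.
have bout n x : ~ cube n%:R x -> b n x = 0 by exact: indicE_out.
have mb n : meas (b n) by apply: indic_meas; apply: closed_measurable_rV; exact: cube_closed.
have ib n : ibl leb (b n) by apply: ibl_indic; exact: cube_compact.
have qb x : `|q x| <= 1 by have [->|->] := q01 x; rewrite ?normr0 ?normr1.
have q'b x : `|1 - q x| <= 1 by have [->|->] := q01 x; rewrite ?subr0 ?subrr ?normr0 ?normr1.
have mq' : meas (fun x => 1 - q x) by exact: measurable_funB.
pose u n x := b n x * q x; pose v n x := b n x * (1 - q x).
have iu n : ibl leb (u n) by exact: (iblMb (ib n) mq qb).
have iv n : ibl leb (v n) by exact: (iblMb (ib n) mq' q'b).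
have vb n x : `|v n x| <= 1 by rewrite normrM mulr_ile1// indic_le1.
have prod0 n : Int leb (u n) * Int leb (v n) = 0.
 have mk : meas (fun p : Rd * Rd => v n (p.1 + p.2)).
  exact: (measurableT_comp (ibl_meas (iv n)) add_measurable).
 (* If [x] and [x + y] lie in the cube of size [n], then [y] lies in the cube of size [2n]; this
    cutoff makes the [y]-integral finite without changing it. *)
 have [_ _ E] := Int_swap (iu n) (ib (2 * n)%N) mk (fun p => vb n (p.1 + p.2)).
 have E1 : Int leb (fun x => u n x * Int leb (fun y => b (2 * n)%N y * v n (x + y))) = Int leb (u n) * Int leb (v n).
  rewrite mulrC -(IntZ _ (iu n)); apply: eq_Int => x; rewrite mulrC.
  have [cx|cx] := pselect (cube n%:R x); last first.
   have -> : u n x = 0 by rewrite /u (bout n x cx) mul0r.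
   by rewrite !mulr0.
  congr (_ * _); rewrite -((Int_shift x (iv n)).2); apply: eq_Int => y; rewrite [x + y]addrC.
  have [cy|cy] := pselect (cube (2 * n)%:R y); first by rewrite (bin _ _ cy) mul1r.
  rewrite (bout _ _ cy) mul0r; have [cz|cz] := pselect (cube n%:R (y + x)); last first.
   by rewrite /v (bout _ _ cz) mul0r.
  exfalso; apply: cy => i; rewrite -[y](addrK x) !mxE; apply: le_trans (ler_normB _ _) _.
  have := cz i; have := cx i; rewrite !mxE natrM => h1 h2.
  by apply: le_trans (lerD h2 h1) _; rewrite mulr_natl mulr2n.
 rewrite -E1 E; apply: etrans (Int0 leb); apply: eq_Int => y.
 have -> : Int leb (fun x => u n x * v n (x + y)) = Int leb (fun=> 0 : R).
  apply: ae_eq_Int; [|exact: measurable_cst|].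
   by apply: measurable_funM; [exact: ibl_meas (iu n)|exact: (shift_measurableM y (ibl_meas (iv n)))].
  apply: filterS (hq y) => x e; rewrite /u /v e.
  by have [->|->] := q01 x; rewrite ?subrr !(mulr0, mul0r).
 by rewrite Int0 mulr0.
have un0 n x : 0 <= u n x by rewrite mulr_ge0 ?indic_ge0//; have [->|->] := q01 x.
have vn0 n x : 0 <= v n x by rewrite mulr_ge0 ?indic_ge0//; have [->|->] := q01 x; rewrite ?subr0 ?subrr.
have cb x n : (Num.bound `|x| <= n)%N -> b n x = 1.
 move=> hn; rewrite /b indicE_in// => i; apply: le_trans (norm_coord x i) _.
 by apply: le_trans (ltW (archi_boundP (normr_ge0 x))) _; rewrite ler_nat.
have [hv|/existsNP[n hn]] := pselect (forall n, Int leb (v n) = 0).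
 right; have : {ae leb, forall x, forall n, v n x = 0}.
  by apply/ae_foralln => n; exact: Int_eq0 (iv n) (vn0 n) (hv n).
 apply: filterS => x hx; have := hx (Num.bound `|x|); rewrite /v (cb x _ (leqnn _)) mul1r => /eqP.
 by rewrite subr_eq0 => /eqP.
left; have hu m : (n <= m)%N -> Int leb (u m) = 0.
 move=> nm; have /eqP := prod0 m; rewrite mulf_eq0 => /orP[/eqP //|/eqP h0]; exfalso; apply: hn.
 apply/eqP; rewrite eq_le Int_ge0 ?andbT// -h0; apply: Int_le => // x.
 apply: ler_wpM2r; first by have [->|->] := q01 x; rewrite ?subr0 ?subrr.
 have [cx|cx] := pselect (cube n%:R x); last by rewrite /b indicE_out// indic_ge0.
 rewrite /b !indicE_in// => i; apply: le_trans (cx i) _; by rewrite ler_nat.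
have : {ae leb, forall x, forall k, u (n + k)%N x = 0}.
 by apply/ae_foralln => k; apply: Int_eq0 (iu _) (un0 _) (hu _ (leq_addr _ _)).
apply: filterS => x hx; have := hx (Num.bound `|x|); rewrite /u cb ?mul1r//; exact: leq_addl.
Qed.

End translation_invariance.

Lemma shift_defect_real {R : realType} (N X Y : R) : N + N - 2 * Y <= X -> N - X / 2 <= Y.
Proof. lra. Qed.

Lemma average_real {R : realType} (cb m N X : R) : 2 * m <= cb -> 0 < m -> 0 <= N ->
 cb * (N - X / 2) <= m * N -> N <= X.
Proof. by move=> h m0 N0 hh; rewrite leNgt; apply/negP => XN; nra. Qed.

(** [w] is bounded above by [v] but not below; this suffices because [f], a value of [f1], is
    nonpositive. [e] is a value of the cutoff and [l] the level. *)
Lemma sublevel_drift_real {R : realType} (l rho Mr w v f e : R) : 0 <= v -> v <= l -> w <= v -> f <= 0 ->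
 0 <= e -> e <= 1 -> 0 <= rho -> rho <= Mr -> - f <= l -> 0 <= Mr ->
 - (w * (f * (e * e))) * rho <= l ^+ 2 * Mr.
Proof.
move=> v0 vl wv f0 e0 e1 r0 rM fl M0; have ee1 : e * e <= 1 by rewrite mulr_ile1.
have ee0 : 0 <= e * e by rewrite mulr_ge0.
have a1 : 0 <= - f by rewrite oppr_ge0.
have a2 : w * - f <= l * l.
 apply: (@le_trans _ _ (v * - f)); first exact: ler_wpM2r.
 by apply: ler_pM.
have a3 : w * - f * (e * e) <= l * l.
 have ll : 0 <= l * l by rewrite -expr2 sqr_ge0.
 apply: (@le_trans _ _ (l * l * (e * e))); first exact: ler_wpM2r.
 by rewrite ler_piMr.
rewrite (_ : - (w * (f * (e * e))) = w * - f * (e * e)); last by ring.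
rewrite expr2; apply: le_trans (ler_wpM2r r0 a3) _; apply: ler_wpM2l => //.
by rewrite -expr2 sqr_ge0.
Qed.

Lemma sublevel_real {R : realType} (d : nat) (l g r K1 K2 Mr Cs Phi m W Y Z : R) : (0 < d)%N -> 0 < l -> 0 < g -> g <= 1 ->
 0 < r -> r <= 1 -> 0 <= K1 -> 0 <= K2 -> 0 <= Mr -> 0 <= Cs -> 0 <= Phi -> m <= r ^+ d ->
 Y <= l ^+ 2 * m -> Z <= l ^+ 2 / 2 * (r ^+ d.-1 * (1 + Phi)) -> - W <= l ^+ 2 * (Mr * m) ->
 d%:R * (r ^+ 2 * (2 * (K1 * - W + K2 * ((2 * Cs / g) ^+ 2 * Y + (2 * Cs / g) * Z)) + 2 * ((2 * Cs / g) ^+ 2 * d%:R) * Y)) <=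
 d%:R * (2 * (K1 * Mr) + 2 * (K2 * (4 * Cs ^+ 2 + Cs * (1 + Phi))) + 8 * Cs ^+ 2 * d%:R) * (l ^+ 2 * g ^- 2 * r ^+ d.+1).
Proof.
move=> d0 l0 g0 g1 r0 r1 K10 K20 M0 Cs0 P0 mr hY hZ hW.
have [n dE] : exists n, d = n.+1 by exists d.-1; rewrite prednK.
rewrite dE /= in mr hZ *; set q := r ^+ n in hZ; have q0 : 0 < q by rewrite exprn_gt0.
have mq : m <= q by apply: le_trans mr _; rewrite exprS -/q ler_piMl// ltW.
have l20 : 0 <= l ^+ 2 by exact: sqr_ge0.
have -> : r ^+ n.+2 = r ^+ 2 * q by rewrite !exprS expr0 /q; ring.
set G := g^-1; have G1 : 1 <= G by rewrite /G invf_ge1.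
have GG : 1 <= G ^+ 2 by rewrite exprn_ege1.
have G2 : G <= G ^+ 2 by rewrite expr2 ler_peMr//; lra.
have hY' : Y <= l ^+ 2 * q by apply: le_trans hY _; exact: ler_wpM2l.
have hW' : - W <= l ^+ 2 * Mr * q.
 by apply: le_trans hW _; rewrite -mulrA; apply: ler_wpM2l => //; exact: ler_wpM2l.
rewrite -[g ^- 2]exprVn -/G -[X in _ <= X]mulrA; apply: ler_wpM2l => //.
have -> : forall T, T * (l ^+ 2 * G ^+ 2 * (r ^+ 2 * q)) = r ^+ 2 * (T * (l ^+ 2 * q) * G ^+ 2) by move=> T; ring.
apply: ler_wpM2l; first exact: sqr_ge0.
set V := l ^+ 2 * q; have V0 : 0 <= V by rewrite mulr_ge0// ltW.
have a1 : K1 * - W <= K1 * Mr * V * G ^+ 2.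
 apply: (@le_trans _ _ (K1 * (l ^+ 2 * Mr * q))); first exact: ler_wpM2l.
 rewrite (_ : K1 * (l ^+ 2 * Mr * q) = K1 * Mr * V); last by rewrite /V; ring.
 by apply: ler_peMr => //; apply: mulr_ge0 => //; exact: mulr_ge0.
have a2 : (2 * Cs / g) ^+ 2 * Y <= 4 * Cs ^+ 2 * V * G ^+ 2.
 rewrite (_ : 4 * Cs ^+ 2 * V * G ^+ 2 = (2 * Cs / g) ^+ 2 * V); last by rewrite /G; ring.
 by apply: ler_wpM2l => //; exact: sqr_ge0.
have a3 : (2 * Cs / g) * Z <= Cs * (1 + Phi) * V * G ^+ 2.
 have CG : 0 <= 2 * Cs / g by rewrite divr_ge0 ?mulr_ge0// ltW.
 apply: le_trans (ler_wpM2l CG hZ) _.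
 rewrite (_ : 2 * Cs / g * (l ^+ 2 / 2 * (q * (1 + Phi))) = Cs * (1 + Phi) * V * G); last by rewrite /V /G; field; rewrite gt_eqF.
 by apply: ler_wpM2l => //; apply: mulr_ge0 => //; apply: mulr_ge0 => //; exact: addr_ge0.
have a4 := ler_wpM2l K20 (lerD a2 a3).
have a5 : 0 <= n.+1%:R :> R by [].
have a6 := ler_wpM2l a5 a2.
move: (2 * Cs / g) a2 a3 a4 a6 => c2 a2 a3 a4 a6.
rewrite (_ : 2 * (K1 * - W + K2 * (c2 ^+ 2 * Y + c2 * Z)) + 2 * (c2 ^+ 2 * n.+1%:R) * Y =
 2 * (K1 * - W) + 2 * (K2 * (c2 ^+ 2 * Y + c2 * Z)) + 2 * (n.+1%:R * (c2 ^+ 2 * Y))); last by ring.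
rewrite (_ : (2 * (K1 * Mr) + 2 * (K2 * (4 * Cs ^+ 2 + Cs * (1 + Phi))) + 8 * Cs ^+ 2 * n.+1%:R) * V * G ^+ 2 =
 2 * (K1 * Mr * V * G ^+ 2) + 2 * (K2 * (4 * Cs ^+ 2 * V * G ^+ 2 + Cs * (1 + Phi) * V * G ^+ 2)) + 2 * (n.+1%:R * (4 * Cs ^+ 2 * V * G ^+ 2))); last by ring.
by apply: lerD; [apply: lerD|]; rewrite ler_pM2l.
Qed.

(** * Averaged shifts *)

Section sublevel_iteration_aux.
Context {R : realType} {d : nat}.
Local Notation Rd := 'rV[R]_d.
Local Notation leb := (lebesgue_rV R d).
Implicit Types (x y z : Rd) (f g : Rd -> R) (i : 'I_d) (D : set Rd).

Lemma step_deriv_bounded : exists (s1 : R -> R) (K : R), [/\ is_deriv (@step R) s1, 0 <= K & forall s, `|s1 s| <= K].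
Proof.
have [s1 [ds ss]] := smooth_derive (@smooth_step R).
have dc (c : R) : is_deriv (fun=> c) (fun=> 0) by move=> y; exact: is_derive_cst.
have [||K K0 hK] := @off_bounded R s1; last by exists s1, K.
 exact: smooth_continuous.
exists 0 => s; rewrite negb_and -!ltNge => /orP[h|h].
 apply: (deriv_itv (a := s - 1) (b := 0) ds (dc 0)) => [y /andP[_ y0]|]; first exact: step_le0 (ltW y0).
 by apply/andP; split; lra.
apply: (deriv_itv (a := 1) (b := s + 1) ds (dc 1)) => [y /andP[y0 _]|]; first exact: step_ge1 (ltW y0).
by apply/andP; split; lra.
Qed.

Lemma Int_indic D : measurable D -> (leb D < +oo)%E -> ibl leb (\1_D : Rd -> R) /\ ((Int leb (\1_D : Rd -> R))%:E = leb D)%E.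
Proof.
move=> mD fD; have i1 : ibl leb (\1_D : Rd -> R).
 apply/integrableP; split; first by apply/measurable_EFinP; exact: indic_meas.
 under eq_integral do rewrite /= ger0_norm ?indic_ge0//.
 by rewrite integral_indic// setIT.
by split => //; rewrite -ibl_integral// integral_indic// setIT.
Qed.

Lemma Int_cube_ge (b : R) : 0 < b -> (2 * b) ^+ d <= Int leb (\1_(cube b) : Rd -> R).
Proof.
move=> b0; rewrite -lee_fin.
have mc : measurable (cube b : set Rd) by apply: closed_measurable_rV; exact: cube_closed.
have [_ ->] := Int_indic mc (leb_compact_lty (@cube_compact R d b)).
have bb i : (const_mx (- b) : Rd) ord0 i <= (const_mx b : Rd) ord0 i by rewrite !mxE; lra.
have := lebesgue_rV_box bb; rewrite (eq_bigr (fun=> 2 * b)); last by move=> i _; rewrite !mxE opprK; ring.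
rewrite prodr_const card_ord => <-; apply: le_measure; rewrite ?inE//; first exact: measurable_box.
by move=> x h i; have := h i; rewrite !mxE ler_norml => /andP[h1 ->]; rewrite ltW.
Qed.

Lemma L2cvg_shift (fs : nat -> Rd -> R) f z : L2cvg leb fs f ->
 L2cvg leb (fun n x => fs n (x + z)) (fun x => f (x + z)).
Proof.
move=> [h1 h2 h3]; have sh g : L2fun leb g -> L2fun leb (fun x => g (x + z)).
 by move=> [mg ig]; split; [exact: shift_measurableM|exact: (Int_shift z ig).1].
split => [n||]; [exact: sh|exact: sh|].
apply: cvg_ext h3 => n; have [_ i] := L2funB (h1 n) h2.
by rewrite -[LHS]((Int_shift z i).2).
Qed.

(* Averaging the shifts over a cube whose measure dominates that of the support of f replaces the Faber-Krahn inequality. *)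
Lemma average_shift f D (b X M m : R) : ibl leb f -> (forall x, `|f x| <= M) ->
 measurable D -> ibl leb (\1_D : Rd -> R) -> Int leb (\1_D : Rd -> R) <= m ->
 {ae leb, forall x, f x = \1_D x * f x} -> 2 * m <= Int leb (\1_(cube b) : Rd -> R) -> 0 < m ->
 (forall z, cube b z -> Int leb (fun x => (f (x + z) - f x) ^+ 2) <= X) ->
 Int leb (fun x => f x ^+ 2) <= X.
Proof.
move=> hf fM mD iD Dm fD hm m0 hX; have mf := ibl_meas hf.
have mc : measurable (cube b : set Rd) by apply: closed_measurable_rV; exact: cube_closed.
have ic : ibl leb (\1_(cube b) : Rd -> R) by apply: ibl_indic; exact: cube_compact.
have if2 : ibl leb (fun x => f x ^+ 2).
 by apply: eq_ibl (iblMb hf mf fM) => x; rewrite expr2.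
have mk : meas (fun p : Rd * Rd => f (p.1 + p.2)).
 exact: (measurableT_comp mf (@add_measurable R d)).
have [j1 j2 E] := Int_swap hf ic mk (fun p => fM (p.1 + p.2)).
set N := Int leb (fun x => f x ^+ 2).
have iff z : ibl leb (fun x => f x * f (x + z)).
 by apply: (iblMb hf (shift_measurableM z mf)) => x; exact: fM.
have key z : cube b z -> N - X / 2 <= Int leb (fun x => f x * f (x + z)).
 move=> cz; have := hX z cz; have [i2 I2] := Int_shift z if2.
 have -> : Int leb (fun x => (f (x + z) - f x) ^+ 2) = N + N - 2 * Int leb (fun x => f x * f (x + z)).
  have I2' : N = Int leb (fun x => f (x + z) ^+ 2) by rewrite I2.
  rewrite {1}I2' -(IntD i2 if2) -(IntZ 2 (iff z)) -IntB; [|exact: iblD|exact: iblZ].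
  by apply: eq_Int => x; ring.
 exact: shift_defect_real.
have low : Int leb (\1_(cube b) : Rd -> R) * (N - X / 2) <= Int leb (fun y => \1_(cube b) y * Int leb (fun x => f x * f (x + y))).
 rewrite mulrC -(IntZ _ ic); apply: Int_le; [exact: iblZ|exact: j2|] => z; have [cz|cz] := pselect (cube b z); last by rewrite indicE_out// mul0r mulr0.
 by rewrite indicE_in// mulr1 mul1r; exact: key.
set F := Int leb (fun x => `|f x|).
have F0 : 0 <= F by apply: Int_ge0.
(* The averaged correlation is at most the square of the integral of [|f|], and Cauchy-Schwarz on
   [D] bounds this by [m] times the squared norm. The cube is at least twice as large as [m], so [f]
   cannot be nearly invariant under the average shift. *)
have up : Int leb (fun x => f x * Int leb (fun y => \1_(cube b) y * f (x + y))) <= F ^+ 2.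
 rewrite expr2 -(IntZ F (ibl_abs hf)); apply: Int_le; [exact: j1|by apply: iblZ; exact: ibl_abs|] => x.
 apply: le_trans (ler_norm _) _; rewrite normrM mulrC; apply: ler_wpM2r => //.
 have sx := Int_shift x hf; have msx : meas (fun y => f (x + y)).
  by apply: eq_measurable_fun (ibl_meas sx.1) => y _; rewrite addrC.
 have i3 : ibl leb (fun y => \1_(cube b) y * f (x + y)).
  by apply: (iblMb ic msx) => y; exact: fM.
 apply: le_trans (Int_abs i3) _; have sa := Int_shift x (ibl_abs hf).
 rewrite /F -sa.2; apply: Int_le => [||y]; [exact: ibl_abs|exact: sa.1|].
 by rewrite normrM [x + y]addrC ger0_norm ?indic_ge0// ler_piMl//; have /andP[] := indic01 (cube b) y.
have CS : F ^+ 2 <= m * N.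
 have iD2 : ibl leb (fun x => (\1_D x : R) ^+ 2).
  by apply: eq_ibl iD => x; have [h|h] := pselect (D x); rewrite ?(indicE_in h) ?(indicE_out h) ?expr1n ?expr0n.
 have ia2 : ibl leb (fun x => `|f x| ^+ 2) by apply: eq_ibl if2 => x; rewrite real_normK ?num_real.
 have mDi := indic_meas mD; have mfa : meas (fun x => `|f x|) by exact: measurableT_comp.
 have := CauchySchwarz mDi mfa iD2 ia2.
 have -> : Int leb (fun x => \1_D x * `|f x|) = F.
  apply: ae_eq_Int; [exact: measurable_funM|exact: mfa|]; apply: filterS fD => x e; rewrite [in RHS]e normrM ger0_norm ?indic_ge0//.
 have -> : Int leb (fun x => (\1_D x : R) ^+ 2) = Int leb (\1_D : Rd -> R).
  by apply: eq_Int => x; have [h|h] := pselect (D x); rewrite ?(indicE_in h) ?(indicE_out h) ?expr1n ?expr0n.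
 have -> : Int leb (fun x => `|f x| ^+ 2) = N by apply: eq_Int => x; rewrite real_normK ?num_real.
 move=> h; apply: le_trans h _; apply: ler_wpM2r => //.
 by apply: Int_ge0 => x; exact: sqr_ge0.
have N0 : 0 <= N by apply: Int_ge0 => x; exact: sqr_ge0.
rewrite E in up; have := le_trans low (le_trans up CS).
move: (Int leb (\1_(cube b) : Rd -> R)) hm => cb hm hh.
exact: average_real hm m0 N0 hh.
Qed.

End sublevel_iteration_aux.

(** With level [k (1 + t) / 2], radius [1 + t] and bound [(r0 t^4)^d], passing from [t] to [t / 2]
    costs at most [64 / t^4] from the level and radius gaps, and [16^d] from the smaller target. The
    additional factor [r0 t^4] pays for both: this fixes the exponent 4 and the value of [r0]. *)
Lemma sublevel_iter_real {R : realType} (d : nat) (K k t r0 : R) : 0 <= K -> 0 < k -> 0 < t -> t <= 1 -> 0 < r0 ->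
 r0 * (16 ^+ d * (64 * K + 1)) = 1 ->
 K * ((k * (1 + t) / 2 / (k * t / 4)) ^+ 2 * (1 + t - (1 + t / 2)) ^- 2 * (r0 * t ^+ 4) ^+ d.+1) <= (r0 * (t / 2) ^+ 4) ^+ d.
Proof.
move=> K0 k0 t0 t1 r0p rE.
have -> : (r0 * (t / 2) ^+ 4) ^+ d = (r0 * t ^+ 4) ^+ d * 16 ^- d.
 by rewrite -exprVn -exprMn; congr (_ ^+ _); field.
have -> : k * (1 + t) / 2 / (k * t / 4) = 2 * (1 + t) / t by field; rewrite !gt_eqF.
have -> : 1 + t - (1 + t / 2) = t / 2 by field.
rewrite [(r0 * t ^+ 4) ^+ d.+1]exprS; set q := (r0 * t ^+ 4) ^+ d.
have q0 : 0 <= q by rewrite exprn_ge0// mulr_ge0 ?exprn_ge0// ltW.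
have -> : K * ((2 * (1 + t) / t) ^+ 2 * (t / 2) ^- 2 * (r0 * t ^+ 4 * q)) = q * (16 * (1 + t) ^+ 2 * K * r0).
 by field; rewrite gt_eqF.
apply: ler_wpM2l => //; have t2 : (1 + t) ^+ 2 <= 4 by nra.
have p0 : 0 < 16 ^+ d :> R by rewrite exprn_gt0.
rewrite -[leRHS]mul1r ler_pdivlMr// -[leRHS]rE.
have a : 16 * (1 + t) ^+ 2 * K <= 64 * K + 1.
 have : (1 + t) ^+ 2 * K <= 4 * K by apply: ler_wpM2r.
 by rewrite -mulrA; move: ((1 + t) ^+ 2 * K) => X hX; lra.
rewrite (_ : 16 * (1 + t) ^+ 2 * K * r0 * 16 ^+ d = r0 * (16 ^+ d * (16 * (1 + t) ^+ 2 * K))); last by ring.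
by rewrite ler_pM2l// ler_pM2l.
Qed.

(** * Positive functionals *)

Section positive_functionals.
Context {R : realType} {dsp} {T : measurableType dsp} (m : {measure set T -> \bar R}).
Implicit Types (f g : T -> R).

(* Positivity gives no continuity for convergence in mean: g is dominated by n f plus a remainder, and the remainders are summed into a single integrable function. *)
Lemma functional_vanishes (l : (T -> R) -> R) f g :
 (forall f g, ibl m f -> ibl m g -> {ae m, forall x, f x <= g x} -> l f <= l g) ->
 (forall a f g, ibl m f -> ibl m g -> l (fun x => a * f x + g x) = a * l f + l g) ->
 ibl m f -> {ae m, forall x, 0 < f x} -> l f = 0 ->
 ibl m g -> {ae m, forall x, 0 <= g x} -> l g = 0.
Proof.
move=> lle laD hf f0 lf hg g0; have z0 := @ibl0 _ _ _ m.
have l0 : l (fun=> 0) = 0.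
 have e : (fun x : T => 1 * 0 + 0) = (fun=> 0 : R) by apply/funext => x; rewrite mulr0 addr0.
 by have := laD 1 _ _ z0 z0; rewrite e mul1r => h; lra.
pose r n x := Num.max (`|g x| - n%:R * `|f x|) 0.
have r0 n x : 0 <= r n x by rewrite le_max lexx orbT.
have rle n x : r n x <= `|g x| by rewrite ge_max normr_ge0 andbT gerBl mulr_ge0.
have ifa := ibl_abs hf; have iga := ibl_abs hg.
have mr n : meas (r n).
 by apply: measurable_maxr => //; apply: ibl_meas; exact: (iblB iga (iblZ n%:R ifa)).
have ir n : ibl m (r n) by apply: ibl_le iga => // x; rewrite ger0_norm.
have cr : Int m (r n) @[n --> \oo] --> 0.
 rewrite -[X in _ --> X](Int0 m); apply: (Int_dom mr _ _ iga) => [||n x]; [exact: measurable_cst| |by rewrite ger0_norm].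
 apply: filterS f0 => x fx; apply: cvg0P => e e0.
 exists (Num.bound (`|g x| / f x)) => n hn; rewrite (_ : r n x = 0) ?normr0//.
 apply/max_idPr; rewrite subr_le0 (gtr0_norm fx) -ler_pdivrMr//.
 apply: le_trans (ltW (archi_boundP _)) _; first by rewrite divr_ge0// ltW.
 by rewrite ler_nat.
have hn k : exists n, Int m (r n) <= 2^-1 ^+ k.
 have e0 : 0 < 2^-1 ^+ k :> R by rewrite exprn_gt0.
 by have [N hN] := cvg0_eN cr e0; exists N; apply: le_trans (ler_norm _) (ltW (hN N (leqnn N))).
have /choice[n hn'] := hn.
have sb k : \sum_(j < k) Int m (r (n j)) <= 2 - 2 * 2^-1 ^+ k.
 elim: k => [|k IH]; first by rewrite big_ord0 expr0 mulr1 subrr.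
 by rewrite big_ord_recr/= exprS; have := hn' k; lra.
have sb2 k : \sum_(j < k) Int m (r (n j)) <= 2.
 by apply: le_trans (sb k) _; rewrite gerBl mulr_ge0// exprn_ge0.
have [G [iG G0 hG]] := ibl_series (fun k => ir (n k)) (fun k => r0 (n k)) sb2.
have lg k : l g <= l (r (n k)).
 have -> : l (r (n k)) = l (fun x => (n k)%:R * f x + r (n k) x) by rewrite laD// lf mulr0 add0r.
 apply: lle => //; first by apply: iblD => //; exact: iblZ.
 move: f0 g0; apply: filterS2 => x fx gx; rewrite /r (ger0_norm gx) (gtr0_norm fx) -lerBlDl.
 by rewrite le_max lexx.
have isum k : ibl m (fun x => \sum_(j < k) r (n j) x) by apply: ibl_sum.
have ls k : k%:R * l g <= l (fun x => \sum_(j < k) r (n j) x).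
 elim: k => [|k IH].
  rewrite mul0r (_ : (fun x => _) = fun=> 0) ?l0//; by apply/funext => x; rewrite big_ord0.
 rewrite (_ : (fun x => \sum_(j < k.+1) r (n j) x) = fun x => 1 * r (n k) x + \sum_(j < k) r (n j) x); last first.
  by apply/funext => x; rewrite big_ord_recr/= addrC mul1r.
 by rewrite laD// -natr1 mulrDl !mul1r addrC lerD.
(* [G] exceeds every partial sum of the remainders, each of which contributes at least [l g]. *)
have lG k : k%:R * l g <= l G.
 by apply: le_trans (ls k) _; apply: lle => //; apply: filterS hG => x; apply.
apply/eqP; rewrite eq_le -{2}l0 lle// andbT leNgt; apply/negP => lg0.
have := lG (Num.bound (l G / l g)); rewrite -ler_pdivlMr// leNgt => /negP; apply.
by apply: archi_boundP; rewrite divr_ge0 ?(ltW lg0)// -l0; apply: lle => //; exact: aeW.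
Qed.

End positive_functionals.

(** * Approximation of the global generator *)

Section generator_estimates.
Context {R : realType} {d : nat}.
Local Notation Rd := 'rV[R]_d.
Local Notation leb := (lebesgue_rV R d).
Local Notation e_ i := (delta_mx ord0 i : Rd).
Variables (A C : Rd -> 'M[R]_d) (H : Rd -> Rd) (rho : Rd -> R).
Variables (mu : {measure set Rd -> \bar R}) (p : R).
Hypotheses (d2 : (2 <= d)%N) (dp : d%:R < p).
Hypotheses (hA : assumption_a A C H p) (hmu : invariant_density A C H rho mu p).
Variable S : R -> (Rd -> R) -> Rd -> R.
Hypothesis hL : L1_semigroup A C H rho mu S.
Implicit Types (x y z : Rd) (f g u v w psi U eta : Rd -> R) (i j : 'I_d) (Q V : set Rd).

Let rc := rho_continuous hmu.
Let hS : submarkov_C0_contraction mu setT S. Proof. by case: hL. Qed.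
Local Notation qf := (Aform A).
Local Notation Jf := (Jform A C H rho).

Definition oball n : set Rd := ball (0 : Rd) n.+1%:R.

Lemma oballP n x : oball n x <-> forall i, `|x ord0 i| < n.+1%:R.
Proof.
rewrite /oball ball_rV; split=> [[_ h] i|h].
 by have := h i; rewrite mxE sub0r normrN.
by split=> [|i]; [rewrite ltr0n|rewrite mxE sub0r normrN].
Qed.

Lemma oball_cube n : oball n `<=` cube n.+1%:R.
Proof. by move=> x /oballP h i; exact: ltW. Qed.

Lemma oball_relc n : relatively_compact (oball n).
Proof.
apply: (subclosed_compact _ (@cube_compact R d n.+1%:R)); first exact: closed_closure.
rewrite [X in _ `<=` X](closure_id _).1; last exact: cube_closed.
by move=> y cy B /cy[z [oz Bz]]; exists z; split => //; exact: oball_cube.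
Qed.

Lemma oball_open n : open (oball n). Proof. exact: ball_open. Qed.

Lemma cube_oball (r : R) : exists N, forall n, (N <= n)%N -> cube r `<=` oball n.
Proof.
exists (Num.bound r) => n hn x cx; apply/oballP => i; apply: le_lt_trans (cx i) _.
have [r0|r0] := leP 0 r; last by apply: lt_trans r0 _; rewrite ltr0n.
by apply: lt_le_trans (archi_boundP r0) _; rewrite ler_nat (leq_trans hn).
Qed.

Lemma oball_exhaustion : exhaustion oball.
Proof.
split=> [n|n x /oballP h|].
- by split; [exact: oball_open|exact: oball_relc].
- by apply/oballP => i; apply: lt_trans (h i) _; rewrite ltr_nat.
- apply/seteqP; split => // x _; have [N hN] := cube_oball `|x|.
 by exists N => //; apply: (hN N (leqnn N)) => i; exact: norm_coord.
Qed.

Lemma oball_cvg f : ibl mu f -> Int mu (fun x => `|(f \* \1_(oball n)) x - f x|) @[n --> \oo] --> 0.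
Proof.
move=> hf; rewrite -[X in _ --> X](Int0 mu).
have m1 n : meas (fun x => f x * (\1_(oball n) x : R)).
 apply: measurable_funM; first exact: ibl_meas hf.
 by apply: indic_meas; apply: open_measurable_rV; exact: oball_open.
apply: (@Int_dom _ _ _ _ _ _ (fun x => `|f x|)) => //.
- move=> n; exact: (measurableT_comp _ (measurable_funB (m1 n) (ibl_meas hf))).
- apply: aeW => x; have [N hN] := cube_oball `|x|.
 apply: cvg0P => e e0; exists N => n /hN h /=.
 by rewrite indicE_in ?mulr1 ?subrr ?normr0//; apply: h => i; exact: norm_coord.
- exact: ibl_abs.
- move=> n x /=; rewrite normr_id -[X in _ - X]mulr1 -mulrBr normrM ler_piMr//.
 by rewrite abs_sub01 ?indic01 ?lexx ?ler01.
Qed.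

Lemma local_op_L1 n u w : local_op A C H rho mu (oball n) u w ->
 [/\ ibl mu u, ibl mu w & forall x, ~ oball n x -> u x = 0].
Proof.
move=> [w0 [[[un [_ [/L2fun_Lfun hL2 u0] _ _]] _ _] _ [/Lfun1P hw _] _]]; split => //.
have n0 : 0 < n.+1%:R :> R by rewrite ltr0n.
have [mu1 u2] := hL2.
have iX : ibl mu (cutoff n.+1%:R).
 by apply/(ibl_mu hmu); apply: eq_ibl (test_ibl_c rc (cutoff_test n0)) => x; rewrite mulrC.
apply: ibl_le (iblD iX u2) => // x; have [Vx|Vx] := pselect (oball n x).
 rewrite (cutoff_in n0 (oball_cube Vx)) -[_ ^+ 2]real_normK ?num_real//.
 by move: (`|u x|) (normr_ge0 (u x)) => s s0; have := sqr_ge0 (s - 1); nra.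
rewrite u0// normr0 expr0n addr0; by have /andP[] := cutoff01 n.+1%:R x.
Qed.

Lemma Int_dist_triangle f g h : ibl mu f -> ibl mu g -> ibl mu h ->
 Int mu (fun x => `|f x - h x|) <= Int mu (fun x => `|f x - g x|) + Int mu (fun x => `|g x - h x|).
Proof.
move=> hf hg hh; have i1 := ibl_abs (iblB hf hg); have i2 := ibl_abs (iblB hg hh).
rewrite -IntD//; apply: Int_le; [exact: ibl_abs (iblB hf hh)|exact: iblD|].
by move=> x; have := ler_normD (f x - g x) (g x - h x); rewrite addrA subrK.
Qed.

Lemma abs_triple (a b c h e : R) : `|a - b| < h -> `|b - c| < e / 2 -> h < e / 2 -> `|a - c| < e.
Proof. by move=> h1 h2 h3; have := ler_normD (a - b) (b - c); rewrite addrA subrK; lra. Qed.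

Lemma cvg_le2 (a b c : nat -> R) : (forall n, 0 <= a n) -> (forall n, a n <= b n + c n) ->
 b n @[n --> \oo] --> 0 -> c n @[n --> \oo] --> 0 -> a n @[n --> \oo] --> 0.
Proof.
move=> a0 h hb hc; have := cvg_add hb hc; rewrite addr0; apply: cvg0_le => n.
by rewrite ger0_norm.
Qed.

Lemma cvg_inv_nat (a : nat -> R) : (forall n, 0 <= a n) -> (forall n, a n < n.+1%:R^-1) ->
 a n @[n --> \oo] --> 0.
Proof.
move=> a0 h; have := @cvg_harmonic R 1; apply: cvg0_le => n.
by rewrite ger0_norm// mul1r ltW.
Qed.

(** By uniqueness [u] is the resolvent of [u - w], which is the limit in mean of the resolvents on
    balls. The generators there are closures of [local_op], so each local resolvent may be replaced
    by an element of [local_op] with error below [1 / (n + 1)]. This is the bridge from the global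
    generator to the local forms. *)
Lemma gen_local_approx u w : generator mu setT S u w -> exists un wn,
 [/\ forall n, local_op A C H rho mu (oball n) (un n) (wn n),
   forall n, ibl mu (un n) /\ ibl mu (wn n),
   Int mu (fun x => `|un n x - u x|) @[n --> \oo] --> 0 &
   Int mu (fun x => `|wn n x - w x|) @[n --> \oo] --> 0].
Proof.
move=> gu; have [hu hw _] := gen_eps hS gu.
have [_ [[GV [G [hloc hres hcv]]] _]] := hL.
have [f fE] : {f | forall x, f x = u x - w x} by exists (fun x => u x - w x).
have hf : ibl mu f by apply: eq_ibl (iblB hu hw) => x; rewrite fE.
have hG := hres 1 f ltr01 ((Lp_onT _ _).2 hf).
have [hg hg' _] := gen_eps hS hG.
have ug : {ae mu, forall x, u x = G 1 f x}.
 apply: (gen_unique hS gu); move: hG; congr generator.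
 by apply/funext => x; rewrite mul1r fE.
pose fn n := f \* \1_(oball n); pose Gn n := GV (oball n) 1 (fn n).
have mf n : meas (\1_(oball n) : Rd -> R).
 by apply: indic_meas; apply: open_measurable_rV; exact: oball_open.
have hfn n : ibl mu (fn n) by apply: (iblMb hf (mf n)) => x; exact: indic_le1.
have hfnV n : Lp_on mu 1%:E (oball n) (fn n).
 by split=> [|x nx]; [apply/Lfun1P|rewrite /fn /= indicE_out// mulr0].
have cv := hcv oball 1 f oball_exhaustion ltr01 ((Lp_onT _ _).2 hf).
have hn n : ibl mu (Gn n) /\ exists uw : (Rd -> R) * (Rd -> R), [/\ local_op A C H rho mu (oball n) uw.1 uw.2,
  ibl mu uw.1 /\ ibl mu uw.2,
  Int mu (fun x => `|uw.1 x - Gn n x|) < n.+1%:R^-1 &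
  Int mu (fun x => `|uw.2 x - (Gn n x - fn n x)|) < n.+1%:R^-1].
 have [S' [hS' geq rs]] := hloc (oball n) (@oball_open n) (@oball_relc n).
 have gl := (geq _ _).1 (rs 1 (fn n) ltr01 (hfnV n)).
 have [[/Lfun1P h1 _] [/Lfun1P h2 _] [us [ws [hop cu cw]]]] := gl.
 split => //; have iu k := local_op_L1 (hop k).
 have cu' := (Lpcvg1P (fun k => let: And3 a _ _ := iu k in a) h1).1 cu.
 have cw' := (Lpcvg1P (fun k => let: And3 _ a _ := iu k in a) h2).1 cw.
 have n0 : 0 < n.+1%:R^-1 :> R by rewrite invr_gt0 ltr0n.
 have [N hN] := cvg0_eN cu' n0; have [N' hN'] := cvg0_eN cw' n0.
 exists (us (maxn N N'), ws (maxn N N')) => /=; have [a b _] := iu (maxn N N').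
 split => //; first by apply: le_lt_trans (hN _ (leq_maxl _ _)); exact: ler_norm.
 apply: le_lt_trans (hN' _ (leq_maxr N N')); apply: le_trans (ler_norm _).
 apply: eq_ler; apply: eq_Int => x.
 by rewrite mul1r.
have hGn n := (hn n).1; have /choice[uw huw] := fun n => (hn n).2.
exists (fun n => (uw n).1), (fun n => (uw n).2).
have cvG := (Lpcvg1P hGn hg).1 cv.
have e0 : Int mu (fun x => `|(uw n).1 x - Gn n x|) @[n --> \oo] --> 0.
 by apply: cvg_inv_nat => k; [exact: Int_ge0|have [] := huw k].
have cu : Int mu (fun x => `|(uw n).1 x - u x|) @[n --> \oo] --> 0.
 apply: (@cvg_le2 _ _ _ _ _ e0 cvG) => n; first exact: Int_ge0.
 have [_ [a b] _ _] := huw n.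
 have -> : Int mu (fun x => `|(uw n).1 x - u x|) = Int mu (fun x => `|(uw n).1 x - G 1 f x|).
  apply: ae_eq_Int; [exact: ibl_meas (ibl_abs (iblB a hu))|exact: ibl_meas (ibl_abs (iblB a hg))|].
  by apply: filterS ug => x ->.
 exact: Int_dist_triangle.
split => // [n|n|]; [by have [] := huw n|by have [] := huw n|].
have e1 : Int mu (fun x => `|(uw n).2 x - (Gn n x - fn n x)|) @[n --> \oo] --> 0.
 by apply: cvg_inv_nat => k; [exact: Int_ge0|have [] := huw k].
have e2 := cvg_add cvG (oball_cvg hf); rewrite addr0 in e2.
apply: (@cvg_le2 _ _ _ _ _ e1 e2) => n; first exact: Int_ge0.
have [_ [a b] _ _] := huw n; have i1 := iblB (hGn n) (hfn n); have i2 := iblB hg hf.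
apply: le_trans (Int_dist_triangle b i1 hw) _; rewrite lerD2l.
have -> : Int mu (fun x => `|Gn n x - fn n x - w x|) = Int mu (fun x => `|Gn n x - fn n x - (G 1 f x - f x)|).
 apply: ae_eq_Int; [exact: ibl_meas (ibl_abs (iblB i1 hw))|exact: ibl_meas (ibl_abs (iblB i1 i2))|].
 by apply: filterS ug => x <-; rewrite fE; congr `|_|; ring.
rewrite -IntD; [|exact: ibl_abs (iblB (hGn n) hg)|exact: ibl_abs (iblB (hfn n) hf)].
apply: Int_le; [exact: ibl_abs (iblB i1 i2)|exact: iblD (ibl_abs (iblB (hGn n) hg)) (ibl_abs (iblB (hfn n) hf))|] => x.
rewrite (_ : Gn n x - fn n x - (G 1 f x - f x) = (Gn n x - G 1 f x) - (fn n x - f x)); last by ring.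
exact: ler_normB.
Qed.

Lemma weighted_cvg (g : R -> R) (L M : R) (un wn psin : nat -> Rd -> R) u w :
 continuous g -> (forall s, `|g s| <= L) -> (forall s t, `|g s - g t| <= L * `|s - t|) ->
 (forall n, ibl mu (un n)) -> (forall n, ibl mu (wn n)) -> ibl mu u -> ibl mu w ->
 (forall n, meas (psin n)) -> (forall n x, `|psin n x| <= M) ->
 Int mu (fun x => `|un n x - u x|) @[n --> \oo] --> 0 ->
 Int mu (fun x => `|wn n x - w x|) @[n --> \oo] --> 0 ->
 (forall n, ibl mu (fun x => wn n x * (g (un n x) * psin n x))) /\
 (forall n, ibl mu (fun x => w x * (g (u x) * psin n x))) /\
 Int mu (fun x => wn n x * (g (un n x) * psin n x)) - Int mu (fun x => w x * (g (u x) * psin n x))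
  @[n --> \oo] --> 0.
Proof.
move=> cg gL lip iun iwn iu iw mp pM cu cw.
have L0 : 0 <= L by apply: le_trans (gL 0).
have M0 : 0 <= M by apply: le_trans (pM 0%N 0).
have mg (h : Rd -> R) : ibl mu h -> meas (fun x => g (h x)).
 by move=> /ibl_meas mh; apply: (@measurableT_comp _ _ _ _ _ _ g) => //; exact: continuous_measurable_fun.
have bg (h : Rd -> R) n x : `|g (h x) * psin n x| <= L * M by rewrite normrM ler_pM.
have mgp (h : Rd -> R) n : ibl mu h -> meas (fun x => g (h x) * psin n x).
 by move=> ih; apply: measurable_funM => //; exact: mg.
have i1 n : ibl mu (fun x => wn n x * (g (un n x) * psin n x)).
 by apply: (iblMb (iwn n) (mgp _ n (iun n))) => x; exact: bg.
have i2 n : ibl mu (fun x => w x * (g (u x) * psin n x)).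
 by apply: (iblMb iw (mgp _ n iu)) => x; exact: bg.
split => //; split => //.
have iz n : ibl mu (fun x => g (un n x) - g (u x)).
 apply: ibl_le (iblZ L (ibl_abs (iblB (iun n) iu))) => [|x]; last exact: lip.
 by apply: measurable_funB; exact: mg.
have z0 : Int mu (fun x => `|g (un n x) - g (u x)|) @[n --> \oo] --> 0.
 have := @cvg_mull _ L _ _ cu; rewrite mulr0; apply: cvg0_le => n.
 rewrite ger0_norm ?Int_ge0// -IntZ; last exact: ibl_abs (iblB (iun n) iu).
 by apply: Int_le; [exact: ibl_abs|exact: iblZ (ibl_abs (iblB (iun n) iu))|move=> x; exact: lip].
have bz n x : `|g (un n x) - g (u x)| <= 2 * L by exact: abs_sub_le2.
have wz := Int_wcvg0 iw iz bz z0.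
have := cvg_add (@cvg_mull _ (L * M) _ _ cw) (@cvg_mull _ M _ _ wz); rewrite !mulr0 addr0.
apply: cvg0_le => n; rewrite -IntB//; apply: le_trans (Int_abs (iblB (i1 n) (i2 n))) _.
have j1 := ibl_abs (iblB (iwn n) iw).
have j2 : ibl mu (fun x => `|w x * (g (un n x) - g (u x))|).
 by apply: ibl_abs; apply: (iblMb iw (ibl_meas (iz n))) => x; exact: bz.
rewrite -!IntZ// -IntD; [|exact: iblZ|exact: iblZ].
apply: Int_le; [exact: ibl_abs (iblB (i1 n) (i2 n))|by apply: iblD; exact: iblZ|] => x.
rewrite (_ : _ - _ = (wn n x - w x) * (g (un n x) * psin n x) + psin n x * (w x * (g (un n x) - g (u x)))); last by ring.
apply: le_trans (ler_normD _ _) _; rewrite !(normrM (wn n x - w x)) (normrM (psin n x)); apply: lerD.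
 by rewrite mulrC ler_wpM2r.
by rewrite ler_wpM2r.
Qed.

Lemma Jform_algebra0 (h a a' b c e : R) : a = a' -> b = 0 -> c = 0 -> e = 0 ->
 - (h * a) - h * b - c - h * e = - (h * a').
Proof. by move=> -> -> -> ->; rewrite !mulr0 !subr0. Qed.

(** The cutoff is 1 on the ball that carries [U], and [trap 0 = 0]. All terms with a derivative of
    the cutoff vanish, and the penalty energy is left. *)
Lemma Jform_trap n U : test_fun (oball n) U ->
 Jf trap trap1 trap2 (cutoff n.+1%:R) U = - (2^-1 * Int leb (fun x => rho x * (trap2 (U x) * qf U U x))).
Proof.
move=> tU; have n0 : 0 < n.+1%:R :> R by rewrite ltr0n.
have X1 x : oball n x -> cutoff n.+1%:R x = 1 by move=> /oball_cube; exact: cutoff_in.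
have dX i x : oball n x -> pderiv i (cutoff n.+1%:R) x = 0.
 move=> ox; rewrite -(pderiv_cst 1 i x); apply: near_pderiv.
 have : nbhs x (oball n) by apply: open_nbhs_nbhs; split => //; exact: oball_open.
 by apply: filterS => y /X1.
have t0 : trap 0 = 0 :> R by have [] := @trap_in R 0; rewrite ?lexx ?ler01.
have Z (f : Rd -> R) : (forall x, f x = 0) -> Int leb f = 0.
 by move=> h; rewrite (eq_Int _ h) Int0.
apply: Jform_algebra0.
- apply: eq_Int => x; have [ox|ox] := pselect (oball n x); first by rewrite X1// mulr1.
 rewrite [qf U U x](_ : _ = 0) ?mulr0// /Aform big1// => i _; apply: big1 => j _.
 by rewrite (pderiv_out j tU ox) mul0r mulr0.
- apply: Z => x; rewrite [qf _ _ x](_ : _ = 0) ?mulr0// /Aform big1// => i _; apply: big1 => j _.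
 have [ox|ox] := pselect (oball n x); first by rewrite (dX i x ox) !mulr0.
 by rewrite (pderiv_out j tU ox) mul0r mulr0.
- apply: Z => x; have [ox|ox] := pselect (oball n x); last by rewrite (test_out tU ox) t0 mul0r.
 by rewrite big1 ?mulr0// => i _; rewrite (dX i x ox) mulr0.
- apply: Z => x; rewrite [qC _ _ _ x](_ : _ = 0) ?mulr0// /qC big1// => i _; apply: big1 => j _.
 have [ox|ox] := pselect (oball n x); first by rewrite (dX j x ox) !mulr0.
 by rewrite (pderiv_out i tU ox) mul0r mulr0.
Qed.

Lemma L2cvg_L1_mu n Us u : (forall k, test_fun (oball n) (Us k)) -> (forall x, ~ oball n x -> u x = 0) ->
 ibl mu u -> L2cvg leb Us u -> Int mu (fun x => `|Us k x - u x|) @[k --> \oo] --> 0.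
Proof.
move=> tU u0 iu hU; have [U1 U2 U3] := hU; have n0 : 0 < n.+1%:R :> R by rewrite ltr0n.
have tX : testT (@cutoff R d n.+1%:R) by exact: cutoff_test.
have iU k : ibl mu (Us k).
 apply/(ibl_mu hmu); apply: eq_ibl (test_ibl_c rc (tU k)) => x; exact: mulrC.
have LX : L2fun leb (fun x => rho x * cutoff n.+1%:R x).
 split; first by apply: measurable_funM; [exact: fun_measurable|exact: test_measurable tX].
 have h := test_ibl_c (fun_continuousM rc rc) (test_funM tX (test_Coo tX)).
 by apply: eq_ibl h => x; ring.
have hA' : L2cvg leb (fun k x => `|Us k x - u x|) (fun=> 0).
 have Ld k := L2funB (U1 k) U2.
 have La k : L2fun leb (fun x => `|Us k x - u x|).
  have [m1 i1] := Ld k; split; first exact: measurableT_comp.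
  by apply: eq_ibl i1 => x; rewrite real_normK ?num_real.
 split => //.
  split; first exact: measurable_cst.
  by apply: eq_ibl (ibl0 leb) => x; rewrite expr0n.
 apply: cvg_ext U3 => k; apply: eq_Int => x.
 by rewrite subr0 real_normK ?num_real.
have := L2cvg_Int hA' LX.
rewrite (_ : Int leb (fun x => 0 * _) = 0); last first.
 by rewrite -[RHS](Int0 leb); apply: eq_Int => x; rewrite mul0r.
apply: cvg_ext => k; apply: esym; apply: etrans (Int_mu hmu (ibl_abs (iblB (iU k) iu))) _.
apply: eq_Int => x; have [ox|ox] := pselect (oball n x).
 by rewrite (cutoff_in n0 (oball_cube ox)) mulr1.
by rewrite (test_out (tU k) ox) u0// subr0 normr0 !mul0r.
Qed.

(** Applied to [trap], the local identity has the limit 0, because [trap1(u) = 0] when [u] takes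
    values in [0, 1]; hence the penalty energy of the approximants tends to 0. A diagonal choice
    makes one sequence serve the penalty and the given profile together. *)
Lemma gen_test_approx u w (f0 f1 f2 : R -> R) (L : R) psi : generator mu setT S u w ->
 {ae mu, forall x, 0 <= u x <= 1} -> profile f0 f1 f2 L -> testT psi ->
 exists Us, [/\ forall n, testT (Us n),
  Int mu (fun x => `|Us n x - u x|) @[n --> \oo] --> 0,
  Int leb (fun x => rho x * (trap2 (Us n x) * qf (Us n) (Us n) x)) @[n --> \oo] --> 0 &
  Jf f0 f1 f2 psi (Us n) @[n --> \oo] --> Int mu (fun x => w x * (f1 (u x) * psi x))].
Proof.
move=> gu u01 pf tp; have [iu iw _] := gen_eps hS gu.
have [un [wn [hop hi cu cw]]] := gen_local_approx gu.
have [Lt tr] := @trap_profile R.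
have n0 n : 0 < n.+1%:R^-1 :> R by rewrite invr_gt0 ltr0n.
have N0 n : 0 < n.+1%:R :> R by rewrite ltr0n.
have tX n : testT (@cutoff R d n.+1%:R) by exact: cutoff_test.
have t10 : trap1 0 = 0 :> R by have [] := @trap_in R 0; rewrite ?lexx ?ler01.
have hn n : exists U, [/\ test_fun (oball n) U, Int mu (fun x => `|U x - un n x|) < n.+1%:R^-1,
  `|Jf trap trap1 trap2 (cutoff n.+1%:R) U - Int mu (fun x => wn n x * (trap1 (un n x) * cutoff n.+1%:R x))| < n.+1%:R^-1 &
  (test_fun (oball n) psi -> `|Jf f0 f1 f2 psi U - Int mu (fun x => wn n x * (f1 (un n x) * psi x))| < n.+1%:R^-1)].
 have [Us [tU cU hJ]] := local_identity d2 dp hA hmu (@oball_relc n) (hop n).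
 have [iun iwn un0] := local_op_L1 (hop n).
 have [k1 hk1] := cvg0_eN (L2cvg_L1_mu tU un0 iun cU) (n0 n).
 have [k2 hk2] := cvg_eN (hJ _ _ _ _ _ tr (tX n) (or_intror t10)) (n0 n).
 (* For small [n] the support of [psi] may exceed the ball, and nothing is asked of the given
    profile then. *)
 have [tV|ntV] := pselect (test_fun (oball n) psi).
  have [k3 hk3] := cvg_eN (hJ _ _ _ _ _ pf tp (or_introl tV)) (n0 n).
  exists (Us (maxn k1 (maxn k2 k3))); split => //.
  - by apply: le_lt_trans (ler_norm _) (hk1 _ _); rewrite leq_maxl.
  - by apply: hk2; rewrite leq_max leq_maxl orbT.
  - by move=> _; apply: hk3; rewrite leq_max leq_maxr orbT.
 exists (Us (maxn k1 k2)); split => //.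
 - by apply: le_lt_trans (ler_norm _) (hk1 _ _); rewrite leq_maxl.
 - by apply: hk2; rewrite leq_maxr.
have /choice[U hU] := hn; exists U.
have iU n : ibl mu (U n).
 have [t _ _ _] := hU n.
 by apply/(ibl_mu hmu); apply: eq_ibl (test_ibl_c rc t) => x; exact: mulrC.
have iun n := (hi n).1; have iwn n := (hi n).2.
split.
- by move=> n; have [t _ _ _] := hU n; exact: test_funS t.
- have e1 : Int mu (fun x => `|U n x - un n x|) @[n --> \oo] --> 0.
  by apply: cvg_inv_nat => n; [exact: Int_ge0|have [] := hU n].
 apply: (@cvg_le2 _ _ _ _ _ e1 cu) => n; first exact: Int_ge0.
 exact: Int_dist_triangle.
- have c1 := smooth_continuous (pf_smooth1 tr).
 have X1 n x : `|cutoff n.+1%:R x| <= 1 by have /andP[a b] := cutoff01 n.+1%:R x; rewrite ger0_norm.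
 have [_ [_ h]] := weighted_cvg c1 (pf_bound1 tr) (pf_lip1 tr) iun iwn iu iw (fun n => test_measurable (tX n)) X1 cu cw.
 have Z n : Int mu (fun x => w x * (trap1 (u x) * cutoff n.+1%:R x)) = 0.
  rewrite -[RHS](Int0 mu); apply: ae_eq_Int; last first.
  + by apply: filterS u01 => x /trap_in[_ -> _]; rewrite mul0r mulr0.
  + exact: measurable_cst.
  + apply: measurable_funM; first exact: ibl_meas iw.
   apply: measurable_funM; last exact: test_measurable (tX n).
   apply: (@measurableT_comp _ _ _ _ _ _ trap1); [exact: continuous_measurable_fun|exact: ibl_meas iu].
 have {}h : Int mu (fun x => wn n x * (trap1 (un n x) * cutoff n.+1%:R x)) @[n --> \oo] --> 0.
  by apply: cvg_ext h => n; rewrite Z subr0.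
 have e1 : `|Jf trap trap1 trap2 (cutoff n.+1%:R) (U n) - Int mu (fun x => wn n x * (trap1 (un n x) * cutoff n.+1%:R x))|
   @[n --> \oo] --> 0.
  by apply: cvg_inv_nat => n; [exact: normr_ge0|have [] := hU n].
 have e2 : Jf trap trap1 trap2 (cutoff n.+1%:R) (U n) - Int mu (fun x => wn n x * (trap1 (un n x) * cutoff n.+1%:R x))
   @[n --> \oo] --> 0 by apply: cvg0_le e1 => n.
 have := @cvg_mull _ (- 2) _ _ (cvg_add e2 h); rewrite addr0 mulr0; apply: cvg_ext => n.
 have [t _ _ _] := hU n; rewrite subrK (Jform_trap t); set I := Int _ _.
 by rewrite mulrNN mulrA divff ?mul1r// pnatr_eq0.
- have c1 := smooth_continuous (pf_smooth1 pf); have [Mp _ hMp] := test_bounded tp.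
 have [_ [_ h]] := weighted_cvg c1 (pf_bound1 pf) (pf_lip1 pf) iun iwn iu iw (fun=> test_measurable tp) (fun=> hMp) cu cw.
 have [_ kp _] := tp; have [r r0' hr] := compact_cube kp; have [N hN] := cube_oball r.
 have tV n : (N <= n)%N -> test_fun (oball n) psi.
  by move=> nN; have [a b _] := tp; split => //; apply: subset_trans hr _; exact: hN.
 apply: cvg0_sub; apply: cvg0P => e e0; have e2 : 0 < e / 2 by rewrite divr_gt0.
 have [k hk] := cvg0_eN h e2; have [k' hk'] := cvg0_eN (@cvg_harmonic R 1) e2.
 exists (maxn N (maxn k k')) => n; rewrite !geq_max => /and3P[/tV t /hk a /hk' b].
 have [_ _ _ /(_ t) c] := hU n; rewrite mul1r ger0_norm ?(ltW (n0 n))// in b.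
 exact: abs_triple c a b.
Qed.

(** * Caccioppoli estimates *)

Let ac i j : continuous (fun x => A x i j) := A_continuous hA (i:=i) (j:=j).
Let Ccont i j : continuous (fun x => C x i j) := C_continuous hA (i:=i) (j:=j).
Let dgt0 : (0 < d)%N := ltn_trans (ltn0Sn 0) d2.
Local Notation flux := (flux A C H rho).

Definition flux_abs x := \sum_i `|flux i x|.

Lemma localizer_pderiv Q eta (M : R) i x : localizer Q eta M -> ~ Q x -> pderiv i eta x = 0.
Proof. by move=> [_ cQ h _ _] Qx; apply: pderiv_support => /(support_sub cQ h). Qed.

Lemma coef_bounds (r : R) : exists2 K : R, 0 <= K & forall x i j, cube r x -> `|A x i j| <= K /\ `|C x i j| <= K.
Proof.
have cr := @cube_compact R d r.
have /choice[a ha] (ij : 'I_d * 'I_d) : exists M : R, 0 <= M /\ forall x, cube r x -> `|A x ij.1 ij.2| <= M /\ `|C x ij.1 ij.2| <= M.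
 have [M M0 hM] := compact_fun_bounded cr (@ac ij.1 ij.2).
 have [N N0 hN] := compact_fun_bounded cr (@Ccont ij.1 ij.2).
 exists (M + N); split; first exact: addr_ge0.
 by move=> x cx; split; [apply: le_trans (hM x cx) _; rewrite lerDl|apply: le_trans (hN x cx) _; rewrite lerDr].
exists (\sum_ij a ij); first by apply: sumr_ge0 => ij _; have [] := ha ij.
move=> x i j cx; have [_ /(_ x cx)[h1 h2]] := ha (i, j).
have le : a (i, j) <= \sum_ij a ij.
 by rewrite (bigD1 (i, j))//= lerDl; apply: sumr_ge0 => ij _; have [] := ha ij.
by split; [exact: le_trans h1 le|exact: le_trans h2 le].
Qed.

Lemma qf_ge0 r f x : cube r x -> 0 <= qf f f x.
Proof.
have [nu nu0 h] := qf_bounds hA r; move=> cx; have /andP[+ _] := h f x cx.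
by apply: le_trans; rewrite mulr_ge0 ?invr_ge0 ?(ltW nu0)// sumr_ge0// => i _; exact: sqr_ge0.
Qed.

Lemma ibl_flux_abs Q eta (M : R) f : localizer Q eta M -> meas f ->
 (exists L, forall x, `|f x| <= L) -> ibl leb (fun x => flux_abs x * eta x * f x).
Proof.
move=> [te _ _ e01 _] mf [L hb].
have h i : ibl leb (fun x => `|flux i x * eta x|) by apply: ibl_abs; exact: powloc_test (flux_powloc1 d2 dp hA hmu i) te.
have h2 : ibl leb (fun x => \sum_i `|flux i x * eta x|) by apply: ibl_sum => i _; exact: h.
have h3 : ibl leb (fun x => (\sum_i `|flux i x * eta x|) * f x) by exact: (iblMb h2 mf hb).
apply: eq_ibl h3 => x; rewrite /flux_abs !mulr_suml; apply: eq_bigr => i _.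
by rewrite normrM [`|eta x|]ger0_norm//; have /andP[] := e01 x.
Qed.

Lemma ibl_closed_bounded r Q f L : closed Q -> Q `<=` cube r -> meas f ->
 (forall x, `|f x| <= L) -> ibl leb (fun x => \1_Q x * f x).
Proof.
move=> cQ Qr mf fL; have kQ : compact Q := subclosed_compact cQ (@cube_compact R d r) Qr.
apply: (@ibl_bounded _ _ Q _ L) => //.
- by apply: measurable_funM => //; apply: indic_meas; exact: closed_measurable_rV.
- by move=> x Qx; rewrite indicE_in// mul1r.
- by move=> x Qx; rewrite indicE_out// mul0r.
Qed.

(** Caccioppoli's inequality with the test function [f1(U) eta^2]. The constants depend on the cube
    alone: levels, cutoffs and profiles are to vary later, and in the De Giorgi iteration infinitely
    many of them share one constant. *)
Lemma gradient_test (r : R) : 0 < r -> exists K1 K2 : R, [/\ 0 <= K1, 0 <= K2 &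
 forall Q eta (M : R) (f0 f1 f2 h h1 m : R -> R) (L c : R) U,
 localizer Q eta M -> Q `<=` cube r -> mprofile f0 f1 f2 h h1 m L c -> testT U ->
 Int leb (fun x => eta x * eta x * (h1 (U x) * h1 (U x)) * \sum_i pderiv i U x ^+ 2) <=
 K1 * (- Jf f0 f1 f2 (fun x => eta x * eta x) U
    + c * Int leb (fun x => rho x * (trap2 (U x) * qf U U x)))
  + K2 * (M ^+ 2 * Int leb (fun x => \1_Q x * m (U x) ^+ 2)
     + M * Int leb (fun x => flux_abs x * eta x * `|f0 (U x)|))].
Proof.
move=> rp; have [c0 [M0 [c00 hcM]]] := rho_bounds hmu r.
have [nu nu0 hnu] := qf_bounds hA r; have [K K0 hK] := coef_bounds r.
have M00 : 0 <= M0.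
 have /hcM/andP[h1 h2] : cube r (0 : Rd) by move=> i; rewrite mxE normr0 ltW.
 by move: (rho _) h1 h2 => s h1 h2; lra.
have [K' K'E] : {k | k = 2 * K * d%:R} by exists (2 * K * d%:R).
have K'0 : 0 <= K' by rewrite K'E !mulr_ge0.
have [K3 K3E] : {k | k = d%:R * nu * K' ^+ 2 * M0} by exists (d%:R * nu * K' ^+ 2 * M0).
have K30 : 0 <= K3 by rewrite K3E !mulr_ge0 ?sqr_ge0// ltW.
have [K1 K1E] : {k | k = 4 * nu / c0} by exists (4 * nu / c0).
have K10 : 0 <= K1 by rewrite K1E divr_ge0 ?mulr_ge0// ltW.
exists K1, (K1 * (K3 + 2)); split => //.
 by rewrite mulr_ge0 ?addr_ge0.
move=> Q eta M f0 f1 f2 h h1 m L c U loc Qr mp tU.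
have [te cQ e0 e01 eM] := loc; have ce := test_Coo te; have cU := test_Coo tU.
have pf := mp_profile mp; have cg0 := mp_c mp.
have Md i (x : Rd) : 0 <= M by apply: le_trans (eM i x).
have MM : 0 <= M := Md (Ordinal dgt0) 0.
have L0 : 0 <= L := le_trans (normr_ge0 _) (mp_bound0 mp 0).
have q0 x : 0 <= qf U U x by apply: (@qf_ge0 `|x|) => i; exact: norm_coord.
have [psi psiE] : {psi : Rd -> R | forall x, psi x = eta x * eta x} by exists (fun x => eta x * eta x).
have tp : testT psi by rewrite (funext psiE); exact: test_funM.
have dpsi i x : pderiv i psi x = 2 * (eta x * pderiv i eta x).
 by rewrite (funext psiE) pderivM//; ring.
have psi_out x : ~ Q x -> psi x = 0 by move=> /e0 ex; rewrite psiE ex mul0r.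
have dpsi_out i x : ~ Q x -> pderiv i psi x = 0 by move=> /(localizer_pderiv i loc) ex; rewrite dpsi ex !mulr0.
rewrite -(funext psiE).
have [w wE] : {w : Rd -> R | forall x, w x = psi x * (h1 (U x) * h1 (U x)) * \sum_i pderiv i U x ^+ 2}.
 by exists (fun x => psi x * (h1 (U x) * h1 (U x)) * \sum_i pderiv i U x ^+ 2).
have ch1 : Coo (fun x => h1 (U x)) := Coo_comp (mp_smooth1 mp) cU.
have ch : Coo (fun x => h (U x)) := Coo_comp (mp_smooth mp) cU.
have cf1 := Coo_comp (pf_smooth1 pf) cU; have cf2 := Coo_comp (pf_smooth2 pf) cU.
have tt2 : testT (fun x => trap2 (U x)).
 by apply: test_comp => //; [exact: smooth_trap2|have [] := @trap_in R 0; rewrite ?lexx ?ler01].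
have iX : ibl leb (fun x => rho x * (h1 (U x) * h1 (U x) * psi x * qf U U x)).
 by apply: (ibl_qf hA hmu (t := fun x => h1 (U x) * h1 (U x) * psi x)) => //; apply: test_funMr => //; exact: CooM.
have iT1 : ibl leb (fun x => rho x * (f2 (U x) * psi x * qf U U x)).
 by apply: (ibl_qf hA hmu (t := fun x => f2 (U x) * psi x)) => //; exact: test_funMr.
have iE : ibl leb (fun x => rho x * (trap2 (U x) * qf U U x)) by exact: (ibl_qf hA hmu tt2).
have iT2 : ibl leb (fun x => rho x * (f1 (U x) * qf U psi x)) by exact: (ibl_qf1 hA hmu).
have iT4 : ibl leb (fun x => rho x * (f1 (U x) * qC C U psi x)) by exact: (ibl_qC hA hmu).
have iT3 : ibl leb (fun x => f0 (U x) * \sum_i flux i x * pderiv i psi x).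
 have h' : ibl leb (fun x => \sum_i flux i x * (f0 (U x) * pderiv i psi x)).
  apply: ibl_sum => i _; apply: powloc_test (flux_powloc1 d2 dp hA hmu i) _.
  exact: (test_funMr (test_pderiv i tp) (Coo_comp (pf_smooth0 pf) cU)).
 by apply: eq_ibl h' => x; rewrite mulr_sumr; apply: eq_bigr => i _; ring.
have mU (g : R -> R) : continuous g -> meas (fun x => g (U x)).
 move=> cg; apply: (@measurableT_comp _ _ _ _ _ _ g); first exact: continuous_measurable_fun.
 exact: Coo_measurable.
have iY : ibl leb (fun x => \1_Q x * m (U x) ^+ 2).
 apply: (ibl_closed_bounded (L := L ^+ 2) cQ Qr).
  by apply: measurable_funX; exact: mU (mp_cont mp).
 move=> x; rewrite ger0_norm ?sqr_ge0//.
 by rewrite -[leLHS]real_normK ?num_real//; apply: lerXn2r; rewrite ?nnegrE// (mp_mb mp).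
have iZ : ibl leb (fun x => flux_abs x * eta x * `|f0 (U x)|).
 apply: (ibl_flux_abs loc).
  by apply: measurableT_comp => //; apply: mU; exact: smooth_continuous (pf_smooth0 pf).
 by exists L => x; rewrite normr_id (mp_bound0 mp).
(* The energy of [h(U)] against the leading term of [Jform], up to the penalty that [mp_slack]
   allows. *)
have pt1 x : rho x * (h1 (U x) * h1 (U x) * psi x * qf U U x) <=
  rho x * (f2 (U x) * psi x * qf U U x) + c * (rho x * (trap2 (U x) * qf U U x)).
 have r0 := ltW (rho_gt0 hmu x); have t0 := @trap2_ge0 R (U x).
 have p01 : 0 <= psi x <= 1.
  have /andP[a1 a2] := e01 x; rewrite psiE mulr_ge0//=.
  by apply: le_trans (ler_wpM2l a1 a2) _; rewrite mulr1.
 have s := mp_slack mp (U x); rewrite expr2 in s.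
 have -> : rho x * (f2 (U x) * psi x * qf U U x) + c * (rho x * (trap2 (U x) * qf U U x)) =
   rho x * ((f2 (U x) * psi x + c * trap2 (U x)) * qf U U x) by ring.
 rewrite ler_wpM2l// ler_wpM2r//; move/andP : p01 => [p0' p1'].
 exact: slack_real (mulr_ge0 cg0 t0) s.
(* The mixed terms from [A] and [C]: the factorization [f1 = m h1] lets Young's inequality absorb
   [h1] and the gradient of [U] in the energy, leaving [m^2]. *)
have pt2 x : - (2^-1 * (rho x * (f1 (U x) * qf U psi x))) - 2^-1 * (rho x * (f1 (U x) * qC C U psi x)) <=
  4^-1 * (rho x * (h1 (U x) * h1 (U x) * psi x * qf U U x)) + K3 * M ^+ 2 * (\1_Q x * m (U x) ^+ 2).
 have r0 := ltW (rho_gt0 hmu x).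
 have [Qx|Qx] := pselect (Q x); last first.
  rewrite [qf U psi x](_ : _ = 0); last first.
   by rewrite /Aform big1// => i _; apply: big1 => j _; rewrite dpsi_out// !mulr0.
  rewrite [qC _ U psi x](_ : _ = 0); last first.
   by rewrite /qC big1// => i _; apply: big1 => j _; rewrite dpsi_out// !mulr0.
  by rewrite psi_out// indicE_out// !(mulr0, mul0r) subr0 oppr0 addr0.
 have cx := Qr x Qx; rewrite indicE_in// mul1r.
 have /andP[ex0 _] := e01 x.
 pose v := \sum_j `|pderiv j U x|.
 have gle : \sum_i `|pderiv i psi x| <= d%:R * (2 * (eta x * M)).
  apply: le_trans (_ : \sum_(i < d) 2 * (eta x * M) <= _); last by rewrite sumr_const card_ord -[leLHS]mulr_natl.
  apply: ler_sum => i _; rewrite dpsi !normrM (ger0_norm ex0) ger0_norm// ler_wpM2l// ler_wpM2l//.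
 have v0 : 0 <= v by apply: sumr_ge0 => j _.
 have B1 : `|qf U psi x| <= K * (v * (d%:R * (2 * (eta x * M)))).
  apply: le_trans (@bilin_bound R d K (fun i j => A x i j) (fun j => pderiv j U x) (fun i => pderiv i psi x) _) _.
   by move=> i j; have [] := hK x i j cx.
  by rewrite ler_wpM2l// ler_wpM2l.
 have B2 : `|qC C U psi x| <= K * (v * (d%:R * (2 * (eta x * M)))).
  rewrite /qC exchange_big /=.
  apply: le_trans (@bilin_bound R d K (fun i j => C x i j) (fun j => pderiv j U x) (fun i => pderiv i psi x) _) _.
   by move=> i j; have [] := hK x i j cx.
  by rewrite ler_wpM2l// ler_wpM2l.
 have vP : v ^+ 2 <= d%:R * \sum_i pderiv i U x ^+ 2.
  apply: le_trans (sqr_sum_le _) _; rewrite ler_wpM2l//; apply: ler_sum => i _.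
  by rewrite real_normK ?num_real.
 have Pq : \sum_i pderiv i U x ^+ 2 <= nu * qf U U x.
  by have /andP[+ _] := hnu U x cx; rewrite ler_pdivrMl.
 have Y := young_absorb (m (U x)) (h1 (U x)) dgt0 nu0 K'0 MM r0 ex0 vP Pq.
 have N1 : - (2^-1 * (rho x * (f1 (U x) * qf U psi x))) - 2^-1 * (rho x * (f1 (U x) * qC C U psi x)) <=
   rho x * (`|m (U x) * h1 (U x)| * (K' * (v * (eta x * M)))).
  have F := mp_f1 mp (U x).
  have := @cross_bound R (rho x) (f1 (U x)) _ _ K d%:R v (eta x * M) r0 B1 B2.
  by rewrite -K'E {3}F.
 apply: le_trans N1 (le_trans Y _); rewrite psiE lerD//.
 rewrite K3E; have /andP[_ rM] := hcM x cx.
 rewrite (_ : d%:R * nu * K' ^+ 2 * (M ^+ 2 * (rho x * m (U x) ^+ 2)) = (d%:R * nu * K' ^+ 2 * M ^+ 2) * (rho x * m (U x) ^+ 2)); last by ring.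
 rewrite (_ : d%:R * nu * K' ^+ 2 * M0 * M ^+ 2 * m (U x) ^+ 2 = (d%:R * nu * K' ^+ 2 * M ^+ 2) * (M0 * m (U x) ^+ 2)); last by ring.
 rewrite ler_wpM2l ?mulr_ge0 ?sqr_ge0 ?(ltW nu0)//.
 by rewrite ler_wpM2r ?sqr_ge0.
(* The drift term contains no derivative of [U] and is bounded without absorption. *)
have pt3 x : - (f0 (U x) * \sum_i flux i x * pderiv i psi x) <= 2 * M * (flux_abs x * eta x * `|f0 (U x)|).
 have /andP[ex0 _] := e01 x.
 apply: le_trans (ler_norm _) _; rewrite normrN normrM.
 rewrite (_ : 2 * M * (flux_abs x * eta x * `|f0 (U x)|) = `|f0 (U x)| * (flux_abs x * (2 * (eta x * M)))); last by ring.
 rewrite ler_wpM2l//; apply: le_trans (ler_norm_sum _ _ _) _; rewrite /flux_abs mulr_suml.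
 apply: ler_sum => i _; rewrite normrM ler_wpM2l// dpsi !normrM (ger0_norm ex0) ger0_norm// ler_wpM2l// ler_wpM2l//.
(* Ellipticity and the lower bound on [rho] return from the energy to the Euclidean gradient. *)
have pt4 x : w x <= nu / c0 * (rho x * (h1 (U x) * h1 (U x) * psi x * qf U U x)).
 rewrite wE; have [Qx|Qx] := pselect (Q x); last by rewrite psi_out// !(mulr0, mul0r).
 have cx := Qr x Qx.
 have /andP[h1' h2'] := hcM x cx; have /andP[+ _] := hnu U x cx; rewrite ler_pdivrMl// => Pq.
 have s0 : 0 <= psi x * (h1 (U x) * h1 (U x)) by rewrite psiE -!expr2 mulr_ge0 ?sqr_ge0.
 rewrite (_ : nu / c0 * _ = psi x * (h1 (U x) * h1 (U x)) * (rho x / c0 * (nu * qf U U x))); last by ring.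
 apply: ler_wpM2l => //.
 apply: le_trans Pq _; apply: ler_peMl; first by apply: mulr_ge0 => //; exact: ltW.
 by rewrite ler_pdivlMr// mul1r.
have I1 := Int_le iX (iblD iT1 (iblZ c iE)) pt1.
have I2 := Int_le (iblB (iblN (iblZ 2^-1 iT2)) (iblZ 2^-1 iT4)) (iblD (iblZ 4^-1 iX) (iblZ (K3 * M ^+ 2) iY)) pt2.
have I3 := Int_le (iblN iT3) (iblZ (2 * M) iZ) pt3.
have iS : ibl leb w.
 have h' : ibl leb (fun x => \sum_i psi x * (h1 (U x) * h1 (U x) * (pderiv i U x * pderiv i U x))).
  apply: ibl_sum => i _; apply: (@test_ibl _ _ setT); apply: test_funM => //.
  by apply: CooM; apply: CooM => //; exact: Coo_pderiv.
 apply: eq_ibl h' => x; rewrite wE mulr_sumr; apply: eq_bigr => i _; ring.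
have I4 := Int_le iS (iblZ (nu / c0) iX) pt4.
rewrite (IntD iT1 (iblZ c iE)) (IntZ c iE) in I1.
rewrite (IntB (iblN (iblZ 2^-1 iT2)) (iblZ 2^-1 iT4)) (IntN (iblZ 2^-1 iT2)) (IntZ 2^-1 iT2) (IntZ 2^-1 iT4) in I2.
rewrite (IntD (iblZ 4^-1 iX) (iblZ (K3 * M ^+ 2) iY)) (IntZ 4^-1 iX) (IntZ (K3 * M ^+ 2) iY) in I2.
rewrite (IntN iT3) (IntZ (2 * M) iZ) in I3.
rewrite (IntZ (nu / c0) iX) in I4.
have E0 : 0 <= Int leb (fun x => rho x * (trap2 (U x) * qf U U x)).
 by apply: Int_ge0 => x; rewrite !mulr_ge0 ?trap2_ge0// ltW// (rho_gt0 hmu).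
have Y0 : 0 <= Int leb (fun x => \1_Q x * m (U x) ^+ 2).
 by apply: Int_ge0 => x; rewrite mulr_ge0 ?indic_ge0 ?sqr_ge0.
have Z0 : 0 <= Int leb (fun x => flux_abs x * eta x * `|f0 (U x)|).
 by apply: Int_ge0 => x; rewrite !mulr_ge0//; [apply: sumr_ge0|have /andP[] := e01 x].
have -> : Int leb (fun x => eta x * eta x * (h1 (U x) * h1 (U x)) * \sum_i pderiv i U x ^+ 2) = Int leb w.
 by apply: eq_Int => x; rewrite wE psiE.
exact: (gradient_algebra nu0 c00 K30 MM cg0 E0 Y0 Z0 K1E I1 I2 I3 I4).
Qed.

(** On a bounded set [rho] stays away from 0, so convergence in mean passes from [mu] to Lebesgue
    measure, and bounded Lipschitz functions preserve it. *)
Lemma local_comp_cvg r Q (Us : nat -> Rd -> R) u (g : R -> R) (L : R) : closed Q -> Q `<=` cube r ->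
 (forall n, ibl mu (Us n)) -> ibl mu u -> Int mu (fun x => `|Us n x - u x|) @[n --> \oo] --> 0 ->
 continuous g -> (forall s, `|g s| <= L) -> (forall s t, `|g s - g t| <= L * `|s - t|) ->
 [/\ forall n, ibl leb (fun x => \1_Q x * (g (Us n x) - g (u x))),
   forall n x, `|\1_Q x * (g (Us n x) - g (u x))| <= 2 * L &
   Int leb (fun x => `|\1_Q x * (g (Us n x) - g (u x))|) @[n --> \oo] --> 0].
Proof.
move=> cQ Qr iU iu cU cg gL lip; have [c0 [M0 [c00 hcM]]] := rho_bounds hmu r.
have L0 : 0 <= L := le_trans (normr_ge0 _) (gL 0).
have mg (h : Rd -> R) : ibl mu h -> meas (fun x => g (h x)).
 by move=> /ibl_meas mh; apply: (@measurableT_comp _ _ _ _ _ _ g) => //; exact: continuous_measurable_fun.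
have B n x : `|g (Us n x) - g (u x)| <= 2 * L by exact: abs_sub_le2.
have ib n : ibl leb (fun x => \1_Q x * (g (Us n x) - g (u x))).
 by apply: (ibl_closed_bounded cQ Qr _ (B n)); apply: measurable_funB; exact: mg.
split => // [n x|].
 rewrite normrM; apply: le_trans (ler_wpM2r _ (indic_le1 Q x)) _ => //.
 by rewrite mul1r.
have := @cvg_mull _ (L / c0) _ _ cU; rewrite mulr0; apply: cvg0_le => n.
have iD := ibl_abs (iblB (iU n) iu); have iDl := (ibl_mu hmu _).1 iD.
rewrite ger0_norm ?Int_ge0// (Int_mu hmu iD) -IntZ//.
apply: Int_le; [exact: ibl_abs|exact: iblZ|] => x.
have [Qx|Qx] := pselect (Q x); last first.
 rewrite indicE_out// mul0r normr0 mulr_ge0 ?divr_ge0 ?(ltW c00)//.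
 by rewrite mulr_ge0// ltW// (rho_gt0 hmu).
rewrite indicE_in// mul1r; apply: le_trans (lip _ _) _.
rewrite -mulrA ler_wpM2l// mulrCA ler_peMr//.
by rewrite ler_pdivlMl// mulr1; have /andP[] := hcM x (Qr x Qx).
Qed.

Lemma sqr_lip (h : R -> R) (L : R) : (forall s, `|h s| <= L) -> (forall s t, `|h s - h t| <= L * `|s - t|) ->
 (forall s, `|h s ^+ 2| <= 2 * L ^+ 2) /\ (forall s t, `|h s ^+ 2 - h t ^+ 2| <= 2 * L ^+ 2 * `|s - t|).
Proof.
move=> hb hl; have L0 : 0 <= L := le_trans (normr_ge0 _) (hb 0); split => [s|s t].
 rewrite normrX; apply: le_trans (_ : L ^+ 2 <= _); first by apply: lerXn2r; rewrite ?nnegrE.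
 by rewrite ler_peMl ?sqr_ge0// ler1n.
rewrite subr_sqr normrM.
rewrite (_ : 2 * L ^+ 2 * `|s - t| = (L * `|s - t|) * (2 * L)); last by ring.
apply: ler_pM => //; apply: le_trans (ler_normD _ _) _.
by have := hb s; have := hb t; move: (`|h s|) (`|h t|) => a b; lra.
Qed.

Lemma ibl_test_mu f : testT f -> ibl mu f.
Proof.
move=> tf; apply/(ibl_mu hmu); apply: eq_ibl (test_ibl_c (rho_continuous hmu) tf) => x; exact: mulrC.
Qed.

Lemma measurable_comp_ibl (g : R -> R) f : continuous g -> ibl mu f -> meas (fun x => g (f x)).
Proof.
move=> cg /ibl_meas mf; apply: (@measurableT_comp _ _ _ _ _ _ g) => //.
exact: continuous_measurable_fun.
Qed.

Lemma local_comp_L2fun r Q eta (M : R) (g : R -> R) (L : R) f : localizer Q eta M -> Q `<=` cube r ->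
 continuous g -> (forall s, `|g s| <= L) -> ibl mu f -> L2fun leb (fun x => g (f x) * eta x).
Proof.
move=> [te cQ e0 e01 eM] Qr cg gL hf.
have mF : meas (fun x => g (f x) * eta x).
 by apply: measurable_funM; [exact: measurable_comp_ibl|exact: test_measurable te].
have L0 : 0 <= L := le_trans (normr_ge0 _) (gL 0).
split => //; have B x : `|(g (f x) * eta x) ^+ 2| <= L ^+ 2.
 rewrite normrX; apply: lerXn2r; rewrite ?nnegrE//.
 rewrite normrM -[leRHS]mulr1; apply: ler_pM => //.
 by have /andP[? ?] := e01 x; rewrite ger0_norm.
have := ibl_closed_bounded cQ Qr (measurable_funX 2 mF) B; apply: eq_ibl => x.
have [Qx|Qx] := pselect (Q x); first by rewrite indicE_in// mul1r.
by rewrite indicE_out// e0// mulr0 expr0n mul0r.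
Qed.

Lemma local_comp_L2 r Q eta (M : R) (g : R -> R) (L : R) (Us : nat -> Rd -> R) u :
 localizer Q eta M -> Q `<=` cube r ->
 continuous g -> (forall s, `|g s| <= L) -> (forall s t, `|g s - g t| <= L * `|s - t|) ->
 (forall n, ibl mu (Us n)) -> ibl mu u -> Int mu (fun x => `|Us n x - u x|) @[n --> \oo] --> 0 ->
 L2cvg leb (fun n x => g (Us n x) * eta x) (fun x => g (u x) * eta x).
Proof.
move=> loc Qr cg gL lip iU iu cU; have [te cQ e0 e01 eM] := loc.
have [b1 b2 b3] := local_comp_cvg cQ Qr iU iu cU cg gL lip.
have eQ x : eta x = \1_Q x * eta x.
 by have [Qx|Qx] := pselect (Q x); [rewrite indicE_in// mul1r|rewrite e0// mulr0].
have en x : `|eta x| <= 1 by have /andP[? ?] := e01 x; rewrite ger0_norm.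
have L2F f := @local_comp_L2fun r Q eta M g L f loc Qr cg gL.
split => [n||]; [exact: L2F|exact: L2F|].
have := @cvg_mull _ (2 * L) _ _ b3; rewrite mulr0; apply: cvg0_le => n.
have [_ iF2] := L2funB (L2F _ (iU n)) (L2F _ iu).
rewrite ger0_norm; last by apply: Int_ge0 => x; exact: sqr_ge0.
have ib := ibl_abs (b1 n); rewrite -IntZ//; apply: Int_le => //; first exact: iblZ.
move=> x; rewrite -mulrBl {1}(eQ x) mulrA [_ * \1_Q x]mulrC exprMn.
apply: le_trans (_ : (\1_Q x * (g (Us n x) - g (u x))) ^+ 2 <= _).
 rewrite ler_piMr ?sqr_ge0// -[_ ^+ 2]real_normK ?num_real//.
 by apply: exprn_ile1 => //; exact: en.
by rewrite -[leLHS]real_normK ?num_real// expr2 ler_wpM2r//; exact: b2.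
Qed.

(** No weak gradient of [u] is available, so the gradient stays with the approximants, below numbers
    [B n] whose limit involves only values of [u] and [w]. Applications replace the gradients by
    translation differences before letting [n] grow. *)
Lemma gradient_limit (r : R) : 0 < r -> exists K1 K2 : R, [/\ 0 <= K1, 0 <= K2 &
 forall Q eta (M : R) (f0 f1 f2 h h1 m : R -> R) (L c : R) u w,
 localizer Q eta M -> Q `<=` cube r -> mprofile f0 f1 f2 h h1 m L c ->
 generator mu setT S u w -> {ae mu, forall x, 0 <= u x <= 1} ->
 exists (Us : nat -> Rd -> R) (B : nat -> R), [/\ forall n, testT (Us n),
  Int mu (fun x => `|Us n x - u x|) @[n --> \oo] --> 0,
  forall n, Int leb (fun x => eta x * eta x * (h1 (Us n x) * h1 (Us n x)) * \sum_i pderiv i (Us n) x ^+ 2) <= B n &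
  B n @[n --> \oo] --> K1 * (- Int mu (fun x => w x * (f1 (u x) * (eta x * eta x))))
   + K2 * (M ^+ 2 * Int leb (fun x => \1_Q x * m (u x) ^+ 2)
      + M * Int leb (fun x => flux_abs x * eta x * `|f0 (u x)|))]].
Proof.
move=> rp; have [K1 [K2 [K10 K20 hK]]] := gradient_test rp.
exists K1, K2; split => // Q eta M f0 f1 f2 h h1 m L c u w loc Qr mp gu u01.
have [te cQ e0 e01 eM] := loc; have pf := mp_profile mp.
have tp : testT (fun x => eta x * eta x) by apply: test_funM => //; exact: test_Coo te.
have [Us [tU cU cE cJ]] := gen_test_approx gu u01 pf tp.
have [iu iw _] := gen_eps hS gu; have iU n := ibl_test_mu (tU n).
have L0 : 0 <= L := le_trans (normr_ge0 _) (mp_bound0 mp 0).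
have cm2 : continuous (fun s => m s ^+ 2).
 by move=> s; apply: continuousM; exact: (mp_cont mp).
have [mq1 mq2] := sqr_lip (mp_mb mp) (mp_ml mp).
have [a1 a2 a3] := local_comp_cvg cQ Qr iU iu cU cm2 mq1 mq2.
have cf0 : continuous (fun s => `|f0 s|).
 have h0 := smooth_continuous (pf_smooth0 pf).
 by move=> s; apply: cvg_norm; exact: h0.
have f0b s : `| `|f0 s| | <= L by rewrite normr_id (mp_bound0 mp).
have f0l s t : `| `|f0 s| - `|f0 t| | <= L * `|s - t|.
 by apply: le_trans (ler_dist_dist _ _) _; exact: (pf_lip0 pf).
have [e1 e2 e3] := local_comp_cvg cQ Qr iU iu cU cf0 f0b f0l.
have eQ x : eta x = \1_Q x * eta x.
 by have [Qx|Qx] := pselect (Q x); [rewrite indicE_in// mul1r|rewrite e0// mulr0].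
have iYf f : ibl mu f -> ibl leb (fun x => \1_Q x * m (f x) ^+ 2).
 move=> hf; apply: (ibl_closed_bounded (L := 2 * L ^+ 2) cQ Qr) => [|x]; last exact: mq1.
 exact: (measurable_comp_ibl cm2 hf).
have cY : Int leb (fun x => \1_Q x * m (Us n x) ^+ 2) @[n --> \oo] --> Int leb (fun x => \1_Q x * m (u x) ^+ 2).
 apply: Int_cvg; [by move=> n; exact: iYf|exact: iYf|].
 by apply: cvg_ext a3 => n; apply: eq_Int => x; rewrite mulrBr.
have iW : ibl leb (fun x => flux_abs x * eta x).
 have h1' : ibl leb (fun x => flux_abs x * eta x * 1).
  by apply: (ibl_flux_abs loc (f := fun=> 1)) => //; exists 1 => x; rewrite normr1.
 by apply: eq_ibl h1' => x; rewrite mulr1.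
have iZf f : ibl mu f -> ibl leb (fun x => flux_abs x * eta x * `|f0 (f x)|).
 by move=> hf; apply: (iblMb iW (measurable_comp_ibl cf0 hf)) => x; exact: f0b.
have cZ : Int leb (fun x => flux_abs x * eta x * `|f0 (Us n x)|) @[n --> \oo] -->
  Int leb (fun x => flux_abs x * eta x * `|f0 (u x)|).
 apply: Int_cvg; [by move=> n; exact: iZf|exact: iZf|].
 have := Int_wcvg0 iW e1 e2 e3; apply: cvg_ext => n; apply: eq_Int => x.
 rewrite -mulrBr; congr `|_|; rewrite [in RHS](eQ x); ring.
have cR := cvg_add (@cvg_mull _ K1 _ _ (cvg_add (cvgN cJ) (@cvg_mull _ c _ _ cE)))
 (@cvg_mull _ K2 _ _ (cvg_add (@cvg_mull _ (M ^+ 2) _ _ cY) (@cvg_mull _ M _ _ cZ))).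
rewrite mulr0 addr0 in cR.
eexists Us, _; split => //; last exact: (cR _).
by move=> n; exact: (hK _ _ _ _ _ _ _ _ _ _ _ _ loc Qr mp (tU n)).
Qed.

(** * Logarithmic estimates along the semigroup *)

Definition shift_osc (r : R) (f0 : R -> R) g i (t : R) : R :=
 Int leb (fun x => \1_(cube r) x * (f0 (g (x + t *: e_ i)) - f0 (g x)) ^+ 2).

Lemma cube_shift (r s t : R) i x : 0 <= s <= t -> cube r (x - s *: e_ i) -> cube (r + t) x.
Proof.
move=> /andP[s0 st] h j; have := h j; rewrite !mxE eqxx /=.
case: (j == i); rewrite ?mulr1 ?mulr0 ?subr0 => hj; last by apply: le_trans hj _; rewrite lerDl (le_trans s0).
rewrite -[x ord0 j](subrK s); apply: le_trans (ler_normD _ _) _.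
by apply: lerD => //; rewrite ger0_norm.
Qed.

Lemma sqr_diff_lip (L a b a' b' A1 B1 : R) : `|a| <= L -> `|b| <= L -> `|a'| <= L -> `|b'| <= L ->
 `|a - a'| <= L * A1 -> `|b - b'| <= L * B1 ->
 `|(a - b) ^+ 2 - (a' - b') ^+ 2| <= 4 * L ^+ 2 * (A1 + B1).
Proof.
move=> h1 h2 h3 h4 h5 h6.
rewrite subr_sqr normrM mulrC (_ : 4 * L ^+ 2 * (A1 + B1) = (4 * L) * (L * A1 + L * B1)); last by ring.
apply: ler_pM => //.
 apply: le_trans (ler_normD _ _) _; apply: (@le_trans _ _ (`|a| + `|b| + (`|a'| + `|b'|))).
  by apply: lerD; exact: ler_normB.
 lra.
rewrite (_ : a - b - (a' - b') = (a - a') - (b - b')); last by ring.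
by apply: le_trans (ler_normB _ _) _; exact: lerD.
Qed.

(** The oscillation contains no derivative, so it is continuous in mean: bounded Lipschitz [f0]
    turns the difference of two oscillations into the L^1 distance, over a cube enlarged by 1 to
    contain the shifted points. *)
Lemma shift_osc_lip (r : R) : 0 < r -> exists2 K, 0 <= K & forall (f0 : R -> R) (L : R) g g' i t,
 continuous f0 -> (forall s, `|f0 s| <= L) -> (forall s s', `|f0 s - f0 s'| <= L * `|s - s'|) ->
 ibl mu g -> ibl mu g' -> 0 < t -> t <= 1 ->
 shift_osc r f0 g i t <= shift_osc r f0 g' i t + K * L ^+ 2 * Int mu (fun x => `|g x - g' x|).
Proof.
move=> r0; have [c [M [c0 hc]]] := rho_bounds hmu (r + 1).
exists (8 / c) => [|f0 L g g' i t cf fL lip ig ig' t0 t1]; first by rewrite divr_ge0// ltW.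
have L0 : 0 <= L := le_trans (normr_ge0 _) (fL 0).
have iD := ibl_abs (iblB ig ig').
pose D x := \1_(cube (r + 1)) x * `|g x - g' x|.
have mD : meas D.
 by apply: measurable_funM; [apply: indic_meas; exact: closed_measurable_rV (@cube_closed R d _)|exact: ibl_meas iD].
have D0 x : 0 <= D x by rewrite mulr_ge0 ?indic_ge0.
have Dle x : D x <= c^-1 * (`|g x - g' x| * rho x).
 rewrite /D; have [cx|cx] := pselect (cube (r + 1) x); last first.
  rewrite indicE_out// mul0r; apply: mulr_ge0; first by rewrite invr_ge0 ltW.
  by apply: mulr_ge0 => //; exact: ltW (rho_gt0 hmu x).
 rewrite indicE_in// mul1r [leRHS]mulrC ler_pdivlMr//.
 by apply: ler_wpM2l => //; have /andP[] := hc _ cx.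
have jD := (ibl_mu hmu _).1 iD.
have iDl : ibl leb D by apply: ibl_le (iblZ c^-1 jD) => // x; rewrite ger0_norm.
have ID : Int leb D <= c^-1 * Int mu (fun x => `|g x - g' x|).
 by rewrite (Int_mu hmu iD) -IntZ//; apply: Int_le => //; exact: iblZ.
have sD := Int_shift (t *: e_ i) iDl.
have mc (h : Rd -> R) : ibl mu h -> meas (fun x => f0 (h (x + t *: e_ i)) - f0 (h x)).
 move=> ih; have m1 := measurable_comp_ibl cf ih.
 by apply: measurable_funB => //; exact: (shift_measurableM (t *: e_ i) m1).
have iV (h : Rd -> R) : ibl mu h -> ibl leb (fun x => \1_(cube r) x * (f0 (h (x + t *: e_ i)) - f0 (h x)) ^+ 2).
 move=> ih; apply: (@ibl_closed_bounded r _ _ ((2 * L) ^+ 2) (@cube_closed R d r)) => //.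
  by apply: measurable_funX; exact: mc.
 by move=> x; rewrite normrX; apply: lerXn2r; rewrite ?nnegrE ?mulr_ge0//; exact: abs_sub_le2.
have B x : \1_(cube r) x * (f0 (g (x + t *: e_ i)) - f0 (g x)) ^+ 2 <=
  \1_(cube r) x * (f0 (g' (x + t *: e_ i)) - f0 (g' x)) ^+ 2 + 4 * L ^+ 2 * (D (x + t *: e_ i) + D x).
 have [cx|cx] := pselect (cube r x); last first.
  by rewrite indicE_out// !mul0r add0r !mulr_ge0// addr_ge0.
 have c1 : cube (r + 1) x by move=> j; apply: le_trans (cx j) _; rewrite lerDl.
 have c2 : cube (r + 1) (x + t *: e_ i).
  move=> j; have := cube_shift (r := r) (s := t) (t := 1) (i := i) (x := x + t *: e_ i).
  by rewrite (ltW t0) t1 addrK; apply.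
 rewrite /D !indicE_in// !mul1r -lerBlDl; apply: le_trans (ler_norm _) _.
 by apply: sqr_diff_lip.
have iB : ibl leb (fun x => 4 * L ^+ 2 * (D (x + t *: e_ i) + D x)).
 by apply: iblZ; apply: iblD => //; exact: sD.1.
apply: le_trans (Int_le (iV _ ig) (iblD (iV _ ig') iB) B) _.
rewrite (IntD (iV _ ig') iB) lerD2l IntZ; last by apply: iblD => //; exact: sD.1.
rewrite (IntD sD.1 iDl) sD.2.
have L2 : 0 <= 4 * L ^+ 2 by rewrite mulr_ge0// sqr_ge0.
apply: le_trans (ler_wpM2l L2 (lerD ID ID)) _.
by move: (Int mu _) => I; apply: eq_ler; field; rewrite gt_eqF.
Qed.

Lemma log_abs_bound (eps s : R) : 0 < eps -> eps <= 1 -> 0 <= s <= 1 -> `|- ln (eps + s)| <= 1 - ln eps.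
Proof.
move=> e0 e1 /andP[s0 s1]; have p0 : 0 < eps + s by lra.
have h1 : ln eps <= ln (eps + s) by rewrite ler_ln ?posrE// lerDl.
have h2 : ln eps <= 0 by rewrite ln_le0.
have h3 : ln (eps + s) <= 1.
 have := @le_ln1Dx R (eps + s - 1); rewrite (_ : 1 + (eps + s - 1) = eps + s); last by ring.
 by move=> h; apply: le_trans (h _) _; lra.
by rewrite normrN ler_norml; apply/andP; split; lra.
Qed.

(** The tangent inequality for [- ln], in the form that bounds one time step of the semigroup. *)
Lemma log_convex (eps a b : R) : 0 < eps -> 0 <= a -> 0 <= b ->
 - (eps + b)^-1 * (a - b) <= - ln (eps + a) - - ln (eps + b).
Proof.
move=> e0 a0 b0; have pa : 0 < eps + a by lra.
have pb : 0 < eps + b by lra.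
have := @le_ln1Dx R ((a - b) / (eps + b)).
have E : 1 + (a - b) / (eps + b) = (eps + a) / (eps + b) by field; rewrite gt_eqF.
have q0 : 0 < (eps + a) / (eps + b) by rewrite divr_gt0.
rewrite E ln_div ?posrE// => h; have {}h : ln (eps + a) - ln (eps + b) <= (a - b) / (eps + b).
 by apply: h; rewrite -E in q0; lra.
by rewrite mulNr mulrC; lra.
Qed.

(** Since [m = 1], the error terms grow only through [|f0| <= 1 - ln eps] in the flux integral,
    which is linear in [ln eps]. The integral of [w f1(u)] is left for averaging over time. *)
Lemma log_shift_osc (r : R) : 0 < r -> exists K1 K3 : R, [/\ 0 <= K1, 0 <= K3 &
 forall eps (f0 f1 f2 h1 : R -> R) (L c : R) u w i t, 0 < eps -> eps <= 1 ->
 mprofile f0 f1 f2 f0 h1 (fun=> 1) L c ->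
 (forall s, 0 <= s <= 1 -> f0 s = - ln (eps + s)) -> generator mu setT S u w ->
 {ae mu, forall x, 0 <= u x <= 1} -> 0 < t -> t <= 1 ->
 shift_osc r f0 u i t <=
 K1 * (- Int mu (fun x => w x * (f1 (u x) * (cutoff (r + 2) x * cutoff (r + 2) x)))) + K3 * (2 - ln eps)].
Proof.
move=> r0; have r20 : 0 < r + 2 by rewrite addr_gt0.
have [M loc] := @cutoff_localizer R d _ r20.
have [te cQ e0 e01 eM] := loc; set eta := cutoff (r + 2) in loc te e0 e01 eM *.
have r2p : 0 < 2 * (r + 2) by rewrite mulr_gt0.
have [K1 [K2 [K10 K20 hK]]] := gradient_limit r2p.
have [K K0 hV] := shift_osc_lip r0.
have iF : ibl leb (fun x => flux_abs x * eta x * 1).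
 by apply: (ibl_flux_abs loc (f := fun=> 1)) => //; exists 1 => x; rewrite normr1.
set IF := Int leb (fun x => flux_abs x * eta x * 1).
set IQ := Int leb (fun x => \1_(cube (2 * (r + 2)) : set Rd) x * 1 ^+ 2).
have f_ge0 x : 0 <= flux_abs x by apply: sumr_ge0.
have IF0 : 0 <= IF by apply: Int_ge0 => x; rewrite mulr1 mulr_ge0//; have /andP[] := e01 x.
have IQ0 : 0 <= IQ by apply: Int_ge0 => x; rewrite expr1n mulr1 indic_ge0.
(* A coordinate is needed to read [0 <= M] off the derivative bound; without one the estimate is
   vacuous. *)
have [i0|d00] := pselect (exists i : 'I_d, True); last first.
 by exists 0, 0; split => // eps f0 f1 f2 h1 L c u w i; exfalso; apply: d00; exists i.
have M0 : 0 <= M by case: i0 => i _; apply: le_trans (eM i 0).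
exists K1, (K2 * (M ^+ 2 * IQ + M * IF)); split => //.
 by rewrite mulr_ge0// addr_ge0// mulr_ge0// sqr_ge0.
move=> eps f0 f1 f2 h1 L c u w i t ep ep1 mp f0E gu u01 t0 t1.
have [Us [B [tU cU hB cB]]] := hK _ _ _ _ _ _ _ _ _ _ _ _ _ loc (@subset_refl _ _) mp gu u01.
have pf := mp_profile mp; have [iu iw _] := gen_eps hS gu; have iU n := ibl_test_mu (tU n).
have cf0 := smooth_continuous (pf_smooth0 pf).
have B1 n : shift_osc r f0 (Us n) i t <= B n.
 apply: le_trans (hB n).
 (* Subtracting [f0 0] gives compact support and leaves differences and derivatives unchanged. *)
 pose F x := f0 (Us n x) - f0 0.
 have tF : testT F.
  apply: (@test_comp _ _ setT (Us n) (fun s => f0 s - f0 0)) => //; last by rewrite subrr.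
  by move=> k; apply: S1B; [exact: (pf_smooth0 pf)|exact: S1_cst].
 have dF j x : pderiv j F x = h1 (Us n x) * pderiv j (Us n) x.
  apply: (@pderiv_comp _ _ (fun s => f0 s - f0 0) h1); last exact: test_Coo (tU n).
  move=> s; have := is_deriveB (mp_derive mp s) (is_derive_cst (f0 0) s 1).
  by rewrite subr0.
 have cm (s : R) : meas (\1_(cube s : set Rd) : Rd -> R).
  by apply: indic_meas; apply: closed_measurable_rV; exact: cube_closed.
 have W := @shift_estimate_weighted _ _ setT F (\1_(cube r)) (\1_(cube (r + 1))) i t tF t0
  (cm _) (indic01 _) (cm _) (indic01 _).
 have {}W := W _.
 apply: (le_trans (y := t ^+ 2 * Int leb (fun x => \1_(cube (r + 1)) x * pderiv i F x ^+ 2))).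
  rewrite /shift_osc (@eq_Int _ _ _ _ _ (fun x => \1_(cube r) x * (F (x + t *: e_ i) - F x) ^+ 2)).
   apply: W => s x /andP[s0 st].
   have [cx|cx] := pselect (cube r (x - s *: e_ i)); last by rewrite indicE_out// indic_ge0.
   have c1 : cube (r + 1) x by apply: (cube_shift (s := s) (t := 1) (i := i)) => //; rewrite s0 (le_trans st).
   by rewrite !indicE_in.
  by move=> x; rewrite /F (_ : f0 (Us n (x + t *: e_ i)) - f0 0 - (f0 (Us n x) - f0 0) = f0 (Us n (x + t *: e_ i)) - f0 (Us n x))//; ring.
 have tP := test_pderiv i tF.
 have i1 : ibl leb (fun x => \1_(cube (r + 1)) x * pderiv i F x ^+ 2).
  apply: (iblbM (C := 1)) => //; last by move=> x; exact: indic_le1.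
  by apply: eq_ibl (test_ibl (test_funM tP (test_Coo tP))) => x; rewrite expr2.
 have i2 : ibl leb (fun x => eta x * eta x * (h1 (Us n x) * h1 (Us n x)) * \sum_j pderiv j (Us n) x ^+ 2).
  apply: (@test_ibl _ _ setT).
  have cU' := test_Coo (tU n); have ch : Coo (fun x => h1 (Us n x)).
   by apply: Coo_comp => //; exact: (mp_smooth1 mp).
  apply: test_funM; last by move=> k; apply: Ck_sum => j; apply: CkM; exact: Coo_pderiv.
  by apply: test_funM; [apply: test_funM => //; exact: test_Coo te|exact: CooM].
 have I10 : 0 <= Int leb (fun x => \1_(cube (r + 1)) x * pderiv i F x ^+ 2).
  by apply: Int_ge0 => x; rewrite mulr_ge0 ?indic_ge0 ?sqr_ge0.
 have t2 : t ^+ 2 <= 1 by rewrite expr_le1// ltW.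
 apply: le_trans (ler_wpM2r I10 t2) _; rewrite mul1r.
 apply: Int_le => // x; have [cx|cx] := pselect (cube (r + 1) x); last first.
  rewrite indicE_out// mul0r; apply: mulr_ge0; last by apply: sumr_ge0 => j _; exact: sqr_ge0.
  by apply: mulr_ge0; rewrite -expr2 sqr_ge0.
 have -> : eta x = 1 by apply: cutoff_in => // j; apply: le_trans (cx j) _; lra.
 rewrite indicE_in// !mul1r dF exprMn -expr2; apply: ler_wpM2l; first exact: sqr_ge0.
 by rewrite (bigD1 i)//= lerDl; apply: sumr_ge0 => j _; exact: sqr_ge0.
have cD : Int mu (fun x => `|u x - Us n x|) @[n --> \oo] --> 0.
 by apply: cvg_ext cU => n; apply: eq_Int => x; rewrite distrC.
have cR := cvg_add cB (@cvg_mull _ (K * L ^+ 2) _ _ cD); rewrite mulr0 addr0 in cR.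
apply: (@le_trans _ _ _ _ _ (cvg_ge_cst (fun n => le_trans
 (hV f0 L u (Us n) i t cf0 (mp_bound0 mp) (pf_lip0 pf) iu (iU n) t0 t1) (lerD (B1 n) (lexx _))) cR)).
rewrite lerD2l -mulrA; apply: ler_wpM2l => //.
have le0 : ln eps <= 0 by rewrite ln_le0.
rewrite [leRHS]mulrDl; apply: lerD; first by rewrite ler_peMr ?mulr_ge0 ?sqr_ge0//; lra.
rewrite -mulrA; apply: ler_wpM2l => //.
have iZ : ibl leb (fun x => flux_abs x * eta x * `|f0 (u x)|).
 apply: (ibl_flux_abs loc); last by exists L => x; rewrite normr_id (mp_bound0 mp).
 by apply: measurableT_comp => //; exact: measurable_comp_ibl cf0 iu.
rewrite mulrC -(IntZ _ iF); apply: ae_le_Int => //; first exact: iblZ.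
apply: filterS ((ae_mu hmu _).1 u01) => x ux; rewrite mulr1 mulrC; apply: ler_wpM2r.
 by rewrite mulr_ge0//; have /andP[] := e01 x.
by rewrite f0E//; apply: le_trans (log_abs_bound ep ep1 ux) _; lra.
Qed.

(** The sum over [k] telescopes, so the inequality claimed cannot fail at all [N] indices. *)
Lemma telescope_exists (J y : nat -> R) (N : nat) (tau E D : R) : 0 < tau -> (0 < N)%N ->
 (forall k, (k < N)%N -> y k <= tau^-1 * (J k - J k.+1) + E) -> J 0%N - J N <= D ->
 exists2 k, (k < N)%N & y k <= D / (N%:R * tau) + E.
Proof.
move=> t0 N0 hy hD; apply: contrapT => hn; set X := D / (N%:R * tau) + E in hn.
have h k : (k < N)%N -> X < y k.
 by move=> kN; rewrite ltNge; apply/negP => hk; apply: hn; exists k.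
have P n : (n <= N)%N -> n%:R * X <= tau^-1 * (J 0%N - J n) + n%:R * E.
 elim: n => [_|n IH nN]; first by rewrite subrr mulr0 !mul0r addr0.
 have := IH (ltnW nN); have := h n nN; have := hy n nN.
 rewrite -natr1; move: (tau^-1) => a b1 b2 b3; lra.
have lN : (N.-1 < N)%N by rewrite prednK.
have h1 := h _ lN; have h2 := hy _ lN; have h5 := P _ (leq_pred N); rewrite prednK// in h2.
have h3 : tau^-1 * (J 0%N - J N) <= tau^-1 * D by rewrite ler_pM2l ?invr_gt0.
have Np : N%:R != 0 :> R by rewrite pnatr_eq0 -lt0n.
have h4 : N%:R * X = tau^-1 * D + N%:R * E by rewrite /X; field; rewrite gt_eqF.
have e1 : N%:R = N.-1%:R + 1 :> R by rewrite natr1 prednK.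
rewrite e1 in h4; move: (tau^-1) h1 h2 h3 h4 h5 => a h1 h2 h3 h4 h5; lra.
Qed.

Lemma log_step_real (tau wv fb a b fa L e : R) : 0 < tau -> 0 <= e -> e <= 1 -> fb * (a - b) <= fa -> `|fb| <= L ->
 - (wv * (fb * e)) <= tau^-1 * (fa * e) + L * `|wv - tau^-1 * (b - a)|.
Proof.
move=> t0 e0 e1 h1 h2; have it : 0 < tau^-1 by rewrite invr_gt0.
have -> : - (wv * (fb * e)) = tau^-1 * (fb * (a - b) * e) + - (fb * (wv - tau^-1 * (b - a))) * e by ring.
apply: lerD; first by rewrite ler_pM2l// ler_wpM2r.
apply: le_trans (ler_norm _) _; rewrite normrM normrN normrM -[leRHS]mulr1.
by apply: ler_pM; [by apply: mulr_ge0|by []|by apply: ler_wpM2r|by rewrite ger0_norm].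
Qed.

(** Stands in for differentiating the integral of [f0(S_s u) eta] in [s]. Convexity bounds the
    tangent term by a difference of two such integrals; the error of the difference quotient at time
    [s] is at most its value at time 0, by contractivity. *)
Lemma log_time_step (eta : Rd -> R) eps (f0 f1 f2 h1 : R -> R) (L c : R) u w (s tau : R) : testT eta ->
 (forall x, 0 <= eta x <= 1) -> 0 < eps ->
 mprofile f0 f1 f2 f0 h1 (fun=> 1) L c ->
 (forall s, 0 <= s <= 1 -> f0 s = - ln (eps + s)) -> (forall s, 0 <= s <= 1 -> f1 s = - (eps + s)^-1) ->
 generator mu setT S u w -> {ae mu, forall x, 0 <= u x <= 1} -> 0 < s -> 0 < tau ->
 - Int mu (fun x => S (s + tau) w x * (f1 (S (s + tau) u x) * eta x)) <=
 tau^-1 * (Int mu (fun x => f0 (S s u x) * eta x) - Int mu (fun x => f0 (S (s + tau) u x) * eta x)) +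
 L * Int mu (fun x => `|S tau w x - tau^-1 * (S tau u x - u x)|).
Proof.
move=> te e01 ep mp f0E f1E gu u01 s0 t0; have [iu iw _] := gen_eps hS gu.
have st0 : 0 < s + tau by exact: addr_gt0.
have [iSs iSt iT] : [/\ ibl mu (S s u), ibl mu (S (s + tau) u) & ibl mu (S tau u)].
 by split; exact: (sgL1 hS).
have iW := sgL1 hS st0 iw; have iWt := sgL1 hS t0 iw.
pose G x := S tau w x - tau^-1 * (S tau u x - u x).
have iG1 := iblB iT iu.
have iG : ibl mu G by apply: iblB => //; exact: iblZ.
have pf := mp_profile mp; have cf0 := smooth_continuous (pf_smooth0 pf); have cf1 := smooth_continuous (pf_smooth1 pf).
have ie : ibl mu eta := ibl_test_mu te.
have en x : `|eta x| <= 1 by have /andP[? ?] := e01 x; rewrite ger0_norm.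
have iJ h : ibl mu h -> ibl mu (fun x => f0 (h x) * eta x).
 by move=> ih; apply: (iblbM ie (measurable_comp_ibl cf0 ih)) => x; exact: mp_bound0 mp _.
have iI : ibl mu (fun x => S (s + tau) w x * (f1 (S (s + tau) u x) * eta x)).
 apply: (iblMb (C := L * 1) iW).
  by apply: measurable_funM; [exact: measurable_comp_ibl cf1 iSt|exact: ibl_meas ie].
 by move=> x; rewrite normrM ler_pM//; exact: (pf_bound1 pf).
pose W x := `|S (s + tau) w x - tau^-1 * (S (s + tau) u x - S s u x)|.
have iWW : ibl mu W by apply: ibl_abs; apply: iblB => //; apply: iblZ; exact: iblB.
have EW : Int mu W <= Int mu (fun x => `|G x|).
 apply: le_trans (sg_norm hS s0 iG); apply: eq_ler.
 apply: ae_eq_Int; [exact: ibl_meas iWW|exact: ibl_meas (ibl_abs (sgL1 hS s0 iG))|].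
 have a1 := sg_B hS s0 iWt (iblZ tau^-1 iG1).
 have a2 := sg_Z hS tau^-1 s0 iG1.
 have a3 := sg_B hS s0 iT iu.
 have a4 := sg_add hS s0 t0 ((Lp_onT mu _).2 iw).
 have a5 := sg_add hS s0 t0 ((Lp_onT mu _).2 iu).
 have a6 : {ae mu, forall x, S s G x = S s (S tau w) x - tau^-1 * (S s (S tau u) x - S s u x)}.
  by move: a1 a2 a3; apply: filterS3 => x b1 b2 b3; rewrite /G b1 b2 b3.
 by move: a4 a5 a6; apply: filterS3 => x b4 b5 b6; rewrite /W b4 b5 b6.
have L0 : 0 <= L := le_trans (normr_ge0 _) (mp_bound0 mp 0).
have i3 : ibl mu (fun x => tau^-1 * (f0 (S s u x) * eta x - f0 (S (s + tau) u x) * eta x)).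
 by apply: iblZ; apply: iblB; exact: iJ.
apply: le_trans (lerD (lexx _) (ler_wpM2l L0 EW)).
rewrite -(IntB (iJ _ iSs) (iJ _ iSt)) -(IntZ tau^-1 (iblB (iJ _ iSs) (iJ _ iSt))) -(IntZ L iWW).
rewrite -(IntD i3 (iblZ L iWW)) -(IntN iI).
apply: ae_le_Int; [exact: iblN|by apply: iblD => //; exact: iblZ|].
have b1 := sg_le1 hS s0 iu u01; have b2 := sg_le1 hS st0 iu u01.
apply: filterS2 b1 b2 => x x1 x2; rewrite -mulrBl; have /andP[? ?] := e01 x.
apply: log_step_real => //; last exact: (pf_bound1 pf).
rewrite f1E// !f0E//; have /andP[? _] := x1; have /andP[? _] := x2; exact: log_convex.
Qed.

(** The interval is cut into steps short enough for the difference quotients of [u], the steps are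
    summed, and a time at most as bad as the average is taken. The resulting bound is linear in
    [ln eps], with a constant that depends on neither [u] nor [eps]. *)
Lemma log_time (r : R) : 0 < r -> exists2 K : R, 0 <= K &
 forall eps (f0 f1 f2 h1 : R -> R) (L c : R) u w (a b : R), 0 < eps -> eps <= 1 ->
 mprofile f0 f1 f2 f0 h1 (fun=> 1) L c ->
 (forall s, 0 <= s <= 1 -> f0 s = - ln (eps + s)) -> (forall s, 0 <= s <= 1 -> f1 s = - (eps + s)^-1) ->
 generator mu setT S u w -> {ae mu, forall x, 0 <= u x <= 1} -> 0 < a -> a < b ->
 exists2 s, a <= s <= b & forall i t, 0 < t -> t <= 1 ->
  shift_osc r f0 (S s u) i t <= K * (2 - ln eps) * (1 + (b - a)^-1) + 1.
Proof.
move=> r0; have [K1 [K3 [K10 K30 hK]]] := log_shift_osc r0.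
have r20 : 0 < r + 2 by rewrite addr_gt0.
pose eta (x : Rd) : R := cutoff (r + 2) x * cutoff (r + 2) x.
have tX := @cutoff_test R d _ r20.
have te : testT eta by apply: test_funM => //; exact: test_Coo tX.
have e01 x : 0 <= eta x <= 1.
 by have /andP[? ?] := cutoff01 (r + 2) x; rewrite mulr_ge0//= mulr_ile1.
have ie : ibl mu eta := ibl_test_mu te.
have Ie0 : 0 <= Int mu eta by apply: Int_ge0 => x; have /andP[] := e01 x.
exists (K1 * (2 * Int mu eta) + K3); first by rewrite addr_ge0// mulr_ge0// mulr_ge0.
move=> eps f0 f1 f2 h1 L c u w a b ep ep1 mp f0E f1E gu u01 a0 ab.
have [iu iw hg] := gen_eps hS gu.
have L0 : 0 <= L := le_trans (normr_ge0 _) (mp_bound0 mp 0).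
(* Two errors of this size, multiplied by [K1 * L], stay below the summand 1 of the conclusion. [L]
   depends on [eps], and the number of time steps adapts to it. *)
have pe : 0 < (2 * (K1 * L + 1))^-1 by rewrite invr_gt0 mulr_gt0// ltr_wpDl// mulr_ge0.
have [d1 d10 hd1] := hg _ pe; have [d3 d30 hd3] := sg_cont0 hS iw pe.
have [tm [tm0 tm1 tm2]] := small_pos d10 d30.
have ba : 0 < b - a by rewrite subr_gt0.
pose N := (Num.bound ((b - a) / tm)).+1; pose tau := (b - a) / N%:R.
have N0 : 0 < N%:R :> R by rewrite ltr0n.
have t0 : 0 < tau by rewrite divr_gt0.
have ttm : tau < tm.
 rewrite ltr_pdivrMr// mulrC -ltr_pdivrMr//; apply: lt_le_trans (archi_boundP _) _.
  by rewrite ltW// divr_gt0.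
 by rewrite ler_nat leqnSn.
have Nt : N%:R * tau = b - a by rewrite /tau mulrC divfK// gt_eqF.
have eb : L * Int mu (fun x => `|S tau w x - tau^-1 * (S tau u x - u x)|) <= L / (K1 * L + 1).
 apply: ler_wpM2l => //.
 have i1 := sgL1 hS t0 iw; have i2 := sgL1 hS t0 iu; have i3 := iblZ tau^-1 (iblB i2 iu).
 have T := Int_dist_triangle i1 iw i3.
 apply: le_trans T _.
 have e1 := hd3 _ t0 (lt_trans ttm tm2); have e2 := hd1 _ t0 (lt_trans ttm tm1).
 have e2' : Int mu (fun x => `|w x - tau^-1 * (S tau u x - u x)|) = Int mu (fun x => `|tau^-1 * (S tau u x - u x) - w x|).
  by apply: eq_Int => x; rewrite distrC.
 rewrite e2' (_ : (K1 * L + 1)^-1 = (2 * (K1 * L + 1))^-1 + (2 * (K1 * L + 1))^-1).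
  by apply: lerD; exact: ltW.
 by rewrite invfM; field; rewrite gt_eqF// ltr_wpDl// mulr_ge0.
pose J k := Int mu (fun x => f0 (S (a + k%:R * tau) u x) * eta x).
pose y k := - Int mu (fun x => S (a + k.+1%:R * tau) w x * (f1 (S (a + k.+1%:R * tau) u x) * eta x)).
have ak k : 0 < a + k%:R * tau by rewrite ltr_pwDl// mulr_ge0// ltW.
have hy k : (k < N)%N -> y k <= tau^-1 * (J k - J k.+1) + L / (K1 * L + 1).
 move=> _; have := log_time_step te e01 ep mp f0E f1E gu u01 (ak k) t0.
 have E : a + k%:R * tau + tau = a + k.+1%:R * tau by rewrite -natr1; ring.
 by rewrite E => h; apply: le_trans h _; rewrite lerD2l.
have Jb k : `|J k| <= (1 - ln eps) * Int mu eta.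
 have ib := sgL1 hS (ak k) iu; have cf0 := smooth_continuous (pf_smooth0 (mp_profile mp)).
 have iJ : ibl mu (fun x => f0 (S (a + k%:R * tau) u x) * eta x).
  by apply: (iblbM ie (measurable_comp_ibl cf0 ib)) => x; exact: mp_bound0 mp _.
 apply: le_trans (Int_abs iJ) _; rewrite -(IntZ _ ie); apply: ae_le_Int; [exact: ibl_abs|exact: iblZ|].
 apply: filterS (sg_le1 hS (ak k) iu u01) => x hx; have /andP[ex _] := e01 x.
 by rewrite normrM (ger0_norm ex); apply: ler_wpM2r => //; rewrite f0E//; exact: log_abs_bound.
have hD : J 0%N - J N <= 2 * ((1 - ln eps) * Int mu eta).
 by apply: le_trans (ler_norm _) _; exact: abs_sub_le2.
have [k kN hk] := telescope_exists t0 (isT : (0 < N)%N) hy hD.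
exists (a + k.+1%:R * tau).
 rewrite lerDl mulr_ge0 ?(ltW t0)//= -lerBrDl -Nt ler_pM2r// ler_nat; exact: kN.
move=> i t tp t1; have gs := gen_sg hS (ak k.+1) gu.
apply: le_trans (hK eps f0 f1 f2 h1 L c _ _ i t ep ep1 mp f0E gs (sg_le1 hS (ak k.+1) iu u01) tp t1) _.
rewrite Nt in hk; have lge : ln eps <= 0 by rewrite ln_le0.
have KL : K1 * (L / (K1 * L + 1)) <= 1.
 by rewrite mulrA ler_pdivrMr ?mul1r ?lerDl//; rewrite ltr_wpDl// mulr_ge0.
have hk2 := ler_wpM2l K10 hk; rewrite /y in hk2.
apply: le_trans (lerD hk2 (lexx _)) _; move: KL Ie0.
have ib : 0 <= (b - a)^-1 by rewrite invr_ge0 ltW.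
exact: log_final_real.
Qed.

(** * Positivity at a dense set of times *)

Definition gen_approx f := forall e : R, 0 < e -> exists u w, [/\ generator mu setT S u w,
 {ae mu, forall x, 0 <= u x <= 1} & Int mu (fun x => `|u x - f x|) < e].

(** The oscillation is a fraction [1 / (k + 1)] of [(2 - ln eps)^2], the square of the size that
    [f0] has on the zero set; the condition [k + 1 <= 2 - ln eps] forces [eps] to 0 as [k] grows. *)
Definition small_osc (k : nat) g := exists (eps : R) (f0 : R -> R), [/\ 0 < eps, eps <= 1,
 k.+1%:R <= 2 - ln eps, continuous f0 & [/\ exists L, forall s, `|f0 s| <= L,
  forall s, 0 <= s <= 1 -> f0 s = - ln (eps + s) &
  forall i t, 0 < t -> t <= 1 -> shift_osc k.+1%:R f0 g i t <= (2 - ln eps) ^+ 2 / k.+1%:R]].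

Lemma sg_dist s f g : 0 < s -> ibl mu f -> ibl mu g ->
 Int mu (fun x => `|S s f x - S s g x|) <= Int mu (fun x => `|f x - g x|).
Proof.
move=> s0 hf hg; apply: le_trans (sg_norm hS s0 (iblB hf hg)); apply: eq_ler.
apply: ae_eq_Int; [exact: ibl_meas (ibl_abs (iblB (sgL1 hS s0 hf) (sgL1 hS s0 hg)))|
 exact: ibl_meas (ibl_abs (sgL1 hS s0 (iblB hf hg)))|].
by apply: filterS (sg_B hS s0 hf hg) => x ->.
Qed.

Lemma sg_dist_time s t f : 0 < s -> 0 < t -> ibl mu f ->
 Int mu (fun x => `|S (s + t) f x - S s f x|) <= Int mu (fun x => `|S t f x - f x|).
Proof.
move=> s0 t0 hf; have ht := sgL1 hS t0 hf.
apply: le_trans (sg_dist s0 ht hf); apply: eq_ler.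
apply: ae_eq_Int; [exact: ibl_meas (ibl_abs (iblB (sgL1 hS (addr_gt0 s0 t0) hf) (sgL1 hS s0 hf)))|
 exact: ibl_meas (ibl_abs (iblB (sgL1 hS s0 ht) (sgL1 hS s0 hf)))|].
by apply: filterS (sg_add hS s0 t0 ((Lp_onT mu _).2 hf)) => x ->.
Qed.

Lemma sg_continuous s f (e : R) : 0 < s -> ibl mu f -> 0 < e -> exists2 dl : R, 0 < dl &
 forall s', `|s' - s| < dl -> 0 < s' /\ Int mu (fun x => `|S s' f x - S s f x|) < e.
Proof.
move=> s0 hf e0; have [d0 d00 h0] := sg_cont0 hS hf e0.
have [dl [l0 l1 l2]] := small_pos d00 s0; exists dl => // s' hs.
move: hs; rewrite ltr_norml => /andP[a b]; have s'0 : 0 < s' by lra.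
split => //; have [ss|ss|->] := ltgtP s' s.
- have t0 : 0 < s - s' by rewrite subr_gt0.
 have := sg_dist_time s'0 t0 hf; rewrite addrC subrK => h.
 have h1 := h0 _ t0; have l3 : s - s' < d0 by lra.
 apply: le_lt_trans (h1 l3); apply: le_trans h; apply: eq_ler.
 by apply: eq_Int => x; rewrite distrC.
- have t0 : 0 < s' - s by rewrite subr_gt0.
 have := sg_dist_time s0 t0 hf; rewrite addrC subrK => h.
 by apply: le_lt_trans h (h0 _ t0 _); lra.
- rewrite (@eq_Int _ _ _ _ _ (fun=> 0)) ?Int0// => x; by rewrite subrr normr0.
Qed.

Lemma osc_budget (K y k ib : R) : 0 < k -> 0 <= K -> 0 <= ib -> 2 * k * (K * (1 + ib) + 1) <= y -> 1 <= y ->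
 K * y * (1 + ib) + 1 + 2 * (y ^+ 2 / (4 * k)) <= y ^+ 2 / k.
Proof.
move=> k0 K0 i0 h y1; set c := K * (1 + ib) in h *.
have -> : K * y * (1 + ib) = c * y by rewrite /c; ring.
have -> : y ^+ 2 / k = y ^+ 2 / (2 * k) + 2 * (y ^+ 2 / (4 * k)) by field; rewrite gt_eqF.
rewrite lerD2r ler_pdivlMr ?mulr_gt0//.
have : (2 * k * (c + 1)) * y <= y * y by apply: ler_wpM2r => //; lra.
move: (2 * k) (mulr_gt0 (ltr0n R 2) k0) => K2 K20 hh; rewrite expr2.
have : K2 * 1 <= K2 * y by rewrite ler_pM2l.
lra.
Qed.

(** For small [eps] the linear bound of [log_time] takes at most half of the quadratic budget. The
    other half is shared equally by two errors in mean: replacing [f] by an element of the domain,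
    and [s] by a nearby time. *)
Lemma small_osc_near k f (a b : R) : ibl mu f -> gen_approx f -> 0 < a -> a < b ->
 exists2 s, a <= s <= b & exists2 dl : R, 0 < dl & forall s', `|s' - s| < dl -> small_osc k (S s' f).
Proof.
move=> hf app a0 ab; have k0 : 0 < k.+1%:R :> R by rewrite ltr0n.
have [K K0 hK] := log_time k0; have [V V0 hV] := shift_osc_lip k0.
have ib0 : 0 <= (b - a)^-1 by rewrite invr_ge0 subr_ge0 ltW.
(* With [eps = exp(- Y)] the number [y = 2 - ln eps] satisfies the lower bound of [osc_budget]; the
   last summand gives [k + 1 <= y]. *)
pose Y := 2 * k.+1%:R * (K * (1 + (b - a)^-1) + 1) + k.+1%:R.
have Y0 : 0 < Y by rewrite ltr_wpDl// !mulr_ge0// addr_ge0// mulr_ge0// addr_ge0.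
have kY : k.+1%:R <= Y by rewrite lerDr !mulr_ge0// addr_ge0// mulr_ge0// addr_ge0.
have k1 : 1 <= k.+1%:R :> R by rewrite ler1n.
pose eps := expR (- Y); have ep : 0 < eps := expR_gt0 _.
have ep1 : eps <= 1 by rewrite -expR0 ler_expR oppr_le0 ltW.
have lnE : ln eps = - Y by rewrite expRK.
have [f0 [f1 [f2 [h1 [L [c [mp f0E f1E]]]]]]] := log_profile ep ep1.
have cf0 := smooth_continuous (pf_smooth0 (mp_profile mp)).
set y := 2 - ln eps; have y1 : 1 <= y by rewrite /y lnE; lra.
have yY : 2 * k.+1%:R * (K * (1 + (b - a)^-1) + 1) <= y by rewrite /y lnE /Y; lra.
have bud := osc_budget k0 K0 ib0 yY y1.
pose e1 := y ^+ 2 / (4 * k.+1%:R); have e10 : 0 < e1.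
 by apply: divr_gt0; [exact: exprn_gt0 (lt_le_trans ltr01 y1)|exact: mulr_gt0].
set X := V * L ^+ 2; have X0 : 0 <= X by rewrite mulr_ge0// sqr_ge0.
have X1 : 0 < X + 1 by rewrite ltr_wpDl.
pose e0 := e1 / (X + 1); have e00 : 0 < e0 by rewrite divr_gt0.
have Xe t : t < e0 -> X * t <= e1.
 move=> /ltW te; apply: le_trans (ler_wpM2l X0 te) _.
 by rewrite /e0 mulrCA -[leRHS]mulr1 ler_pM2l// ler_pdivrMr// mul1r lerDl.
have [u [w [gu u01 uf]]] := app _ e00; have [iu _ _] := gen_eps hS gu.
have [s /andP[sa sb] hs] := hK eps f0 f1 f2 h1 L c u w a b ep ep1 mp f0E f1E gu u01 a0 ab.
have s0 : 0 < s := lt_le_trans a0 sa.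
have [dl dl0 hdl] := sg_continuous s0 hf e00.
exists s; [by rewrite sa|exists dl => // s' /hdl[s'0 hs']].
exists eps, f0; split => //; first by rewrite lnE; lra.
split => //; first by exists L; exact: mp_bound0 mp.
move=> i t t0 t1; apply: le_trans bud.
have lip := pf_lip0 (mp_profile mp); have bd := mp_bound0 mp.
have q1 := hV f0 L _ _ i t cf0 bd lip (sgL1 hS s'0 hf) (sgL1 hS s0 hf) t0 t1.
have q2 := hV f0 L _ _ i t cf0 bd lip (sgL1 hS s0 hf) (sgL1 hS s0 iu) t0 t1.
have q3 : Int mu (fun x => `|S s f x - S s u x|) < e0.
 apply: le_lt_trans (sg_dist s0 hf iu) _; apply: le_lt_trans uf; apply: eq_ler.
 by apply: eq_Int => x; rewrite distrC.
have q4 := hs i t t0 t1; have q5 := Xe _ hs'; have q6 := Xe _ q3.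
apply: le_trans q1 _; apply: (le_trans (lerD q2 q5)); apply: le_trans (lerD (lerD q4 q6) (lexx _)) _.
by rewrite -addrA mulr_natl mulr2n.
Qed.

(** A good time for one [k] depends on [k]. Each condition holds on an open dense set of times, and
    Baire's theorem provides times that are good for all [k] at once. *)
Lemma small_osc_dense f (a b : R) : ibl mu f -> gen_approx f -> 0 < a -> a < b ->
 exists2 s, a < s < b & forall k, small_osc k (S s f).
Proof.
(* Baire's theorem is applied on the whole line, so nonpositive times are declared good. *)
move=> hf app a0 ab; pose O k := interior [set s : R | s <= 0 \/ small_osc k (S s f)].
have hO k : open (O k) /\ dense (O k).
 split; first exact: open_interior.
 move=> D [x Dx] oD; have /nbhs_ballP[e /= e0 xe] : nbhs x D by exact: open_nbhs_nbhs.
 have [x0|x0] := leP x 0.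
  exists (x - e / 2); split; first by apply: xe; rewrite /ball/= opprB addrC subrK gtr0_norm; lra.
  apply/nbhs_ballP; exists (e / 2) => /=; first by rewrite divr_gt0.
  by move=> y; rewrite /ball/= ltr_norml => /andP[y1 y2]; left; lra.
 have [m [m0 m1 m2]] := small_pos e0 x0; have xm : 0 < x - m by lra.
 have xm2 : x - m < x by lra.
 have [s /andP[s1 s2] [dl dl0 hs]] := small_osc_near k hf app xm xm2.
 exists s; split; first by apply: xe; rewrite /ball/= ltr_norml; apply/andP; split; lra.
 apply/nbhs_ballP; exists dl => //= y; rewrite /ball/= distrC => ys.
 by right; exact: hs.
have ne : [set x : R | a < x < b] !=set0 by exists ((a + b) / 2) => /=; apply/andP; split; lra.
have oab : open [set x : R | a < x < b].
 rewrite (_ : [set x | _] = [set x | a < x] `&` [set x | x < b]).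
  by apply: openI; [exact: open_gt|exact: open_lt].
 by apply/seteqP; split => x /= => [/andP[]|[-> ->]].
have [s [/= /andP[s1 s2] hs]] := @Baire R R O hO _ ne oab.
exists s => [|k]; first by rewrite s1.
have /interior_subset /= [h|//] := hs k I; lra.
Qed.

Definition zero_ind g x : R := \1_[set (0 : R)] (g x).

Lemma zero_ind01 g x : zero_ind g x = 0 \/ zero_ind g x = 1.
Proof. by rewrite /zero_ind indicE; case: (_ \in _); [right|left]. Qed.

Lemma zero_ind_meas g : meas g -> meas (zero_ind g).
Proof.
have m1 : meas (\1_[set (0 : R)] : R -> R) by apply: measurable_indic; exact: measurable_set1.
by move=> mg; exact: (measurableT_comp m1 mg).
Qed.

(** For [s = 0] numerator and denominator differ by 2; for [s > 0] the numerator stays bounded while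
    the denominator grows. *)
Lemma log_ratio_cvg (ep : nat -> R) (F : nat -> R -> R) s : (forall k, 0 < ep k) -> (forall k, ep k <= 1) ->
 (forall k, k.+1%:R <= 2 - ln (ep k)) -> (forall k s, 0 <= s <= 1 -> F k s = - ln (ep k + s)) ->
 0 <= s <= 1 -> F k s / (2 - ln (ep k)) @[k --> \oo] --> (\1_[set (0 : R)] s : R).
Proof.
move=> e0 e1 ek hF s01; apply: cvg0_sub.
pose B := 2 + `|ln s|; have B0 : 0 <= B by rewrite addr_ge0.
have := @cvg_harmonic R B; apply: cvg0_le => k.
have k0 : 0 < k.+1%:R :> R by rewrite ltr0n.
have y0 : 0 < 2 - ln (ep k) := lt_le_trans k0 (ek k).
apply: (@le_trans _ _ (B / (2 - ln (ep k)))); last first.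
 by apply: ler_wpM2l => //; rewrite lef_pV2 ?posrE.
rewrite hF// ler_pdivlMr// -{2}[2 - ln (ep k)]gtr0_norm// -normrM mulrBl divfK ?gt_eqF//.
rewrite indicE; have [/set_mem /= ->|/negP sn] := boolP (s \in [set (0 : R)]).
 rewrite addr0 mul1r (_ : - ln (ep k) - (2 - ln (ep k)) = - 2); last by ring.
 by rewrite normrN ger0_norm// /B lerDl.
have s0 : 0 < s.
 have /andP[h _] := s01; rewrite lt_neqAle h andbT eq_sym; apply/eqP => h0.
 by apply: sn; rewrite inE.
rewrite mul0r subr0 normrN /B.
have a1 : ln s <= ln (ep k + s) by rewrite ler_ln ?posrE ?lerDr ?ltW// ltr_wpDl// ltW.
have a2 : ln (ep k + s) <= 1.
 have := @le_ln1Dx R (ep k + s - 1); rewrite (_ : 1 + (ep k + s - 1) = ep k + s); last by ring.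
 have /andP[_ s1] := s01; have := e0 k; have := e1 k => h3 h4 h; apply: le_trans (h _) _; lra.
by rewrite ler_norml; have := ler_norm (- ln s); rewrite normrN => h; apply/andP; split; have := normr_ge0 (ln s); lra.
Qed.

(** After division by [(2 - ln eps)^2] the oscillations have integral at most [1 / (k + 1)], while
    the integrands converge to the squared difference of the indicators of the zero set and of its
    translate. Fatou's lemma concludes. *)
Lemma zero_set_invariant g i t : ibl mu g -> {ae mu, forall x, 0 <= g x <= 1} ->
 (forall k, small_osc k g) -> 0 < t -> t <= 1 -> invariant_shift (zero_ind g) (t *: e_ i).
Proof.
move=> hg g01 ho t0 t1; have /choice[ep /choice[F hF]] := ho; set z := t *: e_ i.
have mg := ibl_meas hg; have mz := zero_ind_meas mg.
have mzz : meas (fun x => (zero_ind g (x + z) - zero_ind g x) ^+ 2).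
 by apply: measurable_funX; apply: measurable_funB => //; exact: (shift_measurableM z mz).
have g01l := (ae_mu hmu _).1 g01.
pose G k x := \1_(cube k.+1%:R) x * (F k (g (x + z)) - F k (g x)) ^+ 2 * (2 - ln (ep k)) ^- 2.
have iG k : ibl leb (G k).
 have [_ _ _ cF [[L hL'] _ _]] := hF k; apply: iblZr.
 have mF := measurable_comp_ibl cF hg.
 apply: (@ibl_closed_bounded k.+1%:R _ _ ((2 * L) ^+ 2) (@cube_closed R d _)) => //.
  by apply: measurable_funX; apply: measurable_funB => //; exact: (shift_measurableM z mF).
 have L0 : 0 <= L := le_trans (normr_ge0 _) (hL' 0).
 by move=> x; rewrite normrX; apply: lerXn2r; rewrite ?nnegrE ?mulr_ge0//; exact: abs_sub_le2.
have y0 k : 0 < 2 - ln (ep k).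
 by have [_ _ h _ _] := hF k; apply: lt_le_trans h; rewrite ltr0n.
have G0 k x : 0 <= G k x.
 by apply: mulr_ge0; [apply: mulr_ge0; [exact: indic_ge0|exact: sqr_ge0]|rewrite invr_ge0 sqr_ge0].
have IG k : Int leb (G k) <= k.+1%:R^-1.
 have [_ _ _ _ [_ _ /(_ i t t0 t1) h]] := hF k.
 have -> : Int leb (G k) = (2 - ln (ep k)) ^- 2 * shift_osc k.+1%:R (F k) g i t.
  have [_ _ _ cF [[L hL'] _ _]] := hF k; have mF := measurable_comp_ibl cF hg.
  have L0 : 0 <= L := le_trans (normr_ge0 _) (hL' 0).
  rewrite -IntZ; first by apply: eq_Int => x; rewrite /G mulrC.
  apply: (@ibl_closed_bounded k.+1%:R _ _ ((2 * L) ^+ 2) (@cube_closed R d _)) => //.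
   by apply: measurable_funX; apply: measurable_funB => //; exact: (shift_measurableM z mF).
  by move=> x; rewrite normrX; apply: lerXn2r; rewrite ?nnegrE ?mulr_ge0//; exact: abs_sub_le2.
 rewrite mulrC ler_pdivrMr ?exprn_gt0// mulrC; exact: h.
have cG : {ae leb, forall x, G k x @[k --> \oo] --> (zero_ind g (x + z) - zero_ind g x) ^+ 2}.
 move: g01l (ae_shift z g01l); apply: filterS2 => x h1 h2.
 have e0 k : 0 < ep k by have [] := hF k.
 have e1 k : ep k <= 1 by have [] := hF k.
 have e2 k : k.+1%:R <= 2 - ln (ep k) by have [] := hF k.
 have e3 k s : 0 <= s <= 1 -> F k s = - ln (ep k + s) by have [_ _ _ _ [_ + _]] := hF k; apply.
 have c1 := log_ratio_cvg e0 e1 e2 e3 h1; have c2 := log_ratio_cvg e0 e1 e2 e3 h2.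
 have cc : \1_(cube k.+1%:R) x @[k --> \oo] --> (1 : R).
  apply: cvg0_sub; apply: cvg0P => e ee; exists (Num.bound `|x|) => k hk.
  rewrite indicE_in ?subrr ?normr0// => j; apply: le_trans (norm_coord x j) _.
  apply: le_trans (ltW (archi_boundP (normr_ge0 x))) _; rewrite ler_nat; exact: leqW.
 pose D k := F k (g (x + z)) / (2 - ln (ep k)) - F k (g x) / (2 - ln (ep k)).
 have cD : D k @[k --> \oo] --> zero_ind g (x + z) - zero_ind g x by apply: cvgB; [exact: c2|exact: c1].
 have : \1_(cube k.+1%:R) x * (D k * D k) @[k --> \oo] --> 1 * ((zero_ind g (x + z) - zero_ind g x) * (zero_ind g (x + z) - zero_ind g x)).
  by apply: cvgM; [exact: cc|apply: cvgM; exact: cD].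
 rewrite mul1r -expr2; apply: cvg_ext => k; rewrite /D.
 rewrite /G; field; exact: lt0r_neq0 (y0 k).
have hM (e : R) : 0 < e -> ibl leb (fun x => (zero_ind g (x + z) - zero_ind g x) ^+ 2) /\
  Int leb (fun x => (zero_ind g (x + z) - zero_ind g x) ^+ 2) <= e.
 move=> e0; have [N hN] := cvg0_eN (@cvg_harmonic R 1) e0.
 apply: (@Int_fatou _ _ _ leb (fun k => G (k + N)%N)) => //.
 - by move: cG; apply: filterS => x; rewrite (cvg_shiftn N (fun k => G k x)).
 - move=> k; apply: le_trans (IG _) _; have := hN (k + N)%N (leq_addl _ _).
  by rewrite div1r gtr0_norm ?invr_gt0 ?ltr0n//; exact: ltW.
 - by move=> x; exact: sqr_ge0.
have [iz _] := hM 1 ltr01.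
have Iz : Int leb (fun x => (zero_ind g (x + z) - zero_ind g x) ^+ 2) = 0.
 apply/eqP; rewrite eq_le; apply/andP; split; last by apply: Int_ge0 => x; exact: sqr_ge0.
 by apply/ler_addgt0Pr => e e0; rewrite add0r; exact: (hM e e0).2.
have := Int_eq0 iz (fun x => sqr_ge0 _) Iz; apply: filterS => x /eqP.
by rewrite sqrf_eq0 subr_eq0 => /eqP.
Qed.

(** The zero set of [S s f] is null or of full measure. Full measure would put [S s f] at distance
    [|f|_1] from [f], which continuity at time 0 excludes for [s < t1]. *)
Lemma sg_positive f : ibl mu f -> {ae mu, forall x, 0 <= f x <= 1} -> gen_approx f ->
 0 < Int mu (fun x => `|f x|) -> exists2 t1 : R, 0 < t1 &
 forall a b, 0 < a -> a < b -> b <= t1 -> exists2 s, a < s < b & {ae mu, forall x, 0 < S s f x}.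
Proof.
move=> hf f01 app If; have [t1 t10 ht] := sg_cont0 hS hf If.
exists t1 => // a b a0 ab bt; have [s /andP[sa sb] hs] := small_osc_dense hf app a0 ab.
exists s; first by rewrite sa.
have s0 : 0 < s by lra.
have ig := sgL1 hS s0 hf; have g01 := sg_le1 hS s0 hf f01.
have inv := invariant_shift_all (fun i t h1 h2 => zero_set_invariant i ig g01 hs h1 h2).
have [h|h] := invariant_const 0 (zero_ind_meas (ibl_meas ig)) (zero_ind01 _) inv.
 move: g01 ((ae_mu hmu _).2 h); apply: filterS2 => x /andP[g0 _] hz; rewrite lt_neqAle g0 andbT eq_sym.
 apply/eqP => e; move: hz; rewrite /zero_ind indicE mem_set// => /eqP; by rewrite oner_eq0.
exfalso; have st : s < t1 by lra.
have := ht s s0 st; rewrite lt_neqAle => /andP[/eqP hn _]; apply: hn.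
apply: ae_eq_Int; [exact: ibl_meas (ibl_abs (iblB ig hf))|exact: ibl_meas (ibl_abs hf)|].
apply: filterS ((ae_mu hmu _).2 h) => x; rewrite /zero_ind indicE.
have [/set_mem /= -> _|_ /eqP] := boolP (_ \in _); first by rewrite sub0r normrN.
by rewrite eq_sym oner_eq0.
Qed.

(** * De Giorgi iteration on sublevel sets *)

Definition sublevel v x0 (l r : R) : set Rd := cube_at x0 r `&` [set x | v x < l].

Lemma sublevel_measurable v x0 l r : meas v -> measurable (sublevel v x0 l r).
Proof.
move=> mv; apply: measurableI; first by apply: closed_measurable_rV; exact: cube_at_closed.
have := superlevel_measurable (- l) (measurableT_comp (@oppr_measurable R setT) mv).
by congr measurable; apply/seteqP; split => x /=; rewrite ltrN2.
Qed.

Lemma sublevel_ibl v x0 l r : meas v -> ibl leb (\1_(sublevel v x0 l r) : Rd -> R).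
Proof.
move=> mv; have mD := sublevel_measurable x0 l r mv.
apply: (Int_indic mD _).1; apply: le_lt_trans (leb_compact_lty (@cube_compact R d (r + `|x0|))).
apply: le_measure; rewrite ?inE//; first by apply: closed_measurable_rV; exact: cube_closed.
by move=> x [/cube_at_cube].
Qed.

Lemma flux_abs_pow K : compact K -> ibl leb (fun x => flux_abs x ^+ d * \1_K x).
Proof.
move=> cK; have d0 : (0 < d)%N by exact: ltnW.
have h : powloc d flux_abs.
 apply: powloc_sum => // i; have [mf hf] := flux_powloc d2 dp hA hmu i; split.
  exact: measurableT_comp.
 by move=> K' /hf; apply: eq_ibl => x; rewrite normr_id.
have [_ /(_ K cK)] := h; apply: eq_ibl => x; rewrite ger0_norm//; exact: sumr_ge0.
Qed.

(** Young's inequality at the scale [r]. Over a set of measure at most [r^d] the first term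
    integrates to at most [r^(d-1)], and the second to [r^(d-1)] times a fixed integral; here the
    L^d_loc bound on [flux] enters. *)
Lemma flux_split (y r : R) : 0 <= y -> 0 < r -> y <= r^-1 + r ^+ d.-1 * y ^+ d.
Proof.
move=> y0 r0; have dE : d = d.-1.+1 by rewrite prednK//; exact: ltnW.
have ry0 : 0 <= r * y by rewrite mulr_ge0// ltW.
have : r * y <= 1 + (r * y) ^+ d.
 have [h|h] := leP (r * y) 1; first by apply: le_trans h _; rewrite lerDl exprn_ge0.
 apply: (@le_trans _ _ ((r * y) ^+ d)); last by rewrite lerDr.
 by rewrite dE exprS ler_peMr// exprn_ege1// ltW.
by move=> h; rewrite -(ler_pM2l r0) mulrDr mulfV ?gt_eqF// mulrA -exprS -dE -exprMn.
Qed.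

(** The number [r], whose power [r^d] bounds the measure of the larger sublevel set, is also the
    length of the shifts. Over such shifts the gradient bound gains a factor [r^2], and
    [average_shift] turns the translation estimate into a norm estimate, so the measure improves
    from [r^d] to a multiple of [r^(d+1)]. *)
Lemma sublevel_step x0 : exists2 K : R, 0 <= K & forall v w (l kap rr r' r : R),
 generator mu setT S v w -> {ae mu, forall x, 0 <= v x <= 1} -> {ae mu, forall x, w x <= v x} ->
 0 < l -> l <= 1 -> 0 < kap -> r' < rr -> rr <= 2 -> rr - r' <= 1 -> 0 < r -> r <= 1 ->
 Int leb (\1_(sublevel v x0 l rr) : Rd -> R) <= r ^+ d ->
 Int leb (\1_(sublevel v x0 (l - kap) r') : Rd -> R) <=
 K * ((l / kap) ^+ 2 * (rr - r') ^- 2 * r ^+ d.+1).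
Proof.
have rb : 0 < 2 + `|x0| by rewrite ltr_pwDl.
have [K1 [K2 [K10 K20 hK]]] := gradient_limit rb.
have [c0 [Mr [c00 hM]]] := rho_bounds hmu (2 + `|x0|).
have Mr0 : 0 <= Mr.
 have /hM/andP[h1 h2] : cube (2 + `|x0|) (0 : Rd) by move=> i; rewrite mxE normr0 ltW.
 exact: le_trans (le_trans (ltW c00) h1) h2.
have [s1 [Cs [ds Cs0 hs1]]] := @step_deriv_bounded R.
have iPhi := flux_abs_pow (@cube_compact R d (2 + `|x0|)).
set Phi := Int leb (fun x => flux_abs x ^+ d * \1_(cube (2 + `|x0|)) x) in iPhi.
have fa0 x : 0 <= flux_abs x by apply: sumr_ge0.
have Phi0 : 0 <= Phi by apply: Int_ge0 => x; rewrite mulr_ge0 ?indic_ge0 ?exprn_ge0.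
have cR0 : 0 < ramp (1 : R) by rewrite /ramp mul1r bexp_gt0.
pose C1 := d%:R * (2 * (K1 * Mr) + 2 * (K2 * (4 * Cs ^+ 2 + Cs * (1 + Phi))) + 8 * Cs ^+ 2 * d%:R).
have C10 : 0 <= C1.
 by rewrite /C1; repeat (first [exact: ler0n|exact: exprn_ge0|apply: mulr_ge0|apply: addr_ge0|by []]).
exists (C1 / ramp 1 ^+ 2) => [|v w l kap rr r' r gv v01 wv l0 l1 k0 r'r rr2 g1 r0 r1 hm].
 by rewrite divr_ge0// sqr_ge0.
have g0 : 0 < rr - r' by rewrite subr_gt0.
set g := rr - r' in g0 g1 *; have [iv iw _] := gen_eps hS gv; have mv := ibl_meas iv.
have v01l := (ae_mu hmu _).1 v01; have wvl := (ae_mu hmu _).1 wv.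
(* A cutoff for one coordinate: 1 for [|s| <= r'], 0 for [|s| >= rr], with a slope of order [1 / g]
   in between. *)
pose sg (s : R) := step (rr / g + (- g^-1) * s) * step (rr / g + g^-1 * s).
pose sg1 (s : R) := step (rr / g + (- g^-1) * s) * (g^-1 * s1 (rr / g + g^-1 * s)) +
  step (rr / g + g^-1 * s) * ((- g^-1) * s1 (rr / g + (- g^-1) * s)).
have ss : smooth sg.
 by move=> k; apply: S1M; apply: (S1_comp (@smooth_step R k)); exact: S1_affine.
have dsg : is_deriv sg sg1.
 move=> s; exact: is_deriveM (is_deriv_shift (rr / g) (- g^-1) ds s) (is_deriv_shift (rr / g) g^-1 ds s).
have st01 (s : R) : 0 <= step s <= 1 by rewrite step_ge0 step_le1.
have sg01 s : 0 <= sg s <= 1 by rewrite mulr_ge0 ?step_ge0//= mulr_ile1 ?step_ge0 ?step_le1.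
have ig0 : 0 < g^-1 by rewrite invr_gt0.
pose M := 2 * Cs / g; have M0 : 0 <= M by rewrite divr_ge0 ?mulr_ge0// ltW.
have sgM s : `|sg1 s| <= M.
 have B (a b e : R) : `|e| = g^-1 -> `|step a * (e * s1 b)| <= g^-1 * Cs.
  move=> eE; rewrite (normrM (step a)) (normrM e) eE -[leRHS]mul1r; apply: ler_pM => //; first by rewrite mulr_ge0// ltW.
   by rewrite ger0_norm ?step_ge0 ?step_le1.
  by rewrite ler_pM2l.
 have n1 : `|g^-1| = g^-1 by rewrite gtr0_norm.
 have n2 : `|- g^-1| = g^-1 by rewrite normrN.
 apply: le_trans (ler_normD _ _) _; apply: le_trans (lerD (B _ _ _ n1) (B _ _ _ n2)) _.
 by rewrite /M; apply: eq_ler; ring.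
have sgo s : rr < `|s| -> sg s = 0.
 rewrite ltr_normr => /orP[h|h].
  rewrite /sg step_le0 ?mul0r// mulNr mulrC -mulrBr pmulr_rle0// subr_le0; exact: ltW.
 rewrite /sg [X in _ * X]step_le0 ?mulr0// mulrC -mulrDr pmulr_rle0//; lra.
have sgi s : `|s| <= r' -> sg s = 1.
 rewrite ler_norml => /andP[h1 h2]; rewrite /sg !step_ge1 ?mulr1//.
  by rewrite [rr / g]mulrC -mulrDr mulrC ler_pdivlMr// mul1r /g; lra.
 by rewrite mulNr [rr / g]mulrC -mulrBr mulrC ler_pdivlMr// mul1r /g; lra.
have loc := @coord_cut_localizer R d sg sg1 x0 rr M ss dsg sg01 sgM sgo.
pose Q := cube_at x0 rr; set eta := coord_cut sg x0 in loc.
have [te cQ e0 e01 eM] := loc.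
have Qr : Q `<=` cube (2 + `|x0|).
 by move=> x /cube_at_cube h i; apply: le_trans (h i) _; rewrite lerD2r.
have eta1 x : cube_at x0 r' x -> eta x = 1.
 by move=> h; rewrite /eta /coord_cut big1// => i _; apply: sgi; have := h i; rewrite !mxE.
have [f0 [f1 [f2 [h [h1 [L [c [mp f0E hE f1E]]]]]]]] := sublevel_profile l0 l1 k0.
have [Us [B [tU cU hB cB]]] := hK _ _ _ _ _ _ _ _ _ _ _ _ _ loc Qr mp gv v01.
have iU n := ibl_test_mu (tU n).
have sh := mp_smooth mp; have ch := smooth_continuous sh.
have L0 : 0 <= L := le_trans (normr_ge0 _) (mp_bound0 mp 0).
pose D := sublevel v x0 l rr; have mD : measurable D by exact: sublevel_measurable.
have iD : ibl leb (\1_D : Rd -> R) by exact: sublevel_ibl.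
have hv : {ae leb, forall x, [/\ 0 <= h (v x), v x < l -> h (v x) <= l, l <= v x -> h (v x) = 0 &
  v x <= l - kap -> kap * ramp 1 <= h (v x)]}.
 apply: filterS v01l => x /andP[vx0 vx1]; rewrite hE//.
 have ik : 0 < kap^-1 by rewrite invr_gt0.
 split.
 - by rewrite mulr_ge0 ?ramp_ge0// ltW.
 - move=> vl; apply: (@le_trans _ _ (kap * (kap^-1 * (l - v x)))).
   by rewrite ler_pM2l//; apply: ramp_le; rewrite mulr_ge0 ?subr_ge0// ltW.
  by rewrite mulrA mulfV ?gt_eqF// mul1r; lra.
 - by move=> lv; rewrite ramp_le0 ?mulr0// pmulr_rle0// subr_le0.
 - move=> vl; rewrite ler_pM2l//; apply: ramp_mono.
  by rewrite mulrC ler_pdivlMr// mul1r; lra.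
have hD : {ae leb, forall x, Q x -> [/\ h (v x) <= l * \1_D x, 0 <= h (v x) & h (v x) = \1_D x * h (v x)]}.
 apply: filterS hv => x [a1 a2 a3 _] Qx; have [vl|vl] := ltP (v x) l.
  have Dx : D x by split.
  by rewrite (indicE_in Dx) mulr1 mul1r; split => //; exact: a2.
 have Dx : ~ D x by move=> [_ /=]; rewrite ltNge vl.
 by rewrite (indicE_out Dx) mulr0 mul0r a3.
set m := Int leb (\1_D : Rd -> R) in hm.
have [hq1 hq2] := sqr_lip (mp_hb mp) (mp_hl mp).
have ch2 : continuous (fun s => h s ^+ 2) by move=> s; apply: continuousM; exact: ch.
pose Yf f := Int leb (fun x => \1_Q x * h (f x) ^+ 2).
have iYf f : ibl mu f -> ibl leb (fun x => \1_Q x * h (f x) ^+ 2).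
 move=> hf; apply: (ibl_closed_bounded (L := 2 * L ^+ 2) cQ Qr) => [|x]; last exact: hq1.
 exact: (measurable_comp_ibl ch2 hf).
have cY : Yf (Us n) @[n --> \oo] --> Yf v.
 have [a1 a2 a3] := local_comp_cvg cQ Qr iU iv cU ch2 hq1 hq2.
 apply: Int_cvg; [by move=> n; exact: iYf|exact: iYf|].
 by apply: cvg_ext a3 => n; apply: eq_Int => x; rewrite mulrBr.
have Y1 : Yf v <= l ^+ 2 * m.
 rewrite /m -(IntZ _ iD); apply: ae_le_Int; [exact: iYf|exact: iblZ|].
 apply: filterS hD => x hx; have [Qx|Qx] := pselect (Q x); last first.
  by rewrite (indicE_out Qx) mul0r mulr_ge0 ?sqr_ge0 ?indic_ge0.
 have [b1 b2 b3] := hx Qx; rewrite (indicE_in Qx) mul1r.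
 have [Dx|Dx] := pselect (D x).
  rewrite (indicE_in Dx) mulr1 in b1; rewrite (indicE_in Dx) mulr1; by apply: lerXn2r => //; rewrite nnegrE// ltW.
 by rewrite b3 (indicE_out Dx) mul0r expr0n mulr0.
have e1 x : `|eta x| <= 1 by have /andP[? ?] := e01 x; rewrite ger0_norm.
set Z := Int leb (fun x => flux_abs x * eta x * `|f0 (v x)|) in cB.
have cf0 := smooth_continuous (pf_smooth0 (mp_profile mp)).
have iZ : ibl leb (fun x => flux_abs x * eta x * `|f0 (v x)|).
 apply: (ibl_flux_abs loc); last by exists L => x; rewrite normr_id (mp_bound0 mp).
 by apply: measurableT_comp => //; exact: measurable_comp_ibl cf0 iv.
(* [f0(v) = h(v)^2 / 2] is at most [l^2 / 2] and vanishes outside [D], where the flux is split by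
   [flux_split]. *)
have Z1 : Z <= l ^+ 2 / 2 * (r ^+ d.-1 * (1 + Phi)).
 have i1 := iblZ (l ^+ 2 / 2) (iblD (iblZ r^-1 iD) (iblZ (r ^+ d.-1) iPhi)).
 apply: (@le_trans _ _ (l ^+ 2 / 2 * (r^-1 * m + r ^+ d.-1 * Phi))); last first.
  apply: ler_wpM2l; first by rewrite divr_ge0 ?sqr_ge0.
  rewrite mulrDr mulr1 lerD2r -(ler_pM2l r0) mulrA mulfV ?gt_eqF// mul1r -exprS prednK//; exact: ltnW.
 rewrite -(IntZ _ iD) -(IntZ _ iPhi) -(IntD (iblZ r^-1 iD) (iblZ (r ^+ d.-1) iPhi)) -IntZ; last first.
  by apply: iblD; exact: iblZ.
 apply: ae_le_Int => //; apply: filterS hD => x hx; rewrite f0E.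
 have [Qx|Qx] := pselect (Q x); last first.
  rewrite (e0 _ Qx) mulr0 mul0r; apply: mulr_ge0; first by rewrite divr_ge0 ?sqr_ge0.
  apply: addr_ge0; first by rewrite mulr_ge0 ?indic_ge0// invr_ge0 ltW.
  by rewrite mulr_ge0 ?mulr_ge0 ?indic_ge0 ?exprn_ge0// ltW.
 have [b1 b2 b3] := hx Qx; rewrite (indicE_in (Qr _ Qx)) mulr1.
 have [Dx|Dx] := pselect (D x); last first.
  rewrite b3 (indicE_out Dx) mul0r expr0n/= mulr0 normr0 !mulr0 add0r.
  by rewrite mulr_ge0 ?divr_ge0 ?sqr_ge0 ?mulr_ge0 ?exprn_ge0// ltW.
 rewrite (indicE_in Dx) mulr1 in b1; rewrite (indicE_in Dx) mulr1.
 rewrite mulrC; apply: ler_pM => //; first by apply: mulr_ge0 => //; have /andP[] := e01 x.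
  rewrite ger0_norm; last by apply: mulr_ge0; [rewrite invr_ge0|exact: sqr_ge0].
  by rewrite mulrC ler_pM2r ?invr_gt0//; apply: lerXn2r => //; rewrite nnegrE// ltW.
 apply: le_trans (flux_split (fa0 x) r0); rewrite ler_piMr//; by have /andP[] := e01 x.
set W := Int mu (fun x => w x * (f1 (v x) * (eta x * eta x))) in cB.
have cf1 := smooth_continuous (pf_smooth1 (mp_profile mp)).
(* The inequality [w <= v] is used here: on [D] it makes the generator term as small as the squared
   level. *)
have W1 : - W <= l ^+ 2 * (Mr * m).
 have me2 : meas (fun x => eta x * eta x).
  by apply: measurable_funM; exact: test_measurable te.
 have iW : ibl mu (fun x => w x * (f1 (v x) * (eta x * eta x))).
  apply: (iblMb (C := L * 1) iw); first by apply: measurable_funM => //; exact: measurable_comp_ibl cf1 iv.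
  by move=> x; rewrite normrM; apply: ler_pM => //; [exact: (pf_bound1 (mp_profile mp))|rewrite normrM mulr_ile1].
 rewrite -(IntN iW) (Int_mu hmu (iblN iW)) mulrA -(IntZ _ iD).
 apply: ae_le_Int; [exact: (ibl_mu hmu _).1 (iblN iW)|exact: iblZ|].
 move: hD v01l wvl; apply: filterS3 => x hx vx wx.
 have [Qx|Qx] := pselect (Q x); last first.
  rewrite (e0 _ Qx) !mulr0 oppr0 mul0r; apply: mulr_ge0; last exact: indic_ge0.
  by apply: mulr_ge0 => //; exact: sqr_ge0.
 have [b1 b2 b3] := hx Qx; have /andP[rx0 rx1] := hM _ (Qr _ Qx); have [y1 y2] := f1E _ vx.
 have /andP[ex0 ex1] := e01 x; have /andP[vx0 vx1] := vx.
 have [Dx|Dx] := pselect (D x).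
  rewrite (indicE_in Dx) mulr1 in b1; rewrite (indicE_in Dx) mulr1; have [_ /= vl] := Dx.
  exact: sublevel_drift_real vx0 (ltW vl) wx y1 ex0 ex1 (le_trans (ltW c00) rx0) rx1 (le_trans y2 b1) Mr0.
 have hz : h (v x) = 0 by rewrite b3 (indicE_out Dx) mul0r.
 rewrite hz in y2; have -> : f1 (v x) = 0 by apply/eqP; rewrite eq_le y1 -oppr_le0.
 by rewrite mul0r mulr0 oppr0 mul0r (indicE_out Dx) mulr0.
pose fn n x := h (Us n x) * eta x; pose f x := h (v x) * eta x.
have tf n : testT (fn n).
 by apply: test_funMr => //; apply: Coo_comp => //; exact: test_Coo (tU n).
have cf : L2cvg leb fn f by apply: (local_comp_L2 loc Qr ch (mp_hb mp) (mp_hl mp) iU iv cU).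
(* The product rule for [h(U) eta] adds the term with the gradient of the cutoff, bounded by [M] in
   each of the [d] coordinates. *)
have grad n : Int leb (fun x => \sum_i pderiv i (fn n) x ^+ 2) <= 2 * B n + 2 * (M ^+ 2 * d%:R) * Yf (Us n).
 have ip i : ibl leb (fun x => pderiv i (fn n) x ^+ 2).
  have tp := test_pderiv i (tf n).
  by apply: eq_ibl (test_ibl (test_funM tp (test_Coo tp))) => x; rewrite expr2.
 have ch1 := mp_smooth1 mp; have cUn := test_Coo (tU n).
 have iE : ibl leb (fun x => eta x * eta x * (h1 (Us n x) * h1 (Us n x)) * \sum_j pderiv j (Us n) x ^+ 2).
  apply: (@test_ibl _ _ setT).
  have chU : Coo (fun x => h1 (Us n x)) by exact: Coo_comp.
  apply: test_funM; last by move=> k; apply: Ck_sum => j; apply: CkM; exact: Coo_pderiv.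
  by apply: test_funM; [apply: test_funM => //; exact: test_Coo te|exact: CooM].
 apply: (@le_trans _ _ (Int leb (fun x => 2 * (eta x * eta x * (h1 (Us n x) * h1 (Us n x)) * \sum_j pderiv j (Us n) x ^+ 2)
   + 2 * (M ^+ 2 * d%:R) * (\1_Q x * h (Us n x) ^+ 2)))); last first.
  rewrite IntD; [|exact: iblZ|by apply: iblZ; exact: iYf].
  rewrite IntZ// IntZ; last exact: iYf.
  by rewrite lerD2r ler_pM2l.
 apply: Int_le; [by apply: ibl_sum|by apply: iblD; apply: iblZ => //; exact: iYf|] => x.
 have dfn i : pderiv i (fn n) x = h (Us n x) * pderiv i eta x + eta x * (h1 (Us n x) * pderiv i (Us n) x).
  rewrite pderivM; [|exact: Coo_comp|exact: test_Coo te].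
  by rewrite (pderiv_comp _ _ (mp_derive mp) cUn).
 have bi i : pderiv i (fn n) x ^+ 2 <= 2 * (eta x * eta x * (h1 (Us n x) * h1 (Us n x)) * pderiv i (Us n) x ^+ 2)
   + 2 * M ^+ 2 * (\1_Q x * h (Us n x) ^+ 2).
  rewrite dfn; apply: le_trans (sqrD_le _ _) _; rewrite addrC; apply: lerD.
   by apply: eq_ler; ring.
  rewrite -mulrA ler_pM2l//; have [Qx|Qx] := pselect (Q x); last first.
   by rewrite (localizer_pderiv i loc Qx) mulr0 expr0n (indicE_out Qx) mul0r mulr0.
  rewrite (indicE_in Qx) mul1r exprMn mulrC; apply: ler_wpM2r; first exact: sqr_ge0.
  by rewrite -[leLHS]real_normK ?num_real//; apply: lerXn2r; rewrite ?nnegrE.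
 apply: le_trans (ler_sum _ (fun i _ => bi i)) _; rewrite big_split/= sumr_const card_ord -!mulr_sumr.
 rewrite lerD2l -[leLHS]mulr_natl; apply: eq_ler; ring.
pose X := C1 * (l ^+ 2 * g ^- 2 * r ^+ d.+1).
(* The translation difference of [f] is the limit of those of the test functions [fn n]; this is the
   point where gradients disappear. *)
have shz z : cube r z -> Int leb (fun x => (f (x + z) - f x) ^+ 2) <= X.
 have n1 (x : Rd) : `|-1 : R| <= 1 by rewrite normrN normr1.
 move=> cz; have cd := L2cvgD (L2cvg_shift z cf) (@L2cvg_bM _ _ _ _ _ _ (fun=> -1) 1 (measurable_cst _) n1 cf).
 have c1 := L2cvg_IntM cd cd.
 have c2 : Int leb (fun x => (fn n (x + z) - fn n x) ^+ 2) @[n --> \oo] --> Int leb (fun x => (f (x + z) - f x) ^+ 2).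
  have -> : Int leb (fun x => (f (x + z) - f x) ^+ 2) = Int leb (fun x => (f (x + z) + -1 * f x) * (f (x + z) + -1 * f x)).
   by apply: eq_Int => x; ring.
  by apply: cvg_ext c1 => n; apply: eq_Int => x; ring.
 have up n : Int leb (fun x => (fn n (x + z) - fn n x) ^+ 2) <= d%:R * (r ^+ 2 * (2 * B n + 2 * (M ^+ 2 * d%:R) * Yf (Us n))).
  apply: le_trans (shift_estimate (tf n) cz) _; apply: ler_wpM2l => //.
  by apply: ler_wpM2l; [exact: sqr_ge0|exact: grad].
 have c3 := @cvg_mull _ d%:R _ _ (@cvg_mull _ (r ^+ 2) _ _ (cvg_add (@cvg_mull _ 2 _ _ cB) (@cvg_mull _ (2 * (M ^+ 2 * d%:R)) _ _ cY))).
 apply: le_trans (cvg_le up c2 c3) _; rewrite /X /C1.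
 have m0 : 0 <= m by apply: Int_ge0 => x; exact: indic_ge0.
 by apply: sublevel_real hm Y1 Z1 W1 => //; exact: ltnW.
have if1 : ibl leb f.
 have : ibl leb (fun x => \1_Q x * (h (v x) * eta x)).
  apply: (ibl_closed_bounded (L := L * 1) cQ Qr) => [|x].
   by apply: measurable_funM; [exact: measurable_comp_ibl ch iv|exact: test_measurable te].
  by rewrite normrM; apply: ler_pM => //; exact: mp_hb mp _.
 apply: eq_ibl => x; have [Qx|Qx] := pselect (Q x); first by rewrite (indicE_in Qx) mul1r.
 by rewrite /f (e0 _ Qx) mulr0 mulr0.
have rd0 : 0 < r ^+ d by rewrite exprn_gt0.
(* [average_shift] with cube size [r] and [m = r^d]: as [d >= 1], the cube has measure at least
   [(2 r)^d >= 2 r^d]. *)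
have fin : Int leb (fun x => f x ^+ 2) <= X.
 apply: (@average_shift _ _ f D r X (L * 1) (r ^+ d) if1) => //.
 - by move=> x; rewrite normrM; apply: ler_pM => //; exact: mp_hb mp _.
 - apply: filterS hD => x hx; have [Qx|Qx] := pselect (Q x); last by rewrite /f (e0 _ Qx) !mulr0.
  by have [_ _ b3] := hx Qx; rewrite /f [in LHS]b3 mulrA.
 - apply: le_trans (Int_cube_ge r0); rewrite exprMn ler_pM2r//.
  have dE : d = d.-1.+1 by rewrite prednK//; exact: ltnW.
  by rewrite [X in _ <= 2 ^+ X]dE exprS ler_peMr// exprn_ege1// ler1n.
have mD' := sublevel_measurable x0 (l - kap) r' mv; have iD' := sublevel_ibl x0 (l - kap) r' mv.
have [_ if2] : L2fun leb f by case: cf.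
have low : (kap * ramp 1) ^+ 2 * Int leb (\1_(sublevel v x0 (l - kap) r') : Rd -> R) <= X.
 apply: le_trans fin; rewrite -(IntZ _ iD'); apply: ae_le_Int => //; first exact: iblZ.
 apply: filterS hv => x [_ _ _ a4]; have [Dx|Dx] := pselect (sublevel v x0 (l - kap) r' x); last first.
  by rewrite (indicE_out Dx) mulr0 sqr_ge0.
 rewrite (indicE_in Dx) mulr1 /f; have [cx /= vx] := Dx; rewrite (eta1 _ cx) mulr1.
 have kr := ltW (mulr_gt0 k0 cR0); have hk := a4 (ltW vx).
 by apply: lerXn2r; rewrite ?nnegrE//; exact: le_trans kr hk.
have kr0 : 0 < (kap * ramp 1) ^+ 2 by rewrite exprn_gt0// mulr_gt0.
rewrite -(ler_pM2l kr0); apply: le_trans low _; rewrite /X; apply: eq_ler.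
move: (ramp 1) cR0 => q q0; field; rewrite !gt_eqF//.
Qed.

Lemma sublevel_small v x0 (e : R) : meas v -> {ae leb, forall x, 0 < v x} -> 0 < e ->
 exists k : R, [/\ 0 < k, k <= 1 & Int leb (\1_(sublevel v x0 k 2) : Rd -> R) < e].
Proof.
move=> mv v0 e0.
have ic : ibl leb (\1_(cube (2 + `|x0|)) : Rd -> R) by apply: ibl_indic; exact: cube_compact.
have c : Int leb (\1_(sublevel v x0 n.+1%:R^-1 2) : Rd -> R) @[n --> \oo] --> Int leb (fun=> 0 : R).
 apply: (Int_dom _ _ _ ic) => [n|||n x].
 - exact: indic_meas (sublevel_measurable x0 _ _ mv).
 - exact: measurable_cst.
 - apply: filterS v0 => x vx; apply: cvg0P => y y0.
  have [N hN] := cvg0_eN (@cvg_harmonic R 1) vx; exists N => n /hN.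
  rewrite div1r gtr0_norm ?invr_gt0 ?ltr0n// => h; rewrite indicE_out ?normr0// => -[_ /=].
  by rewrite ltNge ltW.
 - have [Dx|Dx] := pselect (sublevel v x0 n.+1%:R^-1 2 x); last by rewrite (indicE_out Dx) normr0 indic_ge0.
  by rewrite (indicE_in Dx) (indicE_in (cube_at_cube Dx.1)) normr1.
rewrite Int0 in c; have [N hN] := cvg0_eN c e0; exists N.+1%:R^-1; split.
- by rewrite invr_gt0 ltr0n.
- by rewrite invf_le1 ?ltr0n// ler1n.
- by apply: le_lt_trans (ler_norm _) (hN N (leqnn N)).
Qed.

(** Positivity almost everywhere makes the sublevel set at some level [k] small enough to start the
    iteration, which keeps all levels above [k / 2] and all radii above 1. *)
Lemma generator_lower_bound x0 v w : generator mu setT S v w -> {ae mu, forall x, 0 <= v x <= 1} ->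
 {ae mu, forall x, w x <= v x} -> {ae mu, forall x, 0 < v x} ->
 exists2 k : R, 0 < k & {ae leb, forall x, cube_at x0 1 x -> k <= v x}.
Proof.
move=> gv v01 wv vp; have [iv _ _] := gen_eps hS gv; have mv := ibl_meas iv.
have [K K0 hK] := sublevel_step x0.
have q0 : 0 < 16 ^+ d * (64 * K + 1) by rewrite mulr_gt0 ?exprn_gt0// ltr_wpDl ?mulr_ge0.
pose r0 := (16 ^+ d * (64 * K + 1))^-1; have r0p : 0 < r0 by rewrite invr_gt0.
have rE : r0 * (16 ^+ d * (64 * K + 1)) = 1 by rewrite mulVf ?gt_eqF.
have r01 : r0 <= 1.
 rewrite invf_le1//; apply: (@le_trans _ _ (1 * 1)); first by rewrite mulr1.
 by apply: ler_pM => //; [rewrite exprn_ege1// ler1n|rewrite lerDr mulr_ge0].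
have [k [k0 k1 hk]] := sublevel_small x0 mv ((ae_mu hmu _).1 vp) (exprn_gt0 d r0p).
(* At stage [j] the level is [k (1 + t j) / 2] and the radius [1 + t j], from [k] and 2 down to the
   limits [k / 2] and 1. *)
pose t (j : nat) : R := 2^-1 ^+ j.
have t0 (j : nat) : 0 < t j by rewrite exprn_gt0.
have t1 (j : nat) : t j <= 1 by rewrite exprn_ile1// invf_le1// ler1n.
have claim (j : nat) : Int leb (\1_(sublevel v x0 (k * (1 + t j) / 2) (1 + t j)) : Rd -> R) <= (r0 * t j ^+ 4) ^+ d.
 elim: j => [|j IH].
  rewrite /t expr0 expr1n mulr1 (_ : k * (1 + 1) / 2 = k); last by field.
  by rewrite (_ : 1 + 1 = 2)//; exact: ltW.
 have tS : t j.+1 = t j / 2 by rewrite /t exprSr.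
 have tj0 := t0 j; have tj1 := t1 j; move: (t j) tj0 tj1 tS IH => s s0 s1 -> IH.
 have kap0 : 0 < k * s / 4 by rewrite divr_gt0// mulr_gt0.
 have -> : k * (1 + s / 2) / 2 = k * (1 + s) / 2 - k * s / 4 by field.
 have l0 : 0 < k * (1 + s) / 2 by rewrite divr_gt0// mulr_gt0// addr_gt0.
 have l1 : k * (1 + s) / 2 <= 1.
  rewrite ler_pdivrMr// mul1r -[leRHS]mul1r; apply: ler_pM => //; [exact: ltW|by rewrite addr_ge0// ltW|lra].
 have rs0 : 0 < r0 * s ^+ 4 by rewrite mulr_gt0// exprn_gt0.
 have rs1 : r0 * s ^+ 4 <= 1 by rewrite mulr_ile1 ?exprn_ge0 ?exprn_ile1 ?(ltW s0) ?(ltW r0p).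
 apply: le_trans (hK v w _ _ _ _ _ gv v01 wv l0 l1 kap0 _ _ _ rs0 rs1 IH) _; [lra|lra|lra|].
 exact: sublevel_iter_real.
exists (k / 2); first by rewrite divr_gt0.
have D0 : Int leb (\1_(sublevel v x0 (k / 2) 1) : Rd -> R) = 0.
 apply/eqP; rewrite eq_le; apply/andP; split; last by apply: Int_ge0 => x; exact: indic_ge0.
 apply: (cvg_ge_cst (a := t)) => [j|]; last first.
  by apply: cvg_expr; rewrite gtr0_norm ?invr_gt0// invf_lt1// ltr1n.
 apply: (@le_trans _ _ ((r0 * t j ^+ 4) ^+ d)).
  apply: le_trans (claim j); apply: Int_le => [||x]; [exact: sublevel_ibl|exact: sublevel_ibl|].
  have [Dx|Dx] := pselect (sublevel v x0 (k / 2) 1 x); last by rewrite (indicE_out Dx) indic_ge0.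
  rewrite (indicE_in Dx) indicE_in//; case: Dx => cx /= vx; split => /=.
   by move=> i; apply: le_trans (cx i) _; rewrite lerDl ltW.
  by apply: lt_le_trans vx _; rewrite ler_pM2r ?invr_gt0// ler_peMr ?(ltW k0)// lerDl ltW.
 have a0 : 0 <= r0 * t j ^+ 4 by rewrite mulr_ge0 ?exprn_ge0// ltW.
 have tj0 := ltW (t0 j).
 have a1 : r0 * t j ^+ 4 <= t j.
  apply: (@le_trans _ _ (1 * t j ^+ 4)); first by rewrite ler_wpM2r ?exprn_ge0.
  by rewrite mul1r exprS ler_piMr// exprn_ile1.
 have dE : d = d.-1.+1 by rewrite prednK//; exact: ltnW.
 rewrite dE exprS; apply: le_trans (_ : r0 * t j ^+ 4 * 1 <= _); last by rewrite mulr1.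
 by apply: ler_wpM2l => //; rewrite exprn_ile1// (le_trans a1).
have := Int_eq0 (sublevel_ibl x0 (k / 2) 1 mv) (fun x => indic_ge0 _ _) D0.
apply: filterS => x hx cx; rewrite leNgt; apply/negP => vx; move: hx.
by rewrite indicE_in => [/eqP|]; [rewrite oner_eq0|split].
Qed.

End generator_estimates.

(** * Continuous versions and irreducibility *)

Section irreducibility.
Context {R : realType} {d : nat}.
Local Notation Rd := 'rV[R]_d.
Local Notation leb := (lebesgue_rV R d).
Variables (A C : Rd -> 'M[R]_d) (H : Rd -> Rd) (rho : Rd -> R).
Variables (mu : {measure set Rd -> \bar R}) (p : R).
Hypotheses (d2 : (2 <= d)%N) (dp : d%:R < p).
Hypotheses (hA : assumption_a A C H p) (hmu : invariant_density A C H rho mu p).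
Variables S T P : R -> (Rd -> R) -> Rd -> R.
Hypotheses (hL : L1_semigroup A C H rho mu S) (hT : Lp_extension mu S T) (hP : continuous_version mu T P).
Implicit Types (x z : Rd) (f g u v w : Rd -> R) (E : set Rd).

Let hS : submarkov_C0_contraction mu setT S. Proof. by case: hL. Qed.

Definition clip (n : nat) f x := Num.max (Num.min (f x) n%:R) (- n%:R).

Lemma clip_le n f x : `|clip n f x| <= n%:R.
Proof.
rewrite /clip ler_norml le_max lexx orbT /= ge_max ge_min lexx orbT /=.
by apply: (@le_trans _ _ 0) => //; rewrite oppr_le0.
Qed.

Lemma clip_dist n f x : `|clip n f x - f x| <= `|f x|.
Proof.
rewrite /clip; have n0 : 0 <= n%:R :> R by []; move: (f x) (n%:R) n0 => a b b0.
have [ab|ab] := leP a b.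
 have [h|h] := leP a (- b); last by rewrite subrr normr0.
 rewrite ger0_norm; last by lra.
 rewrite ler0_norm; by lra.
rewrite (@ger0_norm _ a); last by lra.
by have [h|h] := leP b (- b); rewrite ler0_norm; lra.
Qed.

Lemma clip_in n f x : `|f x| <= n%:R -> clip n f x = f x.
Proof. by rewrite ler_norml => /andP[a b]; rewrite /clip (min_idPl b) (max_idPl a). Qed.

(** [T] and [S] are known to agree on bounded integrable functions. Clipped functions converge in
    mean, and both operators follow this convergence. *)
Lemma T_L1 t f : 0 < t -> ibl mu f -> {ae mu, forall x, T t f x = S t f x}.
Proof.
move=> t0 hf; have mf := ibl_meas hf.
have mc n : meas (clip n f).
 by apply: measurable_maxr => //; exact: measurable_minr.
have ic n : ibl mu (clip n f).
 have h : ibl mu (fun x => clip n f x - f x).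
  by apply: ibl_le (ibl_abs hf) => [|x]; [exact: measurable_funB|exact: clip_dist].
 by apply: eq_ibl (iblD h hf) => x; rewrite subrK.
have cL n : L1_Loo mu (clip n f).
 by split; [apply/Lfun1P; exact: ic|exact: bounded_Lfun_oo (mc n) (clip_le n f)].
have c1 : Int mu (fun x => `|clip n f x - f x|) @[n --> \oo] --> 0.
 rewrite -[X in _ --> X](Int0 mu); apply: (Int_dom _ _ _ (ibl_abs hf)) => [n|||n x].
 - by apply: measurableT_comp => //; exact: measurable_funB.
 - exact: measurable_cst.
 - apply: aeW => x; apply: cvg0P => e e0; exists (Num.bound `|f x|) => n hn.
  rewrite clip_in ?subrr ?normr0//; apply: le_trans (ltW (archi_boundP (normr_ge0 _))) _.
  by rewrite ler_nat.
 - by rewrite normr_id; exact: clip_dist.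
have [/Lfun1P iT cT] := ext_Ls hT t0 (lexx 1) ((Lfun1P _ _).2 hf).
have iTc n : ibl mu (T t (clip n f)).
 by apply/Lfun1P; exact: (ext_Ls hT t0 (lexx 1) ((Lfun1P _ _).2 (ic n))).1.
have c2 := (Lpcvg1P iTc iT).1 (cT _ cL ((Lpcvg1P ic hf).2 c1)).
have c3 := sg_Int_cvg hS t0 ic hf c1.
have iS := sgL1 hS t0 hf; have iSc n := sgL1 hS t0 (ic n).
have h0 : Int mu (fun x => `|T t f x - S t f x|) <= 0.
 have c4 := cvg_add c2 c3; rewrite addr0 in c4; apply: (cvg_ge_cst _ c4) => n.
 apply: le_trans (Int_dist_triangle iT (iTc n) iS) _; apply: lerD.
  by apply: eq_ler; apply: eq_Int => x; rewrite distrC.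
 apply: eq_ler; apply: ae_eq_Int.
 - exact: ibl_meas (ibl_abs (iblB (iTc n) iS)).
 - exact: ibl_meas (ibl_abs (iblB (iSc n) iS)).
 - by apply: filterS (ext_L1_Loo hT t0 (cL n)) => x ->.
by apply: filterS (Int0_ae (iblB iT iS) h0) => x /eqP; rewrite subr_eq0 => /eqP.
Qed.

Lemma P_L1 t f : 0 < t -> ibl mu f -> continuous (P t f) /\ {ae leb, forall x, P t f x = S t f x}.
Proof.
move=> t0 hf; have [|cP hh] := hP (t := t) (f := f) t0; first by exists 1%E => //; apply/Lfun1P.
split => //; apply/(ae_mu hmu); move: hh (T_L1 t0 hf); apply: filterS2 => x e1 e2; exact: etrans e1 e2.
Qed.

Lemma continuous_ae_le f g : continuous f -> continuous g -> {ae leb, forall x, f x <= g x} ->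
 forall x, f x <= g x.
Proof.
move=> cf cg h x; rewrite -subr_ge0; rewrite -mulN1r; apply: (@continuous_ae_ge0 R d (fun y => g y + (-1) * f y)).
 by apply: fun_continuousD => //; apply: fun_continuousM => //; exact: cst_continuous.
by apply: filterS h => y; rewrite mulN1r subr_ge0.
Qed.

Lemma P_le t f g x : 0 < t -> ibl mu f -> ibl mu g -> {ae mu, forall x, f x <= g x} -> P t f x <= P t g x.
Proof.
move=> t0 hf hg fg; have [c1 e1] := P_L1 t0 hf; have [c2 e2] := P_L1 t0 hg.
apply: continuous_ae_le => //; move: e1 e2 ((ae_mu hmu _).1 (sg_le hS t0 hf hg fg)).
by apply: filterS3 => y -> ->.
Qed.

Lemma P_aD t (a : R) f g x : 0 < t -> ibl mu f -> ibl mu g ->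
 P t (fun y => a * f y + g y) x = a * P t f x + P t g x.
Proof.
move=> t0 hf hg; have [c1 e1] := P_L1 t0 hf; have [c2 e2] := P_L1 t0 hg.
have [c3 e3] := P_L1 t0 (iblD (iblZ a hf) hg).
have c4 : continuous (fun x => a * P t f x + P t g x).
 by apply: fun_continuousD => //; apply: fun_continuousM => //; exact: cst_continuous.
have e12 : {ae leb, forall x, P t f x = S t f x /\ P t g x = S t g x}.
 by move: e1 e2; apply: filterS2.
apply: (continuous_ae_eq c3 c4); move: e12 e3 ((ae_mu hmu _).1 (sg_aD hS a t0 hf hg)).
by apply: filterS3 => y [h1 h2] h3 h4; rewrite h1 h2 h3.
Qed.

Lemma P_add s t f x : 0 < s -> 0 < t -> ibl mu f -> P (s + t) f x = P s (S t f) x.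
Proof.
move=> s0 t0 hf; have [c1 e1] := P_L1 (addr_gt0 s0 t0) hf; have [c2 e2] := P_L1 s0 (sgL1 hS t0 hf).
apply: (continuous_ae_eq c1 c2); move: e1 e2 ((ae_mu hmu _).1 (sg_add hS s0 t0 ((Lp_onT mu _).2 hf))).
by apply: filterS3 => y h1 h2 h3; rewrite h1 h2.
Qed.

Definition null_at x0 (s : R) := forall g, ibl mu g -> {ae mu, forall x, 0 <= g x} -> P s g x0 = 0.

Lemma null_at_up x0 s r : 0 < s -> s < r -> null_at x0 s -> null_at x0 r.
Proof.
move=> s0 sr hs g ig g0; have t0 : 0 < r - s by rewrite subr_gt0.
rewrite -(subrKC s r) (P_add x0 s0 t0 ig); apply: hs; [exact: sgL1|exact: (sg_ge0 hS)].
Qed.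

Lemma null_at_of_pos x0 s f : 0 < s -> ibl mu f -> {ae mu, forall x, 0 < f x} -> P s f x0 = 0 -> null_at x0 s.
Proof.
move=> s0 hf f0 Pf g hg g0.
apply: (functional_vanishes (l := fun h => P s h x0) _ _ hf f0 Pf hg g0).
 by move=> h k ih ik hk; exact: P_le.
by move=> a h k ih ik; exact: P_aD.
Qed.

(** One step moves from a time [s] with [P s f x0 = 0] to all positive times above [s - t1]. The
    length [t1] is independent of [s], and vanishing on all nonnegative functions includes [f], so
    the step can be repeated until every positive time is reached. *)
Lemma null_at_all x0 t0 f : 0 < t0 -> ibl mu f -> {ae mu, forall x, 0 <= f x <= 1} -> gen_approx mu S f ->
 0 < Int mu (fun x => `|f x|) -> P t0 f x0 = 0 -> forall s, 0 < s -> null_at x0 s.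
Proof.
move=> t00 hf f01 app If P0.
have [t1 t10 hpos] := sg_positive d2 dp hA hmu hL hf f01 app If.
have step s r : 0 < s -> P s f x0 = 0 -> 0 < r -> s - r < t1 -> null_at x0 r.
 move=> s0 Ps r0 sr.
 have [m [m0 m1 m2]] : exists m : R, [/\ 0 < m, m <= t1 & m <= s].
  by have [ts|ts] := leP t1 s; [exists t1|exists s; split => //; exact: ltW].
 have mm : exists m', [/\ 0 < m', m' <= t1, m' <= s & s - r < m'].
  have [ts|ts] := leP t1 s; first by exists t1; split.
  by exists s; split => //; [exact: ltW|lra].
 have [m' [a1 a2 a3 a4]] := mm.
 (* A time [q] between [a] and [m'] at which [S q f > 0] satisfies both [0 < s - q] and
    [s - q < r]. *)
 pose a := Num.max (s - r) (m' / 2).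
 have aP : 0 < a by rewrite /a lt_max (divr_gt0 a1) ?orbT.
 have am : a < m' by rewrite /a gt_max a4 /=; lra.
 have ra : s - r <= a by rewrite /a le_max lexx.
 have [q /andP[qa qm] hq] := hpos a m' aP am a2.
 have q0 : 0 < q := lt_trans aP qa; have sq : 0 < s - q by lra.
 apply: (@null_at_up x0 (s - q)) => //; first by lra.
 apply: (@null_at_of_pos x0 (s - q) (S q f)) => //; first exact: sgL1.
 by rewrite -P_add// subrK.
have f0 : {ae mu, forall x, 0 <= f x} by apply: filterS f01 => x /andP[].
(* Steps of length [t1 / 2] keep the inequality [s - r < t1] strict. *)
have ind n r : 0 < r -> t0 - n%:R * (t1 / 2) < r -> null_at x0 r.
 elim: n r => [|n IH] r r0 hr; first by apply: (step t0) => //; lra.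
 have s0 : 0 < r + t1 / 2 by lra.
 have hs : null_at x0 (r + t1 / 2) by apply: IH => //; move: hr; rewrite -natr1; lra.
 by apply: (step (r + t1 / 2)) => //; [exact: hs|lra].
move=> s s0; apply: (ind (Num.bound (t0 / (t1 / 2)))) => //.
have th : 0 < t1 / 2 by rewrite divr_gt0.
have := archi_boundP (ltW (divr_gt0 t00 th)); rewrite ltr_pdivrMr//; lra.
Qed.

(** The resolvent [v] of [f] is itself in the domain, so positivity holds for [S s v] at some time
    [s]. Since [f >= 0], the generator maps [S s v] below itself, and the lower bound near [x0]
    contradicts the vanishing of the continuous version there. *)
Lemma not_null_at_all x0 f : ibl mu f -> {ae mu, forall x, 0 <= f x <= 1} ->
 0 < Int mu (fun x => `|f x|) -> ~ (forall s, 0 < s -> null_at x0 s).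
Proof.
move=> hf f01 If hn; have [_ [[GV [G [_ hG _]]] _]] := hL.
have gv : generator mu setT S (G 1 f) (fun x => G 1 f x - f x).
 have := hG 1 f ltr01 ((Lp_onT mu _).2 hf); congr generator; by apply/funext => x; rewrite mul1r.
have [iv iw hv] := gen_eps hS gv; have v01 := gen_bounds hS hf f01 gv.
set v := G 1 f in gv iv iw hv v01.
(* If [v] vanished, so would its difference quotients, whereas the generator maps [v] to [v - f],
   that is to [- f]. *)
have Iv : 0 < Int mu (fun x => `|v x|).
 rewrite lt_neqAle Int_ge0 ?andbT//; apply/eqP => /esym I0.
 have v0 : {ae mu, forall x, v x = 0} by apply: Int0_ae => //; rewrite I0.
 have [dl dl0 hdl] := hv _ If; have [t [t0 tl _]] := small_pos dl0 dl0.
 have := hdl t t0 tl; rewrite lt_neqAle => /andP[/eqP h _]; apply: h.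
 apply: ae_eq_Int; [|exact: ibl_meas (ibl_abs hf)|].
  exact: ibl_meas (ibl_abs (iblB (iblZ t^-1 (iblB (sgL1 hS t0 iv) iv)) iw)).
 by move: v0 (sg0 hS t0 iv v0); apply: filterS2 => x e1 e2; rewrite e1 e2 subrr mulr0 !sub0r opprK.
have app : gen_approx mu S v.
 move=> e e0; exists v, (fun x => v x - f x); split => //.
 rewrite (@eq_Int _ _ _ _ _ (fun=> 0)) ?Int0// => x; by rewrite subrr normr0.
have [t1 t10 hpos] := sg_positive d2 dp hA hmu hL iv v01 app Iv.
have [s /andP[s1 s2] hs] := hpos (t1 / 2) t1 ltac:(lra) ltac:(lra) (lexx t1).
have s0 : 0 < s by lra.
have gs := gen_sg hS s0 gv.
have wv : {ae mu, forall x, S s (fun x => v x - f x) x <= S s v x}.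
 have f0 : {ae mu, forall x, 0 <= f x} by apply: filterS f01 => x /andP[].
 by move: (sg_B hS s0 iv hf) (sg_ge0 hS s0 hf f0); apply: filterS2 => x -> h; rewrite gerBl.
have [k k0 hk] := generator_lower_bound d2 dp hA hmu hL x0 gs (sg_le1 hS s0 iv v01) wv hs.
have v0 : {ae mu, forall x, 0 <= v x} by apply: filterS v01 => x /andP[].
have Pv := hn s s0 v iv v0; have [cP eP] := P_L1 s0 iv.
(* The lower bound holds almost everywhere, so it is read at a good point close to [x0], where
   continuity keeps [P s v] below [k]. *)
have /nbhs_ballP[e /= e0 he] : nbhs x0 [set y | `|P s v x0 - P s v y| < k].
 by have /cvgrPdist_lt /(_ k k0) := cP x0.
have e10 : 0 < Num.min e 1 by rewrite lt_min e0 ltr01.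
have [y by_ [hy1 hy2]] := ae_ball x0 e10 (filterI hk eP).
have : `|P s v x0 - P s v y| < k.
 by apply: he; apply: le_ball by_; rewrite ge_min lexx.
have cy : cube_at x0 1 y.
 move=> i; rewrite !mxE distrC; move/ball_rV : by_ => [_ /(_ i)]; rewrite lt_min => /andP[_ /ltW].
 exact.
rewrite Pv sub0r normrN hy2 => h; have := hy1 cy => h2.
by have := le_lt_trans h2 (le_lt_trans (ler_norm _) h); rewrite ltxx.
Qed.

(** Test functions belong to the domain of the generator, and those with values in [0, 1]
    approximate the indicator in Lebesgue mean. A factor that is 1 on the box confines them to a
    cube on which [rho] is bounded, which gives the approximation in [mu]-mean. *)
Lemma bigbox_approx N E : measurable E -> let f := (\1_(E `&` bigbox N) : Rd -> R) in
 [/\ ibl mu f, forall x, 0 <= f x <= 1 & gen_approx mu S f].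
Proof.
move=> mE f; have f01 x : 0 <= f x <= 1 := indic01 _ _.
have mB : measurable (bigbox N : set Rd) by exact: measurable_box.
have mf : meas f by apply: indic_meas; exact: measurableI.
have N0 : 0 < N.+1%:R :> R by rewrite ltr0n.
have X1 x : bigbox N x -> cutoff N.+1%:R x = 1 :> R.
 move=> h; apply: cutoff_in => // i; have := h i; rewrite !mxE ler_norml -natr1 => /andP[a b].
 by apply/andP; split; lra.
have tX := @cutoff_test R d _ N0.
have fX x : f x = f x * cutoff N.+1%:R x.
 rewrite /f; have [[Ex Bx]|Ex] := pselect ((E `&` bigbox N) x); first by rewrite X1// mulr1.
 by rewrite (indicE_out Ex) mul0r.
have ifm : ibl mu f.
 apply: eq_ibl (iblbM (C := 1) (ibl_test_mu hmu tX) mf _) => [x|x]; first by rewrite -fX.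
 exact: indic_le1.
split => // e e0.
have [c [M [c0 hM]]] := rho_bounds hmu (2 * N.+1%:R).
have M0 : 0 <= M.
 have /hM/andP[h1 h2] : cube (2 * N.+1%:R) (0 : Rd) by move=> i; rewrite mxE normr0 mulr_ge0.
 exact: le_trans (le_trans (ltW c0) h1) h2.
have [|g [tg g01 hg]] := @test_dense R d N E (e / (M + 1)) mE; first by rewrite divr_gt0// ltr_wpDl.
have [_ [_ hgen]] := hL.
have tu : testT (fun x => g x * cutoff N.+1%:R x) by apply: test_funM => //; exact: test_Coo tX.
exists (fun x => g x * cutoff N.+1%:R x), (Lop A C H (fun x => g x * cutoff N.+1%:R x)); split.
- exact: hgen.
- apply: aeW => x; have /andP[a1 a2] := g01 x; have /andP[b1 b2] := cutoff01 N.+1%:R x.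
 by rewrite mulr_ge0//= mulr_ile1.
have iu := ibl_test_mu hmu tu; have iD := ibl_abs (iblB iu ifm).
have ifl : ibl leb f by apply: eq_ibl (ibl_bigboxM N (indic_meas mE) (indic_le1 E)) => x; rewrite /f indicI mulrC.
have iDl := ibl_abs (iblB (test_ibl tg) ifl).
apply: (@le_lt_trans _ _ (M * Int leb (fun x => `|g x - f x|))).
 rewrite (Int_mu hmu iD) -(IntZ _ iDl); apply: Int_le; [exact: (ibl_mu hmu _).1 iD|exact: iblZ|].
 move=> x; rewrite [X in `|_ - X|]fX -mulrBl normrM; have /andP[b1 b2] := cutoff01 N.+1%:R x.
 have [cx|cx] := pselect (cube (2 * N.+1%:R) x); last first.
  by rewrite (cutoff_out N0 cx) normr0 mulr0 mul0r mulr_ge0.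
 have /andP[h1 h2] := hM _ cx; rewrite mulrC; apply: ler_pM => //; first exact: ltW (rho_gt0 hmu x).
 by rewrite (ger0_norm b1) ler_piMr.
apply: (@le_lt_trans _ _ ((M + 1) * Int leb (fun x => `|g x - f x|))).
 by apply: ler_wpM2r; [exact: Int_ge0|rewrite lerDl].
by rewrite mulrC -ltr_pdivlMr// ltr_wpDl.
Qed.

Lemma null_of_bigbox E : measurable E ->
 (forall N, Int mu (\1_(E `&` bigbox N) : Rd -> R) = 0) -> mu E = 0%E.
Proof.
move=> mE h; have : {ae mu, forall x, forall N, \1_(E `&` bigbox N) x = 0 :> R}.
 apply/ae_foralln => N; have [i1 f01 _] := bigbox_approx N mE.
 by apply: Int_eq0 i1 _ (h N) => x; exact: indic_ge0.
move=> [Z [mZ Z0 hZ]]; apply/eqP; rewrite eq_le measure_ge0 andbT -Z0.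
apply: le_measure; rewrite ?inE// => x Ex; apply: hZ => /= hx.
have : (\bigcup_n bigbox n) x by rewrite bigbox_cover.
by move=> [n _ bx]; have := hx n; rewrite indicE_in// => /eqP; rewrite oner_eq0.
Qed.

(** [E] may have infinite measure, and then [T] is given on its indicator only as a limit along
    cut-offs. Beyond a certain ball each cut-off dominates the bounded part of [E]; the inequality
    almost everywhere holds everywhere by continuity. *)
Lemma P_indic_ge t N E x : 0 < t -> measurable E -> P t (\1_(E `&` bigbox N)) x <= P t \1_E x.
Proof.
move=> t0 mE; have [i1 f01 _] := bigbox_approx N mE; have [c1 e1] := P_L1 t0 i1.
have oE : (\1_E : Rd -> R) \in Lfun mu +oo%E by exact: bounded_Lfun_oo (indic_meas mE) (indic_le1 E).
have [|c2 e2] := hP (t := t) (f := \1_E) t0; first by exists +oo%E => //; exact: leey.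
apply: continuous_ae_le => //.
have [_ hoo] := ext_Loo hT t0 oE; have {}hoo := hoo _ (@oball_exhaustion R d).
have [n0 hn0] := @cube_oball R d N.+1%:R.
have mo n : measurable (oball n : set Rd) by apply: open_measurable_rV; exact: oball_open.
have io n : ibl mu (\1_E \* \1_(oball n) : Rd -> R).
 have X := ibl_test_mu hmu (@cutoff_test R d n.+1%:R (ltr0Sn R n)).
 have mm : meas (\1_E \* \1_(oball n) : Rd -> R) by apply: measurable_funM; exact: indic_meas.
 apply: ibl_le X => // y /=.
 have [oy|oy] := pselect (oball n y); last by rewrite (indicE_out oy) mulr0 normr0; have /andP[] := cutoff01 n.+1%:R y.
 by rewrite (indicE_in oy) mulr1 (cutoff_in (ltr0Sn R n) (oball_cube oy)); exact: indic_le1.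
have mono : {ae mu, forall y, forall k, T t (\1_(E `&` bigbox N)) y <= T t (\1_E \* \1_(oball (n0 + k))) y}.
 apply/ae_foralln => k.
 have le : {ae mu, forall y, \1_(E `&` bigbox N) y <= (\1_E \* \1_(oball (n0 + k))) y :> R}.
  apply: aeW => y /=; have [[Ey By]|Ey] := pselect ((E `&` bigbox N) y); last first.
   by rewrite (indicE_out Ey) mulr_ge0 ?indic_ge0.
  rewrite !indicE_in ?mulr1//; apply: (hn0 _ (leq_addr _ _)) => i.
  have := By i; rewrite !mxE ler_norml -natr1 => /andP[a b]; by apply/andP; split; lra.
 move: (T_L1 t0 i1) (T_L1 t0 (io (n0 + k))) (sg_le hS t0 i1 (io _) le).
 by apply: filterS3 => y -> ->.
have key : {ae mu, forall y, P t (\1_(E `&` bigbox N)) y <= P t \1_E y}.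
 have e3 : {ae mu, forall y, P t \1_E y = T t \1_E y /\ T t (\1_(E `&` bigbox N)) y = S t (\1_(E `&` bigbox N)) y}.
  by move: e2 (T_L1 t0 i1); apply: filterS2.
 have e4 : {ae mu, forall y, (T t (\1_E \* \1_(oball n)) y @[n --> \oo] --> T t \1_E y) /\
   forall k, T t (\1_(E `&` bigbox N)) y <= T t (\1_E \* \1_(oball (n0 + k))) y}.
  by move: hoo mono; apply: filterS2.
 move: ((ae_mu hmu _).2 e1) e3 e4.
 apply: filterS3 => y h1 [h2 h3] [h4 h5]; rewrite h1 h2 -h3.
 apply: (cvg_ge_cst (a := fun k => T t (\1_E \* \1_(oball (n0 + k))) y)) => //.
 rewrite (_ : (fun k => _) = (fun k => T t (\1_E \* \1_(oball (k + n0))) y)); last by apply/funext => k; rewrite addnC.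
 by rewrite (cvg_shiftn n0 (fun k => T t (\1_E \* \1_(oball k)) y)).
exact: (ae_mu hmu _).1 key.
Qed.

Lemma P_indic_gt0 x t E : 0 < t -> measurable E -> (0 < mu E)%E -> 0 < P t \1_E x.
Proof.
move=> t0 mE Ep; have [N hN] : exists N, Int mu (\1_(E `&` bigbox N) : Rd -> R) <> 0.
 apply: contrapT => h; move: Ep; rewrite null_of_bigbox ?ltxx// => N.
 by apply: contrapT => hN; apply: h; exists N.
have [i1 f01 app] := bigbox_approx N mE.
apply: lt_le_trans (P_indic_ge N x t0 mE).
have z0 := @ibl0 _ _ _ mu.
have P00 : P t (fun=> 0) x = 0.
 have e : (fun y : Rd => 1 * 0 + 0) = (fun=> 0 : R) by apply/funext => y; rewrite mulr0 addr0.
 by have := P_aD 1 x t0 z0 z0; rewrite e mul1r => h; lra.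
have P0 : 0 <= P t (\1_(E `&` bigbox N)) x.
 by rewrite -P00; apply: P_le => //; apply: aeW => y; exact: indic_ge0.
rewrite lt_neqAle P0 andbT; apply/eqP => /esym Pz.
have If : 0 < Int mu (fun x => `|\1_(E `&` bigbox N) x : R|).
 rewrite lt_neqAle Int_ge0 ?andbT//; apply/eqP => /esym I0; apply: hN.
 by rewrite -I0; apply: eq_Int => y; rewrite ger0_norm ?indic_ge0.
exact: (not_null_at_all i1 (aeW _ f01) If (null_at_all t0 i1 (aeW _ f01) app If Pz)).
Qed.

(** The indicator of a big box is square integrable. Weak invariance makes the image of its
    restriction to [E] vanish off [E] at time 1, while this image is positive everywhere once the
    box meets [E] in positive measure; hence almost every point lies in [E]. *)
Lemma weakly_invariant_trivial E : weakly_invariant mu T E -> mu E = 0%E \/ mu (~` E) = 0%E.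
Proof.
move=> [mE hE]; have [E0|E0] := eqVneq (mu E) 0%E; [by left|right].
have Ep : (0 < mu E)%E by rewrite lt_neqAle eq_sym E0 measure_ge0.
have [N hN] : exists N, Int mu (\1_(E `&` bigbox N) : Rd -> R) <> 0.
 apply: contrapT => h; move: Ep; rewrite null_of_bigbox ?ltxx// => N.
 by apply: contrapT => hN; apply: h; exists N.
have [i1 f01 _] := bigbox_approx N mE; have mB : measurable (bigbox N : set Rd) by exact: measurable_box.
have Bp : (0 < mu (E `&` bigbox N))%E.
 rewrite lt_neqAle measure_ge0 andbT; apply/eqP => m0; apply: hN.
 have h := ibl_integral i1; rewrite integral_indic// ?setIT -?m0 in h; last exact: measurableI.
 by case: h => <-.
have b2 : (\1_(bigbox N) : Rd -> R) \in Lfun mu 2%:E.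
 apply/(L2fun_Lfun); split; first exact: indic_meas.
 have [i2 _ _] := bigbox_approx N (@measurableT _ Rd); apply: eq_ibl i2 => x.
 rewrite setTI; have [h|h] := pselect (bigbox N x); by rewrite ?(indicE_in h) ?(indicE_out h) ?expr1n ?expr0n.
have h1 := hE 1 _ ltr01 b2.
have fE : (\1_(bigbox N) \* \1_E : Rd -> R) = \1_(E `&` bigbox N).
 by apply/funext => x; rewrite /= indicI mulrC.
rewrite fE in h1; have [_ e1] := P_L1 ltr01 i1.
have h2 : {ae mu, forall x, E x}.
 move: h1 ((ae_mu hmu _).2 e1) (T_L1 ltr01 i1); apply: filterS3 => x a1 a2 a3.
 apply: contrapT => Ex; have := P_indic_gt0 x ltr01 (measurableI _ _ mE mB) Bp.
 by rewrite a2 -a3 (a1 Ex) ltxx.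
move: h2 => [Z [mZ Z0 hZ]]; apply/eqP; rewrite eq_le measure_ge0 andbT -Z0.
by apply: le_measure; rewrite ?inE//; exact: measurableC.
Qed.

End irreducibility.

Theorem proposition2p39 (R : realType) (d : nat) (p : R)
  (A C : 'rV[R]_d -> 'M[R]_d) (H : 'rV[R]_d -> 'rV[R]_d)
  (rho : 'rV[R]_d -> R) (mu : {measure set 'rV[R]_d -> \bar R})
  (T P : R -> ('rV[R]_d -> R) -> 'rV[R]_d -> R) :
  (2 <= d)%N -> d%:R < p ->
  assumption_a A C H p ->
  invariant_density A C H rho mu p ->
  Lp_semigroup A C H rho mu T ->
  continuous_version mu T P ->
  (forall (x : 'rV[R]_d) (t : R) (E : set 'rV[R]_d),
      0 < t -> measurable E -> (0 < mu E)%E -> 0 < P t \1_E x) /\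
  (forall E : set 'rV[R]_d, weakly_invariant mu T E ->
      mu E = 0%E \/ mu (~` E) = 0%E).
Proof.
move=> d2 dp hA hmu [S hL hT] hP; split=> [x t E|E].
  exact: (P_indic_gt0 d2 dp hA hmu hL hT hP).
exact: (weakly_invariant_trivial d2 dp hA hmu hL hT hP).
Qed.
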